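(* Let $X_1,X_2,\ldots$ be i.i.d. with density $f$ on $A:=[c_1,c_2]$, and let $r>0$. As $n\to\infty$, $$n^{-1}\operatorname{Var}[S^g_{n,r,1}]\to\sigma_r^2(f,g)\quad\text{and}\quad n^{-1/2}\big(S^g_{n,r,1}-\mathbb{E}S^g_{n,r,1}\big)\xrightarrow{\mathcal{D}}N\big(0,\sigma_r^2(f,g)\big),$$ where, with $w_r:=\Gamma(2r+1)-2r\,\Gamma(r+1)^2$ and $t_r:=\Gamma(r+1)(1-r)$, $$\sigma_r^2(f,g):=w_r\int_A\Big(\frac{g(x)}{f(x)}\Big)^{2r}f(x)\,dx-t_r^2\Big(\int_A\Big(\frac{g(x)}{f(x)}\Big)^{r}f(x)\,dx\Big)^2.$$
   Context: $f$ and $g$ are probability densities with common support $A=[c_1,c_2]\subset\mathbb{R}$ (both vanish outside it), bounded, and bounded away from zero on $A$; $G$ is the distribution function of $g$. $X_{(1)}\le\cdots\le X_{(n)}$ are the order statistics of $X_1,\ldots,X_n$. $$S^g_{n,r,1}:=\sum_{i=1}^{n-1}\big(n[G(X_{(i+1)})-G(X_{(i)})]\big)^r.$$ $\Gamma(\cdot)$ is the Euler gamma function. $N(0,\sigma^2)$ is the centered normal law with variance $\sigma^2$, with $N(0,0)$ the point mass at $0$. *)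

(* Defs.v *)
From HB Require Import structures.
From mathcomp Require Import all_boot all_order all_algebra.
From mathcomp Require Import all_classical all_reals all_analysis.

Set Implicit Arguments.
Unset Strict Implicit.
Unset Printing Implicit Defensive.
Import Order.TTheory GRing.Theory Num.Theory.
Import numFieldNormedType.Exports.
Local Open Scope classical_set_scope.
Local Open Scope ring_scope.

Section densities.
Context {R : realType}.
Local Notation mu := (@lebesgue_measure R).
Implicit Types (f g : R -> R) (A : set R).

Definition is_density f : Prop :=
  [/\ measurable_fun [set: R] f,
      forall x, 0 <= f x &
      (\int[mu]_x (f x)%:E = 1)%E].

Definition admissible_density A f : Prop :=
  [/\ is_density f,
      forall x, ~ A x -> f x = 0,
      exists M : R, forall x, f x <= M &
      exists2 m : R, 0 < m & forall x, A x -> m <= f x].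

Definition dist_fun g (x : R) : R := \int[mu]_(y in `]-oo, x]) g y.

Definition Gamma (s : R) : R :=
  \int[mu]_(x in `]0, +oo[) (x `^ (s - 1) * expR (- x)).

End densities.

Section random_variables.
Context d {T : measurableType d} {R : realType} (P : probability T R).

Definition mutually_independent (X : nat -> {RV P >-> R}) : Prop :=
  forall (s : seq nat) (B : nat -> set R), uniq s ->
    (forall i, measurable (B i)) ->
    (P (\bigcap_(i in [set` s]) (X i @^-1` B i)) =
     \prod_(i <- s) P (X i @^-1` B i))%E.

Definition has_density (Y : {RV P >-> R}) (f : R -> R) : Prop :=
  forall B : set R, measurable B ->
    distribution P Y B = (\int[@lebesgue_measure R]_(x in B) (f x)%:E)%E.

Definition iid_with_density (X : nat -> {RV P >-> R}) (f : R -> R) : Prop :=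
  mutually_independent X /\ forall i, has_density (X i) f.

(* convergence of distribution functions at the continuity points of the limit *)
Definition cvg_in_distribution (Y : nat -> T -> R)
    (nu : probability (measurableTypeR R) R) : Prop :=
  forall x : R, {for x, continuous (fun y : R => nu `]-oo, y]%classic)} ->
    P [set w | Y n w <= x] @[n --> \oo] --> nu `]-oo, x]%classic.

(* The k-th smallest (k counted from 0) of X 0, ..., X (n - 1), that is,
   X_(k+1) in the usual 1-based notation. *)
Definition order_stat (X : nat -> T -> R) (n k : nat) (w : T) : R :=
  nth 0 (sort <=%R [seq X i w | i <- iota 0 n]) k.

Definition spacing_stat (X : nat -> T -> R) (g : R -> R) (r : R) (n : nat)
    (w : T) : R :=
  \sum_(0 <= i < n.-1)
    (n%:R * (dist_fun g (order_stat X n i.+1 w) -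
             dist_fun g (order_stat X n i w))) `^ r.

End random_variables.

(* N(0, v).  The second parameter of normal_prob is the standard deviation, and
   normal_prob m 0 is the uniform law on [0, 1], hence the case v = 0. *)
Definition centered_normal {R : realType} (v : R) :
    probability (measurableTypeR R) R :=
  if v == 0 then (\d_(0 : measurableTypeR R) : probability _ R)
  else (normal_prob 0 (Num.sqrt v) : probability _ R).

Section limit_variance.
Context {R : realType}.
Implicit Types r : R.

Definition w_coef r : R := Gamma (2 * r + 1) - 2 * r * Gamma (r + 1) ^+ 2.

Definition t_coef r : R := Gamma (r + 1) * (1 - r).

Definition sigma2 (c1 c2 : R) (f g : R -> R) r : R :=
  let I p := \int[@lebesgue_measure R]_(x in `[c1, c2]) ((g x / f x) `^ p * f x)
  in w_coef r * I (2 * r) - t_coef r ^+ 2 * I r ^+ 2.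

End limit_variance.

(* Main.v *)
Require Import Defs.
From HB Require Import structures.
From mathcomp Require Import all_boot all_order all_algebra.
From mathcomp Require Import all_classical all_reals all_analysis.
From mathcomp Require Import measurable_realfun ring lra.
Import Order.TTheory GRing.Theory Num.Theory.
Import numFieldNormedType.Exports.
Local Open Scope classical_set_scope.
Local Open Scope ring_scope.

(* The map x |-> - ln (1 - F x) turns the sample into independent standard
   exponential variables, so that by Renyi's representation the normalised
   spacings E_k = (n - k) (Z_(k+1) - Z_(k)) of their order statistics are again
   independent standard exponential.  On a small scale G o F^-1 is linear with
   slope g / f; hence, up to a remainder whose variance is o(n) by the
   Efron-Stein inequality, the statistic is
   sum_k phi(Z_(k)) (n exp(- Z_(k)) E_k / (n - k))^r, where phi is a Lipschitz
   approximation of (g / f)^r.  Since Z_(k) = sum_(j < k) E_j / (n - j), a first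
   order expansion around the mean of Z_(k) and an exchange of summations turn
   this into a sum of independent centered variables, up to an error of
   logarithmic size; its variance is a Riemann sum whose limit is sigma2, for phi
   tending to (g / f)^r.  Convergence in law follows from the Lindeberg exchange
   method, with Gaussian distribution functions as test functions. *)

Set Implicit Arguments.
Unset Strict Implicit.
Unset Printing Implicit Defensive.

(** * Measures, expectations, independence *)

(** The ratio g / f is merely measurable, so (g / f)^r itself cannot be expanded around the mean of
    Z_(k). It is replaced by the r-th power of a difference quotient of G o F^-1 at a fixed step:
    Lipschitz for each step, and convergent almost everywhere by Lebesgue differentiation. The
    remainder is then a sum of n terms that are small only on average; a triangle inequality would
    bound its second moment by a multiple of n^2, whence the Efron-Stein inequality. No derivative
    of phi enters the linear part, because y^r is compared with Gamma(r+1) y and not with its mean: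
    the sum for the power 1 telescopes and is almost constant, while y^r - Gamma(r+1) y is centered,
    so that freezing phi at the mean costs only a martingale. The variance of this variable is w_r.
    What remains of the randomness of Z_(k) is the difference of the powers r and 1 of n exp(-
    Z_(k)) / (n - k), to first order (1 - r) times the deviation of Z_(k); this gives t_r. All
    errors are bounded in mean square, which serves the variance and the limit law at once. *)

Section density_integral.
Local Open Scope ereal_scope.
Context d (T : measurableType d) (R : realType).
Variables (m mu : {measure set T -> \bar R}) (g : T -> R).
Hypothesis g0 : forall x, (0 <= g x)%R.
Hypothesis mg : measurable_fun [set: T] g.
Hypothesis mE : forall B, measurable B -> m B = \int[mu]_(x in B) (g x)%:E.

Import HBNNSimple.

Lemma integral_density (f : T -> \bar R) : measurable_fun [set: T] f ->
  (forall x, 0 <= f x) -> \int[m]_x f x = \int[mu]_x (f x * (g x)%:E).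
Proof.
move=> mf f0; pose h := nnsfun_approx measurableT mf.
have mgE : measurable_fun [set: T] (EFin \o g) by exact/measurable_EFinP.
have fE x : f x = limn (fun n => (h n x)%:E).
  by apply/esym/cvg_lim => //; exact: (cvg_nnsfun_approx measurableT mf (fun x _ => f0 x)).
have fgE x : f x * (g x)%:E = limn (fun n => (h n x)%:E * (g x)%:E).
  apply/esym/cvg_lim => //; apply: cvgeZr => //.
  exact: (cvg_nnsfun_approx measurableT mf (fun x _ => f0 x)).
under eq_integral do rewrite fE.
under [RHS]eq_integral do rewrite fgE.
rewrite !monotone_convergence//; last 6 first.
- by move=> n; apply: emeasurable_funM => //; exact/measurable_EFinP.
- by move=> n x _; rewrite mule_ge0 ?lee_fin.
- move=> x _ a b ab /=; rewrite lee_wpmul2r ?lee_fin//.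
  exact/lefP/nd_nnsfun_approx.
- by move=> n; exact/measurable_EFinP.
- by move=> n x _; rewrite lee_fin.
- by move=> x _ a b ab /=; rewrite lee_fin; exact/lefP/nd_nnsfun_approx.
congr (limn _); apply/funext => n.
under eq_integral do rewrite fimfunE -fsumEFin//.
under [RHS]eq_integral => x _.
  rewrite fimfunE -fsumEFin// ge0_mule_fsuml; last first.
    by move=> y; exact: nnfun_muleindic_ge0.
  over.
rewrite !ge0_integral_fsum//; last 4 first.
- move=> y; apply: emeasurable_funM => //.
  by apply/measurable_EFinP; exact: measurable_funM.
- by move=> y x _; rewrite mule_ge0 ?lee_fin//; exact: nnfun_muleindic_ge0.
- by move=> y; apply/measurable_EFinP; exact: measurable_funM.
- by move=> y x _; exact: nnfun_muleindic_ge0.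
apply: eq_fsbigr => y /[!inE] -[x _ <-].
have hx0 : (0 <= h n x)%R by [].
have mA : measurable (h n @^-1` [set h n x]) by exact: measurable_funPTI.
under eq_integral do rewrite EFinM.
rewrite ge0_integralZl//; last first.
  by apply/measurable_EFinP.
rewrite integral_indic// setIT mE//.
under [RHS]eq_integral do rewrite EFinM -muleA.
rewrite ge0_integralZl//; last first.
- by move=> z _; rewrite mule_ge0// lee_fin.
- by apply: emeasurable_funM => //; exact/measurable_EFinP.
congr (_ * _); rewrite integral_mkcond; apply: eq_integral => z _.
rewrite patchE indicE; case: ifPn => zA; first by rewrite mul1e.
by rewrite mul0e.
Qed.

End density_integral.

Section ray_uniqueness.
Context (R : realType).

(** Open upper rays form a pi-system generating the Borel sets; this is the form suited to laws
    known through their tails. *)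
Lemma measure_eq_rays (m1 m2 : {measure set (measurableTypeR R) -> \bar R}) :
  (forall x : R, m1 `]x, +oo[%classic < +oo)%E ->
  (forall x : R, m1 `]x, +oo[%classic = m2 `]x, +oo[%classic) ->
  forall B, measurable B -> m1 B = m2 B.
Proof.
move=> fin e B mB; pose G : set (set R) := [set C | exists x : R, C = `]x, +oo[%classic].
apply: (@measure_unique _ R (measurableTypeR R) G (fun n : nat => `](- n%:R)%R, +oo[%classic) _ _ _ _ m1 m2 _ _ B mB).
- rewrite (@RGenOInfty.measurableE R).
  by congr (<<s _ >>).
- move=> _ _ [x ->] [y ->]; exists (Num.max x y).
  apply/seteqP; split => z /=; rewrite !in_itv/= !andbT gt_max.
    by move=> [-> ->].
  by move=> /andP[].
- by move=> n; exists (- n%:R).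
- apply/seteqP; split => // x _; exists (Num.truncn `|x|).+1 => //=.
  rewrite in_itv/= andbT ltrNl (le_lt_trans _ (truncnS_gt _))//.
  by rewrite -normrN ler_norm.
- by move=> A [x ->].
- by move=> n; exact: fin.
Qed.

End ray_uniqueness.

Section independence.
Local Open Scope ereal_scope.
Context d (T : measurableType d) (R : realType) (P : probability T R).
Variable G : set (set T).
Hypotheses (Gm : forall C, G C -> measurable C) (GI : setI_closed G) (GT : G [set: T]).
Variables (Y : T -> R) (nu : probability (measurableTypeR R) R).
Hypothesis mY : measurable_fun [set: T] Y.
Hypothesis ind : forall C B, G C -> measurable B ->
  P (C `&` Y @^-1` B) = P C * nu B.

(** The sample space under the sigma-algebra of the past: a function on [TG * R] is a function of
    the past and of one new variable. *)
Local Notation TG := (g_sigma_algebraType G).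

Lemma past_measurable (C : set T) : <<s G >> C -> measurable C.
Proof.
apply: smallest_sub; last exact: Gm.
by split => // [A mA|F mF]; [rewrite setTD; exact: measurableC|exact: bigcup_measurable].
Qed.

Lemma past_measurable_fun d' (U : measurableType d') (h : TG -> U) :
  measurable_fun [set: TG] h -> measurable_fun [set: T] (h : T -> U).
Proof.
move=> mh _ B mB; rewrite setTI; apply: past_measurable.
by have := mh measurableT B mB; rewrite setTI.
Qed.

Let idG : T -> TG := fun x => x.

Let midG : measurable_fun [set: T] idG.
Proof. by move=> _ B mB; rewrite setTI; exact: past_measurable. Qed.

(** As functions of [C] both sides are finite measures, and they agree on the pi-system [G]. *)
Lemma past_indep (C : set T) (B : set (measurableTypeR R)) : <<s G >> C -> measurable B ->
  P (C `&` Y @^-1` B) = P C * nu B.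
Proof.
move=> mC mB.
have mYB : measurable (Y @^-1` B) by rewrite -[_ @^-1` _]setTI; exact: mY.
have nuB0 : (0 <= fine (nu B))%R by rewrite fine_ge0.
pose m1 : {measure set TG -> \bar R} :=
  measure_function_pushforward__canonical__measure_function_Measure (mrestr P mYB) midG.
pose m2 : {measure set TG -> \bar R} := mscale (NngNum nuB0)
  (measure_function_pushforward__canonical__measure_function_Measure P midG).
have -> : P (C `&` Y @^-1` B) = m1 C by [].
have -> : P C * nu B = m2 C.
  by rewrite /m2 /= /mscale /= /pushforward /= muleC fineK// fin_num_measure.
apply: (@measure_unique _ R TG G (fun=> setT)) => //.
- by rewrite bigcup_const//; exists 0%N.
- move=> A GA /=.
  rewrite /m2 /= /mscale /= /pushforward /= fineK ?fin_num_measure//.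
  by rewrite muleC -ind.
- move=> _ /=; rewrite /pushforward /mrestr /=.
  rewrite preimage_setT setTI.
  by rewrite (le_lt_trans (probability_le1 _ _)) ?ltry.
Qed.

Let dG : probability TG R := distribution P (mfun_Sub (mem_set midG) : {mfun T >-> TG}).

Let pairY : T -> (TG * measurableTypeR R)%type := fun w => (w, Y w).

Let mpairY : measurable_fun [set: T] pairY.
Proof. exact: measurable_fun_pair. Qed.

(** A product measure is determined by its rectangles, and on these [past_indep] gives the law of
    the pair. *)
Let joint (A : set (TG * measurableTypeR R)) : measurable A ->
  (dG \x nu) A = pushforward P pairY A.
Proof.
move=> mA.
pose m' : {measure set (TG * measurableTypeR R) -> \bar R} :=
  measure_function_pushforward__canonical__measure_function_Measure P mpairY.
have := @product_measure_unique _ _ _ _ _ dG nu m'.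
apply => // B C mB mC.
exact: past_indep.
Qed.

(** The inner integral is a conditional expectation given the past; Tonelli for the product law of
    [joint] takes the place of a theory of conditioning. *)
Lemma indep_fubini_ge0 (f : TG * measurableTypeR R -> \bar R) :
  measurable_fun [set: TG * measurableTypeR R] f -> (forall x, 0 <= f x) ->
  \int[P]_w f (w, Y w) = \int[P]_w \int[nu]_y f (w, y).
Proof.
move=> mf f0.
have -> : \int[P]_w f (w, Y w) = \int[dG \x nu]_x f x.
  rewrite [RHS](eq_measure_integral (measure_function_pushforward__canonical__measure_function_Measure P mpairY)).
    by rewrite ge0_integral_pushforward.
  by move=> A mA _; exact: joint.
rewrite fubini_tonelli1//.
rewrite ge0_integral_distribution//.
  exact: measurable_fun_fubini_tonelli_F.
by move=> y; exact: integral_ge0.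
Qed.

Lemma indep_fubini (f : TG * measurableTypeR R -> \bar R) :
  measurable_fun [set: TG * measurableTypeR R] f ->
  P.-integrable [set: T] (fun w => f (w, Y w)) ->
  \int[P]_w f (w, Y w) = \int[P]_w \int[nu]_y f (w, y).
Proof.
move=> mf fi.
have maf : measurable_fun [set: TG * measurableTypeR R] (abse \o f) by exact: measurableT_comp.
have ifp : (dG \x nu).-integrable [set: TG * measurableTypeR R] f.
  apply/integrable12ltyP => //.
  have /integrableP[_] := fi.
  rewrite (@indep_fubini_ge0 (abse \o f))//; last by move=> x /=; exact: abse_ge0.
  move=> H; rewrite ge0_integral_distribution//; last first.
    by move=> y; exact: integral_ge0.
  by apply: (measurable_fun_fubini_tonelli_F (abse \o f)) => //= x; exact: abse_ge0.
have -> : \int[P]_w f (w, Y w) = \int[dG \x nu]_x f x.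
  rewrite [RHS](eq_measure_integral (measure_function_pushforward__canonical__measure_function_Measure P mpairY)).
    by rewrite integral_pushforward.
  by move=> A mA _; exact: joint.
rewrite -integral12_prod_meas1// integral_distribution//.
  exact: (measurable_fubini_F ifp).
have : dG.-integrable [set: TG] (fubini_F nu f) by exact: integrable_fubini_F.
move/integrableP => [m1 m2]; apply/integrableP; split.
  exact: (measurableT_comp m1 midG).
by move: m2; rewrite ge0_integral_distribution//; exact: measurableT_comp.
Qed.

End independence.

Section expectation.
Context d (T : measurableType d) (R : realType) (P : probability T R).
Implicit Types f g h : T -> R.

Definition L1 f := P.-integrable [set: T] (EFin \o f).

Definition Ex f : R := \int[P]_w f w.

Lemma L1_measurable f : L1 f -> measurable_fun [set: T] f.
Proof. by move=> /integrableP[/measurable_EFinP]. Qed.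

Lemma L1_ge0P f : measurable_fun [set: T] f -> (forall w, 0 <= f w) ->
  L1 f <-> (\int[P]_w (f w)%:E < +oo)%E.
Proof.
move=> mf f0; split.
  move=> /integrableP[_]; under eq_integral do rewrite /= ger0_norm//.
  by [].
move=> H; apply/integrableP; split; first exact/measurable_EFinP.
by under eq_integral do rewrite /= ger0_norm//.
Qed.

Lemma L1_le f g : measurable_fun [set: T] f -> (forall w, `|f w| <= g w) -> L1 g -> L1 f.
Proof.
move=> mf fg; apply: le_integrable => //; first exact/measurable_EFinP.
move=> w _ /=; rewrite lee_fin (le_trans (fg w))//.
exact: ler_norm.
Qed.

Lemma L1_cst (c : R) : L1 (fun=> c).
Proof. exact: finite_measure_integrable_cst. Qed.

Lemma L1_bounded f (c : R) : measurable_fun [set: T] f -> (forall w, `|f w| <= c) -> L1 f.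
Proof. by move=> mf fc; apply: (L1_le mf fc); exact: L1_cst. Qed.

Lemma L1D f g : L1 f -> L1 g -> L1 (fun w => f w + g w).
Proof. by move=> h1 h2; have := integrableD measurableT h1 h2. Qed.

Lemma L1B f g : L1 f -> L1 g -> L1 (fun w => f w - g w).
Proof. by move=> h1 h2; have := integrableB measurableT h1 h2. Qed.

Lemma L1Z (c : R) f : L1 f -> L1 (fun w => c * f w).
Proof. by move=> h1; have := integrableZl measurableT c h1. Qed.

Lemma L1_norm f : L1 f -> L1 (fun w => `|f w|).
Proof. by move=> h; exact: (integrable_norm h). Qed.

Lemma L1_sum (I : Type) (s : seq I) (F : I -> T -> R) :
  (forall i, L1 (F i)) -> L1 (fun w => \sum_(i <- s) F i w).
Proof.
move=> H; elim: s => [|i s IH].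
  by under eq_fun do rewrite big_nil; exact: L1_cst.
by under eq_fun do rewrite big_cons; exact: L1D.
Qed.

Lemma Ex_le f g : L1 f -> L1 g -> (forall w, f w <= g w) -> Ex f <= Ex g.
Proof. by move=> h1 h2 fg; apply: le_Rintegral. Qed.

Lemma Ex_ge0 f : (forall w, 0 <= f w) -> 0 <= Ex f.
Proof. by move=> f0; apply: Rintegral_ge0. Qed.

Lemma ExD f g : L1 f -> L1 g -> Ex (fun w => f w + g w) = Ex f + Ex g.
Proof. by move=> h1 h2; exact: RintegralD. Qed.

Lemma ExB f g : L1 f -> L1 g -> Ex (fun w => f w - g w) = Ex f - Ex g.
Proof. by move=> h1 h2; exact: RintegralB. Qed.

Lemma ExZ (c : R) f : L1 f -> Ex (fun w => c * f w) = c * Ex f.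
Proof. by move=> h1; exact: RintegralZl. Qed.

Lemma Ex_cst (c : R) : Ex (fun=> c) = c.
Proof. rewrite /Ex Rintegral_cst// [X in c * X](_ : _ = 1) ?mulr1//.
by rewrite -[RHS]/(fine 1%E); congr fine; exact: probability_setT. Qed.

Lemma Ex_sum (I : Type) (s : seq I) (F : I -> T -> R) : (forall i, L1 (F i)) ->
  Ex (fun w => \sum_(i <- s) F i w) = \sum_(i <- s) Ex (F i).
Proof.
move=> H; elim: s => [|i s IH].
  by under eq_fun do rewrite big_nil; rewrite big_nil Ex_cst.
under eq_fun do rewrite big_cons; rewrite big_cons ExD ?IH//; exact: L1_sum.
Qed.

Lemma Ex_norm f : L1 f -> `|Ex f| <= Ex (fun w => `|f w|).
Proof. by move=> h; exact: le_normr_Rintegral. Qed.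

Lemma EFin_Ex f : L1 f -> (Ex f)%:E = (\int[P]_w (f w)%:E)%E.
Proof. by move=> h; rewrite /Ex /Rintegral fineK//; exact: integrable_fin_num. Qed.

Definition L2 f := measurable_fun [set: T] f /\ L1 (fun w => f w ^+ 2).

Lemma L2_cst (c : R) : L2 (fun=> c).
Proof. by split; [exact: measurable_cst|exact: L1_cst]. Qed.

Lemma L2M f g : L2 f -> L2 g -> L1 (fun w => f w * g w).
Proof.
move=> [mf f2] [mg g2].
apply: (@L1_le _ (fun w => f w ^+ 2 + g w ^+ 2)).
- exact: measurable_funM.
- move=> w; rewrite normrM -[f w ^+ 2]real_normK ?num_real// -[g w ^+ 2]real_normK ?num_real//.
  have := sqr_ge0 (`|f w| - `|g w|); have := normr_ge0 (f w); have := normr_ge0 (g w).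
  by nra.
- exact: L1D.
Qed.

Lemma L2_L1 f : L2 f -> L1 f.
Proof.
move=> fL2; have := L2M fL2 (L2_cst 1).
by under eq_fun do rewrite mulr1.
Qed.

Lemma L2_dom f h : measurable_fun [set: T] f -> L1 h -> (forall w, f w ^+ 2 <= h w) -> L2 f.
Proof.
move=> mf h1 fh; split => //; apply: (L1_le _ _ h1).
  exact: measurable_funX.
by move=> w; rewrite ger0_norm ?sqr_ge0.
Qed.

Lemma L2D f g : L2 f -> L2 g -> L2 (fun w => f w + g w).
Proof.
move=> [mf f2] [mg g2].
apply: (@L2_dom _ (fun w => 2 * f w ^+ 2 + 2 * g w ^+ 2)).
- exact: measurable_funD.
- by apply: L1D; exact: L1Z.
- by move=> w; have := sqr_ge0 (f w - g w); nra.
Qed.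

Lemma L2Z (c : R) f : L2 f -> L2 (fun w => c * f w).
Proof.
move=> [mf f2]; split; first exact: measurable_funM.
by under eq_fun do rewrite exprMn; exact: L1Z.
Qed.

Lemma L2B f g : L2 f -> L2 g -> L2 (fun w => f w - g w).
Proof.
move=> hf hg; have := L2D hf (L2Z (-1) hg).
by under eq_fun do rewrite mulN1r.
Qed.

Lemma Ex_cauchy_schwarz f g : L2 f -> L2 g ->
  Ex (fun w => f w * g w) ^+ 2 <= Ex (fun w => f w ^+ 2) * Ex (fun w => g w ^+ 2).
Proof.
move=> hf hg; have [mf f2] := hf; have [mg g2] := hg.
have fg := L2M hf hg.
(* The sign of the discriminant of this quadratic in [t] is the claim. *)
have q (t : R) : 0 <= Ex (fun w => f w ^+ 2) + 2 * t * Ex (fun w => f w * g w)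
    + t ^+ 2 * Ex (fun w => g w ^+ 2).
  have : 0 <= Ex (fun w => (f w + t * g w) ^+ 2) by apply: Ex_ge0 => w; exact: sqr_ge0.
  rewrite (_ : (fun w => _) = (fun w => f w ^+ 2 + 2 * t * (f w * g w) + t ^+ 2 * g w ^+ 2)); last first.
    by apply/funext => w; ring.
  rewrite !ExD ?ExZ//; [exact: L1Z|apply: L1D => //; exact: L1Z|exact: L1Z].
set a := Ex _ in q *; set b := Ex _ in q *; set c := Ex _ in q *.
have c0 : 0 <= c by apply: Ex_ge0 => w; exact: sqr_ge0.
have [c_eq0|cn0] := eqVneq c 0.
  rewrite c_eq0 mulr0.
  have [->|bn0] := eqVneq b 0; first by rewrite expr0n.
  (* With leading coefficient 0 the quadratic is affine, and at this point it would take the value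
     -1. *)
  have := q (- (a + 1) / (2 * b)); rewrite c_eq0 mulr0 addr0.
  rewrite (_ : 2 * _ * b = - (a + 1)); last by field.
  by move=> H; exfalso; lra.
have {}c0 : 0 < c by rewrite lt_def cn0.
have := q (- b / c).
rewrite (_ : _ + _ = (a * c - b ^+ 2) / c); last by field.
by rewrite pmulr_lge0 ?invr_gt0// subr_ge0.
Qed.

Lemma Ex_sqr_le f : L2 f -> Ex f ^+ 2 <= Ex (fun w => f w ^+ 2).
Proof.
move=> hf; have := Ex_cauchy_schwarz hf (L2_cst 1).
under eq_fun do rewrite mulr1.
by rewrite expr1n Ex_cst mulr1.
Qed.

(** The form in which every error term is carried: a bound o(n) is negligible for the variance and,
    after division by sqrt n, for the limit law. *)
Definition sqb f (c : R) := L2 f /\ Ex (fun w => f w ^+ 2) <= c.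

Lemma sqb_le f (c c' : R) : c <= c' -> sqb f c -> sqb f c'.
Proof. by move=> cc' [h1 h2]; split => //; exact: le_trans cc'. Qed.

Lemma sqb_dom f h (c : R) : measurable_fun [set: T] f -> L1 h -> Ex h <= c ->
  (forall w, f w ^+ 2 <= h w) -> sqb f c.
Proof.
move=> mf h1 hc fh; have f2 := L2_dom mf h1 fh; split => //.
by apply: le_trans hc; apply: Ex_le => //; case: f2.
Qed.

Lemma sqb_mono f g (c : R) : measurable_fun [set: T] f -> sqb g c ->
  (forall w, `|f w| <= `|g w|) -> sqb f c.
Proof.
move=> mf [[mg g2] gc] fg; apply: (sqb_dom mf g2 gc) => w.
by rewrite -[f w ^+ 2]real_normK ?num_real// -[g w ^+ 2]real_normK ?num_real// lerXn2r ?nnegrE.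
Qed.

Lemma sqbZ (a : R) f (c : R) : sqb f c -> sqb (fun w => a * f w) (a ^+ 2 * c).
Proof.
move=> [f2 fc]; split; first exact: L2Z.
under eq_fun do rewrite exprMn; rewrite ExZ; last by case: f2.
by rewrite ler_wpM2l ?sqr_ge0.
Qed.

Lemma sqbD f g (a b : R) : sqb f a -> sqb g b -> sqb (fun w => f w + g w) (2 * a + 2 * b).
Proof.
move=> [[mf f2] fa] [[mg g2] gb].
apply: (@sqb_dom _ (fun w => 2 * f w ^+ 2 + 2 * g w ^+ 2)).
- exact: measurable_funD.
- by apply: L1D; exact: L1Z.
- rewrite ExD ?ExZ//; [|exact: L1Z|exact: L1Z].
  by rewrite lerD// ler_wpM2l.
- by move=> w; have := sqr_ge0 (f w - g w); nra.
Qed.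

Lemma sqbN f (c : R) : sqb f c -> sqb (fun w => - f w) c.
Proof. by move=> /(sqbZ (-1)); rewrite sqrrN expr1n mul1r; under eq_fun do rewrite mulN1r. Qed.

Lemma sqbB f g (a b : R) : sqb f a -> sqb g b -> sqb (fun w => f w - g w) (2 * a + 2 * b).
Proof. by move=> fa /sqbN gb; exact: sqbD. Qed.

(* Cauchy-Schwarz with the weights [v i]. *)
Lemma sqb_sum (F : nat -> T -> R) (v : nat -> R) (c : R) n :
  (forall i, (i < n)%N -> 0 < v i) ->
  (forall i, (i < n)%N -> sqb (F i) (c * v i ^+ 2)) ->
  sqb (fun w => \sum_(i < n) F i w) (c * (\sum_(i < n) v i) ^+ 2).
Proof.
move=> v0 Fc.
have key w : (\sum_(i < n) F i w) ^+ 2 <=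
    (\sum_(i < n) v i) * \sum_(i < n) (v i)^-1 * F i w ^+ 2.
  elim: n v0 {Fc} => [|n IH] v0; first by rewrite !big_ord0 expr0n mul0r.
  rewrite !big_ord_recr/=.
  have {}IH := IH (fun i hi => v0 i (ltnW hi)).
  have vn := v0 n (ltnSn n).
  have V0 : 0 <= \sum_(i < n) v i.
    by apply: sumr_ge0 => i _; apply/ltW/v0; exact: ltnW (ltn_ord i).
  have : 0 <= \sum_(i < n) (v i)^-1 * F i w ^+ 2.
    by apply: sumr_ge0 => i _; rewrite mulr_ge0 ?sqr_ge0// invr_ge0; apply/ltW/v0; exact: ltnW (ltn_ord i).
  move: IH; set S := \sum_(i < n) F i w; set V := \sum_(i < n) v i.
  set Q := \sum_(i < n) _; set x := F n w; set u := v n in vn *.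
  rewrite -/V in V0 => IH Q0.
  rewrite mulrDr 2!mulrDl (mulrA u) mulfV ?gt_eqF// mul1r.
  have [VP|/eqP] := eqVneq V 0.
    move: IH; rewrite VP !mul0r => IH.
    have S0 : S = 0 by apply/eqP; rewrite -sqrf_eq0 eq_le IH sqr_ge0.
    by rewrite S0 !add0r; rewrite lerDr mulr_ge0// ltW.
  move=> /eqP Vn0; have {}V0 : 0 < V by rewrite lt_def Vn0.
  have : 2 * S * x <= u / V * S ^+ 2 + V / u * x ^+ 2.
    have := sqr_ge0 (S * u - x * V); move=> H.
    rewrite -(ler_pM2r (mulr_gt0 vn V0)) [leRHS](_ : _ = u ^+ 2 * S ^+ 2 + V ^+ 2 * x ^+ 2).
      by nra.
    by field; rewrite !gt_eqF.
  have : u / V * S ^+ 2 <= u * Q.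
    by rewrite mulrAC -mulrA ler_pM2l// ler_pdivrMr// mulrC.
  rewrite (mulrA V) => h1 h2.
  have -> : (S + x) ^+ 2 = S ^+ 2 + 2 * S * x + x ^+ 2 by ring.
  by lra.
have L1F i : (i < n)%N -> L1 (fun w => (v i)^-1 * F i w ^+ 2).
  by move=> hi; apply: L1Z; case: (Fc i hi) => -[].
have mF i : (i < n)%N -> measurable_fun setT (F i).
  by move=> hi; case: (Fc i hi) => -[].
pose h w := (\sum_(i < n) v i) * \sum_(i < n) (v i)^-1 * F i w ^+ 2.
have Lh : L1 (fun w => \sum_(i < n) (v i)^-1 * F i w ^+ 2).
  apply: (@L1_sum _ (index_enum 'I_n) (fun (i : 'I_n) w => (v i)^-1 * F i w ^+ 2)) => i.
  exact: L1F.
apply: (@sqb_dom _ h) => //.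
- apply: measurable_sum => i; exact: mF.
- exact: L1Z.
- rewrite ExZ// (@Ex_sum _ (index_enum 'I_n) (fun (i : 'I_n) w => (v i)^-1 * F i w ^+ 2)); last by move=> i; exact: L1F.
  have -> : c * (\sum_(i < n) v i) ^+ 2 = (\sum_(i < n) v i) * \sum_(i < n) c * v i.
    by rewrite -mulr_sumr expr2; ring.
  rewrite ler_wpM2l//; first by apply: sumr_ge0 => i _; rewrite ltW ?v0.
  apply: ler_sum => i _; have [Fi Fci] := Fc i (ltn_ord i).
  rewrite ExZ; last by case: Fi.
  by rewrite mulrC ler_pdivrMr ?v0// -mulrA -expr2.
Qed.

End expectation.

(** * Independent families and martingale sums *)

Section iid_family.
Context d (T : measurableType d) (R : realType) (P : probability T R).
Variable nu : probability (measurableTypeR R) R.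

(** Only the first [n] variables are constrained: the normalised spacings form a new family for each
    sample size, with no infinite sequence behind them. *)
Definition iid_upto (n : nat) (Y : nat -> T -> R) : Prop :=
  (forall k, (k < n)%N -> measurable_fun [set: T] (Y k)) /\
  forall B : nat -> set (measurableTypeR R), (forall i, measurable (B i)) ->
    P (\bigcap_(i in `I_n) Y i @^-1` B i) = (\prod_(i < n) nu (B i))%E.

(** Rectangles in the first [k] variables: a pi-system generating their sigma-algebra. *)
Definition past (Y : nat -> T -> R) (k : nat) : set (set T) :=
  [set C | exists2 B : nat -> set (measurableTypeR R), (forall i, measurable (B i)) &
     C = \bigcap_(i in `I_k) Y i @^-1` B i].

Lemma pastI Y k : setI_closed (past Y k).
Proof.
move=> _ _ [B mB ->] [C mC ->]; exists (fun i => B i `&` C i).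
  by move=> i; exact: measurableI.
by rewrite -bigcapI.
Qed.

Lemma pastT Y k : past Y k [set: T].
Proof.
by exists (fun=> setT) => //; apply/seteqP; split.
Qed.

Lemma past_sub Y j k : (j <= k)%N -> past Y j `<=` past Y k.
Proof.
move=> jk _ [B mB ->].
exists (fun i => if (i < j)%N then B i else setT).
  by move=> i; case: ifP.
apply/seteqP; split => w H i /= ik.
  by case: ifPn => // ij; exact: H.
by have := H i (leq_trans ik jk); rewrite ik.
Qed.

Lemma past_meas n Y k : iid_upto n Y -> (k <= n)%N ->
  forall C, past Y k C -> measurable C.
Proof.
move=> [mY _] kn _ [B mB ->]; apply: fin_bigcap_measurable => [|i /= ik].
  exact: finite_II.
by rewrite -[_ @^-1` _]setTI; exact: (mY i (leq_trans ik kn) measurableT _ (mB i)).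
Qed.

Lemma iid_upto_le n m Y : (m <= n)%N -> iid_upto n Y -> iid_upto m Y.
Proof.
move=> mn [mY PY]; split => [k km|B mB]; first by apply: mY; exact: leq_trans mn.
pose B' i := if (i < m)%N then B i else setT.
have mB' i : measurable (B' i) by rewrite /B'; case: ifP.
have -> : \bigcap_(i in `I_m) Y i @^-1` B i = \bigcap_(i in `I_n) Y i @^-1` B' i.
  apply/seteqP; split => w H i /= ik.
    by rewrite /B'; case: ifPn => // ij; exact: H.
  by have := H i (leq_trans ik mn); rewrite /B' /= ik.
rewrite PY// (big_ord_widen n (fun i => nu (B i)))//.
rewrite [RHS]big_mkcond/=; apply: eq_bigr => i _; rewrite /B'.
case: ifP => // _; exact: probability_setT.
Qed.

Lemma past_ind n Y k : iid_upto n Y -> (k < n)%N ->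
  forall C B, past Y k C -> measurable B ->
  P (C `&` Y k @^-1` B) = (P C * nu B)%E.
Proof.
move=> iY kn C B [A mA ->] mB.
have [_ P1] := iid_upto_le kn iY.
have [_ P0] := iid_upto_le (ltnW kn) iY.
pose A' i := if (i < k)%N then A i else B.
have mA' i : measurable (A' i) by rewrite /A'; case: ifP.
have -> : \bigcap_(i in `I_k) Y i @^-1` A i `&` Y k @^-1` B =
          \bigcap_(i in `I_k.+1) Y i @^-1` A' i.
  apply/seteqP; split => w.
    move=> [H HB] i /=; rewrite ltnS leq_eqVlt /A' => /predU1P[->|ik].
      by rewrite ltnn.
    by rewrite ik; exact: H.
  move=> H; split => [i /= ik|].
    by have := H i (ltnW ik); rewrite /A' /= ik.
  by have := H k (ltnSn k); rewrite /A' /= ltnn.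
rewrite P1// big_ord_recr/= /A' ltnn; congr (_ * _)%E.
by rewrite P0//; apply: eq_bigr => i _; rewrite ltn_ord.
Qed.

Lemma past_fun Y j k : (j < k)%N ->
  measurable_fun [set: g_sigma_algebraType (past Y k)] (Y j : g_sigma_algebraType (past Y k) -> R).
Proof.
move=> jk _ B mB; rewrite setTI; apply: sub_sigma_algebra.
exists (fun i => if i == j then B else setT).
  by move=> i; case: ifP.
apply/seteqP; split => w.
  by move=> H i /= ik; case: eqP => [->|].
by move=> /(_ j jk) /=; rewrite eqxx.
Qed.

Lemma past_funW d' (U : measurableType d') Y j k (h : T -> U) : (j <= k)%N ->
  measurable_fun [set: g_sigma_algebraType (past Y j)] (h : g_sigma_algebraType (past Y j) -> U) ->
  measurable_fun [set: g_sigma_algebraType (past Y k)] (h : g_sigma_algebraType (past Y k) -> U).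
Proof.
move=> jk mh _ B mB; have := mh measurableT B mB.
by rewrite !setTI; exact: (sub_sigma_algebra2 (past_sub jk)).
Qed.

Section fubini.
Variables (n k : nat) (Y : nat -> T -> R).
Hypotheses (iY : iid_upto n Y) (kn : (k < n)%N).
Local Notation TG := (g_sigma_algebraType (past Y k)).
Variable H : TG * measurableTypeR R -> R.
Hypothesis mH : measurable_fun [set: TG * measurableTypeR R] H.

Lemma measurable_past_now : measurable_fun [set: T] (fun w => H (w, Y k w)).
Proof.
have mY := iY.1 k kn.
have mid : measurable_fun [set: T] (fun w : T => (w : TG)).
  move=> _ B mB; rewrite setTI.
  exact: (past_measurable (past_meas iY (ltnW kn))).
by apply: (measurableT_comp mH); exact: measurable_fun_pair.
Qed.

Lemma past_fubini_ge0 : (forall x, 0 <= H x) ->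
  (\int[P]_w (H (w, Y k w))%:E = \int[P]_w \int[nu]_y (H (w, y))%:E)%E.
Proof.
move=> H0; apply: (@indep_fubini_ge0 _ _ _ _ (past Y k) _ _ _ (Y k) nu _ _ (fun x => (H x)%:E)).
- exact: past_meas iY (ltnW kn).
- exact: pastI.
- exact: pastT.
- exact: iY.1 k kn.
- exact: past_ind iY kn.
- exact/measurable_EFinP.
- by move=> x; rewrite lee_fin.
Qed.

Lemma Ex_past_ge0 : (forall x, 0 <= H x) ->
  (forall w, L1 nu (fun y => H (w, y))) ->
  L1 P (fun w => Ex nu (fun y => H (w, y))) ->
  L1 P (fun w => H (w, Y k w)) /\
  Ex P (fun w => H (w, Y k w)) = Ex P (fun w => Ex nu (fun y => H (w, y))).
Proof.
move=> H0 iH iEH.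
have e : (\int[P]_w (H (w, Y k w))%:E = \int[P]_w (Ex nu (fun y => H (w, y)))%:E)%E.
  rewrite past_fubini_ge0//; apply: eq_integral => w _.
  by rewrite EFin_Ex.
split; last by rewrite /Ex /Rintegral e.
have g0 w : 0 <= Ex nu (fun y => H (w, y)) by apply: Ex_ge0.
apply: (L1_ge0P P measurable_past_now (fun w => H0 (w, Y k w))).2.
by rewrite e; apply: (L1_ge0P P (L1_measurable iEH) g0).1.
Qed.

Lemma Ex_past0 : (forall w, L1 nu (fun y => H (w, y))) ->
  (forall w, Ex nu (fun y => H (w, y)) = 0) ->
  L1 P (fun w => H (w, Y k w)) -> Ex P (fun w => H (w, Y k w)) = 0.
Proof.
move=> iH H0 iHP; rewrite /Ex /Rintegral.
have -> : (\int[P]_w (H (w, Y k w))%:E = \int[P]_w \int[nu]_y (H (w, y))%:E)%E.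
  apply: (@indep_fubini _ _ _ _ (past Y k) _ _ _ (Y k) nu _ _ (fun x => (H x)%:E)) => //.
  - exact: past_meas iY (ltnW kn).
  - exact: pastI.
  - exact: pastT.
  - exact: iY.1 k kn.
  - exact: past_ind iY kn.
  - exact/measurable_EFinP.
under eq_integral do rewrite -EFin_Ex// H0.
by rewrite integral0.
Qed.

End fubini.

Lemma past_now n Y k (H : g_sigma_algebraType (past Y k) * measurableTypeR R -> R) :
  (k < n)%N -> measurable_fun [set: g_sigma_algebraType (past Y k) * measurableTypeR R] H ->
  forall j, (k < j)%N ->
  measurable_fun [set: g_sigma_algebraType (past Y j)]
    ((fun w => H (w, Y k w)) : g_sigma_algebraType (past Y j) -> R).
Proof.
move=> kn mH j kj.
have mid : measurable_fun [set: g_sigma_algebraType (past Y j)]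
    ((fun w => w) : g_sigma_algebraType (past Y j) -> g_sigma_algebraType (past Y k)).
  by apply: (past_funW (ltnW kj)); exact: measurable_id.
apply: (measurableT_comp mH); apply: measurable_fun_pair => //.
exact: past_fun.
Qed.

(** Martingale increments are orthogonal, so second moments add; this is what distinguishes these
    sums from those handled by [sqb_sum], where a whole factor is lost to Cauchy-Schwarz. *)
Lemma martingale_sum n Y (H : forall k, g_sigma_algebraType (past Y k) * measurableTypeR R -> R)
    (c : nat -> R) : iid_upto n Y ->
  (forall k, (k < n)%N -> measurable_fun [set: g_sigma_algebraType (past Y k) * measurableTypeR R] (H k)) ->
  (forall k w, (k < n)%N -> L1 nu (fun y => H k (w, y))) ->
  (forall k w, (k < n)%N -> Ex nu (fun y => H k (w, y)) = 0) ->
  (forall k, (k < n)%N -> sqb P (fun w => H k (w, Y k w)) (c k)) ->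
  sqb P (fun w => \sum_(k < n) H k (w, Y k w)) (\sum_(k < n) c k) /\
  Ex P (fun w => \sum_(k < n) H k (w, Y k w)) = 0.
Proof.
move=> iY mH iH H0 Hc.
suff main m : (m <= n)%N ->
  [/\ measurable_fun [set: g_sigma_algebraType (past Y m)]
     ((fun w => \sum_(k < m) H k (w, Y k w)) : g_sigma_algebraType (past Y m) -> R),
   sqb P (fun w => \sum_(k < m) H k (w, Y k w)) (\sum_(k < m) c k) &
   Ex P (fun w => \sum_(k < m) H k (w, Y k w)) = 0].
  by have [] := main n (leqnn n).
elim: m => [_|m IH mn].
  under eq_fun do rewrite big_ord0; rewrite big_ord0; split.
  - exact: measurable_cst.
  - split; first exact: L2_cst.
    by rewrite expr0n Ex_cst.
  - by rewrite Ex_cst.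
have [mM [ML2 Mc] EM] := IH (ltnW mn).
under eq_fun do rewrite big_ord_recr/=; rewrite big_ord_recr/=.
have [HL2 Hcm] := Hc m mn.
set M := (fun w => \sum_(k < m) H k (w, Y k w)) in mM ML2 Mc EM *.
(* The partial sum is a function of the past, so integrating over the new variable first gives
   zero. *)
have cross : Ex P (fun w => M w * H m (w, Y m w)) = 0.
  apply: (@Ex_past0 n m Y iY mn (fun x => M x.1 * H m x)).
  - apply: measurable_funM; last exact: mH.
    exact: (measurableT_comp mM measurable_fst).
  - by move=> w; exact: (L1Z (M w) (iH m w mn)).
  - by move=> w; rewrite (ExZ (M w) (iH m w mn)) H0 ?mulr0.
  - exact: (L2M ML2 HL2).
split.
- apply: measurable_funD; first exact: (past_funW (leqnSn m)).
  exact: (@past_now n Y m (H m) mn (mH m mn)).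
- split; first exact: L2D.
  rewrite [X in Ex P X](_ : _ = (fun w => M w ^+ 2 + 2 * (M w * H m (w, Y m w)) + H m (w, Y m w) ^+ 2)); last first.
    by apply/funext => w; rewrite /M; ring.
  have M2 : L1 P (fun w => M w ^+ 2) by case: ML2.
  have HH2 : L1 P (fun w => H m (w, Y m w) ^+ 2) by case: HL2.
  have MH := L2M ML2 HL2.
  rewrite !ExD ?ExZ//; [|exact: L1Z|by apply: L1D => //; exact: L1Z].
  by rewrite cross mulr0 addr0 lerD.
- rewrite ExD ?EM ?add0r; [|exact: L2_L1|exact: L2_L1].
  apply: (@Ex_past0 n m Y iY mn (H m)) => //; [exact: mH| | |exact: L2_L1].
  + by move=> w; exact: iH.
  + by move=> w; exact: H0.
Qed.

End iid_family.

(** * The exponential law *)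

Section exponential_law.
Context (R : realType).
Local Notation mu := (@lebesgue_measure R).
Implicit Types (a s t x y p : R).

Definition expo_rate a (a0 : 0 < a) : probability (measurableTypeR R) R :=
  exponential_distribution_exponential_prob__canonical__probability_measure_Probability a0.

Lemma integral_exp_tail a t : 0 < a ->
  (\int[mu]_(x in `[t, +oo[) (a * expR (- a * x))%:E = (expR (- a * t))%:E)%E.
Proof.
move=> a0.
have cE : continuous (fun x : R => expR (- a * x)).
  move=> x; apply: (@continuous_comp _ _ _ ( *%R (- a)) expR); last exact: continuous_expR.
  exact: mulrl_continuous.
have cE2 : continuous (fun x : R => a * expR (- a * x)).
  move=> x; apply: (@continuous_comp _ _ _ (fun x : R => expR (- a * x)) ( *%R a)).
    exact: cE.
  exact: mulrl_continuous.
rewrite (@ge0_continuous_FTC2y _ _ (fun x => - expR (- a * x)) t 0).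
- by rewrite EFinN oppeK add0e.
- by move=> x _; rewrite mulr_ge0 ?expR_ge0// ltW.
- exact: continuous_subspaceT.
- rewrite -oppr0; apply: cvgN.
  rewrite (_ : (fun x => expR (- a * x)) = (fun z => expR (- z)) \o (fun z => a * z)); last first.
    by apply: eq_fun => x; rewrite mulNr.
  apply: (@cvg_comp _ _ _ _ _ _ (pinfty_nbhs R)); last exact: cvgr_expR.
  exact: gt0_cvgMry.
- by move=> x _; exact: ex_derive.
- by apply: cvgN; apply/cvg_at_right_filter; exact: cE.
- move=> x _; rewrite derive1_comp// derive1N// derive1_id mulN1r derive1_comp// derive1E.
  have /funeqP -> := @derive_expR R.
  by rewrite derive1Ml// derive1_id mulr1 mulrN opprK mulrC.
Qed.

Lemma expo_rate_ray a (a0 : 0 < a) t :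
  expo_rate a0 `]t, +oo[%classic = (expR (- a * Num.max 0 t))%:E.
Proof.
rewrite /= /exponential_prob integral_itv_obnd_cbnd; last first.
  by apply/measurable_EFinP/measurable_funTS; exact: measurable_exponential_pdf.
rewrite -(integral_exp_tail (Num.max 0 t) a0).
rewrite integral_mkcond [RHS]integral_mkcond; apply: eq_integral => x _.
rewrite !patchE !mem_setE/= !in_itv/= !andbT ge_max /exponential_pdf patchE mem_setE/= in_itv/= andbT.
by case: (t <= x); case: (0 <= x).
Qed.

Lemma integral_expo_rate a (a0 : 0 < a) (f : measurableTypeR R -> \bar R) :
  measurable_fun [set: measurableTypeR R] f -> (forall x, 0 <= f x)%E ->
  (\int[expo_rate a0]_x f x = \int[mu]_x (f x * (exponential_pdf a x)%:E))%E.
Proof.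
move=> mf f0; apply: integral_density => //.
- by move=> x; apply: exponential_pdf_ge0; exact: ltW.
- exact: measurable_exponential_pdf.
Qed.

Definition expo : probability (measurableTypeR R) R := expo_rate ltr01.

Lemma expo_ray t : 0 <= t -> expo `]t, +oo[%classic = (expR (- t))%:E.
Proof. by move=> t0; rewrite expo_rate_ray max_r// mulN1r. Qed.

Lemma expo_ray_neg t : t <= 0 -> expo `]t, +oo[%classic = 1%E.
Proof. by move=> t0; rewrite expo_rate_ray max_l// mulr0 expR0. Qed.

Lemma expo_neg : expo `]-oo, 0[%classic = 0%E.
Proof.
rewrite /= /exponential_prob integral0_eq// => x /=; rewrite in_itv/= => x0.
by rewrite lt0_exponential_pdf.
Qed.

(** The exceptional points lie in the negative half-line, which is null; hence [Q] may be any
    predicate, measurable or not. *)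
Lemma expo_ae (Q : R -> Prop) : (forall x, 0 <= x -> Q x) ->
  {ae expo, forall x, Q x}.
Proof.
move=> h; exists `]-oo, 0[%classic; split => //; first exact: expo_neg.
move=> x /= nQ; rewrite in_itv/= ltNge; apply/negP => x0; exact: nQ (h _ x0).
Qed.

Lemma eq_Ex_expo (f g : measurableTypeR R -> R) :
  measurable_fun [set: measurableTypeR R] f -> measurable_fun [set: measurableTypeR R] g ->
  (forall x, 0 <= x -> f x = g x) -> Ex expo f = Ex expo g.
Proof.
move=> mf mg fg; rewrite /Ex /Rintegral; congr fine.
apply: ae_eq_integral => //; [exact/measurable_EFinP|exact/measurable_EFinP|].
by apply: expo_ae => x x0 _; rewrite fg.
Qed.

Lemma L1_expo_le (f g : measurableTypeR R -> R) :
  measurable_fun [set: measurableTypeR R] f ->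
  (forall x, 0 <= x -> `|f x| <= g x) -> L1 expo g -> L1 expo f.
Proof.
move=> mf fg ig.
have mg := L1_measurable ig.
have h := L1_norm ig.
apply/integrableP; split; first exact/measurable_EFinP.
move/integrableP : (h) => [_ hlt]; apply: le_lt_trans hlt.
apply: ae_ge0_le_integral => //.
- by apply: measurableT_comp => //; exact/measurable_EFinP.
- by apply: measurableT_comp => //; apply/measurable_EFinP; exact: measurableT_comp.
apply: expo_ae => x x0 _ /=; rewrite lee_fin normr_id.
by rewrite (le_trans (fg _ x0))// ler_norm.
Qed.

Lemma Ex_expo_le (f g : measurableTypeR R -> R) : L1 expo f -> L1 expo g ->
  (forall x, 0 <= x -> f x <= g x) -> Ex expo f <= Ex expo g.
Proof.
move=> hf hg fg.
have mf := L1_measurable hf; have mg := L1_measurable hg.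
rewrite (@eq_Ex_expo f (fun x => Num.min (f x) (g x)))//.
- apply: Ex_le => // [|x]; last by rewrite ge_min lexx orbT.
  apply: (@L1_le _ _ _ _ _ (fun x : measurableTypeR R => `|f x| + `|g x|)).
  + exact: measurable_minr.
  + by move=> x; rewrite minEle; case: ifP => _; rewrite ?lerDl ?lerDr.
  + by apply: L1D; exact: L1_norm.
- exact: measurable_minr.
- by move=> x x0; rewrite min_l// fg.
Qed.

Lemma measurable_expRM s : measurable_fun [set: measurableTypeR R] (fun x : R => expR (s * x)).
Proof. by apply: measurableT_comp => //; exact: measurable_funM. Qed.

Lemma Ex_expo_exp s : s < 1 -> L1 expo (fun x : R => expR (s * x)) /\
  Ex expo (fun x : R => expR (s * x)) = (1 - s)^-1.
Proof.
move=> s1; have r0 : 0 < 1 - s by lra.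
have e : (\int[expo]_x (expR (s * x))%:E = ((1 - s)^-1)%:E)%E.
  rewrite integral_expo_rate; first last.
  - by move=> x; rewrite lee_fin expR_ge0.
  - by apply/measurable_EFinP; exact: measurable_expRM.
  have h := integral_exponential_pdf r0.
  (* Tilting the standard exponential density by exp(s x) gives a multiple of the density of rate 1
     - s. *)
  transitivity (\int[mu]_x (((1 - s)^-1)%:E * (exponential_pdf (1 - s) x)%:E))%E.
    apply: eq_integral => x _; rewrite -!EFinM; congr EFin.
    rewrite /exponential_pdf !patchE; case: ifP => _; last by rewrite !mulr0.
    rewrite mul1r mulrA mulVf ?gt_eqF// mul1r -expRD; congr expR; ring.
  rewrite ge0_integralZl ?h ?mule1//.
  - by apply/measurable_EFinP; exact: measurable_exponential_pdf.
  - by move=> x _; rewrite lee_fin exponential_pdf_ge0// ltW.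
  - by rewrite lee_fin invr_ge0 ltW.
split; last by rewrite /Ex /Rintegral e.
apply: (L1_ge0P _ _ _).2 => //; first exact: measurable_expRM.
by rewrite e ltry.
Qed.

(** This is p ln (x / (2 p)) <= x / 2, exponentiated. The rate 1 / 2 is below 1, so the bound is
    integrable for the standard exponential law. *)
Lemma powR_le_exp p x : 0 < p -> 0 <= x -> x `^ p <= (2 * p) `^ p * expR (x / 2).
Proof.
move=> p0; rewrite le_eqVlt => /predU1P[<-|x0].
  by rewrite powR0 ?gt_eqF// mulr_ge0 ?powR_ge0 ?expR_ge0.
rewrite /powR !gt_eqF// ?mulr_gt0// -expRD ler_expR.
have y0 : 0 < x / (2 * p) by rewrite divr_gt0// mulr_gt0.
have := ln_sublinear y0; rewrite ln_div ?posrE ?mulr_gt0//.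
rewrite -(ltr_pM2l p0) => h.
have : p * (x / (2 * p)) = x / 2 by field; rewrite gt_eqF.
lra.
Qed.

Lemma L1_expo_pow p : 0 <= p -> L1 expo (fun x : R => x `^ p).
Proof.
rewrite le_eqVlt => /predU1P[<-|p0].
  by apply: (@L1_bounded _ _ _ _ _ 1); [exact: measurable_powR|move=> x; rewrite powRr0 normr1].
apply: (@L1_expo_le _ (fun x => (2 * p) `^ p * expR (2^-1 * x))).
- exact: measurable_powR.
- by move=> x x0; rewrite ger0_norm ?powR_ge0// mulrC (mulrC _ x) mulrC; exact: powR_le_exp.
- by apply: L1Z; apply: (Ex_expo_exp _).1; lra.
Qed.

Lemma Ex_expo_pow p : 0 < p -> Ex expo (fun x : R => x `^ p) = Gamma (p + 1).
Proof.
move=> p0; rewrite /Ex /Gamma /Rintegral; congr fine.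
rewrite integral_expo_rate; first last.
- by move=> x; rewrite lee_fin powR_ge0.
- by apply/measurable_EFinP; exact: measurable_powR.
rewrite [RHS]integral_mkcond; apply: eq_integral => x _.
rewrite patchE; case: ifPn => [|].
  rewrite inE/= in_itv/= andbT => x0.
  by rewrite exponential_pdfE ?ltW// -EFinM mulN1r mul1r addrK.
rewrite notin_setE/= in_itv/= andbT => /negP; rewrite -leNgt le_eqVlt => /predU1P[->|x0].
  by rewrite powR0 ?gt_eqF// mul0e.
by rewrite lt0_exponential_pdf// mule0.
Qed.

End exponential_law.


Section exponential_moments.
Context (R : realType).
Local Notation mu := (@lebesgue_measure R).
Local Notation expo := (@expo R).
Implicit Types (a x y p : R).

Lemma integral_powR p x : 0 <= p -> 0 <= x ->
  (\int[mu]_(y in `[0%R, x]) ((p + 1) * y `^ p)%:E = (x `^ (p + 1))%:E)%E.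
Proof.
rewrite le_eqVlt => /predU1P[<-|p0] x0'.
  under eq_integral do rewrite powRr0 add0r mulr1.
  rewrite -[LHS]/(\int[mu]_(y in `[0%R, x]) (cst 1%E) y)%E integral_cst// mul1e.
  transitivity (@lebesgue_measure R `[0, x]%classic) => //.
  rewrite lebesgue_measure_itv/= lte_fin; have := x0'.
  by rewrite add0r powRr1// le_eqVlt => /predU1P[<-|->]; rewrite ?ltxx// oppr0 adde0.
move: x0'; rewrite le_eqVlt => /predU1P[<-|x0].
  by rewrite set_itv1 integral_set1 powR0// gt_eqF// addr_gt0.
have p10 : 0 < p + 1 by rewrite addr_gt0.
have cpx (q y : R) : 0 < y -> {for y, continuous (fun z : R => z `^ q)}.
  move=> y0; apply: differentiable_continuous; apply/derivable1_diffP.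
  by apply: derivable_powR; rewrite in_itv/= y0.
have cp (q : R) : 0 < q -> {within `[0, x], continuous (fun y : R => y `^ q)}.
  move=> q0; apply/continuous_within_itvP => //; split.
  - move=> y; rewrite in_itv/= => /andP[y0 _].
    exact: cpx.
  - by rewrite powR0 ?gt_eqF//; exact: powR_cvg0.
  - by apply: cvg_at_left_filter; exact: cpx.
rewrite (@continuous_FTC2 _ _ (fun y : R => y `^ (p + 1)))//.
- by rewrite powR0 ?gt_eqF// -EFinB subr0.
- by move=> y; apply: cvgM; [exact: cvg_cst|exact: cp].
- split.
  + by move=> y; rewrite in_itv/= => /andP[y0 _]; apply: derivable_powR; rewrite in_itv/= y0.
  + by rewrite powR0 ?gt_eqF//; exact: powR_cvg0.
  + by apply: cvg_at_left_filter; exact: cpx.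
- move=> y; rewrite in_itv/= => /andP[y0 _].
  by rewrite powR_derive1 ?in_itv/= ?y0// addrK.
Qed.

(** The functional equation of Gamma by Tonelli: x^(p+1) is the integral of (p + 1) y^p over 0 <= y
    <= x, and after the exchange the tail of the law at [y] is its density at [y]. *)
Lemma Ex_expo_powS p : 0 <= p ->
  Ex expo (fun x : R => x `^ (p + 1)) = (p + 1) * Ex expo (fun x : R => x `^ p).
Proof.
move=> p0; have p10 : 0 < p + 1 by rewrite ltr_wpDl.
rewrite -ExZ; last exact: L1_expo_pow.
rewrite /Ex /Rintegral; congr fine.
pose h (z : R * R) : R := if (0 <= z.2) && (z.2 <= z.1) then (p + 1) * z.2 `^ p else 0.
have h0 z : 0 <= h z.
  by rewrite /h; case: ifP => // _; rewrite mulr_ge0 ?powR_ge0// ltW.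
have mh : measurable_fun [set: measurableTypeR R * measurableTypeR R] h.
  apply: measurable_fun_ifT => //.
    apply: measurable_and.
      by apply: measurable_fun_ler.
    by apply: measurable_fun_ler.
  apply: measurable_funM => //.
  by apply: (measurableT_comp (measurable_powR p)).
transitivity (\int[expo]_x \int[mu]_y (h (x, y))%:E)%E.
  apply: ae_eq_integral => //.
  - by apply/measurable_EFinP; exact: measurable_powR.
  - apply: (@measurable_fun_fubini_tonelli_F _ _ _ _ _ mu (EFin \o h)) => /=.
      exact/measurable_EFinP.
    by move=> z; rewrite lee_fin.
  - apply: expo_ae => x x0 _; rewrite -integral_powR//.
    rewrite integral_mkcond; apply: eq_integral => y _.
    rewrite /h /= patchE mem_setE/= in_itv/=.
    by case: ifP.
rewrite (@fubini_tonelli _ _ _ _ _ expo mu (EFin \o h)); first last.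
- by move=> z; rewrite /= lee_fin.
- exact/measurable_EFinP.
rewrite integral_expo_rate; first last.
- by move=> y; rewrite lee_fin mulr_ge0 ?powR_ge0// ltW.
- by apply/measurable_EFinP; apply: measurable_funM => //; exact: measurable_powR.
apply: eq_integral => y _ /=.
have [y0|y0] := ltP y 0.
  rewrite lt0_exponential_pdf// mule0 integral0_eq// => x _.
  by rewrite /h /= leNgt y0.
transitivity (((p + 1) * y `^ p)%:E * expo `[y, +oo[%classic)%E; last first.
  congr (_ * _)%E; rewrite exponential_pdfE// mul1r -(integral_exp_tail y ltr01).
  rewrite /= /exponential_prob integral_mkcond [RHS]integral_mkcond.
  apply: eq_integral => x _; rewrite !patchE; case: ifPn => //.
  rewrite inE/= in_itv/= andbT => yx.
  by rewrite exponential_pdfE// (le_trans y0 yx).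
transitivity (((p + 1) * y `^ p)%:E * \int[expo]_x (\1_(`[y, +oo[%classic) x)%:E)%E; last first.
  by rewrite integral_indic// setIT.
rewrite -ge0_integralZl//.
- apply: eq_integral => x _; rewrite /h /= y0/= indicE mem_setE/= in_itv/= andbT.
  by case: (y <= x); rewrite ?mule1 ?mule0.
- by apply/measurable_EFinP; exact: measurable_indic.
- by rewrite lee_fin mulr_ge0 ?powR_ge0// ltW.
Qed.

Lemma Ex_expo_pow0 : Ex expo (fun x : R => x `^ 0) = 1.
Proof. by under eq_fun do rewrite powRr0; exact: Ex_cst. Qed.

Lemma Ex_expo_pow1 : Ex expo (fun x : R => x `^ 1) = 1.
Proof. by have := Ex_expo_powS (lexx 0); rewrite add0r Ex_expo_pow0 mulr1. Qed.

Lemma Ex_expo_pow2 : Ex expo (fun x : R => x `^ 2) = 2.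
Proof.
have := @Ex_expo_powS 1 ler01; rewrite Ex_expo_pow1 mulr1.
by rewrite (_ : 1 + 1 = 2)//; ring.
Qed.

End exponential_moments.

(** * Order statistics and Renyi's representation *)

Section order_statistics.
Context (R : realType).
Implicit Types (s l : seq R) (x : R).

(** Turns an event on an order statistic into one on a count, which gives its measurability. *)
Lemma sorted_nth_le s k x : sorted <=%R s -> (k < size s)%N ->
  (nth 0 s k <= x) = (k < count (fun y : R => y <= x)%R s)%N.
Proof.
elim: s k => [//|a s IH] k /= ps.
have ss : sorted <=%R s by exact: path_sorted ps.
have alls : all (>= a) s by move: ps; rewrite (path_sortedE le_trans) => /andP[].
have [ax|xa] := leP a x; last first.
  have c0 : count (fun y : R => y <= x)%R s = 0%N.
    apply/eqP; rewrite -leqn0 leqNgt -has_count -all_predC.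
    apply: sub_all alls => y /= ay; rewrite -ltNge; exact: lt_le_trans xa ay.
  rewrite c0; case: k => [|k] /=; first by rewrite leNgt xa.
  rewrite ltnS => ks; apply/negbTE; rewrite -ltNge (lt_le_trans xa)//.
  by apply: (allP alls); exact: mem_nth.
case: k => [|k] /=; first by rewrite ax.
by rewrite ltnS => ks; rewrite IH// add1n ltnS.
Qed.

Lemma sort_nth_le l k x : (k < size l)%N ->
  (nth 0 (sort <=%R l) k <= x) = (k < count (fun y : R => y <= x)%R l)%N.
Proof.
move=> kl; rewrite sorted_nth_le ?size_sort ?sort_le_sorted//.
by congr (_ < _)%N; apply/permP; rewrite perm_sort.
Qed.

Lemma measurable_sort_nth d (U : measurableType d) (I : Type) (s : seq I) (f : I -> U -> R) k :
  (forall i, measurable_fun [set: U] (f i)) ->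
  measurable_fun [set: U] (fun u => nth 0 (sort <=%R [seq f i u | i <- s]) k).
Proof.
move=> mf; have [ks|sk] := ltnP k (size s); last first.
  under eq_fun do rewrite nth_default ?size_sort ?size_map//.
  exact: measurable_cst.
apply: (measurability _ (RGenOInfty.measurableE R)) => //.
move=> _ [_ [x ->] <-]; rewrite setTI.
have mc : measurable_fun [set: U]
    (fun u => (k.+1 <= count (fun y : R => y <= x)%R [seq f i u | i <- s])%N).
  apply: measurable_fun_leq; first exact: measurable_cst.
  elim: (s) => [|a s' IH]; first exact: measurable_cst.
  rewrite [X in measurable_fun _ X](_ : _ = (fun u =>
    ((if (f a u <= x)%R then 1 else 0) + count (fun y : R => y <= x)%R [seq f i u | i <- s'])%N)); last first.
    by apply/funext => u /=; case: ifP.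
  apply: measurable_fun_addn => //; apply: measurable_fun_ifT => //.
  by apply: measurable_fun_ler => //; exact: mf.
have mf0 : measurable [set false] by [].
have := mc measurableT [set false] mf0; rewrite setTI; congr (measurable _).
apply/seteqP; split => u /=; rewrite in_itv/= andbT ltNge sort_nth_le ?size_map//.
  by move=> ->.
by move=> /negbTE.
Qed.

Lemma sort_cons_min a s : all (>= a) s -> sort <=%R (a :: s) = a :: sort <=%R s.
Proof.
move=> h; apply: le_sorted_eq.
- exact: sort_le_sorted.
- rewrite /= (path_sortedE le_trans) sort_le_sorted andbT.
  by apply/allP => x; rewrite mem_sort; exact: (allP h).
- by rewrite perm_sort perm_cons perm_sym perm_sort.
Qed.

(* [t] is indexed by the number of points still to come. *)
Fixpoint gaps (t : nat -> R) (z0 : R) (zs : seq R) : bool :=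
  if zs is z :: zs' then
    (t (size zs') < (size zs').+1%:R * (z - z0)) && gaps t z zs'
  else true.

End order_statistics.

Section renyi.
Context d (T : measurableType d) (R : realType) (P : probability T R).
Variable Z : nat -> T -> R.
Hypothesis mZ : forall i, measurable_fun [set: T] (Z i).
Hypothesis Z0 : forall i w, 0 <= Z i w.
Local Notation expo := (expo R).
Hypothesis indZ : forall (s : seq nat) (B : nat -> set (measurableTypeR R)), uniq s ->
  (forall i, measurable (B i)) ->
  P (\bigcap_(i in [set` s]) Z i @^-1` B i) = (\prod_(i <- s) expo (B i))%E.

(** Indexed by a list and not by an initial segment, since the recursion below removes the index of
    the minimum, which can be any one. *)
Definition past_of (s : seq nat) : set (set T) :=
  [set C | exists2 B : nat -> set (measurableTypeR R), (forall i, measurable (B i)) &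
     C = \bigcap_(i in [set` s]) Z i @^-1` B i].

Lemma past_ofI s : setI_closed (past_of s).
Proof.
move=> _ _ [B mB ->] [C mC ->]; exists (fun i => B i `&` C i).
  by move=> i; exact: measurableI.
by rewrite -bigcapI.
Qed.

Lemma past_ofT s : past_of s [set: T].
Proof. by exists (fun=> setT) => //; apply/seteqP; split. Qed.

Lemma past_of_meas s C : past_of s C -> measurable C.
Proof.
move=> [B mB ->]; apply: fin_bigcap_measurable => [|i _].
  exact: finite_seq.
by rewrite -[_ @^-1` _]setTI; exact: (mZ i measurableT (mB i)).
Qed.

Lemma past_of_ind s j : uniq (j :: s) -> forall C B, past_of s C -> measurable B ->
  P (C `&` Z j @^-1` B) = (P C * expo B)%E.
Proof.
move=> us C B [A mA ->] mB.
have js : j \notin s by move: us => /= /andP[].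
pose A' (i : nat) : set (measurableTypeR R) := if i == j then B else A i.
have mA' i : measurable (A' i) by rewrite /A'; case: ifP.
have -> : \bigcap_(i in [set` s]) Z i @^-1` A i `&` Z j @^-1` B =
          \bigcap_(i in [set` j :: s]) Z i @^-1` A' i.
  apply/seteqP; split => w.
    move=> [H HB] i /=; rewrite in_cons /A' => /predU1P[->|ik]; first by rewrite eqxx.
    by case: eqP => [->//|_]; exact: H.
  move=> H; split => [i /= ik|].
    have := H i; rewrite /A' /= in_cons ik orbT => /(_ isT).
    by case: eqP ik => // ->; rewrite (negbTE js).
  by have := H j; rewrite /= in_cons eqxx /A' eqxx => /(_ isT).
rewrite !indZ//; last by move: us => /andP[].
rewrite big_cons /A' eqxx muleC; congr (_ * _)%E.
apply: eq_big_seq => i ik; case: eqP ik => // ->.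
by rewrite (negbTE js).
Qed.

Lemma past_of_fun s j : j \in s ->
  measurable_fun [set: g_sigma_algebraType (past_of s)]
    (Z j : g_sigma_algebraType (past_of s) -> R).
Proof.
move=> js _ B mB; rewrite setTI; apply: sub_sigma_algebra.
exists (fun i => if i == j then B else setT).
  by move=> i; case: ifP.
apply/seteqP; split => w.
  by move=> H i /= ik; case: eqP => [->|].
by move=> /(_ j js) /=; rewrite eqxx.
Qed.

(** The event [gaps] of the sorted values, split according to the index that attains the minimum.
    Unlike sorting, this names the variable over which to integrate next. *)
Fixpoint gaps_event (t : nat -> R) (m : nat) (s : seq nat) (z0 : R) (w : T) : bool :=
  if m is m'.+1 then
    has (fun j => (t m' < m'.+1%:R * (Z j w - z0)) && gaps_event t m' (rem j s) (Z j w) w) s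
  else true.

(** Stated along an arbitrary map [h] into the past, so as to apply on the sample space and on the
    product spaces of Tonelli's theorem. *)
Lemma measurable_gaps_event t m s s' d' (U : measurableType d')
    (h : U -> g_sigma_algebraType (past_of s')) (z : U -> R) :
  measurable_fun [set: U] h -> measurable_fun [set: U] z -> {subset s <= s'} ->
  measurable_fun [set: U] (fun u => gaps_event t m s (z u) (h u)).
Proof.
move=> mh; elim: m s z => [|m IH] s z mz ss' /=; first exact: measurable_cst.
have H (l : seq nat) : {subset l <= s} -> measurable_fun [set: U] (fun u =>
   has (fun j => (t m < m.+1%:R * (Z j (h u) - z u)) &&
       gaps_event t m (rem j s) (Z j (h u)) (h u)) l).
  elim: l => [|j l IHl] ls /=; first exact: measurable_cst.
  have js : j \in s by apply: ls; rewrite mem_head.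
  have mZj : measurable_fun [set: U] (fun u => Z j (h u)).
    by apply: measurableT_comp mh; apply: past_of_fun; exact: ss'.
  apply: measurable_or.
    apply: measurable_and.
      apply: measurable_fun_ltr => //; apply: measurable_funM => //.
      exact: measurable_funB.
    by apply: IH => // i /mem_rem/ss'.
  by apply: IHl => i il; apply: ls; rewrite in_cons il orbT.
by apply: H.
Qed.

Lemma gaps_gt (t : nat -> R) (z0 : R) zs : (forall i, 0 <= t i) -> gaps t z0 zs -> path <%R z0 zs.
Proof.
move=> t0; elim: zs z0 => //= z zs IH z0 /andP[h g]; rewrite IH// andbT.
have := le_lt_trans (t0 _) h; rewrite pmulr_rgt0 ?ltr0Sn// subr_gt0.
by [].
Qed.

(** Nonnegative thresholds force strictly increasing values, so the index chosen at each stage can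
    only be that of the minimum. *)
Lemma gaps_eventE t m s z0 w : (forall i, 0 <= t i) -> size s = m -> uniq s ->
  gaps_event t m s z0 w = gaps t z0 (sort <=%R [seq Z i w | i <- s]).
Proof.
move=> t0; elim: m s z0 => [|m IH] s z0.
  by case: s => //= _ _; rewrite /sort.
move=> sz us /=; apply/idP/idP.
  move=> /hasP[j js /andP[h1 h2]].
  rewrite IH ?size_rem ?sz ?rem_uniq// in h2.
  have gt := gaps_gt t0 h2.
  have pe : perm_eq [seq Z i w | i <- s] (Z j w :: [seq Z i w | i <- rem j s]).
    by rewrite -map_cons; apply: perm_map; exact: perm_to_rem.
  rewrite (perm_sort_leP _ _ pe).
  rewrite sort_cons_min/=; last first.
    apply/allP => x xin; have : x \in sort <=%R [seq Z i w | i <- rem j s] by rewrite mem_sort.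
    move: gt; rewrite (path_sortedE lt_trans) => /andP[/allP al _] /al; exact: ltW.
  by rewrite h2 size_sort size_map size_rem// sz/= h1.
case E : (sort _ _) => [|z zs].
  by have := size_sort <=%R [seq Z i w | i <- s]; rewrite E size_map sz.
move=> /= /andP[h1 h2].
have zs_s : z \in [seq Z i w | i <- s].
  by rewrite -(mem_sort <=%R) E mem_head.
move: zs_s => /mapP[j js zE]; apply/hasP; exists j => //.
have szz : size zs = m.
  by have := size_sort <=%R [seq Z i w | i <- s]; rewrite E size_map sz => -[].
rewrite -zE -szz h1/= szz IH ?size_rem ?sz ?rem_uniq//.
suff -> : sort <=%R [seq Z i w | i <- rem j s] = zs by [].
have so : sorted <=%R (z :: zs) by rewrite -E sort_le_sorted.
apply: le_sorted_eq; first exact: sort_le_sorted.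
  exact: path_sorted so.
rewrite perm_sort -(perm_cons z) {1}zE -map_cons -E.
rewrite perm_sym; apply: (@perm_trans _ [seq Z i w | i <- s]); first by rewrite perm_sort.
by apply: perm_map; exact: perm_to_rem.
Qed.

(** By induction on the number of points: integrate over the minimum, the other points being treated
    by the induction hypothesis with the minimum as new origin. The factor exp(- m z0) is the
    probability that all points exceed [z0]. *)
Lemma renyi_gaps (t : nat -> R) m s z0 : (forall i, 0 <= t i) -> 0 <= z0 ->
  size s = m -> uniq s ->
  P [set w | gaps_event t m s z0 w] =
  (expR (- (m%:R * z0)) * \prod_(i < m) expR (- t i))%:E.
Proof.
move=> t0; elim: m s z0 => [|m IH] s z0 z00 sz us.
  rewrite mul0r oppr0 expR0 big_ord0 mulr1 /=.
  by rewrite [X in P X](_ : _ = setT) ?probability_setT//; apply/seteqP; split.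
pose D j w := (t m < m.+1%:R * (Z j w - z0)) && gaps_event t m (rem j s) (Z j w) w.
have mtoG s' : measurable_fun [set: T] (fun w : T => (w : g_sigma_algebraType (past_of s'))).
  by move=> _ B mB; rewrite setTI; exact: (past_measurable (@past_of_meas s') mB).
have mD j : j \in s -> measurable_fun [set: T] (D j).
  move=> js; apply: measurable_and.
    apply: measurable_fun_ltr => //; apply: measurable_funM => //.
    by apply: measurable_funB => //; exact: mZ.
  by apply: (measurable_gaps_event t m (mtoG s) (mZ j)) => i /mem_rem.
have mDs j : j \in s -> measurable [set w | D j w].
  by move=> js; have := mD j js measurableT [set true]; rewrite setTI; apply.
(* Each of the two values would be strictly below the other. *)
have disj i j w : i \in s -> j \in s -> D i w -> D j w -> i = j.
  move=> is_ js /andP[_ hi] /andP[_ hj]; apply/eqP/negPn/negP => ij.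
  rewrite gaps_eventE ?size_rem ?sz ?rem_uniq// in hi.
  rewrite gaps_eventE ?size_rem ?sz ?rem_uniq// in hj.
  have /allP gi : all (> Z i w) (sort <=%R [seq Z k w | k <- rem i s]).
    by have := gaps_gt t0 hi; rewrite (path_sortedE lt_trans) => /andP[].
  have /allP gj : all (> Z j w) (sort <=%R [seq Z k w | k <- rem j s]).
    by have := gaps_gt t0 hj; rewrite (path_sortedE lt_trans) => /andP[].
  have h1 : Z i w < Z j w.
    apply: gi; rewrite mem_sort; apply: map_f; rewrite mem_rem_uniq// inE eq_sym ij//.
  have h2 : Z j w < Z i w.
    by apply: gj; rewrite mem_sort; apply: map_f; rewrite mem_rem_uniq// inE ij.
  by have := lt_trans h1 h2; rewrite ltxx.
(* Every index is equally likely to attain the minimum, whence the factor 1 / (m + 1). *)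
have PD j : j \in s -> P [set w | D j w] =
    (m.+1%:R^-1 * (expR (- (m.+1%:R * z0)) * \prod_(i < m.+1) expR (- t i)))%:E.
  move=> js.
  pose s' := rem j s.
  have us' : uniq (j :: s') by rewrite -(perm_uniq (perm_to_rem js)).
  pose TG := g_sigma_algebraType (past_of s').
  pose b (x : TG * measurableTypeR R) := (t m < m.+1%:R * (x.2 - z0)) && gaps_event t m s' x.2 x.1.
  have mb d' (U : measurableType d') (h : U -> TG) (y : U -> R) : measurable_fun setT h -> measurable_fun setT y ->
      measurable_fun [set: U] (fun u => b (h u, y u)).
    move=> mh my; apply: measurable_and.
      by apply: measurable_fun_ltr => //; apply: measurable_funM => //; exact: measurable_funB.
    exact: (measurable_gaps_event t m mh my).
  have mbR d' (U : measurableType d') (h : U -> TG) (y : U -> R) : measurable_fun setT h -> measurable_fun setT y ->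
      measurable_fun [set: U] (fun u => ((b (h u, y u))%:R : R)%:E).
    move=> mh my; apply/measurable_EFinP.
    rewrite [X in measurable_fun _ X](_ : _ = (fun u => if b (h u, y u) then 1 else 0)); last first.
      by apply/funext => u; case: (b _).
    by apply: measurable_fun_ifT => //; exact: mb.
  have indicE' d' (U : measurableType d') (mu : {measure set U -> \bar R}) (Q : U -> bool) : measurable_fun setT Q ->
      (\int[mu]_u ((Q u)%:R : R)%:E = mu [set u | Q u])%E.
    move=> mQ; rewrite -[X in mu X]setIT -integral_indic//; last first.
      by have := mQ measurableT [set true]; rewrite setTI; apply.
    by apply: eq_integral => u _; rewrite indicE mem_setE.
  rewrite -indicE'; last exact: mD.
  have := @indep_fubini_ge0 _ _ _ P (past_of s') (@past_of_meas s') (@past_ofI s') (@past_ofT s')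
    (Z j) expo (mZ j) (past_of_ind us') (fun x => ((b x)%:R : R)%:E).
  move=> ->; last 2 first.
  - rewrite [X in measurable_fun _ X](_ : _ = (fun u => ((b (u.1, u.2))%:R : R)%:E)); last first.
      by apply/funext => -[].
    by apply: (mbR _ _ fst snd).
  - by move=> x; rewrite lee_fin ler0n.
  rewrite (@fubini_tonelli _ _ _ _ _ P expo (fun x => ((b x)%:R : R)%:E)); first last.
  - by move=> x; rewrite lee_fin ler0n.
  - rewrite [X in measurable_fun _ X](_ : _ = (fun u => ((b (u.1, u.2))%:R : R)%:E)); last first.
      by apply/funext => -[].
    apply: (mbR _ (T * measurableTypeR R)%type (fun x => x.1) snd) => //.
    exact: (measurableT_comp (mtoG s') measurable_fst).
  pose C := \prod_(i < m) expR (- t i).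
  (* The gap condition on the minimum [y] reads c < y; the remaining points contribute exp(- m y),
     and the density of the minimum variable itself exp(- y). *)
  pose c := z0 + t m / m.+1%:R.
  have c0 : 0 <= c by rewrite addr_ge0// divr_ge0.
  have cE y : (t m < m.+1%:R * (y - z0)) = (c < y).
    by rewrite /c -ltrBrDl ltr_pdivrMr ?ltr0Sn// mulrC.
  transitivity (\int[expo]_y ((C * expR (- (m%:R * y))) * (c < y)%R%:R)%:E)%E.
    apply: eq_integral => y _; rewrite /b /= cE.
    have [cy|yc] := ltP c y; last by rewrite mulr0 integral0_eq.
    rewrite /= indicE'; last first.
      exact: (measurable_gaps_event t m (mtoG s') (@measurable_cst _ _ _ _ _ y)).
    rewrite -[LHS]/(P [set w | gaps_event t m s' y w]) (IH s' y)//; first by rewrite mulr1 mulrC.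
    - exact: ltW (le_lt_trans c0 cy).
    - by rewrite /s' size_rem// sz.
    - by move: us' => /andP[].
  rewrite integral_expo_rate; first last.
  - move=> y; rewrite lee_fin mulr_ge0 ?ler0n// mulr_ge0 ?expR_ge0//.
    by apply: prodr_ge0 => i _; exact: expR_ge0.
  - apply/measurable_EFinP; apply: measurable_funM.
      apply: measurable_funM => //; apply: measurableT_comp => //.
      by apply: measurable_funN; apply: measurable_funM.
    rewrite [X in measurable_fun _ X](_ : _ = (fun y : R => if c < y then 1 else 0)); last first.
      by apply/funext => u; case: (c < u).
    by apply: measurable_fun_ifT => //; apply: measurable_fun_ltr.
  transitivity ((m.+1%:R^-1 * C)%:E * \int[lebesgue_measure]_(y in `[c, +oo[) (m.+1%:R * expR (- m.+1%:R * y))%:E)%E; last first.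
    rewrite integral_exp_tail// -EFinM; congr EFin.
    rewrite big_ord_recr/= -/C -!mulrA; congr (_ * _).
    rewrite mulrCA; congr (_ * _); rewrite -expRD; congr expR.
    by rewrite /c mulNr mulrDr mulrCA mulfV ?pnatr_eq0// mulr1 opprD.
  rewrite -integral_itv_obnd_cbnd; last first.
    apply/measurable_EFinP/measurable_funTS; apply: measurable_funM => //.
    by apply: measurableT_comp => //; exact: measurable_funM.
  rewrite -ge0_integralZl//.
  - rewrite [RHS]integral_mkcond; apply: eq_integral => y _.
    rewrite patchE mem_setE/= in_itv/= andbT; case: ifP => cy; last by rewrite mulr0 mul0e.
    rewrite exponential_pdfE; last exact: ltW (le_lt_trans c0 cy).
    rewrite -!EFinM; congr EFin; rewrite mulr1 mul1r mulrACA mulVf ?pnatr_eq0// mul1r.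
    rewrite -mulrA -expRD; congr (_ * expR _); rewrite -(natr1 m); ring.
  - apply/measurable_EFinP/measurable_funTS; apply: measurable_funM => //.
    by apply: measurableT_comp => //; exact: measurable_funM.
  - by rewrite lee_fin mulr_ge0 ?invr_ge0 ?ler0n//; apply: prodr_ge0 => i _; exact: expR_ge0.
set K := (X in X%:E).
have main (l : seq nat) : {subset l <= s} -> uniq l ->
    P [set w | has (D^~ w) l] = ((size l)%:R * (m.+1%:R^-1 * K))%:E /\
    measurable [set w | has (D^~ w) l].
  elim: l => [|j l IHl] ls ul /=.
    rewrite (_ : [set _ | false] = set0); last by apply/seteqP; split.
    by rewrite measure0 mul0r; split.
  have js : j \in s by apply: ls; rewrite mem_head.
  have ls' : {subset l <= s} by move=> i il; apply: ls; rewrite in_cons il orbT.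
  have [e ml] := IHl ls' (andP ul).2.
  have -> : [set w | D j w || has (D^~ w) l] = [set w | D j w] `|` [set w | has (D^~ w) l].
    by apply/seteqP; split => w /=; [move=> /orP|move=> h; apply/orP].
  split; last by apply: measurableU => //; exact: mDs.
  have dj : [set w | D j w] `&` [set w | has (D^~ w) l] = set0.
    apply/seteqP; split => // w [/= h1 /hasP[i il h2]].
    have ij := disj j i w js (ls' _ il) h1 h2.
    by move: ul; rewrite /= ij il.
  rewrite measureU//; last exact: mDs.
  rewrite [X in (X + _)%E]PD// [X in (_ + X)%E]e -EFinD; congr EFin.
  by rewrite -/K -(natr1 (size l)); ring.
have [-> _] := main s (fun i h => h) us.
by rewrite sz mulrA mulfV ?pnatr_eq0// mul1r.
Qed.

(** The value 0 is put in front so that the gap from 0 to the minimum counts as a spacing; index k +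
    1 here is index k of [order_stat]. *)
Definition ordered (n k : nat) (w : T) : R :=
  nth 0 (0 :: sort <=%R [seq Z i w | i <- iota 0 n]) k.

Definition nspacing (n k : nat) (w : T) : R :=
  (n - k)%:R * (ordered n k.+1 w - ordered n k w).

Lemma measurable_ordered n k : measurable_fun [set: T] (ordered n k).
Proof.
case: k => [|k]; first exact: measurable_cst.
exact: measurable_sort_nth.
Qed.

Lemma measurable_nspacing n k : measurable_fun [set: T] (nspacing n k).
Proof.
by apply: measurable_funM => //; apply: measurable_funB; exact: measurable_ordered.
Qed.

Lemma ordered_le n k w : (k < n)%N -> ordered n k w <= ordered n k.+1 w.
Proof.
move=> kn; rewrite /ordered.
have s0 : sorted <=%R (0 :: sort <=%R [seq Z i w | i <- iota 0 n]).
  rewrite /= (path_sortedE le_trans) sort_le_sorted andbT.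
  by apply/allP => x; rewrite mem_sort => /mapP[i _ ->].
apply: (sorted_leq_nth le_trans lexx 0 s0) => //; rewrite inE/= size_sort size_map size_iota.
  exact: leqW.
by rewrite ltnS.
Qed.

Lemma nspacing_ge0 n k w : (k < n)%N -> 0 <= nspacing n k w.
Proof. by move=> kn; rewrite mulr_ge0 ?ler0n// subr_ge0 ordered_le. Qed.

(** The thresholds of [gaps] are indexed by points still to come, hence the reversed index. *)
Lemma gapsE (t : nat -> R) (z0 : R) zs :
  gaps t z0 zs = all (fun k => t (size zs - k.+1)%N <
     (size zs - k)%:R * (nth 0 (z0 :: zs) k.+1 - nth 0 (z0 :: zs) k)) (iota 0 (size zs)).
Proof.
elim: zs z0 => [//|z zs IH] z0 /=.
rewrite subn1 subn0 /=; congr (_ && _); rewrite IH -[1%N]addn0 iotaDl all_map.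
by apply: eq_all => k /=; rewrite add1n !subSS.
Qed.

Lemma nspacing_rays n (t : nat -> R) :
  P (\bigcap_(k in `I_n) nspacing n k @^-1` `]t k, +oo[) =
  (\prod_(k < n) expo `]t k, +oo[%classic)%E.
Proof.
have pos (u : nat -> R) : (forall k, 0 <= u k) ->
    P (\bigcap_(k in `I_n) nspacing n k @^-1` `]u k, +oo[) = (\prod_(k < n) expR (- u k))%:E.
  move=> u0; pose u' i := u (n - i.+1)%N.
  have := @renyi_gaps u' n (iota 0 n) 0 (fun i => u0 _) (lexx _) (size_iota _ _) (iota_uniq _ _).
  rewrite mulr0 oppr0 expR0 mul1r => e.
  transitivity (P [set w | gaps_event u' n (iota 0 n) 0 w]).
    congr (P _); apply/seteqP; split => w.
      move=> h /=; rewrite gaps_eventE ?iota_uniq ?size_iota//; last by move=> i; exact: u0.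
      rewrite gapsE size_sort size_map size_iota; apply/allP => k.
      rewrite mem_iota add0n => /andP[_ kn].
      have := h k kn; rewrite /= in_itv/= andbT /nspacing /ordered /u'.
      by rewrite subnSK// subKn// ltnW.
    move=> /= h k /= kn; move: h; rewrite gaps_eventE ?iota_uniq ?size_iota//; last by move=> i; exact: u0.
    rewrite gapsE size_sort size_map size_iota => /allP /(_ k).
    rewrite mem_iota add0n kn => /(_ isT).
    rewrite in_itv/= andbT /nspacing /ordered /u'.
    by rewrite subnSK// subKn// ltnW.
  rewrite e; congr EFin.
  rewrite [LHS](reindex_inj rev_ord_inj)/=; apply: eq_bigr => k _.
  by rewrite /u' subnSK// subKn// ltnW.
have mI (u : nat -> R) : measurable (\bigcap_(k in `I_n) nspacing n k @^-1` `]u k, +oo[).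
  apply: fin_bigcap_measurable => [|i _]; first exact: finite_II.
  by rewrite -[_ @^-1` _]setTI; exact: measurable_nspacing.
(* All spacings are strictly positive with probability one, so negative thresholds may be replaced
   by 0. *)
pose N := \bigcap_(k in `I_n) nspacing n k @^-1` `]0, +oo[.
have PN : P N = 1%E.
  by rewrite (pos (fun=> 0))// big1// => i _; rewrite oppr0 expR0.
have PIN A : measurable A -> P A = P (A `&` N).
  move=> mA; apply/eqP; rewrite eq_le; apply/andP; split; last first.
    by apply: le_measure; rewrite ?inE//; apply: measurableI => //; exact: mI.
  have -> : P A = (P (A `&` N) + P (A `\` N))%E.
    by rewrite addeC -measureDI//; exact: mI.
  have -> : P (A `\` N) = 0%E.
    apply/eqP; rewrite eq_le measure_ge0 andbT.
    have -> : 0%E = P (~` N) by rewrite probability_setC ?PN ?subee//; exact: mI.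
    apply: le_measure; rewrite ?inE.
    - by apply: measurableD => //; exact: mI.
    - by apply: measurableC; exact: mI.
    - by move=> w [].
  by rewrite adde0.
rewrite PIN// (_ : _ `&` N = \bigcap_(k in `I_n) nspacing n k @^-1` `]Num.max 0 (t k), +oo[).
  rewrite (pos (fun k => Num.max 0 (t k))); last by move=> k; rewrite le_max lexx.
  rewrite -prodEFin; apply: eq_bigr => k _.
  by rewrite expo_rate_ray mulN1r.
apply/seteqP; split => w.
  move=> [h1 h2] k kn; have := h1 k kn; have := h2 k kn.
  by rewrite /= !in_itv/= !andbT gt_max => -> ->.
move=> h; split => k kn; have := h k kn.
  by rewrite /= !in_itv/= !andbT gt_max => /andP[].
by rewrite /= !in_itv/= !andbT gt_max => /andP[].
Qed.

(** Rays are replaced by Borel sets one coordinate at a time: [C j] has Borel sets before [j] and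
    rays from [j] on. In each coordinate both sides are finite measures that agree on rays. *)
Lemma iid_nspacing n : iid_upto P expo n (nspacing n).
Proof.
split => [k _|B mB]; first exact: measurable_nspacing.
pose C (j : nat) (B : nat -> set (measurableTypeR R)) (t : nat -> R) (i : nat) :=
  if (i < j)%N then B i else `]t i, +oo[%classic.
suff main j : (j <= n)%N -> forall (B : nat -> set (measurableTypeR R)) t, (forall i, measurable (B i)) ->
    P (\bigcap_(k in `I_n) nspacing n k @^-1` C j B t k) = (\prod_(k < n) expo (C j B t k))%E.
  have := main n (leqnn n) B (fun=> 0) mB.
  rewrite (eq_bigr (fun k : 'I_n => expo (B k))); last by move=> k _; rewrite /C ltn_ord.
  move=> <-; congr (P _); apply/seteqP; split => w h k /= kn.
    by rewrite /C kn; exact: h.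
  by have := h k kn; rewrite /C kn.
elim: j => [_ B' t _|j IH jn B' t mB']; first exact: nspacing_rays.
have mC j' i : measurable (C j' B' t i) by rewrite /C; case: ifP.
pose D := \bigcap_(k in [set k | (k < n)%N /\ k != j]) nspacing n k @^-1` C j.+1 B' t k.
have mD : measurable D.
  apply: fin_bigcap_measurable => [|i _].
    by apply: (sub_finite_set _ (finite_II n)) => k [].
  by rewrite -[_ @^-1` _]setTI; exact: (measurable_nspacing n i measurableT (mC _ _)).
have split_j (A : nat -> set (measurableTypeR R)) :
    (forall k, (k < n)%N -> k != j -> A k = C j.+1 B' t k) ->
    \bigcap_(k in `I_n) nspacing n k @^-1` A k = (nspacing n j @^-1` A j) `&` D.
  move=> hA; apply/seteqP; split => w.
    move=> h; split; first exact: h.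
    by move=> k [kn kj]; rewrite -hA//; exact: h.
  move=> [h1 h2] k /= kn; have [->//|kj] := eqVneq k j.
  by have := h2 k (conj kn kj); rewrite -hA.
have prod_j (A : nat -> set (measurableTypeR R)) :
    (forall k, (k < n)%N -> k != j -> A k = C j.+1 B' t k) ->
    (\prod_(k < n) expo (A k) = expo (A j) * \prod_(k < n | k != j :> nat) expo (C j.+1 B' t k))%E.
  move=> hA; rewrite (bigD1 (Ordinal jn))//=; congr (_ * _)%E.
  by apply: eq_bigr => k kj; rewrite hA.
rewrite split_j// prod_j//.
set c := (X in (_ * X)%E).
have c0 : (0 <= c)%E by apply: prode_ge0.
have cfin : c \is a fin_num.
  by apply: prode_fin_num => k _; exact: fin_num_measure.
have fc0 : 0 <= fine c by exact: fine_ge0.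
have mj : measurable_fun [set: T] (nspacing n j : T -> measurableTypeR R) by exact: measurable_nspacing.
pose m1 : {measure set (measurableTypeR R) -> \bar R} :=
  measure_function_pushforward__canonical__measure_function_Measure (mrestr P mD) mj.
pose m2 : {measure set (measurableTypeR R) -> \bar R} := mscale (NngNum fc0) expo.
have -> : P (nspacing n j @^-1` C j.+1 B' t j `&` D) = m1 (C j.+1 B' t j) by [].
have -> : (expo (C j.+1 B' t j) * c)%E = m2 (C j.+1 B' t j).
  by rewrite /m2 /= /mscale /= fineK// muleC.
apply: (@measure_eq_rays _ m1 m2) => //.
- move=> x; apply: (le_lt_trans (probability_le1 P _)); last exact: ltry.
  by apply: measurableI => //; rewrite -[_ @^-1` _]setTI; exact: measurable_nspacing.
- move=> x; rewrite -[LHS]/(P (nspacing n j @^-1` `]x, +oo[ `&` D)).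
  rewrite [RHS]/= /mscale /= fineK// muleC.
  pose t' i := if i == j then x else t i.
  have hA k : (k < n)%N -> k != j -> C j B' t' k = C j.+1 B' t k.
    move=> kn kj; by rewrite /C /t' (negbTE kj) -[(k < j.+1)%N]/(k <= j)%N [(k <= j)%N]leq_eqVlt (negbTE kj).
  have Cj : C j B' t' j = `]x, +oo[%classic by rewrite /C ltnn /t' eqxx.
  have := IH (ltnW jn) B' t' mB'.
  by rewrite (split_j _ hA) (prod_j _ hA) Cj.
Qed.

End renyi.

(** * Linearization of smooth sums over the sample *)

Section past_products.
Context d (T : measurableType d) (R : realType) (P : probability T R).
Variable nu : probability (measurableTypeR R) R.
Variables (n : nat) (Y : nat -> T -> R).
Hypothesis iY : iid_upto P nu n Y.
Variable k : nat.
Hypothesis kn : (k < n)%N.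
Variables (A : T -> R) (b : measurableTypeR R -> R).
Hypothesis mA : measurable_fun [set: g_sigma_algebraType (past Y k)]
  (A : g_sigma_algebraType (past Y k) -> R).

Lemma measurable_past_prod : measurable_fun [set: measurableTypeR R] b ->
  measurable_fun [set: g_sigma_algebraType (past Y k) * measurableTypeR R]
    (fun x : g_sigma_algebraType (past Y k) * measurableTypeR R => A x.1 * b x.2).
Proof.
move=> mb; apply: measurable_funM.
  exact: (measurableT_comp mA measurable_fst).
exact: (measurableT_comp mb measurable_snd).
Qed.

Lemma Ex_past_prod : (forall w, 0 <= A w) -> (forall y, 0 <= b y) -> L1 P A -> L1 nu b ->
  L1 P (fun w => A w * b (Y k w)) /\ Ex P (fun w => A w * b (Y k w)) = Ex P A * Ex nu b.
Proof.
move=> A0 b0 LA Lb.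
have e : (fun w => Ex nu (fun y => A w * b y)) = (fun w => Ex nu b * A w).
  by apply/funext => w; rewrite ExZ// mulrC.
have [h1 h2] := @Ex_past_ge0 _ _ _ P nu n k Y iY kn (fun x => A x.1 * b x.2)
  (measurable_past_prod (L1_measurable Lb)) (fun x => mulr_ge0 (A0 x.1) (b0 x.2))
  (fun w => L1Z (A w) Lb) ltac:(by rewrite /= e; exact: L1Z).
by split => //; rewrite h2 /= e ExZ// mulrC.
Qed.

End past_products.

Lemma sqb_past_prod d (T : measurableType d) (R : realType) (P : probability T R)
    (nu : probability (measurableTypeR R) R) (n : nat) (Y : nat -> T -> R) k
    (A : T -> R) (b : measurableTypeR R -> R) (a c : R) :
  iid_upto P nu n Y -> (k < n)%N ->
  measurable_fun [set: g_sigma_algebraType (past Y k)] (A : g_sigma_algebraType (past Y k) -> R) ->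
  sqb P A a -> sqb nu b c -> sqb P (fun w => A w * b (Y k w)) (a * c).
Proof.
move=> iY kn mA hA hb; have [[mA' A2] Aa] := hA; have [[mb b2] bc] := hb.
have mA2 : measurable_fun [set: g_sigma_algebraType (past Y k)] ((fun w => A w ^+ 2) : g_sigma_algebraType (past Y k) -> R).
  exact: measurable_funX.
have [h1 h2] := @Ex_past_prod _ _ _ P nu n Y iY k kn _ _ mA2
  (fun w => sqr_ge0 _) (fun y => sqr_ge0 (b y)) A2 b2.
have e : (fun w => (A w * b (Y k w)) ^+ 2) = (fun w => A w ^+ 2 * b (Y k w) ^+ 2).
  by apply/funext => w; rewrite exprMn.
split.
  split; last by rewrite e.
  by apply: measurable_funM => //; apply: (measurableT_comp mb); exact: iY.1 k kn.
rewrite e h2 ler_pM//; apply: Ex_ge0 => x; exact: sqr_ge0.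
Qed.

(** * Deviations of exponential order statistics from their means *)

Section sample.
Context d (T : measurableType d) (R : realType) (P : probability T R).
Local Notation expo := (expo R).
Implicit Types (n k : nat) (E : nat -> T -> R).

(** The order statistic Z_(k), when [E] is the family of normalised spacings ([wpos_nspacing]);
    [wdev] is its deviation from its mean. *)
Definition wpos n E k w : R := \sum_(j < k) E j w / (n - j)%:R.

Definition wdev n E k w : R := \sum_(j < k) (E j w - 1) / (n - j)%:R.

(** The expected number of points above Z_(k) divided by their actual number; it is close to 1, and
    [cfac] is what it becomes when Z_(k) is replaced by its mean. *)
Definition scl n E k w : R := n%:R / (n - k)%:R * expR (- wpos n E k w).

Definition cfac n k : R := n%:R / (n - k)%:R * expR (- \sum_(j < k) (n - j)%:R^-1).

Lemma sclE n E k w : scl n E k w = cfac n k * expR (- wdev n E k w).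
Proof.
rewrite /scl /cfac -[RHS]mulrA -expRD; congr (_ * expR _).
rewrite -opprD; congr (- _); rewrite /wpos /wdev -big_split/=.
by apply: eq_bigr => j _; rewrite mulrBl mul1r addrC subrK.
Qed.

(** Amounts to comparing the sum of 1 / (n - j) over j < k with ln (n / (n - k)). Together with
    [cfac_le] the discrepancy is at most 1 / (n - k), hence harmonic when summed. *)
Lemma cfac_ge1 n k : (k < n)%N -> 1 <= cfac n k.
Proof.
elim: k => [n0|k IH kn].
  by rewrite /cfac big_ord0 oppr0 expR0 subn0 divff ?mulr1// pnatr_eq0 -lt0n.
apply: le_trans (IH (ltnW kn)) _.
rewrite /cfac big_ord_recr/= opprD expRD.
have i0 : (0 < n - k.+1)%N by rewrite subn_gt0.
have -> : (n - k)%N = (n - k.+1).+1 by rewrite subnSK// ltnW.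
set i := (n - k.+1)%N in i0 *.
have iR : 0 < i%:R :> R by rewrite ltr0n.
set e := expR (- \sum_(_ < _) _); set f := expR _.
have -> : n%:R / i.+1%:R * e = (n%:R * e) * i.+1%:R^-1 by rewrite mulrAC.
have -> : n%:R / i%:R * (e * f) = (n%:R * e) * (i%:R^-1 * f) by rewrite mulrACA.
rewrite ler_wpM2l ?mulr_ge0 ?ler0n ?expR_ge0//.
have := expR_ge1Dx (- (i.+1%:R^-1 : R)); rewrite -/f -natr1 => h.
rewrite ler_pdivlMl// (le_trans _ h)//.
rewrite le_eqVlt; apply/orP; left; apply/eqP; field.
by rewrite gt_eqF// addr_gt0.
Qed.

Lemma cfac_le n k : (k < n)%N -> cfac n k <= 1 + (n - k)%:R^-1.
Proof.
move=> kn.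
have n0 : 0 < n%:R :> R by rewrite ltr0n (leq_ltn_trans _ kn).
(* The comparison with ln ((n + 1) / (n - k + 1)) is the form that passes through the induction. *)
suff h : cfac n k <= n%:R / (n - k)%:R * ((n - k).+1%:R / n.+1%:R).
  have m0 : 0 < (n - k)%:R :> R by rewrite ltr0n subn_gt0.
  apply: le_trans h _; rewrite -!natr1.
  rewrite (_ : 1 + _^-1 = ((n - k)%:R + 1) / (n - k)%:R); last by field; rewrite gt_eqF.
  have -> : n%:R / (n - k)%:R * (((n - k)%:R + 1) / (n%:R + 1)) =
      (((n - k)%:R + 1) / (n - k)%:R) * (n%:R / (n%:R + 1)) :> R.
    by rewrite mulrACA [RHS]mulrACA (mulrC n%:R) (mulrC (n - k)%:R^-1).
  rewrite ler_piMr//; last by rewrite ler_pdivrMr ?addr_gt0// mul1r lerDl.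
elim: k kn => [_|k IH kn].
  by rewrite /cfac big_ord0 oppr0 expR0 subn0 !mulr1 divff ?gt_eqF// mul1r divff// pnatr_eq0.
have {IH} := IH (ltnW kn).
rewrite /cfac big_ord_recr/= opprD expRD.
have i0 : (0 < n - k.+1)%N by rewrite subn_gt0.
have -> : (n - k)%N = (n - k.+1).+1 by rewrite subnSK// ltnW.
set i := (n - k.+1)%N in i0 *.
have iR : 0 < i%:R :> R by rewrite ltr0n.
set e := expR (- \sum_(_ < _) _).
have e0 : 0 < e by exact: expR_gt0.
rewrite ler_pM2l ?divr_gt0//.
move=> h; rewrite ler_pM2l ?divr_gt0//.
have hh : expR (- (i.+1%:R)^-1) <= i.+1%:R / i.+2%:R :> R.
  rewrite expRN -[leRHS]invrK lef_pV2 ?posrE ?expR_gt0 ?invr_gt0 ?divr_gt0 ?ltr0Sn//.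
  apply: le_trans (expR_ge1Dx _).
  rewrite invf_div -(natr1 i.+1) mulrDl divff ?pnatr_eq0// mul1r.
  by [].
apply: le_trans (ler_pM (ltW e0) (expR_ge0 _) h hh) _.
by rewrite mulrC mulrA mulfVK ?pnatr_eq0.
Qed.

Lemma past_wdev n E k : measurable_fun [set: g_sigma_algebraType (past E k)]
  (wdev n E k : g_sigma_algebraType (past E k) -> R).
Proof.
apply: measurable_sum => j; apply: measurable_funM => //; apply: measurable_funB => //.
exact: past_fun.
Qed.

Lemma past_wpos n E k : measurable_fun [set: g_sigma_algebraType (past E k)]
  (wpos n E k : g_sigma_algebraType (past E k) -> R).
Proof.
by apply: measurable_sum => j; apply: measurable_funM => //; exact: past_fun.
Qed.

Lemma past_scl n E k : measurable_fun [set: g_sigma_algebraType (past E k)]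
  (scl n E k : g_sigma_algebraType (past E k) -> R).
Proof.
apply: measurable_funM => //; apply: measurableT_comp => //.
by apply: measurable_funN; exact: past_wpos.
Qed.

Lemma measurable_of_past n E k (h : T -> R) : iid_upto P expo n E -> (k <= n)%N ->
  measurable_fun [set: g_sigma_algebraType (past E k)] (h : g_sigma_algebraType (past E k) -> R) ->
  measurable_fun [set: T] h.
Proof. by move=> iE kn; apply: past_measurable_fun; exact: past_meas iE kn. Qed.

(** The left side is the Laplace transform at [s] of a centered exponential variable; it is
    sub-Gaussian for all s <= 1 / 2, negative ones included. *)
Lemma expR_le_quad (s : R) : s <= 1 / 2 -> expR (- s) / (1 - s) <= expR (2 * s ^+ 2).
Proof.
move=> s2; have s1 : 0 < 1 - s by lra.
rewrite ler_pdivrMr// (_ : 2 * s ^+ 2 = - s + (s + 2 * s ^+ 2)); last by ring.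
rewrite expRD -mulrA ler_peMr ?expR_ge0//.
apply: (@le_trans _ _ ((1 + (s + 2 * s ^+ 2)) * (1 - s))).
  by have := sqr_ge0 s; nra.
by rewrite ler_wpM2r ?expR_ge1Dx// ltW.
Qed.

(** The left side is the variance of Z_(k); it is compared with the telescoping 1 / (n - k) - 1 /
    n. *)
Lemma inv_sqr_sum n k : (k < n)%N ->
  \sum_(j < k) ((n - j)%:R^-1 : R) ^+ 2 <= (n - k)%:R^-1.
Proof.
move=> kn.
suff : \sum_(j < k) ((n - j)%:R^-1 : R) ^+ 2 <= (n - k)%:R^-1 - n%:R^-1.
  by move=> h; apply: le_trans h _; rewrite gerBl invr_ge0.
elim: k kn => [_|k IH kn]; first by rewrite big_ord0 subn0 subrr.
rewrite big_ord_recr/=; apply: le_trans (lerD (IH (ltnW kn)) (lexx _)) _.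
rewrite addrAC lerD2r.
have i0 : (0 < n - k.+1)%N by rewrite subn_gt0.
have -> : (n - k)%N = (n - k.+1).+1 by rewrite subnSK// ltnW.
set i := (n - k.+1)%N in i0 *.
have iR : 0 < i%:R :> R by rewrite ltr0n.
rewrite -natr1 -subr_ge0.
rewrite (_ : _ - _ = 1 / (i%:R * (i%:R + 1) ^+ 2)); last by field; rewrite !gt_eqF// addr_gt0.
by rewrite divr_ge0// mulr_ge0 ?exprn_ge0 ?addr_ge0// ltW.
Qed.

Lemma Ex_wdev n E k (s : R) : iid_upto P expo n E -> (k <= n)%N ->
  (forall j, (j < k)%N -> s / (n - j)%:R <= 1 / 2) ->
  L1 P (fun w => expR (s * wdev n E k w)) /\
  Ex P (fun w => expR (s * wdev n E k w)) <=
    expR (2 * s ^+ 2 * \sum_(j < k) ((n - j)%:R^-1 : R) ^+ 2).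
Proof.
move=> iE; elim: k => [_ _|k IH kn hs].
  rewrite big_ord0 mulr0 expR0.
  have -> : (fun w => expR (s * wdev n E 0 w)) = (fun=> 1).
    by apply/funext => w; rewrite /wdev big_ord0 mulr0 expR0.
  by split; [exact: L1_cst|rewrite Ex_cst].
have [IL IE] := IH (ltnW kn) (fun j jk => hs j (ltnW jk)).
pose sg := s / (n - k)%:R.
have sg2 : sg <= 1 / 2 by exact: hs.
have [L e] := @Ex_expo_exp R sg ltac:(by lra).
pose b (y : measurableTypeR R) := expR (- sg) * expR (sg * y).
have Lb : L1 expo b by exact: L1Z.
have Eb : Ex expo b <= expR (2 * sg ^+ 2) by rewrite ExZ// e; exact: expR_le_quad.
have mA : measurable_fun [set: g_sigma_algebraType (past E k)]
    ((fun w => expR (s * wdev n E k w)) : g_sigma_algebraType (past E k) -> R).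
  apply: measurableT_comp => //; apply: measurable_funM => //; exact: past_wdev.
have [h1 h2] := @Ex_past_prod _ _ _ P expo n E iE k kn _ b mA (fun w => expR_ge0 _)
  (fun y => mulr_ge0 (expR_ge0 _) (expR_ge0 _)) IL Lb.
have ee : (fun w => expR (s * wdev n E k.+1 w)) = (fun w => expR (s * wdev n E k w) * b (E k w)).
  apply/funext => w; rewrite /b /wdev big_ord_recr/= -!expRD; congr expR.
  by rewrite mulrDr; congr (_ + _); rewrite /sg; ring.
rewrite ee; split => //; rewrite h2 big_ord_recr/= mulrDr expRD ler_pM//.
- by apply: Ex_ge0 => w; exact: expR_ge0.
- by apply: Ex_ge0 => w; rewrite mulr_ge0 ?expR_ge0.
- by apply: le_trans Eb _; rewrite ler_expR /sg exprMn mulrA.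
Qed.

(** The divisors n - j with j < k are at least n - k + 1, so the condition keeps each s / (n - j)
    below 1 / 2. *)
Lemma Ex_wdev_le n E k (s : R) : iid_upto P expo n E -> (k < n)%N ->
  s <= ((n - k)%:R + 1) / 2 ->
  L1 P (fun w => expR (s * wdev n E k w)) /\
  Ex P (fun w => expR (s * wdev n E k w)) <= expR (2 * s ^+ 2 / (n - k)%:R).
Proof.
move=> iE kn hs.
have [|L h] := @Ex_wdev n E k s iE (ltnW kn).
  move=> j jk; have jn : (0 < n - j)%N by rewrite subn_gt0 (ltn_trans jk).
  rewrite ler_pdivrMr ?ltr0n// (le_trans hs)// mulrC mul1r ler_pM2l ?invr_gt0//.
  by rewrite natr1 ler_nat; apply: ltn_sub2l => //; exact: ltn_trans kn.
split => //; apply: le_trans h _; rewrite ler_expR.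
have s20 : 0 <= 2 * s ^+ 2 by apply: mulr_ge0 => //; exact: sqr_ge0.
by rewrite ler_wpM2l// inv_sqr_sum.
Qed.

(* Dominates [1], [scl] and the normalised deviation [sqrt (n - k) * wdev]. *)
Definition ddom n E k w : R :=
  1 + (Num.sqrt (n - k)%:R * `|wdev n E k w| + expR (- wdev n E k w)).

Lemma ddom_ge1 n E k w : 1 <= ddom n E k w.
Proof. by rewrite lerDl addr_ge0 ?expR_ge0// mulr_ge0 ?sqrtr_ge0. Qed.

Lemma past_ddom n E k : measurable_fun [set: g_sigma_algebraType (past E k)]
  (ddom n E k : g_sigma_algebraType (past E k) -> R).
Proof.
apply: measurable_funD => //; apply: measurable_funD.
  apply: measurable_funM => //; apply: measurableT_comp => //; exact: past_wdev.
apply: measurableT_comp => //; apply: measurable_funN; exact: past_wdev.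
Qed.

Lemma exprn_le_expR (N : nat) (x : R) : 0 <= x -> x ^+ N <= (2 * N%:R) ^+ N * expR (x / 2).
Proof.
case: N => [|N] x0; first by rewrite !expr0 mul1r -[leLHS]expR0 ler_expR divr_ge0.
have := @powR_le_exp R N.+1%:R x (ltr0Sn _ _) x0.
by rewrite !powR_mulrn// mulr_ge0.
Qed.

Lemma exprn_sum3_le (N : nat) (x y z : R) : 0 <= x -> 0 <= y -> 0 <= z ->
  (x + (y + z)) ^+ N <= 3 ^+ N * (x ^+ N + (y ^+ N + z ^+ N)).
Proof.
move=> x0 y0 z0; pose M := Num.max x (Num.max y z).
have M0 : 0 <= M by rewrite !le_max x0.
apply: (@le_trans _ _ ((3 * M) ^+ N)).
  rewrite lerXn2r ?nnegrE ?addr_ge0 ?mulr_ge0//.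
  have xM : x <= M by rewrite !le_max lexx.
  have yM : y <= M by rewrite !le_max lexx orbT.
  have zM : z <= M by rewrite !le_max lexx !orbT.
  lra.
rewrite exprMn ler_wpM2l ?exprn_ge0//.
have px : 0 <= x ^+ N by rewrite exprn_ge0.
have py : 0 <= y ^+ N by rewrite exprn_ge0.
have pz : 0 <= z ^+ N by rewrite exprn_ge0.
by rewrite /M /Num.max; case: ifP => _; [case: ifP => _|]; lra.
Qed.

(** The deviation of Z_(k) has standard deviation at most (n - k)^(-1/2), so its exponential moments
    at plus and minus sqrt (n - k) / 2 are bounded uniformly and control every power; the moment at
    - N controls the power of exp(- wdev). *)
Lemma Ex_ddom (N : nat) : exists2 C : R, 0 <= C & forall n E k, iid_upto P expo n E -> (k < n)%N ->
  L1 P (fun w => ddom n E k w ^+ N) /\ Ex P (fun w => ddom n E k w ^+ N) <= C.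
Proof.
exists (3 ^+ N * (1 + ((2 * N%:R) ^+ N * (expR 1 + expR 1) + expR (2 * N%:R ^+ 2)))).
  by rewrite mulr_ge0 ?exprn_ge0// !addr_ge0 ?expR_ge0// mulr_ge0 ?addr_ge0 ?expR_ge0 ?exprn_ge0.
move=> n E k iE kn.
set m : R := (n - k)%:R.
have m1 : 1 <= m by rewrite ler1n subn_gt0.
have m0 : 0 < m by lra.
pose u := Num.sqrt m.
have u2 : u ^+ 2 = m by rewrite sqr_sqrtr// ltW.
have u0 : 0 <= u by exact: sqrtr_ge0.
have u1 : 1 <= u by rewrite -sqrtr1 ler_wsqrtr.
have um : u <= m by rewrite -u2 expr2 ler_peMr.
have [L1p E1p] := @Ex_wdev_le n E k (u / 2) iE kn ltac:(by rewrite -/m; lra).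
have [L1n E1n] := @Ex_wdev_le n E k (- (u / 2)) iE kn ltac:(by rewrite -/m; lra).
have [L1N E1N] := @Ex_wdev_le n E k (- N%:R) iE kn
  ltac:(by rewrite -/m; apply: (@le_trans _ _ 0); [rewrite oppr_le0|rewrite divr_ge0// addr_ge0// ltW]).
have q : 2 * (u / 2) ^+ 2 / m <= 1.
  by rewrite exprMn u2; apply: (@le_trans _ _ (2 / 2 ^+ 2)); [rewrite le_eqVlt; apply/orP; left; apply/eqP; field; rewrite gt_eqF|lra].
rewrite sqrrN in E1n.
have {}E1p := le_trans E1p (_ : _ <= expR 1).
have {}E1n := le_trans E1n (_ : _ <= expR 1).
rewrite ler_expR -/m in E1p E1n.
have {}E1p := E1p q; have {}E1n := E1n q.
have {}E1N : Ex P (fun w => expR (- N%:R * wdev n E k w)) <= expR (2 * N%:R ^+ 2).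
  apply: le_trans E1N _; rewrite ler_expR sqrrN -/m ler_pdivrMr// ler_peMr//.
pose h w := 3 ^+ N * (1 + ((2 * N%:R) ^+ N * (expR (u / 2 * wdev n E k w) + expR (- (u / 2) * wdev n E k w))
   + expR (- N%:R * wdev n E k w))).
have Lpn : L1 P (fun w => (2 * N%:R) ^+ N * (expR (u / 2 * wdev n E k w) + expR (- (u / 2) * wdev n E k w))).
  by apply: L1Z; exact: L1D.
have Lall : L1 P (fun w => 1 + ((2 * N%:R) ^+ N * (expR (u / 2 * wdev n E k w) + expR (- (u / 2) * wdev n E k w))
   + expR (- N%:R * wdev n E k w))).
  by apply: L1D; [exact: L1_cst|exact: L1D].
have Lh : L1 P h by exact: L1Z.
have dh w : ddom n E k w ^+ N <= h w.
  rewrite /ddom -/m -/u; set y := wdev n E k w.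
  apply: le_trans (exprn_sum3_le N ler01 (mulr_ge0 u0 (normr_ge0 y)) (expR_ge0 _)) _.
  rewrite ler_wpM2l ?exprn_ge0// expr1n lerD2l lerD//; last first.
    by rewrite -expRM_natl mulNr mulrN.
  apply: le_trans (exprn_le_expR N (mulr_ge0 u0 (normr_ge0 y))) _.
  rewrite ler_wpM2l ?exprn_ge0 ?mulr_ge0//.
  have [y0|y0] := leP 0 y.
    by rewrite ger0_norm// mulrAC lerDl expR_ge0.
  by rewrite ltr0_norm// mulrN mulNr (mulrAC u) mulNr lerDr expR_ge0.
have md : measurable_fun [set: T] (fun w => ddom n E k w ^+ N).
  apply: measurable_funX; apply: (@measurable_of_past n E k (ddom n E k) iE (ltnW kn)).
  exact: past_ddom.
have Ld : L1 P (fun w => ddom n E k w ^+ N).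
  apply: (L1_le md _ Lh) => w; rewrite ger0_norm// exprn_ge0//.
  exact: le_trans ler01 (ddom_ge1 _ _ _ _).
split => //; apply: le_trans (Ex_le Ld Lh dh) _.
rewrite /h ExZ// ler_wpM2l ?exprn_ge0// ExD//; [|exact: L1_cst|exact: L1D].
rewrite Ex_cst lerD2l ExD// lerD// ExZ ?ler_wpM2l ?exprn_ge0 ?mulr_ge0//; last exact: L1D.
by rewrite ExD// lerD.
Qed.

End sample.

Section expansions.
Context (R : realType).
Implicit Types (x q : R).

(** The factor 1 + exp x makes one bound serve both signs: x^2 exp x is enough for x >= 0 and x^2
    for x < 0. *)
Lemma expR_taylor2 x : `|expR x - 1 - x| <= x ^+ 2 * (1 + expR x).
Proof.
have e1 := expR_ge1Dx x; have e0 := expR_gt0 x.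
rewrite ger0_norm; last by lra.
have [x0|x0] := leP 0 x.
  have h : expR x - 1 <= x * expR x.
    have := expR_ge1Dx (- x); rewrite expRN => h.
    have := ler_wpM2r (ltW e0) h; rewrite mulVf ?gt_eqF// mulrDl mulNr; lra.
  have : x * (expR x - 1) <= x * (x * expR x) by rewrite ler_wpM2l.
  rewrite mulrBr mulr1; have := sqr_ge0 x; rewrite expr2; nra.
have h : expR x * (1 - x) <= 1.
  have := expR_ge1Dx (- x); rewrite expRN => h.
  by have := ler_wpM2l (ltW e0) h; rewrite mulfV ?gt_eqF.
have : (expR x - 1 - x) * (1 - x) <= x ^+ 2 * (1 - x).
  rewrite !mulrBl mul1r; have := sqr_ge0 x; rewrite !expr2; nra.
rewrite ler_pM2r; last by lra.
move=> hh; apply: le_trans hh _; rewrite ler_peMr ?sqr_ge0//; lra.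
Qed.

Lemma expR_sub1_le x : 0 <= x -> expR x - 1 <= x * expR x.
Proof.
move=> x0; have e0 := expR_gt0 x.
have := expR_ge1Dx (- x); rewrite expRN => h.
have := ler_wpM2r (ltW e0) h; rewrite mulVf ?gt_eqF// mulrDl mulNr; lra.
Qed.

Lemma ln_le_subr1 x : 0 < x -> ln x <= x - 1.
Proof.
move=> x0; rewrite -ler_expR lnK ?posrE//.
by apply: le_trans (expR_ge1Dx _); rewrite addrC subrK.
Qed.

Lemma powR_near1 q (x e : R) : 0 <= q -> 1 <= x -> x <= 1 + e -> e <= 1 ->
  1 <= x `^ q /\ x `^ q - 1 <= q * expR q * e.
Proof.
move=> q0 x1 xe e1.
have x0 : 0 < x by lra.
have lx0 : 0 <= ln x by rewrite ln_ge0.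
have lxe : ln x <= e by apply: le_trans (ln_le_subr1 x0) _; lra.
rewrite /powR gt_eqF//; split.
  by rewrite -[leLHS]expR0 ler_expR mulr_ge0.
apply: le_trans (expR_sub1_le (mulr_ge0 q0 lx0)) _.
rewrite -!mulrA ler_wpM2l// mulrC ler_pM ?expR_ge0//.
by rewrite ler_expR ler_piMr//; lra.
Qed.

(** Real exponents are rounded up to a natural number, since [Ex_ddom] bounds natural powers. *)
Lemma expR_le_exprn q (N : nat) (y D : R) : 0 <= q -> q <= N%:R -> 1 <= D -> expR y <= D ->
  expR (q * y) <= D ^+ N.
Proof.
move=> q0 qN D1 yD; have [y0|y0] := leP y 0.
  apply: (@le_trans _ _ 1); last by rewrite exprn_ege1.
  by rewrite -[leRHS]expR0 ler_expR mulr_ge0_le0.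
apply: (@le_trans _ _ (expR y ^+ N)); last by rewrite lerXn2r// nnegrE ?expR_ge0//; lra.
by rewrite -expRM_natl ler_expR ler_wpM2r// ltW.
Qed.

End expansions.

Section sample_expansions.
Context d (T : measurableType d) (R : realType).
Implicit Types (n k : nat) (E : nat -> T -> R).

(** The k / n quantile of the standard exponential law, a deterministic stand-in for Z_(k). *)
Definition ell n k : R := ln (n%:R / (n - k)%:R).

Lemma scl_gt0 n E k w : (k < n)%N -> 0 < scl n E k w.
Proof.
move=> kn; rewrite mulr_gt0 ?expR_gt0// divr_gt0// ltr0n ?subn_gt0//.
exact: leq_ltn_trans kn.
Qed.

Lemma ddom_wdev n E k w : (k < n)%N ->
  `|wdev n E k w| <= ddom n E k w / Num.sqrt (n - k)%:R.
Proof.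
move=> kn; have m0 : 0 < Num.sqrt (n - k)%:R :> R by rewrite sqrtr_gt0 ltr0n subn_gt0.
rewrite ler_pdivlMr// mulrC /ddom.
by have := expR_ge0 (- wdev n E k w); lra.
Qed.

Lemma ddom_exp n E k w : expR (- wdev n E k w) <= ddom n E k w.
Proof.
rewrite /ddom; have : 0 <= Num.sqrt (n - k)%:R * `|wdev n E k w| by rewrite mulr_ge0 ?sqrtr_ge0.
lra.
Qed.

Lemma scl_powR n E k w (q : R) : (k < n)%N ->
  scl n E k w `^ q = cfac R n k `^ q * expR (q * (- wdev n E k w)).
Proof.
move=> kn; have c1 := cfac_ge1 R kn.
rewrite sclE powRM ?expR_ge0//; last by lra.
by rewrite /powR (gt_eqF (expR_gt0 _)) expRK.
Qed.

(** The error is of order 1 / (n - k), so that its sum over [k] is logarithmic. Of the power N + 2,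
    two factors come from the squared deviation and N from the exponential remainder. *)
Lemma scl_expand (q : R) (N : nat) : 0 <= q -> q <= N%:R ->
  exists2 K : R, 0 <= K & forall n E k w, (k < n)%N ->
  `|scl n E k w `^ q - 1 + q * wdev n E k w| <= K * ddom n E k w ^+ N.+2 / (n - k)%:R.
Proof.
move=> q0 qN; exists (q * expR q + 2 * q ^+ 2).
  by rewrite addr_ge0 ?mulr_ge0 ?expR_ge0 ?sqr_ge0.
move=> n E k w kn.
set m : R := (n - k)%:R.
have m1 : 1 <= m by rewrite ler1n subn_gt0.
have m0 : 0 < m by lra.
have c1 := cfac_ge1 R kn; have cm := cfac_le R kn; rewrite -/m in cm.
have [cq1 cq] := powR_near1 q0 c1 cm ltac:(by rewrite invf_le1).
rewrite scl_powR//.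
set y := - wdev n E k w; set D := ddom n E k w; set c := cfac R n k `^ q in cq cq1 *.
have D1 : 1 <= D by exact: ddom_ge1.
have yD : expR y <= D by exact: ddom_exp.
have eqD : expR (q * y) <= D ^+ N by exact: expR_le_exprn.
have DN1 : 1 <= D ^+ N by rewrite exprn_ege1.
have y2 : y ^+ 2 <= D ^+ 2 / m.
  have := ddom_wdev E w kn; rewrite -/D -/m => h.
  rewrite /y sqrrN -real_normK ?num_real// (le_trans (lerXn2r 2 _ _ h)) ?nnegrE//.
    by rewrite divr_ge0 ?sqrtr_ge0//; lra.
  by rewrite exprMn exprVn sqr_sqrtr// ltW.
have D2 : 1 <= D ^+ 2 by rewrite exprn_ege1.
have -> : wdev n E k w = - y by rewrite opprK.
(* The deterministic factor is within O(1 / (n - k)) of 1; the rest is a second order Taylor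
   remainder. *)
rewrite (_ : c * expR (q * y) - 1 + q * - y = (c - 1) * expR (q * y) + (expR (q * y) - 1 - q * y)); last by ring.
apply: le_trans (ler_normD _ _) _.
have h1 : `|(c - 1) * expR (q * y)| <= (q * expR q) * D ^+ N.+2 / m.
  rewrite ger0_norm ?mulr_ge0 ?expR_ge0//; last by lra.
  rewrite mulrAC; apply: ler_pM; rewrite ?expR_ge0//; first by lra.
  by rewrite (le_trans eqD)// -addn2 exprD ler_peMr//; lra.
have h2 : `|expR (q * y) - 1 - q * y| <= (2 * q ^+ 2) * D ^+ N.+2 / m.
  apply: le_trans (expR_taylor2 _) _.
  rewrite exprMn; apply: (@le_trans _ _ (q ^+ 2 * (D ^+ 2 / m) * (2 * D ^+ N))).
    apply: ler_pM.
    - by apply: mulr_ge0; exact: sqr_ge0.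
    - by rewrite addr_ge0 ?expR_ge0.
    - by rewrite ler_wpM2l ?sqr_ge0.
    - by lra.
  rewrite le_eqVlt; apply/orP; left; apply/eqP.
  have -> : D ^+ N.+2 = D ^+ 2 * D ^+ N by rewrite -exprD.
  by move: (D ^+ 2) (D ^+ N) (m^-1) => a b e; ring.
by rewrite (mulrDl (q * expR q)) [leRHS]mulrDl; exact: lerD.
Qed.

(** The weaker rate (n - k)^(-1/2) is enough in front of a martingale increment, where squares are
    summed and again give a harmonic number. *)
Lemma scl_sub1 (q : R) (N : nat) : 0 <= q -> q <= N%:R ->
  exists2 K : R, 0 <= K & forall n E k w, (k < n)%N ->
  `|scl n E k w `^ q - 1| <= K * ddom n E k w ^+ N.+2 / Num.sqrt (n - k)%:R.
Proof.
move=> q0 qN; have [K K0 hK] := scl_expand q0 qN; exists (K + q); first by rewrite addr_ge0.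
move=> n E k w kn; have := hK n E k w kn.
have m1 : 1 <= (n - k)%:R :> R by rewrite ler1n subn_gt0.
set m : R := (n - k)%:R in m1 *; set D := ddom n E k w; set Y := wdev n E k w => h.
pose u := Num.sqrt m.
have u1 : 1 <= u by rewrite -sqrtr1 ler_wsqrtr.
have u2 : u ^+ 2 = m by rewrite sqr_sqrtr//; lra.
have D1 : 1 <= D by exact: ddom_ge1.
have DN : D <= D ^+ N.+2 by rewrite ler_eXnr.
have hY : `|Y| <= D / u := ddom_wdev E w kn.
have um : m^-1 <= u^-1.
  by rewrite lef_pV2 ?posrE//; [rewrite -u2 expr2 ler_peMr//; lra|lra|lra].
have -> : scl n E k w `^ q - 1 = (scl n E k w `^ q - 1 + q * Y) - q * Y by ring.
apply: le_trans (ler_normB _ _) _.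
rewrite !mulrDl lerD//.
  by apply: le_trans h _; rewrite ler_wpM2l// mulr_ge0// exprn_ge0//; lra.
rewrite normrM (ger0_norm q0) -mulrA ler_wpM2l//.
by apply: le_trans hY _; rewrite ler_wpM2r// invr_ge0; lra.
Qed.

Lemma wpos_ell n E k w : (k < n)%N ->
  `|wpos n E k w - ell n k| <= 2 * ddom n E k w / Num.sqrt (n - k)%:R.
Proof.
move=> kn.
have m1 : 1 <= (n - k)%:R :> R by rewrite ler1n subn_gt0.
have n0 : 0 < n%:R :> R by rewrite ltr0n (leq_ltn_trans _ kn).
have hY := ddom_wdev E w kn.
have c1 := cfac_ge1 R kn; have cm := cfac_le R kn.
have e : wpos n E k w - ell n k = wdev n E k w - ln (cfac R n k).
  have s0 := scl_gt0 E w kn.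
  have : ln (scl n E k w) = ln (scl n E k w) by [].
  rewrite {1}sclE lnM ?posrE ?expR_gt0//; last by lra.
  rewrite /scl [in RHS]lnM ?posrE ?expR_gt0 ?divr_gt0//; last by lra.
  by rewrite !expRK /ell; lra.
set m : R := (n - k)%:R in m1 cm hY *; set D := ddom n E k w in hY *.
pose u := Num.sqrt m.
have u1 : 1 <= u by rewrite -sqrtr1 ler_wsqrtr.
have u2 : u ^+ 2 = m by rewrite sqr_sqrtr//; lra.
have D1 : 1 <= D by exact: ddom_ge1.
rewrite e (le_trans (ler_normB _ _))// (_ : 2 * D / u = D / u + D / u); last by ring.
rewrite lerD// ger0_norm ?ln_ge0//.
apply: le_trans (ln_le_subr1 _) _; first by lra.
apply: (@le_trans _ _ m^-1); first by lra.
apply: (@le_trans _ _ u^-1).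
  by rewrite lef_pV2 ?posrE//; [rewrite -u2 expr2 ler_peMr//; lra|lra|lra].
by rewrite ler_peMl// invr_ge0; lra.
Qed.

End sample_expansions.

Section harmonic.
Context (R : realType).

Definition harm (n : nat) : R := \sum_(k < n) (n - k)%:R^-1.

Lemma harmE n : harm n = \sum_(i < n) (i.+1%:R)^-1.
Proof.
rewrite /harm (reindex_inj rev_ord_inj)/=; apply: eq_bigr => i _.
by rewrite subKn.
Qed.

Lemma harm_le_ln n : harm n.+1 <= 1 + ln (n.+1%:R).
Proof.
rewrite harmE; elim: n => [|n IH].
  by rewrite big_ord_recr big_ord0/= add0r invr1 ln1 addr0.
rewrite big_ord_recr/=; apply: le_trans (lerD IH (lexx _)) _.
rewrite -addrA lerD2l -lerBrDl -ln_div ?posrE//.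
rewrite -[leLHS]opprK lerNl -lnV ?posrE// invf_div.
apply: le_trans (ln_le_subr1 _) _; first by rewrite divr_gt0.
rewrite -(natr1 n.+1) le_eqVlt; apply/orP; left; apply/eqP; field.
by rewrite gt_eqF// addr_gt0.
Qed.

(** With [s] the fourth root of n, ln n = 4 ln s <= 4 s, so the left side is at most (1 + 4 s)^2 <=
    25 s^2, and s^2 = sqrt n. *)
Lemma harm_sqr n : harm n ^+ 2 <= 50 * Num.sqrt n%:R.
Proof.
case: n => [|n]; first by rewrite /harm big_ord0 expr0n mulr_ge0 ?sqrtr_ge0.
pose s : R := Num.sqrt (Num.sqrt n.+1%:R).
have s1 : 1 <= s.
  by rewrite -sqrtr1 ler_wsqrtr// -[leLHS]sqrtr1 ler_wsqrtr// ler1n.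
have s2 : s ^+ 2 = Num.sqrt n.+1%:R by rewrite sqr_sqrtr// sqrtr_ge0.
have s4 : s ^+ 4 = n.+1%:R by rewrite (exprM s 2 2) s2 sqr_sqrtr.
have h : harm n.+1 <= 1 + 4 * s.
  apply: le_trans (harm_le_ln n) _; rewrite lerD2l -s4 lnXn; last by lra.
  have := @ln_le_subr1 R s ltac:(by lra); lra.
have h0 : 0 <= harm n.+1 by apply: sumr_ge0 => i _; rewrite invr_ge0.
rewrite -s2; apply: (@le_trans _ _ ((1 + 4 * s) ^+ 2)).
  by rewrite lerXn2r ?nnegrE//; lra.
by rewrite !expr2; nra.
Qed.

End harmonic.

Section martingale_products.
Context d (T : measurableType d) (R : realType) (P : probability T R).
Variable nu : probability (measurableTypeR R) R.

Lemma martingale_prod_sum n (Y : nat -> T -> R) (A : nat -> T -> R)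
    (b : measurableTypeR R -> R) (v : nat -> R) :
  iid_upto P nu n Y -> L2 nu b -> Ex nu b = 0 ->
  (forall k, (k < n)%N -> measurable_fun [set: g_sigma_algebraType (past Y k)]
     (A k : g_sigma_algebraType (past Y k) -> R)) ->
  (forall k, (k < n)%N -> sqb P (A k) (v k)) ->
  sqb P (fun w => \sum_(k < n) A k w * b (Y k w))
    (Ex nu (fun y => b y ^+ 2) * \sum_(k < n) v k).
Proof.
move=> iY b2 b0 mA Av.
have [] := @martingale_sum _ _ _ P nu n Y (fun k x => A k x.1 * b x.2)
  (fun k => v k * Ex nu (fun y => b y ^+ 2)) iY.
- by move=> k kn; apply: measurable_past_prod; [exact: mA|case: b2].
- by move=> k w kn; exact: (L1Z (A k w) (L2_L1 b2)).
- by move=> k w kn; rewrite (ExZ (A k w) (L2_L1 b2)) b0 mulr0.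
- move=> k kn; apply: (@sqb_past_prod _ _ _ P nu n Y k) => //; first exact: mA.
  exact: Av.
by move=> h _; apply: sqb_le h; rewrite -mulr_suml mulrC.
Qed.

End martingale_products.

Section gamma_moments.
Context (R : realType) (r : R) (r0 : 0 < r).
Local Notation expo := (expo R).
Let mu : R := Gamma (r + 1).

(** Centered by a multiple of y and not by a constant: the weighted sum of first powers is almost
    deterministic ([e5] below), so subtracting it is free and removes fluctuation. This is the
    origin of [w_coef] ([Ex_bpow_sqr]) and of [t_coef] ([Ex_bpow_centered]). *)
Definition bpow (y : measurableTypeR R) : R := y `^ r - Gamma (r + 1) * y.

Lemma L2_expo_pow (p : R) : 0 <= p -> L2 expo (fun y : measurableTypeR R => y `^ p).
Proof.
move=> p0; split; first exact: measurable_powR.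
under eq_fun do rewrite -powR_mulrn ?powR_ge0// -powRrM.
by apply: L1_expo_pow; rewrite mulr_ge0.
Qed.

Lemma L2_expo_id : L2 expo (fun y : measurableTypeR R => y : R).
Proof.
have [_ h] := L2_expo_pow (@ler01 R).
split; first exact: measurable_id.
apply: L1_expo_le h; first exact: measurable_funX.
by move=> x x0; rewrite powRr1// ger0_norm ?sqr_ge0.
Qed.

Lemma Ex_expo_id : Ex expo (fun y : measurableTypeR R => y : R) = 1.
Proof.
rewrite -(Ex_expo_pow1 R); apply: eq_Ex_expo.
- exact: measurable_id.
- exact: measurable_powR.
- by move=> x x0; rewrite powRr1.
Qed.

Lemma L2_bpow : L2 expo bpow.
Proof. by apply: L2B; [exact/L2_expo_pow/ltW|apply: L2Z; exact: L2_expo_id]. Qed.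

Lemma L2_pow_centered : L2 expo (fun y : measurableTypeR R => y `^ r - Gamma (r + 1)).
Proof. by apply: L2B; [exact/L2_expo_pow/ltW|exact: L2_cst]. Qed.

Lemma L2_centered : L2 expo (fun y : measurableTypeR R => y - 1).
Proof. by apply: L2B; [exact: L2_expo_id|exact: L2_cst]. Qed.

Let Lr : L1 expo (fun y : measurableTypeR R => y `^ r).
Proof. exact/L2_L1/L2_expo_pow/ltW. Qed.

Let Lid : L1 expo (fun y : measurableTypeR R => y : R).
Proof. exact/L2_L1/L2_expo_id. Qed.

Lemma Ex_bpow : Ex expo bpow = 0.
Proof. by rewrite ExB ?ExZ ?Ex_expo_id ?Ex_expo_pow ?mulr1 ?subrr//; exact: L1Z. Qed.

Lemma Ex_pow_centered : Ex expo (fun y : measurableTypeR R => y `^ r - Gamma (r + 1)) = 0.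
Proof. by rewrite ExB ?Ex_cst ?Ex_expo_pow ?subrr//; exact: L1_cst. Qed.

Lemma Ex_centered : Ex expo (fun y : measurableTypeR R => y - 1) = 0.
Proof. by rewrite ExB ?Ex_cst ?Ex_expo_id ?subrr//; exact: L1_cst. Qed.

Lemma Ex_expo_sqr : Ex expo (fun y : measurableTypeR R => (y : R) ^+ 2) = 2.
Proof.
rewrite -(Ex_expo_pow2 R); apply: eq_Ex_expo.
- exact: measurable_funX.
- exact: measurable_powR.
- by move=> x x0; rewrite -powR_mulrn.
Qed.

Let Lsq : L1 expo (fun y : measurableTypeR R => (y : R) ^+ 2).
Proof. by case: L2_expo_id. Qed.

Let Lrid : L1 expo (fun y : measurableTypeR R => y `^ r * y).
Proof. by apply: L2M; [exact/L2_expo_pow/ltW|exact: L2_expo_id]. Qed.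

Let Erid : Ex expo (fun y : measurableTypeR R => y `^ r * y) = (r + 1) * mu.
Proof.
rewrite /mu -Ex_expo_pow// -Ex_expo_powS; last exact: ltW.
apply: eq_Ex_expo.
- by apply: measurable_funM => //; exact: measurable_powR.
- exact: measurable_powR.
- move=> x; rewrite le_eqVlt => /predU1P[<-|x0].
    by rewrite mulr0 powR0// gt_eqF// addr_gt0.
  by rewrite powRD ?powRr1 ?(ltW x0)//; rewrite (gt_eqF x0) implybT.
Qed.

Let Lrr : L1 expo (fun y : measurableTypeR R => (y `^ r) ^+ 2).
Proof. by case: (L2_expo_pow (ltW r0)). Qed.

Let Err : Ex expo (fun y : measurableTypeR R => (y `^ r) ^+ 2) = Gamma (2 * r + 1).
Proof.
rewrite -Ex_expo_pow ?mulr_gt0//; congr (Ex _ _); apply/funext => y.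
by rewrite -powR_mulrn ?powR_ge0// -powRrM mulrC.
Qed.

Lemma Ex_bpow_sqr : Ex expo (fun y => bpow y ^+ 2) = w_coef r.
Proof.
have -> : (fun y => bpow y ^+ 2) =
    (fun y : measurableTypeR R => (y `^ r) ^+ 2 - (2 * mu) * (y `^ r * y) + mu ^+ 2 * (y : R) ^+ 2).
  by apply/funext => y; rewrite /bpow -/mu; ring.
rewrite ExD; [|by apply: L1B => //; exact: L1Z|exact: L1Z].
rewrite ExB//; last exact: L1Z.
rewrite !ExZ// Err Erid Ex_expo_sqr /w_coef -/mu; ring.
Qed.

Lemma Ex_bpow_centered : Ex expo (fun y => bpow y * (y - 1)) = - t_coef r.
Proof.
have -> : (fun y => bpow y * (y - 1)) =
    (fun y : measurableTypeR R => (y `^ r * y - y `^ r) - mu * ((y : R) ^+ 2 - y)).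
  by apply/funext => y; rewrite /bpow -/mu; ring.
have L1a : L1 expo (fun y : measurableTypeR R => y `^ r * y - y `^ r) by exact: L1B.
have L1b : L1 expo (fun y : measurableTypeR R => (y : R) ^+ 2 - y) by exact: L1B.
rewrite ExB//; last exact: L1Z.
rewrite ExZ// !ExB// Erid Ex_expo_sqr Ex_expo_id Ex_expo_pow// /t_coef -/mu; ring.
Qed.

Lemma Ex_centered_sqr : Ex expo (fun y : measurableTypeR R => (y - 1) ^+ 2) = 1.
Proof.
have -> : (fun y : measurableTypeR R => (y - 1) ^+ 2) =
    (fun y : measurableTypeR R => ((y : R) ^+ 2 - 2 * y) + 1).
  by apply/funext => y; ring.
have L1a : L1 expo (fun y : measurableTypeR R => 2 * y) by exact: L1Z.
rewrite ExD; [|exact: L1B|exact: L1_cst].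
rewrite ExB// ExZ// Ex_cst Ex_expo_sqr Ex_expo_id; ring.
Qed.

End gamma_moments.

Lemma measurable_Ex_inner d1 d2 (U : measurableType d1) (V : measurableType d2) (R : realType)
    (nu : probability V R) (H : U * V -> R) :
  measurable_fun [set: U * V] H -> (forall x, 0 <= H x) -> (forall u, L1 nu (fun y => H (u, y))) ->
  measurable_fun [set: U] (fun u => Ex nu (fun y => H (u, y))).
Proof.
move=> mH H0 iH; apply/measurable_EFinP.
rewrite [X in measurable_fun _ X](_ : _ = fubini_F nu (EFin \o H)); last first.
  by apply/funext => w /=; rewrite EFin_Ex.
apply: measurable_fun_fubini_tonelli_F.
- exact/measurable_EFinP.
- by move=> x /=; rewrite lee_fin.
Qed.

(** * Tail integrals against the exponential law *)

Section tail_integral.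
Context (R : realType).
Local Notation expo := (expo R).
Variables (phi : measurableTypeR R -> R) (C L : R).
Hypothesis mphi : measurable_fun [set: measurableTypeR R] phi.
Hypothesis phiC : forall z, `|phi z| <= C.
Hypothesis phiL : forall x y, 0 <= x -> 0 <= y -> `|phi x - phi y| <= L * `|x - y|.

Let above (z x : R) : R := (z < x)%R%:R.

Let m_above z : measurable_fun [set: measurableTypeR R] (above z : measurableTypeR R -> R).
Proof.
rewrite [X in measurable_fun _ X](_ : _ = (fun y : R => if z < y then 1 else 0)); last first.
  by apply/funext => u; rewrite /above; case: (z < u).
by apply: measurable_fun_ifT => //; apply: measurable_fun_ltr.
Qed.

Let L1_above z : L1 expo (above z).
Proof.
apply: (@L1_bounded _ _ _ _ _ 1) => // x.
by rewrite /above; case: (z < x); rewrite ?normr1 ?normr0.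
Qed.

Let Ex_above z : 0 <= z -> Ex expo (above z) = expR (- z).
Proof.
move=> z0; rewrite -[RHS]/(fine (expR (- z))%:E) -expo_ray// /Ex /Rintegral; congr fine.
rewrite -[X in expo X]setIT -integral_indic//; apply: eq_integral => x _.
by rewrite /above indicE mem_setE/= in_itv/= andbT.
Qed.

(** A primitive of - phi(z) exp(- z): its decrement over a spacing is nearly phi(Z_(k)) exp(- Z_(k))
    times the spacing, so sums of the latter telescope. *)
Definition tail_int (z : R) : R := Ex expo (fun x : measurableTypeR R => phi x * (z < x)%R%:R).

Let L1_tail z : L1 expo (fun x : measurableTypeR R => phi x * above z x).
Proof.
apply: (@L1_bounded _ _ _ _ _ C); first exact: measurable_funM.
move=> x; rewrite normrM (le_trans _ (phiC x))// ler_piMr//.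
by rewrite /above; case: (z < x); rewrite ?normr1 ?normr0.
Qed.

Lemma tail_int_le z : 0 <= z -> `|tail_int z| <= C * expR (- z).
Proof.
move=> z0; apply: le_trans (Ex_norm (L1_tail z)) _.
rewrite -Ex_above// -ExZ//; apply: Ex_le.
- exact: L1_norm.
- exact: L1Z.
- move=> x; rewrite normrM; apply: ler_pM => //.
  by rewrite /above; case: (z < x); rewrite ?normr1 ?normr0.
Qed.

(** Between the two points phi differs from its value at the left one by at most L (z' - z). *)
Lemma tail_int_diff z z' : 0 <= z -> z <= z' ->
  `|tail_int z - tail_int z' - phi z * (expR (- z) - expR (- z'))|
  <= L * (z' - z) * (expR (- z) - expR (- z')).
Proof.
move=> z0 zz'; have z'0 : 0 <= z' by exact: le_trans zz'.
have -> : tail_int z - tail_int z' - phi z * (expR (- z) - expR (- z')) =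
    Ex expo (fun x : measurableTypeR R => (phi x - phi z) * (above z x - above z' x)).
  rewrite -!Ex_above// -ExB// -ExZ; last exact: L1B.
  rewrite /tail_int -ExB//; [|exact: L1_tail|exact: L1_tail].
  rewrite -ExB; [|by apply: L1B; exact: L1_tail|by apply: L1Z; exact: L1B].
  by congr (Ex _ _); apply/funext => x; rewrite -/(above z x) -/(above z' x); ring.
have mm : measurable_fun [set: measurableTypeR R] (fun x : measurableTypeR R => (phi x - phi z) * (above z x - above z' x)).
  by apply: measurable_funM; apply: measurable_funB.
have bd (x : measurableTypeR R) : `|(phi x - phi z) * (above z x - above z' x)| <= L * (z' - z) * (above z x - above z' x).
  rewrite /above; have [zx|xz] := ltP z x.
    have [z'x|xz'] := ltP z' x; first by rewrite subrr !mulr0 normr0.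
    rewrite subr0 !mulr1; apply: le_trans (phiL _ z0) _.
      exact: le_trans z0 (ltW zx).
    rewrite ger0_norm ?subr_ge0 ?(ltW zx)// .
    have L0 : 0 <= L.
      have := phiL ler01 (lexx 0); rewrite subr0 normr1 mulr1.
      by apply: le_trans; exact: normr_ge0.
    by rewrite ler_wpM2l// lerD2r.
  by rewrite ltNge (le_trans xz zz')/= subrr !mulr0 normr0.
have LR : L1 expo (fun x : measurableTypeR R => L * (z' - z) * (above z x - above z' x)).
  by apply: L1Z; exact: L1B.
have LL := L1_le mm bd LR.
apply: le_trans (Ex_norm LL) _.
rewrite -!Ex_above// -ExB// -ExZ; last exact: L1B.
by apply: Ex_le => //; exact: L1_norm.
Qed.

Lemma measurable_tail_int : measurable_fun [set: measurableTypeR R] (tail_int : measurableTypeR R -> R).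
Proof.
(* Adding the bound [C] makes the integrand nonnegative, as [measurable_Ex_inner] requires. *)
pose H1 (x : measurableTypeR R * measurableTypeR R) := (phi x.2 + C) * above x.1 x.2.
pose H2 (x : measurableTypeR R * measurableTypeR R) := above x.1 x.2.
have mH2 : measurable_fun [set: measurableTypeR R * measurableTypeR R] H2.
  rewrite [X in measurable_fun _ X](_ : _ = (fun x : measurableTypeR R * measurableTypeR R => if (x.1 : R) < x.2 then 1 else 0)); last first.
    by apply/funext => u; rewrite /H2 /above; case: (_ < _).
  by apply: measurable_fun_ifT => //; apply: measurable_fun_ltr.
have mH1 : measurable_fun [set: measurableTypeR R * measurableTypeR R] H1.
  apply: measurable_funM => //; apply: measurable_funD => //.
  exact: (measurableT_comp mphi measurable_snd).
have a0 z x : 0 <= above z x by rewrite /above; case: (z < x).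
have pC0 x : 0 <= phi x + C by have := phiC x; rewrite ler_norml => /andP[]; lra.
have LC z : L1 expo (fun y : measurableTypeR R => (phi y + C) * above z y).
  have := L1D (L1_tail z) (L1Z C (L1_above z)).
  by rewrite (_ : (fun w => _) = (fun y : measurableTypeR R => (phi y + C) * above z y))//; apply/funext => y; ring.
have -> : (tail_int : measurableTypeR R -> R) =
   (fun z => Ex expo (fun y => H1 (z, y)) - C * Ex expo (fun y => H2 (z, y))).
  apply/funext => z; rewrite -ExZ; last exact: L1_above.
  rewrite -ExB; [|exact: LC|by apply: L1Z; exact: L1_above].
  by congr (Ex _ _); apply/funext => y; rewrite /H1 /H2/=; ring.
apply: measurable_funB; last apply: measurable_funM => //.
  apply: measurable_Ex_inner => //; first by move=> x; rewrite mulr_ge0// a0.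
apply: (@measurable_Ex_inner _ _ _ _ _ _ H2) => // x; exact: a0.
Qed.

End tail_integral.

Section sqb_domination.
Context d (T : measurableType d) (R : realType) (P : probability T R).
Local Notation expo := (expo R).

Lemma sqb_ddom (N : nat) : exists2 C : R, 0 <= C & forall n (E : nat -> T -> R) k (f : T -> R) (K : R),
  iid_upto P expo n E -> (k < n)%N ->
  measurable_fun [set: g_sigma_algebraType (past E k)] (f : g_sigma_algebraType (past E k) -> R) ->
  (forall w, `|f w| <= K * ddom n E k w ^+ N) -> sqb P f (C * K ^+ 2).
Proof.
have [C C0 hC] := Ex_ddom P (2 * N); exists C => // n E k f K iE kn mf fK.
have [h1 h2] := hC n E k iE kn.
apply: (@sqb_dom _ _ _ P f (fun w => K ^+ 2 * ddom n E k w ^+ (2 * N))).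
- exact: measurable_of_past iE (ltnW kn) mf.
- exact: L1Z.
- by rewrite ExZ// mulrC ler_wpM2r ?sqr_ge0.
- move=> w; rewrite mulnC exprM -exprMn -real_normK ?num_real//.
  by rewrite lerXn2r ?nnegrE// (le_trans (normr_ge0 _) (fK w)).
Qed.

End sqb_domination.

(** * First order expansion of the smooth sum *)

Section smooth_sum.
Context d (T : measurableType d) (R : realType) (P : probability T R).
Local Notation expo := (expo R).
Variables (r : R) (r0 : 0 < r).
Let mu : R := Gamma (r + 1).
Variables (phi : measurableTypeR R -> R) (C L : R).
Hypothesis mphi : measurable_fun [set: measurableTypeR R] phi.
Hypothesis phiC : forall z, `|phi z| <= C.
Hypothesis phiL : forall x y, 0 <= x -> 0 <= y -> `|phi x - phi y| <= L * `|x - y|.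

(** The weight that the exchange of summations puts on E_k - 1: it enters each of the n - k - 1
    later positions with coefficient 1 / (n - k), which explains the divisor. *)
Definition phibar n k : R := (\sum_(k.+1 <= i < n) phi (ell R n i)) / (n - k)%:R.

(** The first term is the contribution of the spacing itself, the second its influence on all later
    positions. *)
Definition lin n k (y : measurableTypeR R) : R :=
  phi (ell R n k) * bpow r y + t_coef r * phibar n k * (y - 1).

Let C0 : 0 <= C. Proof. exact: le_trans (normr_ge0 _) (phiC 0). Qed.

Let L0 : 0 <= L.
Proof.
have := phiL ler01 (lexx 0); rewrite subr0 normr1 mulr1.
by apply: le_trans; exact: normr_ge0.
Qed.

Let ell_ge0 n k : (k < n)%N -> 0 <= ell R n k.
Proof.
move=> kn; rewrite ln_ge0// ler_pdivlMr ?ltr0n ?subn_gt0// mul1r ler_nat leq_subr.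
by [].
Qed.

Let N := (Num.truncn r).+1.
Let rN : r <= N%:R. Proof. by rewrite ltW// Num.Theory.truncnS_gt. Qed.
Let N1 : 1 <= N%:R :> R. Proof. by rewrite ler1n. Qed.

Let phiZ_past n (E : nat -> T -> R) k : measurable_fun [set: g_sigma_algebraType (past E k)]
  ((fun w => phi (wpos n E k w)) : g_sigma_algebraType (past E k) -> R).
Proof. by apply: (measurableT_comp mphi); exact: past_wpos. Qed.

Let sclr_past n (E : nat -> T -> R) k (q : R) : measurable_fun [set: g_sigma_algebraType (past E k)]
  ((fun w => scl n E k w `^ q) : g_sigma_algebraType (past E k) -> R).
Proof. by apply: (measurableT_comp (measurable_powR q)); exact: past_scl. Qed.

Let wpos_ge0 n (E : nat -> T -> R) k w : (k <= n)%N -> (forall j w, (j < n)%N -> 0 <= E j w) -> 0 <= wpos n E k w.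
Proof.
move=> kn E0; apply: sumr_ge0 => j _; rewrite divr_ge0// E0//.
exact: leq_trans (ltn_ord j) kn.
Qed.

Let dphi n (E : nat -> T -> R) k w : (k < n)%N -> (forall j w, (j < n)%N -> 0 <= E j w) ->
  `|phi (wpos n E k w) - phi (ell R n k)| <= 2 * L * ddom n E k w / Num.sqrt (n - k)%:R.
Proof.
move=> kn E0; apply: le_trans (phiL (wpos_ge0 w (ltnW kn) E0) (ell_ge0 kn)) _.
rewrite (_ : 2 * L * _ / _ = L * (2 * ddom n E k w / Num.sqrt (n - k)%:R)); last by ring.
by rewrite ler_wpM2l// wpos_ell.
Qed.

Let harm_ge0 n : 0 <= harm R n.
Proof. by apply: sumr_ge0 => i _; rewrite invr_ge0. Qed.

Let harm_le n : harm R n <= (1 + harm R n) ^+ 2.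
Proof. have := harm_ge0 n; nra. Qed.

Let harm2_le n : harm R n ^+ 2 <= (1 + harm R n) ^+ 2.
Proof. have := harm_ge0 n; nra. Qed.

(** Martingale errors: coefficients of size (n - k)^(-1/2) against a centered variable have squares
    that sum to a harmonic number. *)
Let mart (b : measurableTypeR R -> R) (A : forall n (E : nat -> T -> R), nat -> T -> R) (M : nat) (K : R) :
  L2 expo b -> Ex expo b = 0 -> 0 <= K ->
  (forall n E k, measurable_fun [set: g_sigma_algebraType (past E k)]
     (A n E k : g_sigma_algebraType (past E k) -> R)) ->
  (forall n E k w, (k < n)%N -> (forall j w, (j < n)%N -> 0 <= E j w) ->
     `|A n E k w| <= K * ddom n E k w ^+ M / Num.sqrt (n - k)%:R) ->
  exists2 K' : R, 0 <= K' & forall n E, iid_upto P expo n E ->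
    (forall j w, (j < n)%N -> 0 <= E j w) ->
    sqb P (fun w => \sum_(k < n) A n E k w * b (E k w)) (K' * (1 + harm R n) ^+ 2).
Proof.
move=> b2 b0 K0 mA hA; have [Cd Cd0 hCd] := sqb_ddom P M.
have B0 : 0 <= Ex expo (fun y => b y ^+ 2) by apply: Ex_ge0 => y; exact: sqr_ge0.
exists (Ex expo (fun y => b y ^+ 2) * (Cd * K ^+ 2)).
  by rewrite mulr_ge0// mulr_ge0// sqr_ge0.
move=> n E iE E0.
have := @martingale_prod_sum _ _ _ P expo n E (A n E) b
  (fun k => Cd * K ^+ 2 * (n - k)%:R^-1) iE b2 b0 (fun k _ => mA n E k).
have h k : (k < n)%N -> sqb P (A n E k) (Cd * K ^+ 2 * (n - k)%:R^-1).
  move=> kn; have := hCd n E k (A n E k) (K / Num.sqrt (n - k)%:R) iE kn (mA n E k).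
  rewrite exprMn exprVn sqr_sqrtr// mulrA; apply => w.
  by rewrite mulrAC; exact: hA.
move=> /(_ h); rewrite -mulr_sumr; apply: sqb_le.
rewrite -[leRHS]mulrA ler_wpM2l// ler_wpM2l//; first by rewrite mulr_ge0 ?sqr_ge0.
exact: harm_le.
Qed.

(** Errors without cancellation must be of size 1 / (n - k); Cauchy-Schwarz with these weights then
    gives the square of a harmonic number. *)
Let drift (F : forall n (E : nat -> T -> R), nat -> T -> R) (K : R) : 0 <= K ->
  (forall n E k, (k < n)%N -> iid_upto P expo n E -> (forall j w, (j < n)%N -> 0 <= E j w) ->
     sqb P (F n E k) (K * ((n - k)%:R^-1) ^+ 2)) ->
  forall n E, iid_upto P expo n E ->
    (forall j w, (j < n)%N -> 0 <= E j w) ->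
    sqb P (fun w => \sum_(k < n) F n E k w) (K * (1 + harm R n) ^+ 2).
Proof.
move=> K0 hF n E iE E0.
have := @sqb_sum _ _ _ P (F n E) (fun k => (n - k)%:R^-1) K n.
move=> h; apply: (sqb_le (c := K * harm R n ^+ 2)); last apply: h.
- by rewrite ler_wpM2l.
- by move=> k kn; rewrite invr_gt0 ltr0n subn_gt0.
- by move=> k kn; exact: hF.
Qed.

(** Replaces phi at Z_(k) by phi at the quantile. The factor [bpow] is centered, so the Lipschitz
    bound on phi is all that is used. *)
Let e1 : exists2 K : R, 0 <= K & forall n E, iid_upto P expo n E ->
    (forall j w, (j < n)%N -> 0 <= E j w) ->
    sqb P (fun w => \sum_(k < n) (phi (wpos n E k w) - phi (ell R n k)) * bpow r (E k w)) (K * (1 + harm R n) ^+ 2).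
Proof.
apply: (@mart (bpow r) (fun n E k w => phi (wpos n E k w) - phi (ell R n k)) 1 (2 * L)).
- exact: L2_bpow.
- exact: Ex_bpow.
- by rewrite mulr_ge0.
- by move=> n E k; apply: measurable_funB => //; exact: phiZ_past.
- by move=> n E k w kn E0; rewrite expr1; exact: dphi.
Qed.

Let phi_scl n (E : nat -> T -> R) k w (q K : R) : (k < n)%N ->
  `|scl n E k w `^ q - 1| <= K * ddom n E k w ^+ N.+2 / Num.sqrt (n - k)%:R ->
  `|phi (wpos n E k w) * (scl n E k w `^ q - 1)| <= C * K * ddom n E k w ^+ N.+2 / Num.sqrt (n - k)%:R.
Proof.
move=> kn h; rewrite normrM (_ : C * K * _ / _ = C * (K * ddom n E k w ^+ N.+2 / Num.sqrt (n - k)%:R)).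
  exact: ler_pM.
ring.
Qed.

(** The product of the two deviations, of [scl] to the power r from 1 and of E_k^r from its mean. *)
Let e2 : exists2 K : R, 0 <= K & forall n E, iid_upto P expo n E ->
    (forall j w, (j < n)%N -> 0 <= E j w) ->
    sqb P (fun w => \sum_(k < n) phi (wpos n E k w) * (scl n E k w `^ r - 1) * (E k w `^ r - mu)) (K * (1 + harm R n) ^+ 2).
Proof.
have [K K0 hK] := @scl_sub1 _ T R r N (ltW r0) rN.
apply: (@mart (fun y : measurableTypeR R => y `^ r - mu)
  (fun n E k w => phi (wpos n E k w) * (scl n E k w `^ r - 1)) N.+2 (C * K)).
- exact: L2_pow_centered.
- exact: Ex_pow_centered.
- by rewrite mulr_ge0.
- move=> n E k; apply: measurable_funM; first exact: phiZ_past.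
  by apply: measurable_funB => //; exact: sclr_past.
- by move=> n E k w kn E0; apply: phi_scl => //; exact: hK.
Qed.

(** The analogue of [e2] for the power 1; it separates [scl] from E_k in the telescoping sum of
    [e5]. *)
Let e3 : exists2 K : R, 0 <= K & forall n E, iid_upto P expo n E ->
    (forall j w, (j < n)%N -> 0 <= E j w) ->
    sqb P (fun w => \sum_(k < n) phi (wpos n E k w) * (scl n E k w `^ 1 - 1) * (E k w - 1)) (K * (1 + harm R n) ^+ 2).
Proof.
have [K K0 hK] := @scl_sub1 _ T R 1 N ler01 N1.
apply: (@mart (fun y : measurableTypeR R => y - 1)
  (fun n E k w => phi (wpos n E k w) * (scl n E k w `^ 1 - 1)) N.+2 (C * K)).
- exact: L2_centered.
- exact: Ex_centered.
- by rewrite mulr_ge0.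
- move=> n E k; apply: measurable_funM; first exact: phiZ_past.
  by apply: measurable_funB => //; exact: sclr_past.
- by move=> n E k w kn E0; apply: phi_scl => //; exact: hK.
Qed.

(** The first order terms of the powers r and 1 of [scl] are - r and - 1 times [wdev]; their
    difference is the source of the factor 1 - r in [t_coef]. *)
Let e4 : exists2 K : R, 0 <= K & forall n E, iid_upto P expo n E ->
    (forall j w, (j < n)%N -> 0 <= E j w) ->
    sqb P (fun w => \sum_(k < n) (phi (wpos n E k w) * (scl n E k w `^ r - scl n E k w `^ 1)
       - (1 - r) * phi (ell R n k) * wdev n E k w)) (K * (1 + harm R n) ^+ 2).
Proof.
have [K K0 hK] := @scl_expand _ T R r N (ltW r0) rN.
have [K' K'0 hK'] := @scl_expand _ T R 1 N ler01 N1.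
have [Cd Cd0 hCd] := sqb_ddom P N.+2.
pose K2 := C * (K + K') + 2 * L * (1 + r).
have K20 : 0 <= K2 by rewrite addr_ge0// mulr_ge0 ?addr_ge0 ?mulr_ge0// ltW.
exists (Cd * K2 ^+ 2); first by rewrite mulr_ge0 ?sqr_ge0.
apply: (@drift (fun n E k w => phi (wpos n E k w) * (scl n E k w `^ r - scl n E k w `^ 1)
       - (1 - r) * phi (ell R n k) * wdev n E k w)); first by rewrite mulr_ge0 ?sqr_ge0.
move=> n E k kn iE E0; rewrite -mulrA -exprMn; apply: (hCd n E k) => //.
  apply: measurable_funB.
    apply: measurable_funM; first exact: phiZ_past.
    by apply: measurable_funB; exact: sclr_past.
  by apply: measurable_funM => //; exact: past_wdev.
move=> w; have h1 := hK n E k w kn; have h2 := hK' n E k w kn; have h3 := dphi w kn E0.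
have h4 := ddom_wdev E w kn.
have m1 : 1 <= (n - k)%:R :> R by rewrite ler1n subn_gt0.
have D1 := ddom_ge1 n E k w.
set p := phi (wpos _ _ _ _) in h3 *; set l := phi (ell _ _ _) in h3 *.
set D := ddom _ _ _ _ in h1 h2 h3 h4 D1 *; set Y := wdev _ _ _ _ in h1 h2 h4 *.
set a := _ `^ r in h1 *; set a1 := _ `^ 1 in h2 *.
set m := (n - k)%:R in h1 h2 h3 h4 m1 *.
have s0 : 0 < Num.sqrt m by rewrite sqrtr_gt0; lra.
have s2 : Num.sqrt m * Num.sqrt m = m by rewrite -expr2 sqr_sqrtr//; lra.
have -> : p * (a - a1) - (1 - r) * l * Y =
   p * ((a - 1 + r * Y) - (a1 - 1 + 1 * Y)) + (p - l) * ((1 - r) * Y) by ring.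
apply: le_trans (ler_normD _ _) _; rewrite !normrM.
have -> : K2 / m * D ^+ N.+2 = C * (K * D ^+ N.+2 / m + K' * D ^+ N.+2 / m)
   + (2 * L / Num.sqrt m) * ((1 + r) * (D ^+ N.+2 / Num.sqrt m)).
  move: (Num.sqrt m) s0 s2 => s s0 <-; rewrite /K2; field; exact: lt0r_neq0.
apply: lerD.
  apply: ler_pM => //; first exact: phiC.
  by apply: le_trans (ler_normB _ _) _; exact: lerD.
have rr : `|1 - r| <= 1 + r by have r1 := r0; rewrite ler_norml; apply/andP; split; lra.
apply: (@le_trans _ _ ((2 * L * D / Num.sqrt m) * ((1 + r) * (D / Num.sqrt m)))).
  by apply: ler_pM => //; apply: ler_pM.
have -> : 2 * L * D / Num.sqrt m * ((1 + r) * (D / Num.sqrt m)) =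
   2 * L / Num.sqrt m * ((1 + r) * (D ^+ 2 / Num.sqrt m)) by field; rewrite gt_eqF.
rewrite ler_wpM2l ?divr_ge0 ?mulr_ge0 ?sqrtr_ge0//.
rewrite ler_wpM2l ?addr_ge0 ?(ltW r0)// ler_wpM2r ?invr_ge0 ?sqrtr_ge0//.
by rewrite -[leLHS]mulr1 (_ : N.+2 = 2 + N)%N// exprD ler_wpM2l ?exprn_ge0 ?exprn_ege1//; lra.
Qed.

Let L2_pow4 : L2 expo (fun y : measurableTypeR R => (y : R) ^+ 2).
Proof.
have [_ h] := L2_expo_pow (ler0n R 2).
split; first exact: measurable_funX.
apply: L1_expo_le h; first by apply: measurable_funX; exact: measurable_funX.
by move=> x x0; rewrite powR_mulrn// ger0_norm ?sqr_ge0.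
Qed.

Let sqb_scl : exists2 K : R, 0 <= K & forall n E k, (k < n)%N -> iid_upto P expo n E -> sqb P (scl n E k) K.
Proof.
have [Cd Cd0 hCd] := sqb_ddom P 1.
exists (Cd * 2 ^+ 2); first by rewrite mulr_ge0.
move=> n E k kn iE; apply: (hCd n E k _ _ iE kn); first exact: past_scl.
move=> w; rewrite expr1 gtr0_norm ?scl_gt0// sclE ler_pM ?expR_ge0 ?ddom_exp//.
  by apply: le_trans (cfac_ge1 R kn).
apply: le_trans (cfac_le R kn) _.
have : (n - k)%:R^-1 <= 1 :> R by rewrite invf_le1 ?ler1n ?ltr0n subn_gt0.
lra.
Qed.

(** With x the unscaled spacing, both errors are quadratic in x: replacing 1 - exp(- x) by x costs 2
    C, and the variation of phi along the spacing costs L. *)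
Let step n (E : nat -> T -> R) k w : (k < n)%N -> (forall j w, (j < n)%N -> 0 <= E j w) ->
  `|phi (wpos n E k w) * (scl n E k w * E k w) - n%:R * (tail_int phi (wpos n E k w) - tail_int phi (wpos n E k.+1 w))|
  <= (2 * C + L) * (scl n E k w * E k w ^+ 2 / (n - k)%:R).
Proof.
move=> kn E0.
have m0 : 0 < (n - k)%:R :> R by rewrite ltr0n subn_gt0.
have Z0 := wpos_ge0 w (ltnW kn) E0.
have Ek := E0 k w kn.
have a0 := scl_gt0 E w kn.
have eZ : wpos n E k.+1 w = wpos n E k w + E k w / (n - k)%:R by rewrite /wpos big_ord_recr.
pose x := E k w / (n - k)%:R.
have x0 : 0 <= x by rewrite divr_ge0// ltW.
rewrite -/x in eZ.
have := tail_int_diff mphi phiC phiL Z0 (_ : _ <= wpos n E k.+1 w).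
rewrite eZ lerDl (addrC _ x) addrK opprD (addrC (- x)) expRD => /(_ x0) h.
set z := wpos n E k w in h Z0 *; set p := tail_int phi _ in h *; set p' := tail_int phi (x + z) in h *.
have em : n%:R * expR (- z) = (n - k)%:R * scl n E k w.
  by rewrite /scl -/z; field; rewrite gt_eqF.
have eE : E k w = (n - k)%:R * x by rewrite /x mulrC divfK// gt_eqF.
have ex1 : 0 <= 1 - expR (- x).
  by rewrite subr_ge0 -[leRHS]expR0 ler_expR oppr_le0.
have ex2 : 1 - expR (- x) <= x by have := expR_ge1Dx (- x); lra.
have ex3 : expR (- x) - 1 + x <= 2 * x ^+ 2.
  have := expR_taylor2 (- x); rewrite sqrrN opprK => /(le_trans (ler_norm _)) hh.
  by apply: le_trans hh _; rewrite mulrC ler_wpM2r ?sqr_ge0//; lra.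
have ex4 : 0 <= expR (- x) - 1 + x by have := expR_ge1Dx (- x); lra.
have -> : phi z * (scl n E k w * E k w) - n%:R * (p - p') =
   phi z * (n%:R * expR (- z) * (expR (- x) - 1 + x))
   - n%:R * (p - p' - phi z * (expR (- z) - expR (- z) * expR (- x))).
  rewrite eE (_ : _ * (_ * (_ * x)) = phi z * ((n - k)%:R * scl n E k w * x)); last by ring.
  by rewrite -em; ring.
apply: le_trans (ler_normB _ _) _.
have -> : (2 * C + L) * (scl n E k w * E k w ^+ 2 / (n - k)%:R) =
  C * ((n - k)%:R * scl n E k w * (2 * x ^+ 2)) + L * ((n - k)%:R * scl n E k w * x ^+ 2).
  by rewrite eE; field; rewrite gt_eqF.
have ma0 : 0 <= (n - k)%:R * scl n E k w by rewrite mulr_ge0 ?ltW.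
apply: lerD.
  rewrite normrM ler_pM// em ger0_norm; last by rewrite mulr_ge0.
  by rewrite ler_wpM2l.
rewrite normrM ger0_norm//.
apply: le_trans (ler_wpM2l (ler0n _ n) h) _.
rewrite -em (_ : n%:R * (L * x * _) = L * (n%:R * expR (- z) * (x * (1 - expR (- x))))); last by ring.
by rewrite ler_wpM2l// em ler_wpM2l// expr2 ler_wpM2l.
Qed.

(** The sum for the power 1 telescopes through [tail_int], so it is constant up to logarithmic
    terms. The martingale structure plays no part: each step error is of size 1 / (n - k). *)
Let e5 : exists2 K : R, 0 <= K & forall n E, iid_upto P expo n E ->
    (forall j w, (j < n)%N -> 0 <= E j w) ->
    sqb P (fun w => \sum_(k < n) phi (wpos n E k w) * (scl n E k w * E k w) - n%:R * tail_int phi 0)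
      (K * (1 + harm R n) ^+ 2).
Proof.
have [Ka Ka0 hKa] := sqb_scl.
pose Kb := Ex expo (fun y : measurableTypeR R => ((y : R) ^+ 2) ^+ 2).
have Kb0 : 0 <= Kb by apply: Ex_ge0 => y; exact: sqr_ge0.
have hb : sqb expo (fun y : measurableTypeR R => (y : R) ^+ 2) Kb by split => //; exact: lexx.
pose K1 := (2 * C + L) ^+ 2 * (Ka * Kb).
have K10 : 0 <= K1 by rewrite mulr_ge0 ?sqr_ge0// mulr_ge0.
pose K2 := C ^+ 2 * Ka.
have K20 : 0 <= K2 by rewrite mulr_ge0 ?sqr_ge0.
exists (2 * K1 + 2 * K2); first by apply: addr_ge0; apply: mulr_ge0.
move=> n E iE E0.
have mZ k : (k <= n)%N -> measurable_fun [set: T] (wpos n E k).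
  by move=> kn; apply: (measurable_of_past iE kn); exact: past_wpos.
have mE k : (k < n)%N -> measurable_fun [set: T] (E k) by case: iE => h _; exact: h.
have mscl k : (k < n)%N -> measurable_fun [set: T] (scl n E k).
  by move=> kn; apply: (measurable_of_past iE (ltnW kn)); exact: past_scl.
have mtail : measurable_fun [set: measurableTypeR R] (tail_int phi : measurableTypeR R -> R).
  exact: measurable_tail_int mphi phiC.
have mF k : (k < n)%N -> measurable_fun [set: T] (fun w => phi (wpos n E k w) * (scl n E k w * E k w)
   - n%:R * (tail_int phi (wpos n E k w) - tail_int phi (wpos n E k.+1 w))).
  move=> kn; apply: measurable_funB.
    apply: measurable_funM; first exact: (measurableT_comp mphi (mZ k (ltnW kn))).
    by apply: measurable_funM; [exact: mscl|exact: mE].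
  apply: measurable_funM => //; apply: measurable_funB.
    exact: (measurableT_comp mtail (mZ _ (ltnW kn))).
  exact: (measurableT_comp mtail (mZ _ kn)).
have s1 : sqb P (fun w => \sum_(k < n) (phi (wpos n E k w) * (scl n E k w * E k w)
   - n%:R * (tail_int phi (wpos n E k w) - tail_int phi (wpos n E k.+1 w)))) (K1 * (1 + harm R n) ^+ 2).
  apply: (sqb_le (c := K1 * harm R n ^+ 2)); first by rewrite ler_wpM2l.
  apply: (@sqb_sum _ _ _ P (fun k w => phi (wpos n E k w) * (scl n E k w * E k w)
   - n%:R * (tail_int phi (wpos n E k w) - tail_int phi (wpos n E k.+1 w))) (fun k => (n - k)%:R^-1) K1 n) => k kn.
    by rewrite invr_gt0 ltr0n subn_gt0.
  have h0 := @sqb_past_prod _ _ _ P expo n E k (scl n E k) _ Ka Kb iE kn ltac:(exact: past_scl) (hKa n E k kn iE) hb.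
  have := sqbZ ((2 * C + L) * (n - k)%:R^-1) h0.
  rewrite (_ : _ * (Ka * Kb) = K1 * (n - k)%:R^-1 ^+ 2); last by rewrite exprMn /K1; ring.
  move=> h1; apply: (sqb_mono (mF k kn) h1).
  move=> w; apply: le_trans (step w kn E0) _.
  apply: le_trans (ler_norm _); rewrite le_eqVlt; apply/orP; left; apply/eqP; ring.
(* The boundary term at Z_(n) is bounded at Z_(n-1), where n exp(- Z_(n-1)) equals [scl] because n -
   (n - 1) = 1; at index n the divisor of [scl] would be 0. *)
have s2 : sqb P (fun w => n%:R * tail_int phi (wpos n E n w)) (K2 * (1 + harm R n) ^+ 2).
  case: (posnP n) => [n0|n0].
    rewrite n0; have -> : (fun w => 0%:R * tail_int phi (wpos 0 E 0 w)) = (fun=> 0).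
      by apply/funext => w; rewrite mul0r.
    split; first exact: L2_cst.
    by rewrite expr0n/= Ex_cst mulr_ge0// sqr_ge0.
  have nn : (n.-1 < n)%N by rewrite ltn_predL.
  apply: (sqb_le (c := K2)); first by rewrite ler_peMr// exprn_ege1// lerDl.
  apply: (sqb_mono _ (sqbZ C (hKa n E n.-1 nn iE))).
    by apply: measurable_funM => //; exact: (measurableT_comp mtail (mZ _ (leqnn n))).
  move=> w; rewrite normrM ger0_norm//.
  have hz := tail_int_le mphi phiC (wpos_ge0 w (leqnn n) E0).
  apply: le_trans (ler_wpM2l (ler0n _ n) hz) _.
  apply: le_trans (ler_norm _).
  rewrite mulrCA ler_wpM2l// /scl.
  have -> : (n - n.-1)%N = 1%N by case: (n) n0 => // k _; rewrite subSnn.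
  rewrite divr1 ler_wpM2l// ler_expR lerN2.
  have -> : wpos n E n w = wpos n E n.-1 w + E n.-1 w / (n - n.-1)%:R.
    have gen k : wpos n E k.+1 w = wpos n E k w + E k w / (n - k)%:R by rewrite /wpos big_ord_recr.
    by rewrite -gen prednK.
  by rewrite lerDl divr_ge0// E0.
have s := sqbB s1 s2.
apply: (sqb_le (c := 2 * (K1 * (1 + harm R n) ^+ 2) + 2 * (K2 * (1 + harm R n) ^+ 2))).
  by rewrite le_eqVlt; apply/orP; left; apply/eqP; ring.
rewrite (_ : (fun w => _ - _) = (fun w : T => \sum_(k < n) (phi (wpos n E k w) * (scl n E k w * E k w)
   - n%:R * (tail_int phi (wpos n E k w) - tail_int phi (wpos n E k.+1 w))) - n%:R * tail_int phi (wpos n E n w)))//.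
apply/funext => w; rewrite sumrB -mulr_sumr.
rewrite -(big_mkord predT (fun k => tail_int phi (wpos n E k w) - tail_int phi (wpos n E k.+1 w))).
have -> : \sum_(0 <= k < n) (tail_int phi (wpos n E k w) - tail_int phi (wpos n E k.+1 w)) =
   tail_int phi 0 - tail_int phi (wpos n E n w).
  under eq_bigr do rewrite -opprB.
  by rewrite sumrN telescope_sumr// /wpos big_ord0 opprB.
ring.
Qed.

(** The exchange of summations: deviations accumulated up to position k become a weight on each
    single spacing. *)
Lemma sum_phibar n (u : nat -> R) :
  \sum_(k < n) phi (ell R n k) * (\sum_(j < k) u j / (n - j)%:R) = \sum_(k < n) phibar n k * u k.
Proof.
have -> : \sum_(k < n) phibar n k * u k =
    \sum_(k < n) \sum_(i < n | (k < i)%N) phi (ell R n i) * (u k / (n - k)%:R).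
  apply: eq_bigr => k _; rewrite /phibar.
  rewrite (_ : \sum_(k.+1 <= i < n) _ = \sum_(i < n | (k < i)%N) phi (ell R n i)); last first.
    by rewrite (big_nat_widenl _ 0)// big_mkord; apply: eq_bigl => i.
  rewrite !big_distrl/=; apply: eq_bigr => i _; ring.
rewrite (exchange_big_dep predT)//=; apply: eq_bigr => k _.
rewrite mulr_sumr (big_ord_widen n (fun j => phi (ell R n k) * (u j / (n - j)%:R)))//.
by rewrite ltnW.
Qed.

Lemma smooth_sum : exists2 K : R, 0 <= K & forall n E, iid_upto P expo n E ->
    (forall j w, (j < n)%N -> 0 <= E j w) ->
    sqb P (fun w => \sum_(k < n) phi (wpos n E k w) * (scl n E k w * E k w) `^ r
       - n%:R * (mu * tail_int phi 0) - \sum_(k < n) lin n k (E k w))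
      (K * (1 + harm R n) ^+ 2).
Proof.
have [K1 K10 h1] := e1; have [K2 K20 h2] := e2; have [K3 K30 h3] := e3.
have [K4 K40 h4] := e4; have [K5 K50 h5] := e5.
exists (4 * K1 + 4 * K2 + (4 * (mu ^+ 2 * K3) + (8 * (mu ^+ 2 * K4) + 8 * (mu ^+ 2 * K5)))).
  by rewrite !addr_ge0// mulr_ge0// mulr_ge0// sqr_ge0.
move=> n E iE E0; set H := (1 + harm R n) ^+ 2.
have {}h1 := h1 n E iE E0; have {}h2 := h2 n E iE E0.
have {}h3 := sqbZ mu (h3 n E iE E0); have {}h4 := sqbZ mu (h4 n E iE E0).
have {}h5 := sqbZ mu (h5 n E iE E0).
have := sqbD (sqbD h1 h2) (sqbB (sqbD h4 h5) h3).
have -> : 2 * (2 * (K1 * H) + 2 * (K2 * H)) + 2 * (2 * (2 * (mu ^+ 2 * (K4 * H)) + 2 * (mu ^+ 2 * (K5 * H))) + 2 * (mu ^+ 2 * (K3 * H)))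
  = (4 * K1 + 4 * K2 + (4 * (mu ^+ 2 * K3) + (8 * (mu ^+ 2 * K4) + 8 * (mu ^+ 2 * K5)))) * H by ring.
rewrite [X in sqb P X _ -> _](_ : _ = (fun w => \sum_(k < n) phi (wpos n E k w) * (scl n E k w * E k w) `^ r
       - n%:R * (mu * tail_int phi 0) - \sum_(k < n) lin n k (E k w)))//.
apply/funext => w.
have -> : \sum_(k < n) lin n k (E k w) = \sum_(k < n) phi (ell R n k) * bpow r (E k w) +
    t_coef r * \sum_(k < n) phi (ell R n k) * wdev n E k w.
  rewrite /wdev (sum_phibar n (fun k => E k w - 1)) mulr_sumr -big_split/=.
  by apply: eq_bigr => k _; rewrite /lin; ring.
(* With s the scale, s^r E^r is expanded around s = 1 and E^r around its mean mu; then mu s^r is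
   split into mu (s^r - s) and mu s, and mu s is completed to the telescoping mu s E. *)
have -> : \sum_(k < n) phi (wpos n E k w) * (scl n E k w * E k w) `^ r =
   \sum_(k < n) (phi (wpos n E k w) - phi (ell R n k)) * bpow r (E k w)
   + \sum_(k < n) phi (wpos n E k w) * (scl n E k w `^ r - 1) * (E k w `^ r - mu)
   + (mu * (\sum_(k < n) (phi (wpos n E k w) * (scl n E k w `^ r - scl n E k w `^ 1)
       - (1 - r) * phi (ell R n k) * wdev n E k w))
     + mu * (\sum_(k < n) phi (wpos n E k w) * (scl n E k w * E k w))
     - mu * (\sum_(k < n) phi (wpos n E k w) * (scl n E k w `^ 1 - 1) * (E k w - 1)))
   + (\sum_(k < n) phi (ell R n k) * bpow r (E k w) +
    t_coef r * \sum_(k < n) phi (ell R n k) * wdev n E k w).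
  rewrite !mulr_sumr -!big_split/= -sumrN -!big_split/=; apply: eq_bigr => k _.
  have a0 := scl_gt0 E w (ltn_ord k).
  rewrite powRM ?E0 ?(ltW a0)// powRr1 ?(ltW a0)// /bpow /t_coef -/mu; ring.
ring.
Qed.
End smooth_sum.

Definition del (T : Type) (i : nat) (l : seq T) : seq T := take i l ++ drop i.+1 l.

Lemma size_del (T : Type) i (l : seq T) : (i < size l)%N -> size (del i l) = (size l).-1.
Proof.
move=> il; rewrite size_cat size_take il size_drop.
by case: (size l) il => // m im; rewrite subSS/= subnKC// -ltnS.
Qed.

Lemma del_rcons (T : Type) i (l : seq T) y : (i < size l)%N -> del i (rcons l y) = rcons (del i l) y.
Proof.
by move=> il; rewrite /del -cats1 takel_cat ?(ltnW il)// drop_cat ltn_neqAle il andbT;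
  case: eqP => [->|_]; rewrite -?cats1 ?subnn ?drop0 ?drop_size -?catA.
Qed.

Lemma del_last (T : Type) (l : seq T) y : del (size l) (rcons l y) = l.
Proof. by rewrite /del -cats1 take_size_cat// drop_oversize ?cats0// size_cat addn1. Qed.

(** * The Efron-Stein inequality *)

Section list_functions.
Context (R : realType).
Implicit Types F : seq R -> R.

(* Measurability of a function of [k] real variables, tested on all measurable curves. *)
Definition lmeas (k : nat) F : Prop :=
  forall d (U : measurableType d) (u : nat -> U -> R),
    (forall i, measurable_fun [set: U] (u i)) ->
    measurable_fun [set: U] (fun x => F (mkseq (fun i => u i x) k)).

Definition lbound (k : nat) F (c : R) : Prop := forall l, size l = k -> `|F l| <= c.

Variable nu : probability (measurableTypeR R) R.

Definition lavg F (l : seq R) : R := Ex nu (fun y : measurableTypeR R => F (rcons l y)).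

Lemma lmeas_rcons k F d (U : measurableType d) (u : nat -> U -> R) :
  (forall i, measurable_fun [set: U] (u i)) -> lmeas k.+1 F ->
  measurable_fun [set: U * measurableTypeR R]
    (fun x : U * measurableTypeR R => F (rcons (mkseq (fun i => u i x.1) k) x.2)).
Proof.
move=> mu mF.
have := mF _ (U * measurableTypeR R)%type (fun i x => if (i < k)%N then u i x.1 else x.2).
have h i : measurable_fun [set: U * measurableTypeR R] (fun x : U * measurableTypeR R => if (i < k)%N then u i x.1 else x.2 : R).
  case: (i < k)%N; last exact: measurable_snd.
  exact: (measurableT_comp (mu i) measurable_fst).
move=> /(_ h); rewrite (_ : (fun x : U * measurableTypeR R => F (mkseq _ k.+1)) =
   (fun x : U * measurableTypeR R => F (rcons (mkseq (fun i => u i x.1) k) x.2)))//.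
apply/funext => x; rewrite mkseqS ltnn; congr (F (rcons _ _)).
by apply/eq_in_map => i; rewrite mem_iota add0n/= => ->.
Qed.

Lemma lmeas_rcons1 k F l : size l = k -> lmeas k.+1 F ->
  measurable_fun [set: measurableTypeR R] (fun y : measurableTypeR R => F (rcons l y)).
Proof.
move=> lk mF; have := @mF _ (measurableTypeR R) (fun i y => if (i < k)%N then nth 0 l i else y).
have h i : measurable_fun [set: measurableTypeR R] (fun y : measurableTypeR R => if (i < k)%N then nth 0 l i else y : R).
  by case: (i < k)%N; [exact: measurable_cst|exact: measurable_id].
move=> /(_ h); rewrite (_ : (fun x : measurableTypeR R => F (mkseq _ k.+1)) = (fun y : measurableTypeR R => F (rcons l y)))//.
apply/funext => x; rewrite mkseqS ltnn; congr (F (rcons _ _)).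
rewrite -[RHS](mkseq_nth 0) lk.
by apply/eq_in_map => i; rewrite mem_iota add0n/= => ->.
Qed.

Lemma L1_rcons k F c l : size l = k -> lmeas k.+1 F -> lbound k.+1 F c ->
  L1 nu (fun y : measurableTypeR R => F (rcons l y)).
Proof.
move=> lk mF bF; apply: (@L1_bounded _ _ _ _ _ (c)); first exact: lmeas_rcons1 lk mF.
by move=> y; apply: bF; rewrite size_rcons lk.
Qed.

Lemma lavg_bound k F c : lmeas k.+1 F -> lbound k.+1 F c -> lbound k (lavg F) c.
Proof.
move=> mF bF l lk; have h := L1_rcons lk mF bF.
apply: le_trans (Ex_norm h) _; rewrite -[leRHS](Ex_cst nu); apply: Ex_le.
- exact: L1_norm.
- exact: L1_cst.
- by move=> y; apply: bF; rewrite size_rcons lk.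
Qed.

Lemma measurable_Ex_bounded d1 d2 (U : measurableType d1) (V : measurableType d2)
    (m : probability V R) (H : U * V -> R) c :
  measurable_fun [set: U * V] H -> (forall x, `|H x| <= c) ->
  measurable_fun [set: U] (fun u => Ex m (fun y => H (u, y))).
Proof.
move=> mH Hc.
have mHu u : measurable_fun [set: V] (fun y => H (u, y)).
  by apply: (measurableT_comp mH); exact: measurable_pair1.
have LH u : L1 m (fun y => H (u, y)) by apply: (@L1_bounded _ _ _ _ _ (c)).
(* The shift by [c] makes the integrand nonnegative. *)
have -> : (fun u => Ex m (fun y => H (u, y))) = (fun u => Ex m (fun y => H (u, y) + c) - c).
  by apply/funext => u; rewrite ExD ?Ex_cst ?addrK//; exact: L1_cst.
apply: measurable_funB => //.
apply: (@measurable_Ex_inner _ _ _ _ _ _ (fun x => H x + c)).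
- exact: measurable_funD.
- by move=> x; have := Hc x; rewrite ler_norml => /andP[]; lra.
- by move=> u; apply: L1D; [exact: LH|exact: L1_cst].
Qed.

Lemma lmeas_avg k F c : lmeas k.+1 F -> lbound k.+1 F c -> lmeas k (lavg F).
Proof.
move=> mF bF d U u mu.
apply: (@measurable_Ex_bounded _ _ _ _ nu
  (fun x : U * measurableTypeR R => F (rcons (mkseq (fun i => u i x.1) k) x.2)) c).
- exact: (lmeas_rcons mu mF).
- by move=> x; apply: bF; rewrite size_rcons size_mkseq.
Qed.

End list_functions.

Section efron_stein.
Context d (T : measurableType d) (R : realType) (P : probability T R).
Variable nu : probability (measurableTypeR R) R.

Lemma Ex_past_bounded n k (Y : nat -> T -> R) (c : R)
    (H : g_sigma_algebraType (past Y k) * measurableTypeR R -> R) :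
  iid_upto P nu n Y -> (k < n)%N ->
  measurable_fun [set: g_sigma_algebraType (past Y k) * measurableTypeR R] H ->
  (forall x, `|H x| <= c) ->
  Ex P (fun w => H (w, Y k w)) = Ex P (fun w => Ex nu (fun y => H (w, y))).
Proof.
move=> iY kn mH Hc.
have mHn := measurable_past_now iY kn mH.
have LHn : L1 P (fun w => H (w, Y k w)) by apply: (@L1_bounded _ _ _ _ _ (c)).
have mHi : measurable_fun [set: T] (fun w => Ex nu (fun y => H (w, y))).
  apply: (past_measurable_fun (past_meas iY (ltnW kn))).
  exact: measurable_Ex_bounded mH Hc.
have LHu w : L1 nu (fun y => H (w, y)).
  apply: (@L1_bounded _ _ _ _ _ (c)) => //; apply: (measurableT_comp mH); exact: measurable_pair1.
have LHi : L1 P (fun w => Ex nu (fun y => H (w, y))).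
  apply: (@L1_bounded _ _ _ _ _ (c)) => // w; apply: le_trans (Ex_norm (LHu w)) _.
  by rewrite -[leRHS](Ex_cst nu); apply: Ex_le => //; [exact: L1_norm|exact: L1_cst].
have e w : Ex nu (fun y => H (w, y) + c) = Ex nu (fun y => H (w, y)) + c.
  by rewrite ExD ?Ex_cst//; exact: L1_cst.
have := @Ex_past_ge0 _ _ _ P nu n k Y iY kn (fun x => H x + c).
case.
- exact: measurable_funD.
- by move=> x; have := Hc x; rewrite ler_norml => /andP[]; lra.
- by move=> w; apply: L1D => //; exact: L1_cst.
- by under eq_fun do rewrite e; apply: L1D => //; exact: L1_cst.
move=> _; under [in RHS]eq_fun do rewrite e.
by rewrite !ExD ?Ex_cst//; [move/addIr|exact: L1_cst|exact: L1_cst].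
Qed.

Let W (Y : nat -> T -> R) k w : seq R := mkseq (fun i => Y i w) k.

(** [K i] is any function of the other variables, in place of the conditional mean; this is the form
    used with deletion. The induction is on the number of variables, by the law of total variance
    for the last one. *)
Lemma efron_stein n (Y : nat -> T -> R) (c : R) k (F : seq R -> R) (K : nat -> seq R -> R) :
  iid_upto P nu n Y -> (k <= n)%N ->
  lmeas k F -> lbound k F c ->
  (forall i, (i < k)%N -> lmeas k.-1 (K i)) -> (forall i, (i < k)%N -> lbound k.-1 (K i) c) ->
  Ex P (fun w => (F (W Y k w) - Ex P (fun w => F (W Y k w))) ^+ 2) <=
  \sum_(i < k) Ex P (fun w => (F (W Y k w) - K i (del i (W Y k w))) ^+ 2).
Proof.
move=> iY; elim: k F K => [|k IH] F K kn mF bF mK bK.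
  rewrite big_ord0 (_ : (fun w => F _) = fun=> F [::])//.
  rewrite Ex_cst (_ : (fun w => _) = fun=> 0) ?Ex_cst//.
  by apply/funext => w; rewrite /W /mkseq/= subrr expr0n.
have c0 : 0 <= c by have := bF (nseq k.+1 0); rewrite size_nseq => /(_ erefl); apply: le_trans.
have mY : forall i, (i < k)%N -> measurable_fun [set: g_sigma_algebraType (past Y k)] (Y i : g_sigma_algebraType (past Y k) -> R).
  by move=> i ik; exact: past_fun.
have WS w : W Y k.+1 w = rcons (W Y k w) (Y k w) by rewrite /W mkseqS.
have sW w : size (W Y k w) = k by rewrite size_mkseq.
pose TG := g_sigma_algebraType (past Y k).
have mW (G : seq R -> R) : lmeas k.+1 G ->
    measurable_fun [set: TG * measurableTypeR R] (fun x : TG * measurableTypeR R => G (rcons (W Y k x.1) x.2)).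
  move=> mG; pose u i : TG -> R := if (i < k)%N then Y i else fun=> 0.
  have mu i : measurable_fun [set: TG] (u i) by rewrite /u; case: ifP => // ik; exact: mY.
  have := lmeas_rcons mu mG; congr (measurable_fun _ _); apply/funext => x; congr (G (rcons _ _)).
  by apply/eq_in_map => i; rewrite mem_iota add0n/= /u => ->.
have mWk (G : seq R -> R) : lmeas k G ->
    measurable_fun [set: TG] (fun x : TG => G (W Y k x)).
  move=> mG; pose u i : TG -> R := if (i < k)%N then Y i else fun=> 0.
  have mu i : measurable_fun [set: TG] (u i) by rewrite /u; case: ifP => // ik; exact: mY.
  have := mG _ _ _ mu; congr (measurable_fun _ _); apply/funext => x; congr (G _).
  by apply/eq_in_map => i; rewrite mem_iota add0n/= /u => ->.
have TGT (G : TG -> R) : measurable_fun [set: TG] G -> measurable_fun [set: T] (G : T -> R).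
  exact: (past_measurable_fun (past_meas iY (ltnW kn))).
pose H (x : TG * measurableTypeR R) := F (rcons (W Y k x.1) x.2).
have mH : measurable_fun [set: TG * measurableTypeR R] H by exact: mW.
have bH x : `|H x| <= c by apply: bF; rewrite size_rcons sW.
pose F1 := lavg nu F.
pose K1 i := lavg nu (K i).
pose m := Ex P (fun w => F1 (W Y k w)).
have mE : Ex P (fun w => F (W Y k.+1 w)) = m.
  by under eq_fun do rewrite WS; exact: (Ex_past_bounded iY kn mH bH).
have sq (a b : R) : `|a| <= c -> `|b| <= c -> `|(a - b) ^+ 2| <= 4 * c ^+ 2.
  move=> ac bc; have ab : `|a - b| <= 2 * c by apply: le_trans (ler_normB _ _) _; lra.
  rewrite normrX (le_trans (lerXn2r 2 _ _ ab)) ?nnegrE ?mulr_ge0//.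
  by rewrite exprMn; lra.
have LH w : L1 nu (fun y => H (w, y)).
  by apply: (@L1_bounded _ _ _ _ _ (c)) => //; apply: (measurableT_comp mH); exact: measurable_pair1.
have fub (G : TG * measurableTypeR R -> R) : measurable_fun [set: TG * measurableTypeR R] G ->
    (forall x, `|G x| <= c) ->
    Ex P (fun w => (F (W Y k.+1 w) - G (w, Y k w)) ^+ 2) =
    Ex P (fun w => Ex nu (fun y => (H (w, y) - G (w, y)) ^+ 2)).
  move=> mG bG; under eq_fun do rewrite WS.
  apply: (@Ex_past_bounded n k Y (4 * c ^+ 2) (fun x => (H x - G x) ^+ 2)) => //.
  - by apply: measurable_funX; exact: measurable_funB.
  - by move=> x; exact: sq.
have LHG (G : TG * measurableTypeR R -> R) : measurable_fun [set: TG * measurableTypeR R] G ->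
    (forall x, `|G x| <= c) -> L1 P (fun w => Ex nu (fun y => (H (w, y) - G (w, y)) ^+ 2)).
  move=> mG bG.
  have mHG : measurable_fun [set: TG * measurableTypeR R] (fun x => (H x - G x) ^+ 2).
    by apply: measurable_funX; exact: measurable_funB.
  have bHG x : `|(H x - G x) ^+ 2| <= 4 * c ^+ 2 by exact: sq.
  apply: (@L1_bounded _ _ _ _ _ (4 * c ^+ 2)).
    apply: TGT.
    exact: (@measurable_Ex_bounded _ _ _ TG _ nu (fun x : TG * measurableTypeR R => (H x - G x) ^+ 2) (4 * c ^+ 2)).
  have LL w : L1 nu (fun y => (H (w, y) - G (w, y)) ^+ 2).
    apply: (@L1_bounded _ _ _ _ _ (4 * c ^+ 2)) => //.
    by apply: (measurableT_comp mHG); exact: measurable_pair1.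
  move=> w; apply: le_trans (Ex_norm (LL w)) _; rewrite -[leRHS](Ex_cst nu).
  by apply: Ex_le; [exact: L1_norm|exact: L1_cst|].
have mF1 : lmeas k F1 := lmeas_avg nu mF bF.
have bF1 : lbound k F1 c := lavg_bound nu mF bF.
have bm : `|m| <= c.
  have L : L1 P (fun w => F1 (W Y k w)).
    by apply: (@L1_bounded _ _ _ _ _ (c)) => [|w]; [apply: TGT; exact: mWk|exact: bF1].
  apply: le_trans (Ex_norm L) _; rewrite -[leRHS](Ex_cst P).
  by apply: Ex_le; [exact: L1_norm|exact: L1_cst|move=> w; exact: bF1].
rewrite mE big_ord_recr/=.
(* The decomposition of a mean square around [a] into conditional variance and squared bias. *)
have quad w (a : R) : Ex nu (fun y => (H (w, y) - a) ^+ 2) =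
    Ex nu (fun y => (H (w, y) - F1 (W Y k w)) ^+ 2) + (F1 (W Y k w) - a) ^+ 2.
  have L2H : L2 nu (fun y => H (w, y)).
    split; first by case/integrableP: (LH w) => /measurable_EFinP.
    apply: (@L1_bounded _ _ _ _ _ (c ^+ 2)).
      by apply: measurable_funX; case/integrableP: (LH w) => /measurable_EFinP.
    by move=> y; rewrite normrX lerXn2r ?nnegrE.
  set b := F1 _.
  have eb : Ex nu (fun y => H (w, y)) = b by [].
  have ex2 (a' : R) : Ex nu (fun y => (H (w, y) - a') ^+ 2) = Ex nu (fun y => H (w, y) ^+ 2) - 2 * a' * b + a' ^+ 2.
    rewrite (_ : (fun y => (H (w, y) - a') ^+ 2) = (fun y => H (w, y) ^+ 2 - 2 * a' * H (w, y) + a' ^+ 2)).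
      have [_ L] := L2H.
      rewrite ExD ?Ex_cst ?ExB ?ExZ ?eb//; [exact: L1Z| |exact: L1_cst].
      by apply: L1B => //; exact: L1Z.
    by apply/funext => y; ring.
  by rewrite !ex2; ring.
have -> : Ex P (fun w => (F (W Y k.+1 w) - m) ^+ 2) =
   Ex P (fun w => Ex nu (fun y => (H (w, y) - F1 (W Y k w)) ^+ 2)) + Ex P (fun w => (F1 (W Y k w) - m) ^+ 2).
  rewrite (fub (fun=> m))//; under eq_fun do rewrite quad.
  rewrite ExD//.
    apply: (LHG (fun x => F1 (W Y k x.1))); last by move=> x; exact: bF1.
    exact: (measurableT_comp (mWk _ mF1) measurable_fst).
  apply: (@L1_bounded _ _ _ _ _ (4 * c ^+ 2)); last by move=> w; apply: sq => //; exact: bF1.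
  by apply: measurable_funX; apply: measurable_funB => //; apply: TGT; exact: mWk.
(* The mean conditional variance given the first k variables: the conditional mean is their best
   approximation of [F], and [K k] is another function of them. *)
rewrite [leLHS]addrC; apply: lerD; last first.
  have mKk : lmeas k (K k) := mK k (ltnSn k).
  have e w : del k (W Y k.+1 w) = W Y k w by rewrite WS -{1}(sW w) del_last.
  rewrite (_ : (fun w => (F (W Y k.+1 w) - K k (del k (W Y k.+1 w))) ^+ 2) =
    (fun w => (F (W Y k.+1 w) - K k (W Y k w)) ^+ 2)); last by apply/funext => w; rewrite e.
  rewrite (fub (fun x => K k (W Y k x.1))); first last.
  - by move=> x; apply: (bK k (ltnSn k)).
  - exact: (measurableT_comp (mWk _ mKk) measurable_fst).
  apply: Ex_le.
  - apply: (LHG (fun x => F1 (W Y k x.1))); last by move=> x; exact: bF1.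
    exact: (measurableT_comp (mWk _ mF1) measurable_fst).
  - apply: (LHG (fun x => K k (W Y k x.1))); last by move=> x; apply: (bK k (ltnSn k)).
    exact: (measurableT_comp (mWk _ mKk) measurable_fst).
  - by move=> w; rewrite [leRHS](quad w (K k (W Y k w))) lerDl sqr_ge0.
have kK1 i : (i < k)%N -> lmeas k.-1 (K1 i).
  move=> ik; apply: (@lmeas_avg _ _ _ _ c); rewrite prednK ?(leq_ltn_trans _ ik)//.
    by apply: mK; exact: ltnW.
  by apply: bK; exact: ltnW.
have bK1 i : (i < k)%N -> lbound k.-1 (K1 i) c.
  move=> ik; apply: lavg_bound; rewrite prednK ?(leq_ltn_trans _ ik)//.
    by apply: mK; exact: ltnW.
  by apply: bK; exact: ltnW.
(* The last variable is averaged out of the comparison functions too, so that Jensen's inequality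
   leads back to [F] and [K i]. *)
apply: le_trans (IH F1 K1 (ltnW kn) mF1 bF1 kK1 bK1) _.
apply: ler_sum => i _.
have ik := ltn_ord i.
have e w : del i (W Y k.+1 w) = rcons (del i (W Y k w)) (Y k w) by rewrite WS del_rcons ?sW.
rewrite (_ : (fun w => (F (W Y k.+1 w) - K i (del i (W Y k.+1 w))) ^+ 2) =
    (fun w => (F (W Y k.+1 w) - K i (rcons (del i (W Y k w)) (Y k w))) ^+ 2)); last by apply/funext => w; rewrite e.
pose G (x : TG * measurableTypeR R) := K i (rcons (del i (W Y k x.1)) x.2).
have sd w : size (del i (W Y k w)) = k.-1 by rewrite size_del sW.
have bG x : `|G x| <= c.
  by apply: (bK i (ltnW ik)); rewrite size_rcons sd prednK// (leq_ltn_trans _ ik).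
have mG : measurable_fun [set: TG * measurableTypeR R] G.
  pose u j : TG -> R := if (j < k)%N then Y j else fun=> 0.
  have mu j : measurable_fun [set: TG] (u j) by rewrite /u; case: ifP => // jk; exact: mY.
  pose u' j := if (j < i)%N then u j else u j.+1.
  have mu' j : measurable_fun [set: TG] (u' j) by rewrite /u'; case: ifP.
  have := @lmeas_rcons R k.-1 (K i) _ TG u' mu'.
  rewrite prednK ?(leq_ltn_trans _ ik)// => /(_ (mK i (ltnW ik))).
  congr (measurable_fun _ _); apply/funext => x; congr (K i (rcons _ _)).
  apply: (@eq_from_nth _ 0); first by rewrite size_mkseq sd.
  move=> j; rewrite size_mkseq => jk; rewrite nth_mkseq// /del nth_cat size_take sW ik.
  have kk : k = k.-1.+1 by rewrite prednK// (leq_ltn_trans _ ik).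
  rewrite /u' /u; have [ji|ij] := ltnP j i.
    by rewrite nth_take// (ltn_trans ji ik) nth_mkseq// (ltn_trans ji ik).
  rewrite nth_drop addSn subnKC// kk ltnS jk nth_mkseq//.
rewrite (fub G mG bG).
have LHGn w : L2 nu (fun y => H (w, y) - G (w, y)).
  have mm : measurable_fun [set: measurableTypeR R] (fun y => H (w, y) - G (w, y)).
    by apply: (measurableT_comp (measurable_funB mH mG)); exact: measurable_pair1.
  split => //; apply: (@L1_bounded _ _ _ _ _ (4 * c ^+ 2)); first exact: measurable_funX.
  by move=> y; exact: sq.
have LG w : L1 nu (fun y => G (w, y)).
  by apply: (@L1_bounded _ _ _ _ _ (c)) => //; apply: (measurableT_comp mG); exact: measurable_pair1.
apply: Ex_le.
- apply: (@L1_bounded _ _ _ _ _ (4 * c ^+ 2)); last first.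
    by move=> w; apply: sq; [exact: bF1|apply: (bK1 i ik); rewrite sd].
  apply: measurable_funX; apply: measurable_funB; first by apply: TGT; exact: mWk.
  apply: TGT; exact: (@measurable_Ex_bounded _ _ _ TG _ nu G c).
- exact: LHG.
- move=> w; rewrite /F1 /K1 /lavg -ExB; last exact: (LG w).
    exact: (Ex_sqr_le (LHGn w)).
  exact: (LH w).
Qed.

End efron_stein.

(** * Sums over neighbouring order statistics under deletion of a point *)

Section consecutive_sums.
Context (R : realType).
Implicit Types (h : R -> R -> R) (s l : seq R).

Fixpoint csum h s : R :=
  if s is x :: s' then (if s' is y :: _ then h x y else 0) + csum h s' else 0.

Fixpoint csum2 h s : R :=
  if s is x :: s' then (if s' is _ :: y :: _ then h x y else 0) + csum2 h s' else 0.

Lemma csumE h s : csum h s = \sum_(i < (size s).-1) h (nth 0 s i) (nth 0 s i.+1).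
Proof.
elim: s => [|x [|y s] IH] /=; first by rewrite big_ord0.
  by rewrite big_ord0 addr0.
by rewrite /= in IH; rewrite IH big_ord_recl.
Qed.

Lemma csum2E h s : csum2 h s = \sum_(i < (size s).-2) h (nth 0 s i) (nth 0 s i.+2).
Proof.
elim: s => [|x [|y [|z s]] IH] /=; rewrite ?big_ord0 ?addr0//.
by rewrite /= in IH; rewrite IH big_ord_recl.
Qed.

(** Deleting an inner point replaces two neighbouring terms by one that skips it, and the square of
    the change is at most 3 times the three squares. Each neighbouring pair is met at most twice,
    which gives 6, and each skipping pair once, which gives 3. *)
Lemma csum_del h s :
  \sum_(0 <= j < size s) (csum h s - csum h (del j s)) ^+ 2 <=
  6 * csum (fun x y => h x y ^+ 2) s + 3 * csum2 (fun x y => h x y ^+ 2) s.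
Proof.
set h2 := fun x y => h x y ^+ 2.
(* The slack at the first pair is what the induction consumes: a point prepended to the list turns
   the former end point into an inner one. *)
suff : (1 < size s)%N -> \sum_(0 <= j < size s) (csum h s - csum h (del j s)) ^+ 2 <=
  6 * csum h2 s + 3 * csum2 h2 s - 2 * h (nth 0 s 0) (nth 0 s 1) ^+ 2.
  case: s => [|x [|y s]].
  - by rewrite big_geq//= !mulr0 addr0.
  - by rewrite big_nat1 /= !addr0 subrr expr0n !mulr0 addr0.
  - by move=> /(_ isT) h1; apply: le_trans h1 _; rewrite gerBl mulr_ge0// sqr_ge0.
have dE (t : seq R) x j : del j.+1 (x :: t) = x :: del j t by [].
have d0 (t : seq R) x : del 0 (x :: t) = t by rewrite /del /= drop0.
have cE g x y t : csum g [:: x, y & t] = g x y + csum g (y :: t) by [].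
elim: s => [//|x [//|y [|z s]] IH] _.
  rewrite big_nat_recl// big_nat1 d0 dE d0 /h2 /=; have := sqr_ge0 (h x y).
  by rewrite !addr0 !subr0 !mulr0; lra.
have {IH} := IH isT.
rewrite [X in X <= _ -> _]big_nat_recl// [X in _ -> X <= _]big_nat_recl//.
rewrite [X in _ -> _ + X <= _]big_nat_recl//.
rewrite !d0 dE d0 !cE; set S1 := \sum_(0 <= i < _) _; set S2 := \sum_(0 <= i < _) _.
have -> : S2 = S1.
  rewrite /S1 /S2; apply: eq_bigr => j _; congr (_ ^+ 2).
  rewrite !dE !cE; ring.
have -> : csum2 h2 [:: x, y, z & s] = h2 x z + csum2 h2 [:: y, z & s] by [].
change (nth 0 [:: x, y, z & s] 0) with x; change (nth 0 [:: x, y, z & s] 1) with y.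
change (nth 0 [:: y, z & s] 0) with y; change (nth 0 [:: y, z & s] 1) with z.
rewrite /h2.
have q : (h x y + h y z - h x z) ^+ 2 <= 3 * (h x y ^+ 2 + h y z ^+ 2 + h x z ^+ 2).
  have q0 := sqr_ge0 (h x y - h y z); have q1 := sqr_ge0 (h x y + h x z); have q2 := sqr_ge0 (h y z + h x z).
  by move: q0 q1 q2; rewrite !expr2; lra.
set A := csum h (z :: s); set B := csum _ (z :: s); set D := csum2 _ _.
have e1 : h x y + (h y z + A) - (h y z + A) = h x y by ring.
have e2 : h y z + A - A = h y z by ring.
have e3 : h x y + (h y z + A) - (h x z + A) = h x y + h y z - h x z by ring.
rewrite e1 e2 e3; clearbody S1 B D; move=> IH; lra.
Qed.

Definition gsum h l : R := csum h (sort <=%R l).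

Lemma gsumE h l : gsum h l = \sum_(i < (size l).-1)
  h (nth 0 (sort <=%R l) i) (nth 0 (sort <=%R l) i.+1).
Proof. by rewrite /gsum csumE size_sort. Qed.

Lemma perm_del i l : (i < size l)%N -> perm_eq (del i l) (rem (nth 0 l i) l).
Proof.
move=> il; rewrite -(perm_cons (nth 0 l i)) perm_sym.
rewrite (perm_trans (_ : perm_eq _ l))//; first by rewrite perm_sym perm_to_rem// mem_nth.
rewrite -{1}(cat_take_drop i l) (drop_nth 0 il) /del.
by rewrite -(cat1s _ (drop _ _)) perm_catCA.
Qed.

(** A symmetric function sees only which value is removed, so the deletions may be made in the
    sorted list, where the neighbours are known. *)
Lemma sum_del (G : seq R -> R) l : (forall l1 l2, perm_eq l1 l2 -> G l1 = G l2) ->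
  \sum_(0 <= i < size l) G (del i l) = \sum_(0 <= j < size l) G (del j (sort <=%R l)).
Proof.
move=> Gp.
have h s : \sum_(0 <= i < size s) G (del i s) = \sum_(x <- s) G (rem x s).
  by rewrite [RHS](big_nth 0); apply: eq_big_nat => i /= il; apply: Gp; exact: perm_del.
rewrite h -[in RHS](size_sort <=%R l) h (perm_big (sort <=%R l))/=; last by rewrite perm_sym perm_sort.
apply: eq_big_seq => x; rewrite mem_sort => xl; apply: Gp.
rewrite -(perm_cons x) -(permPl (perm_to_rem xl)).
apply: (@perm_trans _ (sort <=%R l)); first by rewrite perm_sym perm_sort.
by apply: perm_to_rem; rewrite mem_sort.
Qed.

Lemma gsum_del h l :
  \sum_(0 <= i < size l) (gsum h l - gsum h (del i l)) ^+ 2 <=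
  6 * csum (fun x y => h x y ^+ 2) (sort <=%R l) + 3 * csum2 (fun x y => h x y ^+ 2) (sort <=%R l).
Proof.
rewrite (sum_del (G := fun l' => (gsum h l - gsum h l') ^+ 2)); last first.
  move=> l1 l2 l12; congr ((_ - csum h _) ^+ 2); apply/perm_sort_leP => //.
rewrite -{1}(size_sort <=%R l); apply: le_trans (csum_del h _).
rewrite le_eqVlt; apply/orP; left; apply/eqP; apply: eq_big_nat => j /= jl.
congr ((_ - csum h _) ^+ 2); apply: sort_le_id.
apply: (@subseq_sorted _ _ le_trans _ (sort <=%R l)); last exact: sort_le_sorted.
rewrite /del -{3}(cat_take_drop j (sort <=%R l)) cat_subseq//.
by rewrite [X in subseq _ X](drop_nth 0)// subseq_cons.
Qed.

Lemma lmeas_gsum h k :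
  measurable_fun [set: measurableTypeR R * measurableTypeR R]
    (fun x : measurableTypeR R * measurableTypeR R => h x.1 x.2) ->
  lmeas k (gsum h).
Proof.
move=> mh d U u mu; rewrite [X in measurable_fun _ X](_ : _ = (fun x => \sum_(i < k.-1)
   h (nth 0 (sort <=%R (mkseq (u^~ x) k)) i) (nth 0 (sort <=%R (mkseq (u^~ x) k)) i.+1))); last first.
  by apply/funext => x; rewrite gsumE size_mkseq.
apply: measurable_sum => i.
have m j : measurable_fun [set: U] (fun x => nth 0 (sort <=%R (mkseq (u^~ x) k)) j).
  exact: (@measurable_sort_nth R _ _ _ (iota 0 k) u j mu).
exact: (measurableT_comp mh (measurable_fun_pair (m i) (m i.+1))).
Qed.

Lemma lbound_gsum h k (c : R) : (forall x y, `|h x y| <= c) -> lbound k (gsum h) (k.-1%:R * c).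
Proof.
move=> hc l lk; rewrite gsumE lk; apply: le_trans (ler_norm_sum _ _ _) _.
apply: (@le_trans _ _ (\sum_(i < k.-1) c)); first by apply: ler_sum.
by rewrite sumr_const card_ord mulr_natl.
Qed.

End consecutive_sums.

Section spacing_variance.
Context d (T : measurableType d) (R : realType) (P : probability T R).
Variable nu : probability (measurableTypeR R) R.

(** The Efron-Stein inequality, where the comparison function is the same statistic of the sample
    without the i-th point. *)
Lemma variance_gsum n (Z : nat -> T -> R) (h : R -> R -> R) (c : R) :
  iid_upto P nu n Z ->
  measurable_fun [set: measurableTypeR R * measurableTypeR R]
    (fun x : measurableTypeR R * measurableTypeR R => h x.1 x.2) ->
  (forall x y, `|h x y| <= c) ->
  forall S : T -> R,
  (forall w, S w = \sum_(i < n.-1) h (order_stat Z n i w) (order_stat Z n i.+1 w)) ->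
  Ex P (fun w => (S w - Ex P S) ^+ 2) <=
  6 * (\sum_(i < n.-1) Ex P (fun w => h (order_stat Z n i w) (order_stat Z n i.+1 w) ^+ 2)) +
  3 * (\sum_(i < n.-2) Ex P (fun w => h (order_stat Z n i w) (order_stat Z n i.+2 w) ^+ 2)).
Proof.
move=> iZ mh hc S eS.
have c0 : 0 <= c by apply: le_trans (hc 0 0).
pose W w : seq R := mkseq (fun i => Z i w) n.
have SE : S = (fun w => gsum h (W w)).
  by apply/funext => w; rewrite eS gsumE size_mkseq.
have bk k : (k <= n)%N -> lbound k (gsum h) (n%:R * c).
  move=> kn l lk; apply: le_trans (lbound_gsum hc lk) _.
  by rewrite ler_wpM2r// ler_nat (leq_trans (leq_pred _)).
rewrite SE.
have := @efron_stein _ _ _ P nu n Z (n%:R * c) n (gsum h) (fun=> gsum h) iZ (leqnn n)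
  (lmeas_gsum n mh) (bk n (leqnn n)) (fun i _ => lmeas_gsum _ mh) (fun i _ => bk _ (leq_pred n)).
move/le_trans; apply.
have mos i : (i < n)%N -> measurable_fun [set: T] (order_stat Z n i).
  move=> i_n.
  pose Z' i := if (i < n)%N then Z i else fun=> 0.
  have mZ' j : measurable_fun [set: T] (Z' j) by rewrite /Z'; case: ifP => // jn; exact: iZ.1.
  have := @measurable_sort_nth R _ _ _ (iota 0 n) Z' i mZ'.
  congr (measurable_fun _ _); apply/funext => w; congr (nth 0 (sort _ _) i).
  by apply/eq_in_map => j; rewrite mem_iota add0n/= /Z' => ->.
have Lh i j : (i < n)%N -> (j < n)%N -> L1 P (fun w => h (order_stat Z n i w) (order_stat Z n j w) ^+ 2).
  move=> i_n jn; apply: (@L1_bounded _ _ _ _ _ (c ^+ 2)).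
    apply: measurable_funX.
    exact: (measurableT_comp mh (measurable_fun_pair (mos _ i_n) (mos _ jn))).
  by move=> w; rewrite normrX lerXn2r ?nnegrE.
have Ld (i : 'I_n) : L1 P (fun w => (gsum h (W w) - gsum h (del i (W w))) ^+ 2).
  pose Z' j := if (j < n)%N then Z j else fun=> 0.
  have mZ' j : measurable_fun [set: T] (Z' j) by rewrite /Z'; case: ifP => // jn; exact: iZ.1.
  apply: (@L1_bounded _ _ _ _ _ (4 * (n%:R * c) ^+ 2)).
    apply: measurable_funX; apply: measurable_funB.
      have := lmeas_gsum n mh mZ'; congr (measurable_fun _ _); apply/funext => w; congr (gsum h _).
      by apply/eq_in_map => j; rewrite mem_iota add0n/= /Z' => ->.
    pose Z2 j := if (j < i)%N then Z' j else Z' j.+1.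
    have mZ2 j : measurable_fun [set: T] (Z2 j) by rewrite /Z2; case: ifP.
    have := lmeas_gsum n.-1 mh mZ2; congr (measurable_fun _ _); apply/funext => w; congr (gsum h _).
    apply: (@eq_from_nth _ 0); first by rewrite size_mkseq size_del size_mkseq.
    move=> j; rewrite size_mkseq => jk; rewrite nth_mkseq// /del nth_cat size_take size_mkseq ltn_ord.
    have nn : n = n.-1.+1 by rewrite prednK// (leq_ltn_trans _ (ltn_ord i)).
    rewrite /Z2 /Z'; have [ji|ij] := ltnP j i.
      by rewrite nth_take// (ltn_trans ji (ltn_ord i)) nth_mkseq// (ltn_trans ji (ltn_ord i)).
    have jn : (j.+1 < n)%N by rewrite nn ltnS.
    by rewrite nth_drop addSn subnKC// jn nth_mkseq.
  have bd a b : `|a| <= n%:R * c -> `|b| <= n%:R * c -> `|(a - b) ^+ 2| <= 4 * (n%:R * c) ^+ 2.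
    move=> ac bc; have ab : `|a - b| <= 2 * (n%:R * c) by apply: le_trans (ler_normB _ _) _; lra.
    rewrite normrX (le_trans (lerXn2r 2 _ _ ab)) ?nnegrE ?mulr_ge0//.
    by rewrite [leLHS]exprMn; lra.
  move=> w; apply: bd; first by apply: (bk n); rewrite ?size_mkseq.
  by apply: (bk n.-1); rewrite ?leq_pred// size_del size_mkseq.
rewrite -Ex_sum//.
have L1a (i : 'I_n.-1) : L1 P (fun w => h (order_stat Z n i w) (order_stat Z n i.+1 w) ^+ 2).
  have := ltn_ord i; case: (n) i Lh => [[]|m i Lh]//= im; apply: Lh => //; exact: ltnW.
have L1b (i : 'I_n.-2) : L1 P (fun w => h (order_stat Z n i w) (order_stat Z n i.+2 w) ^+ 2).
  have := ltn_ord i; case: (n) i Lh => [[]|[[]|m i Lh]]//= im; apply: Lh => //; exact/ltnW/ltnW.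
rewrite -Ex_sum// -Ex_sum// -[X in _ <= X + _]ExZ; last exact: L1_sum.
rewrite -[X in _ <= _ + X]ExZ; last exact: L1_sum.
rewrite -ExD; [|by apply: L1Z; exact: L1_sum|by apply: L1Z; exact: L1_sum].
apply: Ex_le.
- exact: L1_sum.
- by apply: L1D; apply: L1Z; exact: L1_sum.
- move=> w; have := gsum_del h (W w).
  by rewrite big_mkord csumE csum2E size_sort size_mkseq.
Qed.

End spacing_variance.

(** * Heat kernel and the Lindeberg method *)

Section mean_value_bounds.
Context (R : realType).

Definition derivative (f : R -> R) (x df : R) : Prop := is_derive x 1 f df.

Lemma derivative_eq f x a b : derivative f x a -> a = b -> derivative f x b.
Proof. by move=> h <-. Qed.

Lemma derivative_cst c x : derivative (fun=> c) x 0.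
Proof. exact: is_derive_cst. Qed.

Lemma derivative_id x : derivative (fun y => y) x 1.
Proof. exact: is_derive_id. Qed.

Lemma derivativeN f x a : derivative f x a -> derivative (fun y => - f y) x (- a).
Proof. exact: is_deriveN. Qed.

Lemma derivativeB f g x a b : derivative f x a -> derivative g x b ->
  derivative (fun y => f y - g y) x (a - b).
Proof. exact: is_deriveB. Qed.

Lemma derivativeM f g x a b : derivative f x a -> derivative g x b ->
  derivative (fun y => f y * g y) x (f x * b + g x * a).
Proof. exact: is_deriveM. Qed.

Lemma derivative_comp f g x a b : derivative g x b -> derivative f (g x) a ->
  derivative (fun y => f (g y)) x (a * b).
Proof. by move=> dg df; exact: is_derive1_comp df dg. Qed.

Lemma derivative_expR x : derivative expR x (expR x).
Proof. exact: is_derive_expR. Qed.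

Lemma mvt_bound (g dg : R -> R) (a b K : R) : a <= b ->
  (forall x : R, a <= x <= b -> is_derive x 1 g (dg x)) ->
  (forall x, a <= x <= b -> `|dg x| <= K) -> `|g b - g a| <= K * (b - a).
Proof.
move=> ab hd hK.
have [|//|c] := @MVT_segment R g dg a b ab.
- by move=> x; rewrite in_itv/= => /andP[ax xb]; apply: hd; rewrite (ltW ax) (ltW xb).
- apply: derivable_within_continuous => x; rewrite in_itv/= => xab.
  by have [] := hd x xab.
- rewrite in_itv/= => cab ->; rewrite normrM (ger0_norm (_ : 0 <= b - a)) ?subr_ge0//.
  by rewrite ler_wpM2r ?subr_ge0// hK.
Qed.

Lemma mvt_bound_abs (g dg : R -> R) (x h K : R) :
  (forall y : R, is_derive y 1 g (dg y)) ->
  (forall y, `|y - x| <= `|h| -> `|dg y| <= K) -> `|g (x + h) - g x| <= K * `|h|.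
Proof.
move=> hd hK; have [h0|h0] := leP 0 h.
  rewrite [X in _ * X]ger0_norm// (_ : K * h = K * (x + h - x)); last by ring.
  apply: (mvt_bound (dg := dg)); rewrite ?lerDl// => y /andP[xy yh]; apply: hK.
  by rewrite !ger0_norm// ?subr_ge0// lerBlDl.
rewrite distrC [X in _ * X]ltr0_norm//.
have -> : - h = x - (x + h) by ring.
apply: (mvt_bound (dg := dg)); first by rewrite gerDl ltW.
move=> y /andP[xy yh]; apply: hK.
rewrite (ltr0_norm h0) ler0_norm ?subr_le0//; lra.
Qed.

(** The mean value bound applied three times; hence the constant 1 instead of 1 / 6. *)
Lemma taylor3_bound (f f1 f2 f3 : R -> R) (M x h : R) :
  (forall y : R, is_derive y 1 f (f1 y)) -> (forall y : R, is_derive y 1 f1 (f2 y)) ->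
  (forall y : R, is_derive y 1 f2 (f3 y)) -> (forall y, `|f3 y| <= M) ->
  `|f (x + h) - f x - h * f1 x - h ^+ 2 / 2 * f2 x| <= M * `|h| ^+ 3.
Proof.
move=> d1 d2 d3 bM.
have b2 y : `|f2 y - f2 x| <= M * `|y - x|.
  have := @mvt_bound_abs f2 f3 x (y - x) M d3 (fun z _ => bM z).
  by rewrite (addrC x) subrK.
have M0 : 0 <= M by apply: le_trans (bM 0).
have b1 y : `|f1 y - f1 x - (y - x) * f2 x| <= M * `|y - x| * `|y - x|.
  pose g z := f1 z - z * f2 x.
  have dg z : derivative g z (f2 z - f2 x).
    apply: derivative_eq (derivativeB (d2 z) (derivativeM (derivative_id z) (derivative_cst _ z))) _.
    ring.
  have -> : f1 y - f1 x - (y - x) * f2 x = g (x + (y - x)) - g x.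
    by rewrite /g [X in f1 X - X * _]addrC subrK; ring.
  apply: (mvt_bound_abs dg) => z zy; apply: le_trans (b2 z) _.
  by rewrite ler_wpM2l.
pose g z := f z - z * f1 x - (z - x) * (z - x) / 2 * f2 x.
have dg z : derivative g z (f1 z - f1 x - (z - x) * f2 x).
  have dz := derivativeB (derivative_id z) (derivative_cst x z).
  have dq := derivativeM (derivativeM (derivativeM dz dz) (derivative_cst (2^-1) z)) (derivative_cst (f2 x) z).
  have := derivativeB (derivativeB (d1 z) (derivativeM (derivative_id z) (derivative_cst (f1 x) z))) dq.
  by move/derivative_eq; apply; field.
have -> : f (x + h) - f x - h * f1 x - h ^+ 2 / 2 * f2 x = g (x + h) - g x.
  by rewrite /g; field.
rewrite exprSr (_ : M * (`|h| ^+ 2 * `|h|) = (M * `|h| * `|h|) * `|h|); last by ring.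
apply: (mvt_bound_abs dg) => z zh; apply: le_trans (b1 z) _.
by rewrite -!mulrA ler_wpM2l// ler_pM.
Qed.

End mean_value_bounds.

Section gaussian_cdf.
Context (R : realType).
Local Notation mu := (@lebesgue_measure R).

Definition ncdf (x : R) : R := \int[mu]_(t in [set` `]-oo, x]]) normal_pdf 0 1 t.

Definition ngauss (x : R) : R := normal_peak 1 * expR (- (x * x / 2)).

Lemma ngaussE x : normal_pdf 0 1 x = ngauss x.
Proof.
rewrite normal_pdfE ?oner_neq0// /ngauss /normal_fun subr0 expr1n; congr (_ * expR _).
by rewrite mulNr expr2.
Qed.

Lemma derivative_normal_cdf (s x : R) : s != 0 ->
  derivative (fun y => \int[mu]_(t in [set` `]-oo, y]]) normal_pdf 0 s t) x (normal_pdf 0 s x).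
Proof.
move=> s0; have [] := @continuous_FTC1 R (normal_pdf 0 s) -oo%O x (x + 1).
- by rewrite ltrDl.
- by apply: (integrableS _ _ (@subsetT _ _)) => //; exact: integrable_normal_pdf.
- exact: ltNyr.
- exact: continuous_normal_pdf.
move=> h1; rewrite derive1E => h2; rewrite /derivative -[X in is_derive _ _ _ X]h2.
exact/derivableP.
Qed.

Lemma derivative_ncdf x : derivative ncdf x (ngauss x).
Proof. by rewrite -ngaussE; apply: derivative_normal_cdf; exact: oner_neq0. Qed.

Lemma derivative_ngauss x : derivative ngauss x (- x * ngauss x).
Proof.
have := derivativeM (derivative_cst (normal_peak (1 : R)) x)
  (derivative_comp (derivativeN (derivativeM (derivativeM (derivative_id x) (derivative_id x)) (derivative_cst (2^-1) x))) (derivative_expR _)).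
by move/derivative_eq; apply; rewrite /ngauss; field.
Qed.

Let c0 : R := normal_peak 1.

Let c0_ge0 : 0 <= c0. Proof. exact: normal_peak_ge0. Qed.

Lemma ngauss_ge0 x : 0 <= ngauss x.
Proof. by rewrite mulr_ge0 ?normal_peak_ge0 ?expR_ge0. Qed.

(** Every polynomial that multiplies the density below is dominated by 1 + x^4, and exp(x^2 / 2) >=
    (1 + x^2 / 4)^2 absorbs it. *)
Let ng_bound (x p : R) : `|p| <= 1 + x ^+ 4 -> `|p * ngauss x| <= 20 * c0.
Proof.
move=> hp; rewrite normrM (ger0_norm (ngauss_ge0 x)) /ngauss -/c0.
set y := x * x / 4.
have y0 : 0 <= y by rewrite divr_ge0// -expr2 sqr_ge0.
have e1 : 1 + y <= expR y by exact: expR_ge1Dx.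
have e2 : (1 + y) * (1 + y) <= expR (x * x / 2).
  have -> : x * x / 2 = y + y by rewrite /y; field.
  by rewrite expRD ler_pM//; lra.
have e3 : 1 + x ^+ 4 <= 20 * expR (x * x / 2).
  have -> : x ^+ 4 = 16 * (y * y) by rewrite /y; field.
  nra.
rewrite expRN mulrCA (mulrC 20) ler_wpM2l// ler_pdivrMr ?expR_gt0//.
exact: le_trans hp e3.
Qed.

Lemma ng1_bound x : `|ngauss x| <= 20 * normal_peak 1.
Proof.
rewrite -[ngauss x]mul1r; apply: ng_bound; rewrite normr1 lerDl.
by rewrite exprn_even_ge0.
Qed.

Lemma ng2_bound x : `|- x * ngauss x| <= 20 * normal_peak 1.
Proof.
apply: ng_bound; rewrite normrN ler_norml; apply/andP.
by have := sqr_ge0 (x ^+ 2); have := sqr_ge0 (x ^+ 2 - 1 / 2); have := sqr_ge0 (x - 1 / 2);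
  have := sqr_ge0 (x + 1 / 2); split; nra.
Qed.

Lemma ng3_bound x : `|(x * x - 1) * ngauss x| <= 20 * normal_peak 1.
Proof.
apply: ng_bound; rewrite ler_norml; apply/andP.
by have := sqr_ge0 (x ^+ 2 - 1 / 2); have := sqr_ge0 (x ^+ 2); split; nra.
Qed.

Lemma ng4_bound x : `|x * ((x * x - 1) * ngauss x)| <= 20 * normal_peak 1.
Proof.
rewrite mulrA; apply: ng_bound; rewrite ler_norml; apply/andP.
have := sqr_ge0 (x ^+ 2 - x / 2 - 1 / 2); have := sqr_ge0 (x ^+ 2 + x / 2 - 1 / 2).
by have := sqr_ge0 (x + 1 / 3); have := sqr_ge0 (x - 1 / 3); split; nra.
Qed.

Lemma ncdf_ge0 x : 0 <= ncdf x.
Proof. by apply: Rintegral_ge0 => t _; exact: normal_pdf_ge0. Qed.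

Lemma ncdfE x : (ncdf x)%:E = normal_prob 0 1 `]-oo, x]%classic.
Proof.
rewrite /ncdf /Rintegral fineK//; apply: integrable_fin_num => //.
by apply: (integrableS _ _ (@subsetT _ _)) => //; exact: integrable_normal_pdf.
Qed.

Lemma ncdf_le1 x : ncdf x <= 1.
Proof. by rewrite -lee_fin ncdfE; exact: probability_le1. Qed.

Lemma cdf_tails (nu : probability (measurableTypeR R) R) (e : R) : 0 < e ->
  exists M : R, (forall x, M <= x -> ((1 - e)%:E <= nu `]-oo, x]%classic)%E) /\
    (forall x, x <= - M -> (nu `]-oo, x]%classic <= e%:E)%E).
Proof.
move=> e0.
have mid : @measurable_fun _ _ (measurableTypeR R) R setT (fun x => x) by exact: measurable_id.
pose X : {mfun measurableTypeR R >-> R} := @mfun_Sub _ _ (measurableTypeR R) R _ (mem_set mid).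
have /fine_cvgP[_ /cvgrPdist_lt /(_ e e0) [M1 [_ h1]]] := @cvg_cdfy1 _ _ R nu X.
have /fine_cvgP[_ /cvgrPdist_lt /(_ e e0) [M2 [_ h2]]] := @cvg_cdfNy0 _ _ R nu X.
have fin x : (nu `]-oo, x]%classic = (fine (nu `]-oo, x]%classic))%:E)%E by rewrite fineK// fin_num_measure.
have cE x : fine (cdf (P := nu) X x) = fine (nu `]-oo, x]%classic) by [].
exists (Num.max (M1 + 1) (1 - M2)); split => x xM.
  rewrite fin lee_fin; have /= := h1 x; rewrite cE.
  have xM1 : M1 < x by apply: lt_le_trans xM; rewrite lt_max ltrDl ltr01.
  by move=> /(_ xM1)/ltW /ler_normlW; lra.
rewrite fin lee_fin; have /= := h2 x; rewrite cE.
have xM2 : x < M2.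
  apply: le_lt_trans xM _; rewrite ltrNl lt_max; apply/orP; right; lra.
by move=> /(_ xM2)/ltW; rewrite sub0r normrN => /ler_normlW.
Qed.

(** Both sides have the same derivative, so they differ by a constant, which is 0 because both
    vanish at minus infinity. No change of variables in the integral is made. *)
Lemma ncdf_scale (s x : R) : 0 < s -> normal_prob 0 s `]-oo, x]%classic = (ncdf (x / s))%:E.
Proof.
move=> s0; have sn : s != 0 by rewrite gt_eqF.
pose N y := \int[mu]_(t in [set` `]-oo, y]]) normal_pdf 0 s t.
have NE y : (N y)%:E = normal_prob 0 s `]-oo, y]%classic.
  rewrite /N /Rintegral fineK//; apply: integrable_fin_num => //.
  by apply: (integrableS _ _ (@subsetT _ _)) => //; exact: integrable_normal_pdf.
rewrite -NE; congr EFin.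
have pE y : normal_pdf 0 s y = ngauss (y / s) / s.
  rewrite normal_pdfE// /ngauss /normal_fun /normal_peak subr0 expr1n mul1r.
  rewrite -mulrnAr sqrtrM ?sqr_ge0// sqrtr_sqr gtr0_norm// invfM.
  rewrite (_ : - y ^+ 2 / (s ^+ 2 *+ 2) = - (y / s * (y / s) / 2)); last by field.
  ring.
pose D y := N y - ncdf (y / s).
have dD y : derivative D y 0.
  have h := derivativeB (derivative_normal_cdf y sn)
    (derivative_comp (derivativeM (derivative_id y) (derivative_cst (s^-1) y)) (derivative_ncdf (y / s))).
  by apply: derivative_eq h _; rewrite pE; ring.
have Dc y z : D y = D z := is_derive_0_is_cst y z dD.
suff : forall e, 0 < e -> `|D x| <= e.
  move=> h; apply/eqP; rewrite -subr_eq0 -normr_eq0 -/(D x).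
  rewrite eq_le normr_ge0 andbT; apply/ler_addgt0Pl => e e0; rewrite addr0; exact: h.
move=> e e0.
have [M1 [_ h1]] := cdf_tails (normal_prob 0 s) e0.
have [M2 [_ h2]] := cdf_tails (normal_prob 0 1) e0.
pose y := Num.min (- M1) (- (M2 * s)).
rewrite (Dc x y).
have n1 : 0 <= N y <= e.
  rewrite -!lee_fin NE h1 ?ge_min ?lexx//.
  by rewrite measure_ge0.
have n2 : 0 <= ncdf (y / s) <= e.
  rewrite ncdf_ge0 -lee_fin ncdfE h2//.
  by rewrite ler_pdivrMr// mulNr ge_min lexx orbT.
by rewrite /D ler_norml; lra.
Qed.

End gaussian_cdf.

Section heat_solution.
Context (R : realType) (w : R).
Local Notation c0 := (20 * normal_peak (1 : R)).

Let kap (t : R) : R := (Num.sqrt t)^-1.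

(** P(x + N(0, t) <= w), the solution of the heat equation started from the indicator of the ray up
    to [w]. For small t it is a smooth test function, and at 0 for larger t a Gaussian distribution
    function. *)
Definition heat (t x : R) : R := ncdf ((w - x) * (Num.sqrt t)^-1).

Definition heat1 (t x : R) : R := - (Num.sqrt t)^-1 * ngauss ((w - x) * (Num.sqrt t)^-1).

Definition heat2 (t x : R) : R :=
  (Num.sqrt t)^-1 ^+ 2 * (- ((w - x) * (Num.sqrt t)^-1) * ngauss ((w - x) * (Num.sqrt t)^-1)).

Let heat3 (t x : R) : R := - kap t ^+ 3 *
  ((((w - x) * kap t) * ((w - x) * kap t) - 1) * ngauss ((w - x) * kap t)).

Let darg t x : derivative (fun x => (w - x) * kap t) x (- kap t).
Proof.
have := derivativeM (derivativeB (derivative_cst w x) (derivative_id x)) (derivative_cst (kap t) x).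
by move/derivative_eq; apply; ring.
Qed.

Lemma heat_taylor_space (del t x h : R) : 0 < del -> del <= t ->
  `|heat t (x + h) - heat t x - h * heat1 t x - h ^+ 2 / 2 * heat2 t x|
  <= kap del ^+ 3 * c0 * `|h| ^+ 3.
Proof.
move=> d0 dt; have t0 : 0 < t by exact: lt_le_trans dt.
have k0 : 0 <= kap t by rewrite invr_ge0 sqrtr_ge0.
have kd : kap t <= kap del by rewrite lef_pV2 ?posrE ?sqrtr_gt0// ler_wsqrtr.
apply: (@taylor3_bound R (heat t) (heat1 t) (heat2 t) (heat3 t)) => y.
- have := derivative_comp (darg t y) (derivative_ncdf ((w - y) * kap t)).
  by move/derivative_eq; apply; rewrite /heat1 -/(kap t); ring.
- have := derivativeM (derivative_cst (- kap t) y) (derivative_comp (darg t y) (derivative_ngauss ((w - y) * kap t))).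
  by move/derivative_eq; apply; rewrite /heat2 -/(kap t); ring.
- have d2 (z : R) := derivativeM (derivativeN (derivative_id z)) (derivative_ngauss z).
  have := derivativeM (derivative_cst (kap t ^+ 2) y) (derivative_comp (darg t y) (d2 ((w - y) * kap t))).
  by move/derivative_eq; apply; rewrite /heat3; ring.
- rewrite [leLHS]normrM normrN; apply: ler_pM => //; last exact: ng3_bound.
  by rewrite ger0_norm ?exprn_ge0// lerXn2r ?nnegrE// invr_ge0 sqrtr_ge0.
Qed.

(** The heat equation: the time derivative is half of [heat2], so a time step v matches the second
    order term of a centered increment of variance v. Keeping t >= del bounds the derivatives. *)
Lemma heat_taylor_time (del t s x : R) : 0 < del -> del <= t -> 0 <= s ->
  `|heat (t + s) x - heat t x - s / 2 * heat2 t x| <= kap del ^+ 4 * c0 * s ^+ 2.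
Proof.
move=> d0 dt s0; have t0 : 0 < t by exact: lt_le_trans dt.
set y := w - x.
pose n2 (z : R) := - z * ngauss z.
pose n3 (z : R) := (z * z - 1) * ngauss z.
have dn2 z : derivative n2 z (n3 z).
  have := derivativeM (derivativeN (derivative_id z)) (derivative_ngauss z).
  by move/derivative_eq; apply; rewrite /n3; ring.
pose g1 z := kap z ^+ 2 / 2 * n2 (y * kap z).
pose g2 z := - (kap z ^+ 4 / 2) * (n2 (y * kap z) + (y * kap z) * n3 (y * kap z) / 2).
have dk z : 0 < z -> derivative kap z (- kap z ^+ 3 / 2).
  move=> z0; have sz : Num.sqrt z != 0 by rewrite gt_eqF// sqrtr_gt0.
  have := @is_deriveV R Num.sqrt z _ 1 sz (is_derive1_sqrt z0).
  move/derivative_eq; apply; rewrite /kap.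
  rewrite /GRing.scale/= !exprVn.
  by field; rewrite sz.
have dA z : 0 < z -> derivative (fun z => y * kap z) z (- (y * kap z ^+ 3) / 2).
  move=> z0; have := derivativeM (derivative_cst y z) (dk z z0).
  by move/derivative_eq; apply; ring.
have dh z : 0 < z -> derivative (heat^~ x) z (g1 z).
  move=> z0; have := derivative_comp (dA z z0) (derivative_ncdf (y * kap z)).
  by move/derivative_eq; apply; rewrite /g1 /n2; field.
have dg1 z : 0 < z -> derivative g1 z (g2 z).
  move=> z0.
  have q := derivativeM (derivativeM (dk z z0) (dk z z0)) (derivative_cst (2^-1) z).
  have := derivativeM q (derivative_comp (dA z z0) (dn2 (y * kap z))).
  move/derivative_eq => h.
  have {}h := h (g2 z).
  have e : g1 = (fun z => kap z * kap z / 2 * n2 (y * kap z)) by apply/funext => v; rewrite /g1 expr2.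
  by rewrite e; apply: h; rewrite /g2; field.
have kb z : t <= z -> 0 <= kap z <= kap del.
  move=> tz; rewrite invr_ge0 sqrtr_ge0/= lef_pV2 ?posrE ?sqrtr_gt0 ?(lt_le_trans t0 tz)//.
  by rewrite ler_wsqrtr// (le_trans dt).
have c00 : 0 <= c0 by rewrite mulr_ge0 ?normal_peak_ge0.
have g2b z : t <= z -> `|g2 z| <= kap del ^+ 4 * c0.
  move=> tz; have /andP[k0 kd] := kb z tz.
  rewrite normrM normrN [X in X * _]ger0_norm ?divr_ge0 ?exprn_ge0//.
  have k4 : kap z ^+ 4 <= kap del ^+ 4 by rewrite lerXn2r ?nnegrE// (le_trans k0).
  have k40 : 0 <= kap z ^+ 4 by rewrite exprn_ge0.
  have h : `|n2 (y * kap z) + y * kap z * n3 (y * kap z) / 2| <= 2 * c0.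
    apply: le_trans (ler_normD _ _) _.
    have h1 := ng2_bound (y * kap z); have h2 := ng4_bound (y * kap z).
    rewrite [X in _ + X]normrM (ger0_norm (_ : 0 <= 2^-1 :> R))//.
    by move: h1 h2; rewrite -/(n2 _) -/(n3 _); lra.
  rewrite (_ : kap del ^+ 4 * c0 = kap del ^+ 4 / 2 * (2 * c0)); last by field.
  by apply: ler_pM => //; [rewrite divr_ge0|lra].
have g1b z : t <= z -> z <= t + s -> `|g1 z - g1 t| <= kap del ^+ 4 * c0 * s.
  move=> tz zs; apply: (@le_trans _ _ (kap del ^+ 4 * c0 * (z - t))).
    apply: (@mvt_bound _ g1 g2) => // v /andP[tv vz].
      by apply: dg1; exact: lt_le_trans tv.
    exact: g2b.
  by rewrite ler_wpM2l ?mulr_ge0 ?exprn_ge0 ?invr_ge0 ?sqrtr_ge0//; lra.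
have e2 : s / 2 * heat2 t x = s * g1 t by rewrite /heat2 /g1 -/(kap t) -/y /n2; field.
rewrite e2.
pose G z := heat z x - z * g1 t.
have -> : heat (t + s) x - heat t x - s * g1 t = G (t + s) - G t by rewrite /G; ring.
rewrite (_ : _ * s ^+ 2 = (kap del ^+ 4 * c0 * s) * (t + s - t)); last by ring.
apply: (@mvt_bound _ G (fun z => g1 z - g1 t)); first by rewrite lerDl.
  move=> z /andP[tz _]; have z0 : 0 < z by exact: lt_le_trans tz.
  have := derivativeB (dh z z0) (derivativeM (derivative_id z) (derivative_cst (g1 t) z)).
  by move/derivative_eq; apply; ring.
by move=> z /andP[]; exact: g1b.
Qed.

Lemma heat_lipschitz (t x x' : R) : 0 < t -> `|heat t x - heat t x'| <= kap t * c0 * `|x - x'|.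
Proof.
move=> t0; have := @mvt_bound_abs R (heat t) (heat1 t) x' (x - x') (kap t * c0).
rewrite (addrC x') subrK; apply => y.
  have := derivative_comp (darg t y) (derivative_ncdf ((w - y) * kap t)).
  by move/derivative_eq; apply; rewrite /heat1 -/(kap t); ring.
move=> _; rewrite normrM normrN [X in X * _]ger0_norm ?invr_ge0 ?sqrtr_ge0// ler_wpM2l ?invr_ge0 ?sqrtr_ge0//.
exact: ng1_bound.
Qed.

Lemma measurable_heat t : measurable_fun [set: R] (heat t).
Proof.
apply: (measurableT_comp (f := ncdf (R := R))); last first.
  by apply: measurable_funM => //; exact: measurable_funB.
apply: continuous_measurable_fun => x.
exact/differentiable_continuous/derivable1_diffP/(@ex_derive _ _ _ _ _ _ _ (derivative_ncdf x)).
Qed.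

Lemma heat_bound t x : `|heat t x| <= 1.
Proof. by rewrite ger0_norm ?ncdf_ge0// ncdf_le1. Qed.

End heat_solution.

Section lindeberg.
Context d (T : measurableType d) (R : realType) (P : probability T R).
Variable nu : probability (measurableTypeR R) R.
Variables (w : R) (del : R).
Hypothesis del0 : 0 < del.
Let C1 : R := (Num.sqrt del)^-1 ^+ 3 * (20 * normal_peak 1).
Let C2 : R := (Num.sqrt del)^-1 ^+ 4 * (20 * normal_peak 1).

Let L1_heat d' (U : measurableType d') (Q : probability U R) t (f : U -> R) :
  measurable_fun [set: U] f -> L1 Q (fun u => heat w t (f u)).
Proof.
move=> mf; apply: (@L1_bounded _ _ _ _ _ 1).
  exact: (measurableT_comp (measurable_heat w t) mf).
by move=> u; exact: heat_bound.
Qed.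

(* One replacement step: the increment [x] is traded for the same amount of heat flow. *)
Lemma heat_step (x : measurableTypeR R -> R) (v rho t a : R) :
  L2 nu x -> Ex nu x = 0 -> Ex nu (fun y => x y ^+ 2) = v ->
  L1 nu (fun y => `|x y| ^+ 3) -> Ex nu (fun y => `|x y| ^+ 3) <= rho ->
  del <= t ->
  `|Ex nu (fun y => heat w t (a + x y)) - heat w (t + v) a| <= C1 * rho + C2 * v ^+ 2.
Proof.
move=> x2 x0 xv L3 hr dt.
have [mx L2x] := x2.
have Lx := L2_L1 x2.
have v0 : 0 <= v by rewrite -xv; apply: Ex_ge0 => y; exact: sqr_ge0.
have Lh : L1 nu (fun y => heat w t (a + x y)) by apply: L1_heat; exact: measurable_funD.
have C10 : 0 <= C1 by rewrite mulr_ge0 ?exprn_ge0 ?invr_ge0 ?sqrtr_ge0// mulr_ge0// normal_peak_ge0.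
pose q y := heat w t (a + x y) - (heat w t a + (heat1 w t a * x y + heat2 w t a / 2 * x y ^+ 2)).
have Lq1 : L1 nu (fun y => heat1 w t a * x y + heat2 w t a / 2 * x y ^+ 2).
  by apply: L1D; apply: L1Z.
have Lq2 : L1 nu (fun y => heat w t a + (heat1 w t a * x y + heat2 w t a / 2 * x y ^+ 2)).
  by apply: L1D => //; exact: L1_cst.
have Lq : L1 nu q by exact: L1B.
have Eq : Ex nu q = Ex nu (fun y => heat w t (a + x y)) - (heat w t a + v / 2 * heat2 w t a).
  rewrite ExB// ExD//; last exact: L1_cst.
  by rewrite Ex_cst ExD ?ExZ ?x0 ?xv//; [field|exact: L1Z|exact: L1Z].
have bq : `|Ex nu q| <= C1 * rho.
  apply: le_trans (Ex_norm Lq) _; apply: (@le_trans _ _ (Ex nu (fun y => C1 * `|x y| ^+ 3))).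
    apply: Ex_le; [exact: L1_norm|exact: L1Z|].
    move=> y; apply: le_trans (heat_taylor_space w a (x y) del0 dt).
    by rewrite le_eqVlt; apply/orP; left; apply/eqP; congr (`|_|); rewrite /q; field.
  by rewrite ExZ// ler_wpM2l.
have bt := heat_taylor_time w a del0 dt v0.
rewrite -/C2 in bt.
have -> : Ex nu (fun y => heat w t (a + x y)) - heat w (t + v) a =
  Ex nu q - (heat w (t + v) a - heat w t a - v / 2 * heat2 w t a) by rewrite Eq; ring.
by apply: le_trans (ler_normB _ _) _; exact: lerD.
Qed.

(** Increments are traded for time from the last one on; each exchange is [heat_step] with the
    preceding partial sum, a function of the past, as base point. *)
Lemma lindeberg n (E : nat -> T -> R) (x : nat -> measurableTypeR R -> R) (v rho : nat -> R) :
  iid_upto P nu n E ->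
  (forall k, (k < n)%N -> [/\ L2 nu (x k), Ex nu (x k) = 0, Ex nu (fun y => x k y ^+ 2) = v k,
     L1 nu (fun y => `|x k y| ^+ 3) & Ex nu (fun y => `|x k y| ^+ 3) <= rho k]) ->
  `|Ex P (fun u => heat w del (\sum_(k < n) x k (E k u))) - heat w (del + \sum_(k < n) v k) 0|
  <= \sum_(k < n) (C1 * rho k + C2 * v k ^+ 2).
Proof.
move=> iE hx.
pose W j u := \sum_(k < j) x k (E k u).
(* The time must vary in the induction, since it grows by the variance of each removed increment. *)
suff : forall j t, (j <= n)%N -> del <= t ->
    `|Ex P (fun u => heat w t (W j u)) - heat w (t + \sum_(k < j) v k) 0|
    <= \sum_(k < j) (C1 * rho k + C2 * v k ^+ 2).
  by apply.
have mW j : (j <= n)%N -> measurable_fun [set: g_sigma_algebraType (past E j)] (W j : g_sigma_algebraType (past E j) -> R).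
  move=> jn; apply: measurable_sum => k.
  have [[mx _] _ _ _ _] := hx k (leq_trans (ltn_ord k) jn).
  by apply: (measurableT_comp mx); exact: past_fun.
elim=> [|j IH] t jn dt.
  rewrite !big_ord0 addr0 (_ : (fun u => _) = fun=> heat w t 0).
    by rewrite Ex_cst subrr normr0.
  by apply/funext => u; rewrite /W big_ord0.
have [x2 x0 xv L3 hr] := hx j jn.
have [mx _] := x2.
have v0 : 0 <= v j by rewrite -xv; apply: Ex_ge0 => y; exact: sqr_ge0.
pose H (p : g_sigma_algebraType (past E j) * measurableTypeR R) := heat w t (W j p.1 + x j p.2).
have mH : measurable_fun [set: g_sigma_algebraType (past E j) * measurableTypeR R] H.
  apply: (measurableT_comp (measurable_heat w t)); apply: measurable_funD.
    exact: (measurableT_comp (mW j (ltnW jn)) measurable_fst).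
  exact: (measurableT_comp mx measurable_snd).
have := @Ex_past_bounded _ _ _ P nu n j E 1 H iE jn mH (fun _ => heat_bound _ _ _).
rewrite (_ : (fun u => H (u, E j u)) = (fun u => heat w t (W j.+1 u))); last first.
  by apply/funext => u; rewrite /H /W big_ord_recr.
move=> ->; rewrite !big_ord_recr/= (addrC (\sum_(k < j) v k)) addrA.
have st u := @heat_step (x j) (v j) (rho j) t (W j u) x2 x0 xv L3 hr dt.
have mTW : measurable_fun [set: T] (W j).
  exact: (past_measurable_fun (past_meas iE (ltnW jn)) (mW j (ltnW jn))).
have LW s : L1 P (fun u => heat w s (W j u)) by exact: L1_heat.
have LHi : L1 P (fun u => Ex nu (fun y => H (u, y))).
  apply: (@L1_bounded _ _ _ _ _ 1).
    apply: (past_measurable_fun (past_meas iE (ltnW jn))).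
    by apply: (@measurable_Ex_bounded R _ _ _ _ nu H 1 mH) => p; exact: heat_bound.
  move=> u; have LL : L1 nu (fun y => heat w t (W j u + x j y)).
    by apply: L1_heat; exact: measurable_funD.
  apply: le_trans (Ex_norm LL) _; rewrite -[leRHS](Ex_cst nu).
  by apply: Ex_le; [exact: L1_norm|exact: L1_cst|move=> y; exact: heat_bound].
have {}IH := IH (t + v j) (ltnW jn) (le_trans dt (_ : _ <= _)).
rewrite lerDl in IH; have {}IH := IH v0.
have st2 : `|Ex P (fun u => Ex nu (fun y => H (u, y))) - Ex P (fun u => heat w (t + v j) (W j u))|
   <= C1 * rho j + C2 * v j ^+ 2.
  rewrite -ExB//.
  apply: le_trans (Ex_norm _) _; first exact: L1B.
  rewrite -[leRHS](Ex_cst P); apply: Ex_le.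
  - by apply: L1_norm; exact: L1B.
  - exact: L1_cst.
  - by move=> u; exact: st.
set A := Ex P _ in st2 *; set B := Ex P _ in st2 IH.
have -> : A - heat w (t + v j + \sum_(k < j) v k) 0 = (A - B) + (B - heat w (t + v j + \sum_(k < j) v k) 0) by ring.
by apply: le_trans (ler_normD _ _) _; rewrite addrC lerD.
Qed.

End lindeberg.

Lemma Ex_sqr_sum d (T : measurableType d) (R : realType) (P : probability T R)
    (nu : probability (measurableTypeR R) R) n (E : nat -> T -> R)
    (x : nat -> measurableTypeR R -> R) (v : nat -> R) :
  iid_upto P nu n E ->
  (forall k, (k < n)%N -> [/\ L2 nu (x k), Ex nu (x k) = 0 & Ex nu (fun y => x k y ^+ 2) = v k]) ->
  [/\ L2 P (fun u => \sum_(k < n) x k (E k u)), Ex P (fun u => \sum_(k < n) x k (E k u)) = 0 &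
    Ex P (fun u => (\sum_(k < n) x k (E k u)) ^+ 2) = \sum_(k < n) v k].
Proof.
move=> iE hx.
pose W j u := \sum_(k < j) x k (E k u).
suff : forall j, (j <= n)%N -> [/\ L2 P (W j), Ex P (W j) = 0 & Ex P (fun u => W j u ^+ 2) = \sum_(k < j) v k].
  by apply.
have mW j : (j <= n)%N -> measurable_fun [set: g_sigma_algebraType (past E j)] (W j : g_sigma_algebraType (past E j) -> R).
  move=> jn; apply: measurable_sum => k.
  have [[mx _] _ _] := hx k (leq_trans (ltn_ord k) jn).
  by apply: (measurableT_comp mx); exact: past_fun.
elim=> [|j IH] jn.
  have -> : W 0%N = fun=> 0 by apply/funext => u; rewrite /W big_ord0.
  by rewrite big_ord0 !Ex_cst expr0n; split => //; exact: L2_cst.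
have [LW EW EW2] := IH (ltnW jn).
have [x2 x0 xv] := hx j jn; have [mx Lx2] := x2.
have mxs : measurable_fun [set: g_sigma_algebraType (past E j) * measurableTypeR R]
    (fun p : g_sigma_algebraType (past E j) * measurableTypeR R => x j p.2).
  exact: (measurableT_comp mx measurable_snd).
have [Lxe2 Exe2] := @Ex_past_prod _ _ _ P nu n E iE j jn (fun=> 1) (fun y => x j y ^+ 2)
  (measurable_cst _) (fun=> ler01) (fun y => sqr_ge0 (x j y)) (L1_cst P 1) Lx2.
have e1 : (fun u => 1 * x j (E j u) ^+ 2) = (fun u => x j (E j u) ^+ 2).
  by apply/funext => u; rewrite mul1r.
rewrite e1 in Lxe2 Exe2; rewrite Ex_cst mul1r xv in Exe2.
have mxe : measurable_fun [set: T] (fun u => x j (E j u)).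
  by apply: (measurableT_comp mx); exact: iE.1.
have L2xe : L2 P (fun u => x j (E j u)) by split.
have Exe : Ex P (fun u => x j (E j u)) = 0.
  apply: (@Ex_past0 _ _ _ P nu n j E iE jn (fun p => x j p.2)) => //.
  - by move=> u; exact: L2_L1.
  - exact: L2_L1.
have LWx := L2M LW L2xe.
have EWx : Ex P (fun u => W j u * x j (E j u)) = 0.
  apply: (@Ex_past0 _ _ _ P nu n j E iE jn (fun p => W j p.1 * x j p.2)) => //.
  - apply: measurable_funM => //.
    exact: (measurableT_comp (mW j (ltnW jn)) measurable_fst).
  - by move=> u; exact: (L1Z (W j u) (L2_L1 x2)).
  - by move=> u; rewrite (ExZ (W j u) (L2_L1 x2)) x0 mulr0.
have WS : W j.+1 = (fun u => W j u + x j (E j u)).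
  by apply/funext => u; rewrite /W big_ord_recr.
rewrite WS; split.
- exact: L2D.
- by rewrite ExD ?EW ?Exe ?addr0//; exact: L2_L1.
rewrite big_ord_recr/= -EW2.
have -> : (fun u => (W j u + x j (E j u)) ^+ 2) =
    (fun u => W j u ^+ 2 + (2 * (W j u * x j (E j u)) + x j (E j u) ^+ 2)).
  by apply/funext => u; ring.
have [_ LW2] := LW.
rewrite ExD//; last by apply: L1D => //; exact: L1Z.
by rewrite ExD ?ExZ ?EWx ?mulr0 ?add0r ?Exe2//; exact: L1Z.
Qed.

(** * Variance and limit law of the linear part *)

Section linear_part.
Context (R : realType).
Local Notation expo := (expo R).
Variables (r : R) (r0 : 0 < r).
Let t : R := t_coef r.
Variables (phi : measurableTypeR R -> R) (C L : R).
Hypothesis mphi : measurable_fun [set: measurableTypeR R] phi.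
Hypothesis phiC : forall z, `|phi z| <= C.
Hypothesis phiL : forall x y : R, 0 <= x -> 0 <= y -> `|phi x - phi y| <= L * `|x - y|.

Let C0 : 0 <= C. Proof. exact: le_trans (normr_ge0 _) (phiC 0). Qed.

Let L0 : 0 <= L.
Proof.
have := phiL ler01 (lexx 0); rewrite subr0 normr1 mulr1.
by apply: le_trans; exact: normr_ge0.
Qed.

Let harm_ge0 n : 0 <= harm R n.
Proof. by apply: sumr_ge0 => i _; rewrite invr_ge0. Qed.

(** The points [ell] cut the exponential law into pieces of mass 1 / n, so the sum is a Riemann sum
    for n [tail_int]; neighbouring points k and k + 1 differ by at most 1 / (n - k - 1), which sums
    to a harmonic number. *)
Lemma riemann_tail (psi : measurableTypeR R -> R) (C' L' : R) n : (0 < n)%N ->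
  measurable_fun [set: measurableTypeR R] psi -> (forall z, `|psi z| <= C') ->
  (forall x y : R, 0 <= x -> 0 <= y -> `|psi x - psi y| <= L' * `|x - y|) ->
  `|\sum_(k < n) psi (ell R n k) - n%:R * tail_int psi 0| <= L' * harm R n + 2 * C'.
Proof.
move=> n0 mpsi psiC psiL.
have L'0 : 0 <= L'.
  have := psiL _ _ ler01 (lexx 0); rewrite subr0 normr1 mulr1.
  by apply: le_trans; exact: normr_ge0.
have nR : 0 < n%:R :> R by rewrite ltr0n.
have ellE k : (k < n)%N -> expR (- ell R n k) = (n - k)%:R / n%:R.
  move=> kn; rewrite expRN lnK ?invf_div// posrE divr_gt0// ltr0n subn_gt0//.
have ell0 k : (k < n)%N -> 0 <= ell R n k.
  move=> kn; rewrite ln_ge0// ler_pdivlMr ?ltr0n ?subn_gt0// mul1r ler_nat leq_subr.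
  by [].
case: n n0 nR ellE ell0 => // n _ nR ellE ell0.
(* The last point is treated apart: its right neighbour would be infinite, and [ell] has there a
   junk value from division by 0. *)
rewrite big_ord_recr/=.
have st k : (k < n)%N -> `|psi (ell R n.+1 k) - n.+1%:R * (tail_int psi (ell R n.+1 k) - tail_int psi (ell R n.+1 k.+1))|
    <= L' * (n - k)%:R^-1.
  move=> kn; have kn1 : (k < n.+1)%N by exact: ltnW.
  have m0 : 0 < (n - k)%:R :> R by rewrite ltr0n subn_gt0.
  have dl : 0 <= ell R n.+1 k.+1 - ell R n.+1 k <= (n - k)%:R^-1.
    rewrite -ln_div ?posrE ?divr_gt0 ?ltr0n ?subn_gt0//.
    have -> : (n.+1%:R / (n.+1 - k.+1)%:R) / (n.+1%:R / (n.+1 - k)%:R) = 1 + (n - k)%:R^-1 :> R.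
      rewrite subSS subSn; last exact: ltnW.
      by rewrite -(natr1 (n - k)); field; rewrite !gt_eqF// ?addr_gt0// ltr0n.
    rewrite ln_ge0/=; last by rewrite lerDl invr_ge0 ltW.
    apply: le_trans (ln_le_subr1 _) _; first by rewrite addr_gt0// invr_gt0.
    by rewrite addrAC subrr add0r.
  have /andP[dl0 dl1] := dl.
  have := tail_int_diff mpsi psiC psiL (ell0 k kn1) (_ : _ <= ell R n.+1 k.+1).
  rewrite -subr_ge0 => /(_ dl0); rewrite !ellE//.
  have -> : (n.+1 - k)%:R / n.+1%:R - (n.+1 - k.+1)%:R / n.+1%:R = n.+1%:R^-1 :> R.
    rewrite subSS subSn; last exact: ltnW.
    by rewrite -(natr1 (n - k)) mulrDl mul1r addrAC subrr add0r.
  set a := tail_int _ _; set b := tail_int _ _; set p := psi _ => h.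
  have -> : p - n.+1%:R * (a - b) = - (n.+1%:R * (a - b - p / n.+1%:R)) by field; rewrite gt_eqF.
  rewrite normrN normrM ger0_norm//.
  apply: le_trans (ler_wpM2l (ltW nR) h) _.
  rewrite mulrC divfK ?gt_eqF// ler_wpM2l//.
have hs : \sum_(k < n) (n - k)%:R^-1 <= harm R n.+1.
  rewrite -/(harm R n) !harmE [leRHS]big_ord_recr/= lerDl invr_ge0//.
have := ler_norm_sum (index_enum 'I_n) (fun k : 'I_n => psi (ell R n.+1 k) -
  n.+1%:R * (tail_int psi (ell R n.+1 k) - tail_int psi (ell R n.+1 k.+1))) predT.
have e : \sum_(k < n) (psi (ell R n.+1 k) - n.+1%:R * (tail_int psi (ell R n.+1 k) - tail_int psi (ell R n.+1 k.+1)))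
  = \sum_(k < n) psi (ell R n.+1 k) - n.+1%:R * (tail_int psi 0 - tail_int psi (ell R n.+1 n)).
  rewrite sumrB -mulr_sumr; congr (_ - _ * _).
  rewrite -(big_mkord predT (fun k => tail_int psi (ell R n.+1 k) - tail_int psi (ell R n.+1 k.+1))).
  under eq_bigr do rewrite -opprB.
  rewrite sumrN telescope_sumr// opprB; congr (tail_int psi _ - _).
  by rewrite /ell subn0 divff ?gt_eqF// ln1.
rewrite e => h1.
have h2 : `|tail_int psi (ell R n.+1 n)| <= C' / n.+1%:R.
  apply: le_trans (tail_int_le mpsi psiC (ell0 n (ltnSn n))) _.
  by rewrite ellE// subSnn mul1r.
have h3 : \sum_(k < n) `|psi (ell R n.+1 k) - n.+1%:R * (tail_int psi (ell R n.+1 k) - tail_int psi (ell R n.+1 k.+1))|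
   <= L' * harm R n.+1.
  apply: (@le_trans _ _ (\sum_(k < n) L' * (n - k)%:R^-1)).
    by apply: ler_sum => k _; exact: st.
  by rewrite -mulr_sumr ler_wpM2l.
have {}h1 := le_trans h1 h3.
set S := \sum_(k < n) psi _ in h1 *; set p := psi _; set a := tail_int psi (ell R n.+1 n) in h1 h2.
have -> : S + p - n.+1%:R * tail_int psi 0 = (S - n.+1%:R * (tail_int psi 0 - a)) + (p - n.+1%:R * a) by ring.
apply: le_trans (ler_normD _ _) _; apply: lerD => //.
apply: le_trans (ler_normB _ _) _; rewrite (_ : 2 * C' = C' + C'); last by ring.
apply: lerD; first exact: psiC.
by rewrite normrM ger0_norm// mulrC -ler_pdivlMr.
Qed.

Local Notation xi := (lin r phi).
Local Notation pbar := (phibar phi).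

Lemma phibar_le n k : (k < n)%N -> `|pbar n k| <= C.
Proof.
move=> kn; have m0 : 0 < (n - k)%:R :> R by rewrite ltr0n subn_gt0.
rewrite normrM normfV (gtr0_norm m0) ler_pdivrMr//.
apply: le_trans (ler_norm_sum _ _ _) _.
apply: (@le_trans _ _ (\sum_(k.+1 <= i < n) C)); first by apply: ler_sum => i _; exact: phiC.
rewrite sumr_const_nat -[leLHS]mulr_natr ler_wpM2l// ler_nat.
by rewrite leq_sub2l.
Qed.

(** The variance of [lin]: the moments of [bpow] and y - 1 are [w_coef] and 1, and their covariance
    is - [t_coef], whence the sign of the mixed term. *)
Definition linvar n k : R := w_coef r * phi (ell R n k) ^+ 2
  - t ^+ 2 * (2 * phi (ell R n k) * pbar n k - pbar n k ^+ 2).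

Lemma lin_moments n k : [/\ L2 expo (xi n k), Ex expo (xi n k) = 0 &
  Ex expo (fun y => xi n k y ^+ 2) = linvar n k].
Proof.
have Lb := L2_bpow r0; have Lc := L2_centered R.
have Lx : L2 expo (xi n k) by apply: L2D; apply: L2Z.
split => //.
  rewrite ExD ?ExZ ?Ex_bpow ?Ex_centered ?mulr0 ?addr0//; try exact: L2_L1.
  - by apply: L1Z; exact: L2_L1.
  - by apply: L1Z; exact: L2_L1.
have -> : (fun y => xi n k y ^+ 2) = (fun y : measurableTypeR R => phi (ell R n k) ^+ 2 * bpow r y ^+ 2
   + ((2 * phi (ell R n k) * t * pbar n k) * (bpow r y * (y - 1)) + (t * pbar n k) ^+ 2 * (y - 1) ^+ 2)).
  by apply/funext => y; rewrite /lin -/t; ring.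
have [_ Lb2] := Lb; have [_ Lc2] := Lc; have Lbc := L2M Lb Lc.
rewrite ExD; [|exact: L1Z|by apply: L1D; exact: L1Z].
rewrite ExD; [|exact: L1Z|exact: L1Z].
rewrite !ExZ// Ex_bpow_sqr// Ex_bpow_centered// Ex_centered_sqr /linvar -/t; ring.
Qed.

Lemma linvar_le : exists2 K : R, 0 <= K & forall n k, (k < n)%N -> 0 <= linvar n k <= K.
Proof.
exists (`|w_coef r| * C ^+ 2 + t ^+ 2 * (3 * C ^+ 2)).
  by rewrite addr_ge0// mulr_ge0 ?sqr_ge0// mulr_ge0 ?sqr_ge0.
move=> n k kn; have [_ _ e] := lin_moments n k; apply/andP; split.
  by rewrite -e; apply: Ex_ge0 => y; exact: sqr_ge0.
have p2 : phi (ell R n k) ^+ 2 <= C ^+ 2.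
  by rewrite -real_normK ?num_real// lerXn2r ?nnegrE.
have pb2 : pbar n k ^+ 2 <= C ^+ 2.
  by rewrite -real_normK ?num_real// lerXn2r ?nnegrE ?phibar_le.
have w2 : w_coef r * phi (ell R n k) ^+ 2 <= `|w_coef r| * C ^+ 2.
  apply: le_trans (ler_norm _) _; rewrite normrM ler_wpM2l// ger0_norm ?sqr_ge0//.
rewrite /linvar -mulrN; apply: lerD => //; rewrite ler_wpM2l ?sqr_ge0//.
have := sqr_ge0 (phi (ell R n k) + pbar n k); have := sqr_ge0 (phi (ell R n k)); nra.
Qed.

Lemma lin_cube : exists2 K : R, 0 <= K & forall n k, (k < n)%N ->
  L1 expo (fun y => `|xi n k y| ^+ 3) /\ Ex expo (fun y => `|xi n k y| ^+ 3) <= K.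
Proof.
pose mu : R := Gamma (r + 1).
pose M := C + C * `|mu| + `|t| * C.
have M0 : 0 <= M by rewrite !addr_ge0// mulr_ge0.
have M1 : C <= M by have := mulr_ge0 C0 (normr_ge0 mu); have := mulr_ge0 (normr_ge0 t) C0; rewrite /M; lra.
have M2 : C * `|mu| + `|t| * C <= M by rewrite /M; have := C0; lra.
have M3 : `|t| * C <= M by have := mulr_ge0 C0 (normr_ge0 mu); have := C0; rewrite /M; lra.
pose h (y : measurableTypeR R) : R := (M ^+ 3 * 3 ^+ 3) * (y `^ (3 * r) + (y `^ 3%:R + 1)).
have Lh : L1 expo h.
  apply: L1Z; apply: L1D; first by apply: L1_expo_pow; rewrite mulr_ge0// ltW.
  by apply: L1D; [exact: L1_expo_pow|exact: L1_cst].
exists (Ex expo h).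
  apply: Ex_ge0 => y; rewrite mulr_ge0 ?mulr_ge0 ?exprn_ge0//.
  by rewrite !addr_ge0 ?powR_ge0.
move=> n k kn.
have [[ml _] _ _] := lin_moments n k.
have mc : measurable_fun [set: measurableTypeR R] (fun y => `|xi n k y| ^+ 3).
  by apply: measurable_funX; exact: measurableT_comp.
have dom (y : R) : 0 <= y -> `| `|xi n k y| ^+ 3 | <= h y.
  move=> y0; rewrite normrX normr_id.
  have b : `|xi n k y| <= M * (y `^ r + (y + 1)).
    rewrite /lin /bpow -/mu -/t.
    have pb := phibar_le kn; have pC := phiC (ell R n k).
    have h1 : `|t * pbar n k| <= `|t| * C by rewrite normrM ler_wpM2l.
    have h2 : `|phi (ell R n k) * mu| <= C * `|mu| by rewrite normrM ler_wpM2r.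
    move: (t * pbar n k) (phi (ell R n k)) h1 pC h2 => b p h1 pC h2.
    have -> : p * (y `^ r - mu * y) + b * (y - 1) = p * y `^ r + ((b - p * mu) * y - b) by ring.
    have yr := powR_ge0 y r.
    apply: le_trans (ler_normD _ _) _; rewrite [leRHS]mulrDr; apply: lerD.
      by rewrite normrM (ger0_norm yr) ler_wpM2r// (le_trans pC).
    apply: le_trans (ler_normB _ _) _; rewrite [leRHS]mulrDr mulr1; apply: lerD.
      rewrite normrM (ger0_norm y0) ler_wpM2r//.
      by apply: le_trans (ler_normB _ _) _; lra.
    exact: le_trans h1 M3.
  apply: le_trans (lerXn2r 3 _ _ b) _; rewrite ?nnegrE//.
    by rewrite mulr_ge0// addr_ge0 ?powR_ge0// addr_ge0.
  rewrite exprMn /h -mulrA ler_wpM2l ?exprn_ge0//.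
  apply: le_trans (exprn_sum3_le 3 (powR_ge0 y r) y0 ler01) _.
  have e : y `^ (3 * r) = (y `^ r) ^+ 3 by rewrite -powR_mulrn ?powR_ge0// -powRrM mulrC.
  by rewrite expr1n e powR_mulrn.
have Lc := L1_expo_le mc dom Lh.
split => //; apply: Ex_expo_le => // y y0.
by apply: le_trans (dom y y0); exact: ler_norm.
Qed.

(** With S_k the sum of phi over the positions from k on, S_k^2 / (n - k) decreases at step k by 2
    phi phibar - phibar^2 up to O(1 / (n - k)). The sum telescopes to the square of a mean, which is
    why sigma2 contains a squared integral. *)
Lemma sum_phibar_sqr n : 
  `|\sum_(k < n) (2 * phi (ell R n k) * pbar n k - pbar n k ^+ 2)
    - (\sum_(k < n) phi (ell R n k)) ^+ 2 / n%:R| <= C ^+ 2 * harm R n.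
Proof.
pose S j := \sum_(j <= i < n) phi (ell R n i).
pose Q j := S j ^+ 2 / (n - j)%:R.
have eQ : (\sum_(k < n) phi (ell R n k)) ^+ 2 / n%:R = \sum_(k < n) (Q k - Q k.+1).
  rewrite -(big_mkord predT (fun k => Q k - Q k.+1)).
  under [RHS]eq_bigr do rewrite -opprB.
  rewrite sumrN telescope_sumr// opprB /Q subnn invr0 mulr0 subr0 subn0 /S big_mkord.
  by [].
rewrite eQ -sumrB; apply: le_trans (ler_norm_sum _ _ _) _.
rewrite /harm mulr_sumr; apply: ler_sum => k _; have kn := ltn_ord k.
have SE : S k = phi (ell R n k) + S k.+1 by rewrite /S big_ltn.
have pE : pbar n k = S k.+1 / (n - k)%:R by [].
have Sb : `|S k.+1| <= C * (n - k.+1)%:R.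
  apply: le_trans (ler_norm_sum _ _ _) _.
  apply: (@le_trans _ _ (\sum_(k.+1 <= i < n) C)); first by apply: ler_sum => i _; exact: phiC.
  by rewrite sumr_const_nat -[leLHS]mulr_natr.
have pb : phi (ell R n k) ^+ 2 <= C ^+ 2.
  by rewrite -real_normK ?num_real// lerXn2r ?nnegrE.
rewrite /Q SE pE; move: (phi _) (S k.+1) Sb pb => p s Sb pb.
have -> : (n - k)%N = (n - k.+1).+1 by rewrite subnSK.
move: (n - k.+1)%N Sb => m; case: m => [|m] Sb.
  (* The last index k = n - 1, where the tail sum is empty. *)
  have -> : s = 0 by apply/eqP; rewrite -normr_eq0 eq_le normr_ge0 andbT (le_trans Sb)// mulr0.
  rewrite !(mul0r, mulr0, expr0n, addr0, sub0r, subr0, invr1, mulr1, oppr0) normrN ger0_norm ?sqr_ge0//.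
have m0 : 0 < m.+1%:R :> R by rewrite ltr0n.
have Sb2 : s ^+ 2 <= C ^+ 2 * m.+1%:R ^+ 2.
  rewrite -exprMn -(real_normK (num_real s)) lerXn2r ?nnegrE// mulr_ge0//.
set M : R := m.+1%:R in m0 Sb Sb2 *; rewrite -(natr1 m.+1) -/M.
have M1 : 0 < M + 1 by lra.
have -> : 2 * p * (s / (M + 1)) - (s / (M + 1)) ^+ 2 - ((p + s) ^+ 2 / (M + 1) - s ^+ 2 / M) =
   (s ^+ 2 / M ^+ 2 * (M / (M + 1)) - p ^+ 2) / (M + 1).
  by field; rewrite !gt_eqF.
rewrite normrM [X in _ * X]ger0_norm ?invr_ge0 ?(ltW M1)// ler_wpM2r ?invr_ge0 ?(ltW M1)//.
have q1 : 0 <= s ^+ 2 / M ^+ 2 * (M / (M + 1)).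
  by apply: mulr_ge0; apply: divr_ge0; rewrite ?sqr_ge0//; lra.
have q2 : s ^+ 2 / M ^+ 2 * (M / (M + 1)) <= C ^+ 2.
  rewrite -[leRHS]mulr1; apply: ler_pM.
  - by rewrite divr_ge0 ?sqr_ge0.
  - by rewrite divr_ge0//; lra.
  - by rewrite ler_pdivrMr ?exprn_gt0.
  - by rewrite ler_pdivrMr//; lra.
have p0 := sqr_ge0 p.
by move: q1 q2; set A := s ^+ 2 / _ * _ => q1 q2; rewrite ler_norml; lra.
Qed.

Definition limvar : R := w_coef r * tail_int (fun z => phi z ^+ 2) 0 - t ^+ 2 * tail_int phi 0 ^+ 2.

Lemma sum_linvar : exists2 K : R, 0 <= K & forall n, (0 < n)%N ->
  `|\sum_(k < n) linvar n k - n%:R * limvar| <= K * (1 + harm R n).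
Proof.
pose K1 := `|w_coef r| * (2 * C * L + 2 * C ^+ 2).
pose K2 := t ^+ 2 * (C ^+ 2 + 2 * C * (L + 2 * C)).
have CC : 0 <= C ^+ 2 by exact: sqr_ge0.
have CL : 0 <= C * L by exact: mulr_ge0.
exists (K1 + K2).
  apply: addr_ge0; apply: mulr_ge0; rewrite ?sqr_ge0//; first by lra.
  by move: CC CL; rewrite expr2; lra.
move=> n n0; have nR : 0 < n%:R :> R by rewrite ltr0n.
have h0 := harm_ge0 n.
have r1 := riemann_tail n0 mphi phiC phiL.
have mphi2 : measurable_fun [set: measurableTypeR R] (fun z => phi z ^+ 2) by exact: measurable_funX.
have phi2C z : `|phi z ^+ 2| <= C ^+ 2 by rewrite normrX lerXn2r ?nnegrE.
have phi2L (x y : R) : 0 <= x -> 0 <= y -> `|phi x ^+ 2 - phi y ^+ 2| <= 2 * C * L * `|x - y|.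
  move=> x0 y0; rewrite subr_sqr normrM mulrC -mulrA; apply: ler_pM => //; last exact: phiL.
  by apply: le_trans (ler_normD _ _) _; have := phiC x; have := phiC y; lra.
have r2 := riemann_tail n0 mphi2 phi2C phi2L.
have r3 := sum_phibar_sqr n.
have bT : `|tail_int phi 0| <= C.
  by have := tail_int_le mphi phiC (lexx 0); rewrite oppr0 expR0 mulr1.
rewrite sumrB -!mulr_sumr /limvar -/t.
set S := \sum_(k < n) phi _ in r1 r3; set S2 := \sum_(k < n) phi _ ^+ 2 in r2 *.
set B := \sum_(k < n) _ in r3 *; set T1 := tail_int phi 0 in r1 bT *; set T2 := tail_int _ 0 in r2 *.
have -> : w_coef r * S2 - t ^+ 2 * B - n%:R * (w_coef r * T2 - t ^+ 2 * T1 ^+ 2) =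
  w_coef r * (S2 - n%:R * T2) - t ^+ 2 * ((B - S ^+ 2 / n%:R) + (S - n%:R * T1) * (S / n%:R + T1)).
  by field; rewrite gt_eqF.
apply: le_trans (ler_normB _ _) _; rewrite [leRHS]mulrDl; apply: lerD.
  rewrite normrM -mulrA ler_wpM2l//; apply: le_trans r2 _.
  have : 0 <= 2 * C * L by rewrite mulr_ge0// mulr_ge0.
  have := sqr_ge0 C; nra.
rewrite normrM (ger0_norm (sqr_ge0 t)) /K2 -[leRHS]mulrA ler_wpM2l ?sqr_ge0//.
apply: le_trans (ler_normD _ _) _; rewrite [leRHS]mulrDl; apply: lerD.
  by apply: le_trans r3 _; rewrite ler_wpM2l ?sqr_ge0//; lra.
have Sb : `|S / n%:R| <= C.
  rewrite normrM normfV (gtr0_norm nR) ler_pdivrMr//.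
  apply: le_trans (ler_norm_sum _ _ _) _.
  apply: (@le_trans _ _ (\sum_(k < n) C)); first by apply: ler_sum => i _; exact: phiC.
  by rewrite sumr_const card_ord mulr_natr.
have q : `|S / n%:R + T1| <= 2 * C by apply: le_trans (ler_normD _ _) _; lra.
rewrite normrM (_ : 2 * C * (L + 2 * C) * (1 + harm R n) = (L + 2 * C) * (1 + harm R n) * (2 * C)); last by ring.
apply: ler_pM => //; apply: le_trans r1 _.
have := C0; have := L0; nra.
Qed.

(** Third moments and variances of the summands are bounded uniformly, so the n exchanges cost n
    times n^(-3/2) and n times n^(-2). *)
Lemma clt_lin d (T : measurableType d) (P : probability T R) (w del : R) : 0 < del ->
  exists2 K : R, 0 <= K & forall n E, (0 < n)%N -> iid_upto P expo n E ->
  `|Ex P (fun u => heat w del ((Num.sqrt n%:R)^-1 * \sum_(k < n) xi n k (E k u)))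
    - heat w (del + (\sum_(k < n) linvar n k) / n%:R) 0| <= K / Num.sqrt n%:R.
Proof.
move=> del0.
have [Kv Kv0 hKv] := linvar_le; have [Kc Kc0 hKc] := lin_cube.
set C1 : R := (Num.sqrt del)^-1 ^+ 3 * (20 * normal_peak 1).
set C2 : R := (Num.sqrt del)^-1 ^+ 4 * (20 * normal_peak 1).
have C10 : 0 <= C1 by rewrite mulr_ge0 ?exprn_ge0 ?invr_ge0 ?sqrtr_ge0// mulr_ge0// normal_peak_ge0.
have C20 : 0 <= C2 by rewrite mulr_ge0 ?exprn_ge0 ?invr_ge0 ?sqrtr_ge0// mulr_ge0// normal_peak_ge0.
exists (C1 * Kc + C2 * Kv ^+ 2); first by apply: addr_ge0; apply: mulr_ge0; rewrite ?sqr_ge0.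
move=> n E n0 iE.
have nR : 1 <= n%:R :> R by rewrite ler1n.
pose s : R := Num.sqrt n%:R.
have s1 : 1 <= s by rewrite -sqrtr1 ler_wsqrtr.
have s0 : 0 < s by lra.
have s2 : s ^+ 2 = n%:R by rewrite sqr_sqrtr.
have hl k : (k < n)%N -> [/\ L2 expo (fun y => s^-1 * xi n k y),
    Ex expo (fun y => s^-1 * xi n k y) = 0,
    Ex expo (fun y => (s^-1 * xi n k y) ^+ 2) = linvar n k / n%:R,
    L1 expo (fun y => `|s^-1 * xi n k y| ^+ 3) &
    Ex expo (fun y => `|s^-1 * xi n k y| ^+ 3) <= Kc / (n%:R * s)].
  move=> kn; have [l2 l0 lv] := lin_moments n k; have [c1 c2] := hKc n k kn.
  have e3 : (fun y => `|s^-1 * xi n k y| ^+ 3) = (fun y => s^-1 ^+ 3 * `|xi n k y| ^+ 3).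
    by apply/funext => y; rewrite normrM gtr0_norm ?invr_gt0// exprMn.
  split.
  - exact: L2Z.
  - by rewrite ExZ ?l0 ?mulr0//; exact: L2_L1.
  - under eq_fun do rewrite exprMn.
    by rewrite ExZ ?lv; [rewrite exprVn s2 mulrC|case: l2].
  - by rewrite e3; exact: L1Z.
  - rewrite e3 ExZ// exprVn exprS s2 mulrC (mulrC s) ler_wpM2r// invr_ge0 mulr_ge0//; exact: ltW.
have := @lindeberg _ _ _ P expo w del del0 n E (fun k y => s^-1 * xi n k y)
  (fun k => linvar n k / n%:R) (fun k => Kc / (n%:R * s)) iE hl.
rewrite -/C1 -/C2.
under eq_fun do rewrite -mulr_sumr.
rewrite -mulr_suml; move/le_trans; apply.
have -> : (C1 * Kc + C2 * Kv ^+ 2) / Num.sqrt n%:R = \sum_(k < n) ((C1 * Kc + C2 * Kv ^+ 2) / s / n%:R).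
  by rewrite sumr_const card_ord -[RHS]mulr_natr divfK// pnatr_eq0 -lt0n.
apply: ler_sum => k _; have /andP[v0 vK] := hKv n k (ltn_ord k).
rewrite [(_ + _) / s]mulrDl [leRHS]mulrDl; apply: lerD.
  by rewrite le_eqVlt; apply/orP; left; apply/eqP; field; rewrite !gt_eqF//; lra.
have v2 : linvar n k ^+ 2 <= Kv ^+ 2 by rewrite lerXn2r ?nnegrE// (le_trans v0).
have ns : n%:R^-1 <= s^-1 :> R by rewrite lef_pV2 ?posrE//; [rewrite -s2 expr2 ler_peMr// ltW|lra].
move: (linvar n k) v0 v2 {vK} => v v0 v2.
have -> : C2 * Kv ^+ 2 / s / n%:R = C2 * (Kv ^+ 2 * (s^-1 * n%:R^-1)) by rewrite !mulrA.
rewrite ler_wpM2l// exprMn; apply: ler_pM => //; rewrite ?sqr_ge0//.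
by rewrite expr2 ler_wpM2r// invr_ge0.
Qed.

End linear_part.

(** * Variance of the remainder *)

Section ordered_sample.
Context d (T : measurableType d) (R : realType) (P : probability T R).
Local Notation expo := (expo R).
Variable Z : nat -> T -> R.
Hypothesis mZ : forall i, measurable_fun [set: T] (Z i).
Hypothesis Z0 : forall i w, 0 <= Z i w.
Hypothesis indZ : forall (s : seq nat) (B : nat -> set (measurableTypeR R)), uniq s ->
  (forall i, measurable (B i)) ->
  P (\bigcap_(i in [set` s]) Z i @^-1` B i) = (\prod_(i <- s) expo (B i))%E.

Lemma iid_sample n : iid_upto P expo n Z.
Proof.
split => // B mB; have := indZ (iota_uniq 0 n) mB.
rewrite -(big_mkord predT (fun i => expo (B i))) /index_iota subn0 => <-.
by have -> : [set` iota 0 n] = `I_n by apply/seteqP; split => i /=; rewrite mem_iota add0n.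
Qed.

Lemma Ex_sample (f : measurableTypeR R -> R) i : (forall y, 0 <= f y) -> L1 expo f ->
  L1 P (fun w => f (Z i w)) /\ Ex P (fun w => f (Z i w)) = Ex expo f.
Proof.
move=> f0 Lf; have := @Ex_past_prod _ _ _ P expo i.+1 Z (iid_sample i.+1) i (ltnSn i) (fun=> 1) f
  (measurable_cst _) (fun=> ler01) f0 (L1_cst P 1) Lf.
rewrite Ex_cst mul1r (_ : (fun w => 1 * f (Z i w)) = (fun w => f (Z i w)))//.
by apply/funext => w; rewrite mul1r.
Qed.

Let E n := nspacing Z n.

Lemma wpos_nspacing n k w : (k <= n)%N -> wpos n (E n) k w = ordered Z n k w.
Proof.
elim: k => [_|k IH kn]; first by rewrite /wpos big_ord0.
have := IH (ltnW kn); rewrite /wpos big_ord_recr/= => ->.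
have m0 : (n - k)%:R != 0 :> R by rewrite pnatr_eq0 -lt0n subn_gt0.
by rewrite /E /nspacing mulrC mulKf// addrC subrK.
Qed.

(** Reduces averages over order statistics to averages over the sample, so that no law of an
    individual order statistic is ever computed. *)
Lemma sum_ordered n (f : R -> R) w :
  \sum_(k < n) f (ordered Z n k.+1 w) = \sum_(i < n) f (Z i w).
Proof.
rewrite -(big_mkord predT (fun k => f (ordered Z n k.+1 w))).
rewrite -(big_mkord predT (fun i => f (Z i w))).
transitivity (\sum_(x <- sort <=%R [seq Z i w | i <- iota 0 n]) f x).
  by rewrite [RHS](big_nth 0) size_sort size_map size_iota.
rewrite (perm_big [seq Z i w | i <- iota 0 n])/=; last by rewrite perm_sort.
by rewrite big_map /index_iota subn0.
Qed.

(** The spacing after the next one, and 0 past the maximum; it enters through the two-step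
    neighbours of [variance_gsum]. *)
Let E' n k : T -> R := if (k.+1 < n)%N then E n k.+1 else fun=> 0.
(* Dominates the normalised one-step and two-step spacings after the k-th point. *)
Let y n k w : R := scl n (E n) k w * (E n k w + 2 * E' n k w).
Let u n k w : R := (E n k w + 2 * E' n k w) / (n - k)%:R.

Let iE n : iid_upto P expo n (E n).
Proof. exact: iid_nspacing. Qed.

Let E0 n k w : (k < n)%N -> 0 <= E n k w.
Proof. exact: nspacing_ge0. Qed.

Let E'0 n k w : 0 <= E' n k w.
Proof. by rewrite /E'; case: ifP => // /E0. Qed.

Let mE n k : measurable_fun [set: T] (E n k).
Proof. exact: measurable_nspacing. Qed.

Let mE' n k : measurable_fun [set: T] (E' n k).
Proof. by rewrite /E'; case: ifP => // _; exact: mE. Qed.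

Let my n k : (k < n)%N -> measurable_fun [set: T] (y n k).
Proof.
move=> kn; apply: measurable_funM.
  by apply: (measurable_of_past (iE n) (ltnW kn)); exact: past_scl.
by apply: measurable_funD; [exact: mE|apply: measurable_funM => //; exact: mE'].
Qed.

Let y0 n k w : (k < n)%N -> 0 <= y n k w.
Proof.
move=> kn; rewrite mulr_ge0 ?(ltW (scl_gt0 _ _ kn))// addr_ge0 ?E0//.
by rewrite mulr_ge0.
Qed.

Let u0 n k w : (k < n)%N -> 0 <= u n k w.
Proof. by move=> kn; rewrite divr_ge0// addr_ge0 ?E0// mulr_ge0. Qed.

Let Lpow (N : nat) : L1 expo (fun y : measurableTypeR R => `|y : R| ^+ N).
Proof.
have h : L1 expo (fun y : measurableTypeR R => (y : R) ^+ N).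
  apply: (L1_expo_le (g := fun y : measurableTypeR R => y `^ N%:R)).
  - exact: measurable_funX.
  - by move=> x x0; rewrite powR_mulrn// ger0_norm ?exprn_ge0.
  - exact: L1_expo_pow.
by have := L1_norm h; under eq_fun do rewrite normrX.
Qed.

Let sclD n k w : (k < n)%N -> scl n (E n) k w <= 2 * ddom n (E n) k w.
Proof.
move=> kn; rewrite sclE ler_pM ?expR_ge0 ?ddom_exp//.
  by apply: le_trans (cfac_ge1 R kn).
apply: le_trans (cfac_le R kn) _.
have : (n - k)%:R^-1 <= 1 :> R by rewrite invf_le1 ?ler1n ?ltr0n subn_gt0.
lra.
Qed.

Let y_moment (N : nat) : exists2 K : R, 0 <= K & forall n k, (k < n)%N ->
  L1 P (fun w => y n k w ^+ N.+1) /\ Ex P (fun w => y n k w ^+ N.+1) <= K.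
Proof.
have [C C0 hC] := Ex_ddom P N.+1.
pose B := Ex expo (fun y : measurableTypeR R => `|y : R| ^+ N.+1).
have B0 : 0 <= B by apply: Ex_ge0 => x; rewrite exprn_ge0.
have CB : 0 <= C * B by exact: mulr_ge0.
exists (3 ^+ N.+1 * (2 ^+ N.+1 * (C * B) + 4 ^+ N.+1 * (C * B))).
  by rewrite mulr_ge0 ?exprn_ge0// addr_ge0// mulr_ge0// exprn_ge0.
move=> n k kn; have [hL hE] := hC n (E n) k (iE n) kn.
have D1 w := ddom_ge1 n (E n) k w.
have D0 w : 0 <= ddom n (E n) k w by apply: le_trans (D1 w).
have Dp w : 0 <= ddom n (E n) k w ^+ N.+1 by rewrite exprn_ge0.
have mD : measurable_fun [set: g_sigma_algebraType (past (E n) k)]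
    ((fun w => ddom n (E n) k w ^+ N.+1) : g_sigma_algebraType (past (E n) k) -> R).
  by apply: measurable_funX; exact: past_ddom.
have bp (x : measurableTypeR R) : 0 <= `|x : R| ^+ N.+1 by rewrite exprn_ge0.
have [La Ea] := @Ex_past_prod _ _ _ P expo n (E n) (iE n) k kn _ _ mD Dp bp hL (Lpow N.+1).
have [Lb Eb] : L1 P (fun w => ddom n (E n) k w ^+ N.+1 * `|E' n k w| ^+ N.+1) /\
    Ex P (fun w => ddom n (E n) k w ^+ N.+1 * `|E' n k w| ^+ N.+1) <= C * B.
  rewrite /E'; case: ifP => kn1.
    have mD' : measurable_fun [set: g_sigma_algebraType (past (E n) k.+1)]
        ((fun w => ddom n (E n) k w ^+ N.+1) : g_sigma_algebraType (past (E n) k.+1) -> R).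
      exact: past_funW mD.
    have [Lb Eb] := @Ex_past_prod _ _ _ P expo n (E n) (iE n) k.+1 kn1 _ _ mD' Dp bp hL (Lpow N.+1).
    by split => //; rewrite Eb ler_wpM2r.
  have -> : (fun w => ddom n (E n) k w ^+ N.+1 * `|0 : R| ^+ N.+1) = (fun=> 0).
    by apply/funext => w; rewrite normr0 expr0n/= mulr0.
  by split; [exact: L1_cst|rewrite Ex_cst].
have {}Ea : Ex P (fun w => ddom n (E n) k w ^+ N.+1 * `|E n k w| ^+ N.+1) <= C * B.
  by rewrite Ea ler_wpM2r.
pose g w := 3 ^+ N.+1 * (2 ^+ N.+1 * (ddom n (E n) k w ^+ N.+1 * `|E n k w| ^+ N.+1)
   + 4 ^+ N.+1 * (ddom n (E n) k w ^+ N.+1 * `|E' n k w| ^+ N.+1)).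
have Lg : L1 P g by apply: L1Z; apply: L1D; exact: L1Z.
have yg w : y n k w ^+ N.+1 <= g w.
  rewrite /g (ger0_norm (E0 w kn)) (ger0_norm (E'0 _ _ _)) -!exprMn.
  have h1 : 0 <= 2 * (ddom n (E n) k w * E n k w) by apply: mulr_ge0 => //; apply: mulr_ge0 => //; exact: E0.
  have h2 : 0 <= 4 * (ddom n (E n) k w * E' n k w) by rewrite !mulr_ge0.
  have := exprn_sum3_le N.+1 h1 h2 (lexx 0); rewrite [in X in _ <= X -> _]expr0n/= !addr0.
  apply: le_trans; rewrite lerXn2r ?nnegrE ?addr_ge0 ?y0//.
  have -> : 2 * (ddom n (E n) k w * E n k w) + 4 * (ddom n (E n) k w * E' n k w) =
    (2 * ddom n (E n) k w) * (E n k w + 2 * E' n k w) by ring.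
  by rewrite ler_wpM2r ?sclD// addr_ge0 ?E0// mulr_ge0.
have Ly : L1 P (fun w => y n k w ^+ N.+1).
  apply: (L1_le _ _ Lg); first by apply: measurable_funX; exact: my.
  by move=> w; rewrite ger0_norm ?exprn_ge0 ?y0.
split => //; apply: le_trans (Ex_le Ly Lg yg) _.
rewrite ExZ; last by apply: L1D; exact: L1Z.
rewrite ler_wpM2l ?exprn_ge0// ExD; [|exact: L1Z|exact: L1Z].
by rewrite !ExZ// lerD// ler_wpM2l// exprn_ge0.
Qed.

Let u_moment n k : (k < n)%N -> L1 P (u n k) /\ Ex P (u n k) <= 3 / (n - k)%:R.
Proof.
move=> kn; have m0 : 0 < (n - k)%:R :> R by rewrite ltr0n subn_gt0.
have LE j : (j < n)%N -> L1 P (E n j) /\ Ex P (E n j) = 1.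
  move=> jn.
  have Li : L1 expo (fun y : measurableTypeR R => `|y : R|) by have := Lpow 1; under eq_fun do rewrite expr1.
  have [La Ea] := @Ex_past_prod _ _ _ P expo n (E n) (iE n) j jn (fun=> 1) (fun y : measurableTypeR R => `|y : R|)
    (measurable_cst _) (fun=> ler01) (fun y => normr_ge0 _) (L1_cst P 1) Li.
  have e : (fun w => 1 * `|E n j w|) = E n j by apply/funext => w; rewrite mul1r ger0_norm// E0.
  rewrite e in La Ea; split => //; rewrite Ea Ex_cst mul1r -[RHS](Ex_expo_id R).
  apply: eq_Ex_expo; [exact: L1_measurable Li|exact: measurable_id|].
  by move=> x x0; rewrite ger0_norm.
have [L1k E1k] := LE k kn.
have [L2k E2k] : L1 P (E' n k) /\ Ex P (E' n k) <= 1.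
  rewrite /E'; case: ifP => kn1; last by split; [exact: L1_cst|rewrite Ex_cst].
  by have [h1 h2] := LE k.+1 kn1; rewrite h2.
have e : u n k = (fun w => (n - k)%:R^-1 * (E n k w + 2 * E' n k w)) by apply/funext => w; rewrite /u mulrC.
have Ls : L1 P (fun w => E n k w + 2 * E' n k w) by apply: L1D => //; exact: L1Z.
rewrite e; split; first exact: L1Z.
rewrite ExZ// mulrC ler_wpM2r ?invr_ge0 ?(ltW m0)// ExD//; last exact: L1Z.
by rewrite E1k ExZ//; lra.
Qed.

Variables (r : R) (r0 : 0 < r).

Section remainder.
(** In the application [h] is the difference between a true term and its smooth version, [ep] the
    step of the difference quotient and [W] its local oscillation; [la] is a free weight, to be
    chosen small. *)
Variables (n : nat) (h : R -> R -> R) (W : measurableTypeR R -> R) (K0 ep la : R).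
Hypothesis ep0 : 0 < ep.
Hypothesis la0 : 0 < la.
Hypothesis K00 : 0 <= K0.
Hypothesis mh : measurable_fun [set: measurableTypeR R * measurableTypeR R]
    (fun x : measurableTypeR R * measurableTypeR R => h x.1 x.2).
Hypothesis mW : measurable_fun [set: measurableTypeR R] W.
Hypothesis W01 : forall z, 0 <= W z <= 1.
Hypothesis hb : forall z z' : R, 0 <= z -> z <= z' ->
  `|h z z'| <= K0 * (n%:R * expR (- z) * (z' - z)) `^ r.
Hypothesis hb2 : forall z z' : R, 0 <= z -> z <= z' ->
  h z z' ^+ 2 <= K0 * (n%:R * expR (- z) * (z' - z)) `^ (2 * r) * (W z + Num.min 1 ((z' - z) / ep)).

(** Young's inequality with weight [la] separates the spacing from the oscillation; the oscillation
    factor is at most 2, so its square is at most twice itself and only its mean matters. *)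
Let H2 k w : R := K0 * (la * y n k w `^ (4 * r) + 2 / la * (W (ordered Z n k w) + u n k w / ep)).

Let spacing_le k w j : (k < n)%N -> (j = k.+1) \/ (j = k.+2 /\ (k.+1 < n)%N) ->
  0 <= ordered Z n j w - ordered Z n k w <= u n k w.
Proof.
move=> kn hj; have m0 : 0 < (n - k)%:R :> R by rewrite ltr0n subn_gt0.
have st i : (i < n)%N -> ordered Z n i.+1 w - ordered Z n i w = E n i w / (n - i)%:R.
  move=> i_n; have mi : (n - i)%:R != 0 :> R by rewrite pnatr_eq0 -lt0n subn_gt0.
  by rewrite /E /nspacing mulrC mulKf.
have Ek := E0 w kn.
case: hj => [->|[-> kn1]].
  rewrite st// divr_ge0 ?(ltW m0)//= /u ler_wpM2r ?invr_ge0 ?(ltW m0)// lerDl mulr_ge0//.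
have m1 : 0 < (n - k.+1)%:R :> R by rewrite ltr0n subn_gt0.
have -> : ordered Z n k.+2 w - ordered Z n k w = E n k w / (n - k)%:R + E n k.+1 w / (n - k.+1)%:R.
  by rewrite -!st//; ring.
have Ek1 := E0 w kn1.
rewrite addr_ge0 ?divr_ge0 ?(ltW m0) ?(ltW m1)//= /u /E' kn1 mulrDl lerD2l.
(* 1 / (n - k - 1) <= 2 / (n - k), whence the factor 2 in [y] and [u]. *)
rewrite [leRHS]mulrAC (mulrC (2 / _)) ler_wpM2l// ler_pdivlMr// mulrC ler_pdivrMr//.
rewrite -natrM ler_nat mul2n -addnn.
by rewrite -(subnSK kn) -[X in (X <= _)%N]addn1 leq_add2l subn_gt0.
Qed.

Let dom_x k w j : (k < n)%N -> (j = k.+1) \/ (j = k.+2 /\ (k.+1 < n)%N) ->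
  0 <= n%:R * expR (- ordered Z n k w) * (ordered Z n j w - ordered Z n k w) <= y n k w.
Proof.
move=> kn hj; have /andP[s0 su] := spacing_le w kn hj.
have m0 : 0 < (n - k)%:R :> R by rewrite ltr0n subn_gt0.
rewrite mulr_ge0 ?mulr_ge0 ?expR_ge0//=.
apply: le_trans (ler_wpM2l _ su) _; first by rewrite mulr_ge0 ?expR_ge0.
by rewrite /y /u /scl wpos_nspacing ?(ltnW kn)// le_eqVlt; apply/orP; left; apply/eqP; ring.
Qed.

Let ordered_ge0 k w : (k <= n)%N -> 0 <= ordered Z n k w.
Proof.
move=> kn; rewrite -wpos_nspacing//; apply: sumr_ge0 => j _; rewrite divr_ge0// E0//.
exact: leq_trans (ltn_ord j) kn.
Qed.

Let h_dom k w j : (k < n)%N -> (j = k.+1) \/ (j = k.+2 /\ (k.+1 < n)%N) ->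
  `|h (ordered Z n k w) (ordered Z n j w)| <= K0 * y n k w `^ r /\
  h (ordered Z n k w) (ordered Z n j w) ^+ 2 <= H2 k w.
Proof.
move=> kn hj; have /andP[s0 su] := spacing_le w kn hj; have /andP[x0 xy] := dom_x w kn hj.
have z0 := ordered_ge0 w (ltnW kn).
have zz : ordered Z n k w <= ordered Z n j w by rewrite -subr_ge0.
have yy := y0 w kn.
split.
  apply: le_trans (hb z0 zz) _; rewrite ler_wpM2l//.
  by apply: ge0_ler_powR => //; rewrite ?nnegrE// ltW.
apply: le_trans (hb2 z0 zz) _.
set z := ordered Z n k w in z0 zz s0 su x0 xy *; set s := _ - z in s0 su x0 xy *.
set x := n%:R * _ * _ in x0 xy *.
have /andP[w0 w1] := W01 z.
have mn0 : 0 <= Num.min 1 (s / ep) by rewrite le_min ler01 divr_ge0// ltW.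
have mn1 : Num.min 1 (s / ep) <= 1 by rewrite ge_min lexx.
have mn2 : Num.min 1 (s / ep) <= u n k w / ep.
  by rewrite ge_min; apply/orP; right; rewrite ler_wpM2r// invr_ge0 ltW.
rewrite /H2 -mulrA ler_wpM2l//.
have xp : x `^ (2 * r) <= y n k w `^ (2 * r).
  by apply: ge0_ler_powR => //; rewrite ?nnegrE// mulr_ge0// ltW.
apply: le_trans (ler_wpM2r _ xp) _; first by rewrite addr_ge0.
have -> : y n k w `^ (4 * r) = (y n k w `^ (2 * r)) ^+ 2.
  rewrite -powR_mulrn ?powR_ge0// -powRrM; congr (_ `^ _); ring.
move: (y n k w `^ (2 * r)) (Num.min 1 (s / ep)) mn0 mn1 mn2 => a b b0 b1 bu.
apply: (@le_trans _ _ (la * a ^+ 2 + (W z + b) ^+ 2 / la)).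
  have q := sqr_ge0 (la * a - (W z + b) / 2); rewrite -subr_ge0.
  have -> : la * a ^+ 2 + (W z + b) ^+ 2 / la - a * (W z + b) =
    ((la * a - (W z + b) / 2) ^+ 2 + 3 / 4 * (W z + b) ^+ 2) / la.
    by field; rewrite gt_eqF.
  rewrite divr_ge0 ?(ltW la0)// addr_ge0//.
  by apply: mulr_ge0; [lra|exact: sqr_ge0].
rewrite lerD2l -/z (_ : 2 / la * _ = 2 * (W z + u n k w / ep) / la); last by ring.
rewrite ler_wpM2r ?invr_ge0 ?(ltW la0)//.
have q : (W z + b) ^+ 2 <= 2 * (W z + b) by rewrite expr2; nra.
by lra.
Qed.

Variables (N : nat) (KN : R).
Hypothesis rN : 4 * r <= N.+1%:R.
Hypothesis KN0 : 0 <= KN.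
Hypothesis hKN : forall k, (k < n)%N ->
  L1 P (fun w => y n k w ^+ N.+1) /\ Ex P (fun w => y n k w ^+ N.+1) <= KN.

Let y4 k w : (k < n)%N -> y n k w `^ (4 * r) <= 1 + y n k w ^+ N.+1.
Proof.
move=> kn; have yy := y0 w kn; have r4 : 0 <= 4 * r by rewrite mulr_ge0// ltW.
have [y1|y1] := leP (y n k w) 1.
  apply: (@le_trans _ _ 1); last by rewrite lerDl exprn_ge0.
  have e1 : 1 `^ (4 * r) = 1 :> R by rewrite powR1.
  by rewrite -[leRHS]e1; apply: ge0_ler_powR; rewrite ?nnegrE.
apply: (@le_trans _ _ (y n k w `^ N.+1%:R)); first by rewrite ler_powR// ltW.
by rewrite powR_mulrn// lerDr.
Qed.

Let Ly4 k : (k < n)%N -> L1 P (fun w => y n k w `^ (4 * r)) /\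
  Ex P (fun w => y n k w `^ (4 * r)) <= 1 + KN.
Proof.
move=> kn; have [h1 h2] := hKN kn.
have L : L1 P (fun w => 1 + y n k w ^+ N.+1) by apply: L1D => //; exact: L1_cst.
have Ly : L1 P (fun w => y n k w `^ (4 * r)).
  apply: (L1_le _ _ L); first exact: (measurableT_comp (measurable_powR _) (my kn)).
  by move=> w; rewrite ger0_norm ?powR_ge0// y4.
split => //; apply: le_trans (Ex_le Ly L (fun w => y4 w kn)) _.
by rewrite ExD ?Ex_cst ?lerD2l//; exact: L1_cst.
Qed.

Let LW k : L1 P (fun w => W (ordered Z n k w)).
Proof.
apply: (@L1_bounded _ _ _ _ _ 1).
  exact: (measurableT_comp mW (measurable_ordered mZ n k)).
by move=> w; have /andP[w0 w1] := W01 (ordered Z n k w); rewrite ger0_norm.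
Qed.

Let LH2 k : (k < n)%N -> L1 P (H2 k) /\ Ex P (H2 k) <=
  K0 * (la * (1 + KN) + 2 / la * (Ex P (fun w => W (ordered Z n k w)) + 3 / (n - k)%:R / ep)).
Proof.
move=> kn; have [h1 h2] := Ly4 kn; have [h3 h4] := u_moment kn.
have Lu : L1 P (fun w => u n k w / ep).
  by under eq_fun do rewrite mulrC; exact: L1Z.
have L3 : L1 P (fun w => W (ordered Z n k w) + u n k w / ep) by exact: L1D.
have L4 : L1 P (fun w => la * y n k w `^ (4 * r) + 2 / la * (W (ordered Z n k w) + u n k w / ep)).
  by apply: L1D; exact: L1Z.
split; first exact: L1Z.
rewrite ExZ// ler_wpM2l// ExD; [|exact: L1Z|exact: L1Z].
rewrite !ExZ// lerD// ler_wpM2l ?(ltW la0) ?divr_ge0 ?(ltW la0)//.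
rewrite ExD// lerD2l.
have -> : (fun w => u n k w / ep) = (fun w => ep^-1 * u n k w) by apply/funext => w; rewrite mulrC.
by rewrite ExZ// mulrC ler_wpM2r ?invr_ge0 ?(ltW ep0).
Qed.

Let c : R := n%:R.
(** [variance_gsum] asks for bounded summands. At level n the truncation changes a term by at most
    h^2 / n, so the n changes together stay bounded in mean square by fourth moments. *)
Let hc z z' : R := Num.max (- c) (Num.min c (h z z')).

Let mhc : measurable_fun [set: measurableTypeR R * measurableTypeR R]
    (fun x : measurableTypeR R * measurableTypeR R => hc x.1 x.2).
Proof. by apply: measurable_maxr => //; exact: measurable_minr. Qed.

Let c0 : 0 <= c. Proof. exact: ler0n. Qed.

Let hc_bound z z' : `|hc z z'| <= c.
Proof.
rewrite /hc; have := c0; rewrite ler_norml le_max lexx/= ge_max.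
by move=> cc; rewrite ge_min lexx andbT ge0_cp//; lra.
Qed.

Let hc_le z z' : `|hc z z'| <= `|h z z'|.
Proof.
rewrite /hc; have cc := c0; rewrite ler_norml; apply/andP; split.
  rewrite le_max le_min; apply/orP; right; apply/andP; split.
    by apply: le_trans cc; rewrite oppr_le0.
  by rewrite lerNl -normrN ler_norm.
rewrite ge_max ge_min; apply/andP; split; first by apply: (@le_trans _ _ 0); rewrite ?oppr_le0.
by rewrite ler_norm orbT.
Qed.

Let hc_diff z z' : c ^+ 2 * (h z z' - hc z z') ^+ 2 <= h z z' ^+ 4.
Proof.
have cc := c0; rewrite /hc; have [h1|h1] := leP `|h z z'| c.
  move: h1; rewrite ler_norml => /andP[h1 h2].
  rewrite (min_idPr h2) (max_idPr h1) subrr expr0n/= mulr0.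
  by rewrite exprn_even_ge0.
have [hp|hn] := leP 0 (h z z').
  rewrite ger0_norm// in h1.
  rewrite (min_idPl (ltW h1)) (max_idPr (_ : - c <= c)); last by lra.
  rewrite (exprD _ 2 2) ler_pM ?sqr_ge0// lerXn2r ?nnegrE//; lra.
rewrite ltr0_norm// in h1.
rewrite (min_idPr (_ : h z z' <= c)); last by lra.
rewrite (max_idPl (_ : h z z' <= - c)); last by lra.
rewrite (exprD _ 2 2) -[h z z' ^+ 2]sqrrN ler_pM ?sqr_ge0//.
  by rewrite lerXn2r ?nnegrE//; lra.
by rewrite -sqrrN lerXn2r ?nnegrE//; lra.
Qed.

Definition gap_sum (f : R -> R -> R) w : R :=
  \sum_(i < n.-1) f (order_stat Z n i w) (order_stat Z n i.+1 w).

Let mos k : measurable_fun [set: T] (ordered Z n k) := measurable_ordered mZ n k.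

Let mgap (f : R -> R -> R) : measurable_fun [set: measurableTypeR R * measurableTypeR R]
    (fun x : measurableTypeR R * measurableTypeR R => f x.1 x.2) ->
  forall j k, measurable_fun [set: T] (fun w => f (ordered Z n j w) (ordered Z n k w)).
Proof.
by move=> mf j k; exact: (measurableT_comp mf (measurable_fun_pair (mos j) (mos k))).
Qed.

Let B : R := K0 * (n%:R * (la * (1 + KN)) + 2 / la * (n%:R * Ex expo W + 3 * harm R n / ep)).

Let sum_H2 : (0 < n)%N -> \sum_(i < n.-1) Ex P (H2 i.+1) <= B.
Proof.
rewrite /B; case: (n) LH2 LW => // n' LH2' LW' _.
have LWexpo : L1 expo W.
  by apply: (@L1_bounded _ _ _ _ _ 1) => // z; have /andP[w0 w1] := W01 z; rewrite ger0_norm.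
apply: (@le_trans _ _ (\sum_(i < n') K0 * (la * (1 + KN) + 2 / la * (Ex P (fun w => W (ordered Z n'.+1 i.+1 w)) + 3 / (n'.+1 - i.+1)%:R / ep)))).
  by apply: ler_sum => i _; have [] := LH2' i.+1 (ltn_ord i).
rewrite -mulr_sumr ler_wpM2l// big_split/= lerD//.
  rewrite sumr_const card_ord -[leLHS]mulr_natl ler_wpM2r ?ler_nat//.
  by rewrite mulr_ge0 ?(ltW la0)// addr_ge0.
rewrite -mulr_sumr ler_wpM2l ?divr_ge0 ?(ltW la0)// big_split/= lerD//.
  apply: (@le_trans _ _ (\sum_(i < n'.+1) Ex P (fun w => W (ordered Z n'.+1 i.+1 w)))).
    rewrite [leRHS]big_ord_recr/= lerDl; apply: Ex_ge0 => w.
    by have /andP[] := W01 (ordered Z n'.+1 n'.+1 w).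
  rewrite -Ex_sum; last by move=> i; exact: LW'.
  (* The mean of the weights over all order statistics is n times the mean of [W] under the
     exponential law. *)
  have -> : (fun w => \sum_(i < n'.+1) W (ordered Z n'.+1 i.+1 w)) = (fun w => \sum_(i < n'.+1) W (Z i w)).
    by apply/funext => w; exact: sum_ordered.
  have W0 z : 0 <= W z by have /andP[] := W01 z.
  rewrite Ex_sum; last by move=> i; have [] := Ex_sample i W0 LWexpo.
  under eq_bigr => i _ do rewrite (Ex_sample i W0 LWexpo).2.
  by rewrite sumr_const card_ord -[leLHS]mulr_natl.
rewrite -mulr_suml ler_wpM2r ?invr_ge0 ?(ltW ep0)// -mulr_sumr ler_wpM2l//.
have -> : \sum_(i < n') ((n'.+1 - i.+1)%:R : R)^-1 = harm R n' by rewrite /harm; apply: eq_bigr => i _; rewrite subSS.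
by rewrite !harmE big_ord_recr/= lerDl invr_ge0.
Qed.

(** The truncated sum is at most (6 + 3) [B] by the Efron-Stein inequality; the truncation error is
    bounded in mean square, with a factor 4 for centering. Adding the two doubles both. *)
Lemma remainder_bound :
  sqb P (fun w => gap_sum h w - Ex P (gap_sum h)) (18 * B + 8 * (K0 ^+ 4 * (1 + KN))).
Proof.
case: (posnP n) => [n0|n0].
  have e : gap_sum h = fun=> 0 by apply/funext => w; rewrite /gap_sum n0 big_ord0.
  have B0 : 0 <= B.
    rewrite /B n0 !mul0r !add0r /harm big_ord0 mulr0 mul0r mulr0 mulr0.
    by [].
  rewrite e; split; first by apply: L2B; exact: L2_cst.
  rewrite !Ex_cst subrr expr0n/=; apply: addr_ge0; apply: mulr_ge0 => //.
  by apply: mulr_ge0; rewrite ?exprn_ge0 ?addr_ge0.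
pose Tc := gap_sum hc; pose D w := gap_sum h w - Tc w.
have n1 i : (i < n.-1)%N -> (i.+1 < n)%N by rewrite -ltnS prednK.
have hcB : Ex P (fun w => (Tc w - Ex P Tc) ^+ 2) <= 9 * B.
  apply: le_trans (@variance_gsum _ _ _ P expo n Z hc c (iid_sample n) mhc hc_bound Tc (fun=> erefl)) _.
  have S1 : \sum_(i < n.-1) Ex P (fun w => hc (order_stat Z n i w) (order_stat Z n i.+1 w) ^+ 2) <= B.
    apply: le_trans (sum_H2 n0); apply: ler_sum => i _.
    have kn := n1 i (ltn_ord i); have [L _] := LH2 kn.
    have le w : hc (order_stat Z n i w) (order_stat Z n i.+1 w) ^+ 2 <= H2 i.+1 w.
      have [_] := @h_dom i.+1 w i.+2 kn (or_introl erefl); apply: le_trans.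
      by rewrite -real_normK ?num_real// -[leRHS]real_normK ?num_real// lerXn2r ?nnegrE ?hc_le.
    apply: Ex_le => //; apply: (L1_le _ _ L).
      by apply: measurable_funX; exact: (mgap mhc i.+1 i.+2).
    by move=> w; rewrite ger0_norm ?sqr_ge0.
  have S2 : \sum_(i < n.-2) Ex P (fun w => hc (order_stat Z n i w) (order_stat Z n i.+2 w) ^+ 2) <= B.
    apply: le_trans (sum_H2 n0).
    apply: (@le_trans _ _ (\sum_(i < n.-2) Ex P (H2 i.+1))); last first.
      case: (n.-1) n1 => [|n'] n1; first by rewrite !big_ord0.
      rewrite [leRHS]big_ord_recr/= lerDl; apply: Ex_ge0 => w.
      have [_] := @h_dom n'.+1 w n'.+2 (n1 _ (ltnSn _)) (or_introl erefl).
      by apply: le_trans; exact: sqr_ge0.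
    apply: ler_sum => i _.
    have kn2 : (i.+2 < n)%N by move: (nat_of_ord i) (ltn_ord i) => j; case: (n) => [//|[//|n']].
    have kn := ltnW kn2; have [L _] := LH2 kn.
    have le w : hc (order_stat Z n i w) (order_stat Z n i.+2 w) ^+ 2 <= H2 i.+1 w.
      have [_] := @h_dom i.+1 w i.+3 kn (or_intror (conj erefl kn2)); apply: le_trans.
      by rewrite -real_normK ?num_real// -[leRHS]real_normK ?num_real// lerXn2r ?nnegrE ?hc_le.
    apply: Ex_le => //; apply: (L1_le _ _ L).
      by apply: measurable_funX; exact: (mgap mhc i.+1 i.+3).
    by move=> w; rewrite ger0_norm ?sqr_ge0.
  lra.
have mT f : measurable_fun [set: measurableTypeR R * measurableTypeR R]
    (fun x : measurableTypeR R * measurableTypeR R => f x.1 x.2) ->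
    measurable_fun [set: T] (gap_sum f).
  by move=> mf; apply: measurable_sum => i; exact: (mgap mf i.+1 i.+2).
have Tcb w : `|Tc w| <= n%:R * c.
  apply: le_trans (ler_norm_sum _ _ _) _; apply: (@le_trans _ _ (\sum_(i < n.-1) c)); first exact: ler_sum.
  by rewrite sumr_const card_ord -[leLHS]mulr_natl ler_wpM2r// ler_nat leq_pred.
have LTc : L1 P Tc by apply: (@L1_bounded _ _ _ _ _ (n%:R * c)) => //; exact: mT.
have sTc : sqb P (fun w => Tc w - Ex P Tc) (9 * B).
  split => //; apply: L2B; last exact: L2_cst.
  split; first exact: mT.
  apply: (@L1_bounded _ _ _ _ _ ((n%:R * c) ^+ 2)); first by apply: measurable_funX; exact: mT.
  by move=> w; rewrite normrX lerXn2r ?nnegrE// mulr_ge0.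
have KK := KN0.
have cp : 0 < c by rewrite ltr0n.
have sD : sqb P D (K0 ^+ 4 * (1 + KN)).
  have -> : D = fun w => \sum_(i < n.-1) (h (order_stat Z n i w) (order_stat Z n i.+1 w)
      - hc (order_stat Z n i w) (order_stat Z n i.+1 w)).
    by apply/funext => w; rewrite /D /Tc /gap_sum sumrB.
  apply: (sqb_le (c := (K0 ^+ 4 * (1 + KN)) * (\sum_(i < n.-1) c^-1) ^+ 2)).
    rewrite ler_piMr ?mulr_ge0 ?exprn_ge0 ?addr_ge0//.
    rewrite sumr_const card_ord -mulr_natl exprn_ile1//.
      by rewrite mulr_ge0// invr_ge0 ltW.
    by rewrite ler_pdivrMr// mul1r ler_nat leq_pred.
  apply: (@sqb_sum _ _ _ P (fun i w => h (order_stat Z n i w) (order_stat Z n i.+1 w)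
      - hc (order_stat Z n i w) (order_stat Z n i.+1 w)) (fun=> c^-1)).
    by move=> i _; rewrite invr_gt0.
  move=> i i_n; have kn := n1 i i_n; have [L4 E4] := Ly4 kn.
  apply: (sqb_dom (h := fun w => (K0 ^+ 4 * c^-1 ^+ 2) * y n i.+1 w `^ (4 * r))).
  - by apply: measurable_funB; [exact: (mgap mh i.+1 i.+2)|exact: (mgap mhc i.+1 i.+2)].
  - exact: L1Z.
  - rewrite ExZ// [leRHS]mulrAC; apply: ler_wpM2l => //.
    by apply: mulr_ge0; [exact: exprn_ge0|exact: sqr_ge0].
  - move=> w; have [hd _] := @h_dom i.+1 w i.+2 kn (or_introl erefl).
    rewrite mulrAC exprVn ler_pdivlMr ?exprn_gt0// mulrC.
    apply: le_trans (hc_diff _ _) _.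
    have -> : y n i.+1 w `^ (4 * r) = (y n i.+1 w `^ r) ^+ 4.
      by rewrite -powR_mulrn ?powR_ge0// -powRrM mulrC.
    rewrite -exprMn -(@ger0_norm _ (_ ^+ 4)) ?exprn_even_ge0// normrX lerXn2r ?nnegrE//.
    by rewrite mulr_ge0 ?powR_ge0.
have [LD ED] := sD.
have ED1 : Ex P D ^+ 2 <= K0 ^+ 4 * (1 + KN) by apply: le_trans ED; exact: Ex_sqr_le.
have LDc := L2_L1 LD.
have LT : L1 P (gap_sum h).
  have := L1D LTc LDc; rewrite (_ : (fun w => Tc w + D w) = gap_sum h)//.
  by apply/funext => w; rewrite /D addrC subrK.
have eT : Ex P (gap_sum h) = Ex P Tc + Ex P D.
  by rewrite -ExD//; congr (Ex _ _); apply/funext => w; rewrite /D addrC subrK.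
have sDD : sqb P (fun w => D w - Ex P D) (4 * (K0 ^+ 4 * (1 + KN))).
  have := sqbB sD (_ : sqb P (fun=> Ex P D) (K0 ^+ 4 * (1 + KN))).
  move=> /(_ (conj (L2_cst P _) _)); rewrite Ex_cst => /(_ ED1); apply: sqb_le.
  by lra.
have := sqbD sTc sDD; rewrite (_ : (fun w => _ + _) = (fun w => gap_sum h w - Ex P (gap_sum h))).
  by apply: sqb_le; lra.
by apply/funext => w; rewrite eT /D; ring.
Qed.

End remainder.

Lemma spacing_remainder : exists2 K : R, 0 <= K &
  forall n (h : R -> R -> R) (W : measurableTypeR R -> R) (K0 ep la : R),
  0 < ep -> 0 < la -> 0 <= K0 ->
  measurable_fun [set: measurableTypeR R * measurableTypeR R]
    (fun x : measurableTypeR R * measurableTypeR R => h x.1 x.2) ->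
  measurable_fun [set: measurableTypeR R] W -> (forall z, 0 <= W z <= 1) ->
  (forall z z' : R, 0 <= z -> z <= z' ->
    `|h z z'| <= K0 * (n%:R * expR (- z) * (z' - z)) `^ r) ->
  (forall z z' : R, 0 <= z -> z <= z' -> h z z' ^+ 2 <=
    K0 * (n%:R * expR (- z) * (z' - z)) `^ (2 * r) * (W z + Num.min 1 ((z' - z) / ep))) ->
  sqb P (fun w => gap_sum n h w - Ex P (gap_sum n h))
    (18 * (K0 * (n%:R * (la * (1 + K)) + 2 / la * (n%:R * Ex expo W + 3 * harm R n / ep)))
     + 8 * (K0 ^+ 4 * (1 + K))).
Proof.
have [K K_ge0 hK] := y_moment (Num.truncn (4 * r)).
exists K => // n h W K0 ep la ep0 la0 K00 mh mW W01 hb hb2.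
apply: (remainder_bound ep0 la0 K00 mh mW W01 hb hb2 _ K_ge0 (hK n)).
by rewrite ltW// Num.Theory.truncnS_gt// mulr_ge0// ltW.
Qed.

End ordered_sample.

Lemma tail_int0 (R : realType) (phi : measurableTypeR R -> R) (C : R) :
  measurable_fun [set: measurableTypeR R] phi -> (forall z, `|phi z| <= C) ->
  tail_int phi 0 = Ex (expo R) phi.
Proof.
move=> mphi phiC; rewrite /tail_int /Ex /Rintegral; congr fine.
have m0 : measurable_fun [set: measurableTypeR R] (fun x : measurableTypeR R => (0 < x)%R%:R : R).
  rewrite [X in measurable_fun _ X](_ : _ = (fun y : R => if 0 < y then 1 else 0)); last first.
    by apply/funext => u; case: (0 < u).
  by apply: measurable_fun_ifT => //; apply: measurable_fun_ltr.
apply: ae_eq_integral => //.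
- by apply/measurable_EFinP; exact: measurable_funM.
- exact/measurable_EFinP.
exists (~` `]0, +oo[%classic); split => //.
- exact: measurableC.
- have /= -> := @probability_setC _ _ _ (expo R) `]0, +oo[%classic ltac:(exact: measurable_itv).
  by rewrite expo_ray// oppr0 expR0 subee.
- by move=> x /= h x0; apply: h => _; move: x0; rewrite in_itv/= andbT => ->; rewrite mulr1.
Qed.

(** * The limit theorem for exponential samples *)

Section local_ratio.
Context (R : realType).
Local Notation expo := (expo R).
Variables (r mG MG : R) (Gh k0 : R -> R).
Hypothesis r0 : 0 < r.
Hypothesis mG0 : 0 < mG.
Hypothesis mGh : measurable_fun [set: measurableTypeR R] Gh.
Hypothesis mk0 : measurable_fun [set: measurableTypeR R] k0.
Hypothesis GhB : forall z z', 0 <= z -> z <= z' ->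
  mG * (expR (- z) - expR (- z')) <= Gh z' - Gh z <= MG * (expR (- z) - expR (- z')).
Hypothesis k0B : forall z, mG <= k0 z <= MG.

(** [Gh] stands for G o F^-1 in the exponential coordinate and [k0] for g / f there. As exp(- z) has
    slope - exp(- z), this quotient tends to [k0] at small steps. Negative arguments are moved to 0
    so that the bounds hold everywhere. *)
Definition ratio (z s : R) : R :=
  expR (Num.max z 0) * (Gh (Num.max z 0 + s) - Gh (Num.max z 0)) / s.

Let MG0 : 0 < MG.
Proof. by have /andP[a b] := k0B 0; rewrite (lt_le_trans mG0)// (le_trans a b). Qed.

Let max0 (z : R) : 0 <= Num.max z 0.
Proof. by rewrite le_max lexx orbT. Qed.

Lemma expRN_half s : 0 <= s <= 1 -> expR (- s) <= 1 - s / 2 :> R.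
Proof.
move=> /andP[s0 s1]; rewrite expRN -[leRHS]invrK lef_pV2 ?posrE ?expR_gt0//; last first.
  by rewrite invr_gt0; lra.
apply: le_trans (expR_ge1Dx s); rewrite -[leLHS]mul1r ler_pdivrMr; last by lra.
have : 0 <= s * (1 - s) by apply: mulr_ge0; lra.
by move=> ss; nra.
Qed.

Lemma expRN_ge s : 1 - s <= expR (- s) :> R.
Proof. exact: expR_ge1Dx. Qed.

Let incr z s : 0 <= z -> 0 <= s ->
  mG * (1 - expR (- s)) <= expR z * (Gh (z + s) - Gh z) <= MG * (1 - expR (- s)).
Proof.
move=> z0 s0; have /andP[h1 h2] := @GhB z (z + s) z0 ltac:(by rewrite lerDl).
have e0 : 1 - expR (- s) = expR z * (expR (- z) - expR (- (z + s))).
  by rewrite mulrBr -!expRD subrr expR0; congr (_ - expR _); ring.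
by rewrite e0 !(mulrCA _ (expR z)) !ler_pM2l ?expR_gt0// h1 h2.
Qed.

Lemma ratio_ge0 z s : 0 < s -> 0 <= ratio z s.
Proof.
move=> s0; have /andP[h _] := incr (max0 z) (ltW s0).
rewrite divr_ge0 ?(ltW s0)//; apply: le_trans h; rewrite mulr_ge0 ?(ltW mG0)//.
by rewrite subr_ge0 -[leRHS]expR0 ler_expR oppr_le0 ltW.
Qed.

Lemma ratio_le z s : 0 < s -> ratio z s <= MG.
Proof.
move=> s0; have /andP[_ h] := incr (max0 z) (ltW s0).
rewrite ler_pdivrMr//; apply: le_trans h _; rewrite ler_pM2l//.
by have := expRN_ge s; lra.
Qed.

Lemma ratio_ge z s : 0 < s <= 1 -> mG / 2 <= ratio z s.
Proof.
move=> /andP[s0 s1]; have /andP[h _] := incr (max0 z) (ltW s0).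
rewrite ler_pdivlMr//; apply: le_trans _ h; rewrite -mulrA ler_pM2l//.
by have := @expRN_half s ltac:(by rewrite s1 ltW); lra.
Qed.

Lemma measurable_ratio s : measurable_fun [set: measurableTypeR R] (ratio^~ s).
Proof.
have mm : measurable_fun [set: measurableTypeR R] (fun z : R => Num.max z 0).
  by apply: measurable_maxr; [exact: measurable_id|exact: measurable_cst].
apply: measurable_funM; last exact: measurable_cst.
apply: measurable_funM; first exact: measurableT_comp.
apply: measurable_funB; last exact: (measurableT_comp mGh).
apply: (measurableT_comp mGh); apply: measurable_funD => //.
Qed.

(** At a fixed step the quotient inherits the regularity of [Gh], whereas its limit [k0] may be
    discontinuous; the constant explodes with 1 / s, harmlessly since the step is fixed before n
    grows. *)
Lemma ratio_lipschitz s x y : 0 < s <= 1 -> 0 <= x -> 0 <= y ->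
  `|ratio x s - ratio y s| <= 3 * MG / s * `|x - y|.
Proof.
move=> /andP[s0 s1].
wlog xy : x y / x <= y => [H x0 y0|x0 y0].
  have [xy|/ltW yx] := leP x y; first exact: H.
  by rewrite distrC (distrC x); exact: H.
rewrite /ratio !(max_idPl _)//.
rewrite (_ : _ - _ = (expR x * (Gh (x + s) - Gh x) - expR y * (Gh (y + s) - Gh y)) / s); last by field; lra.
rewrite normrM (gtr0_norm (x := s^-1)) ?invr_gt0// [leRHS]mulrAC ler_pM2r ?invr_gt0//.
rewrite (ler0_norm (x := x - y)) ?subr_le0// opprB.
have dxy : expR (- (y - x)) = expR x * expR (- y).
  by rewrite -expRD; congr expR; ring.
have /andP[a1 a2] := GhB x0 xy.
have /andP[b1 b2] := @GhB (x + s) (y + s) ltac:(lra) ltac:(lra).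
have /andP[c1 c2] := incr y0 (ltW s0).
have ex := expR_gt0 x; have ey := expR_gt0 y.
have q1 := expRN_ge (y - x).
have q2 := expRN_ge s.
set u := Gh (x + s) - Gh x; set u' := Gh (y + s) - Gh y.
have xs : expR (- (x + s)) - expR (- (y + s)) <= expR (- x) - expR (- y).
  rewrite !opprD !expRD -mulrBl ler_piMr//; first by rewrite subr_ge0 ler_expR lerN2.
  by rewrite -[leRHS]expR0 ler_expR oppr_le0 ltW.
have exx : expR x * expR (- x) = 1 by rewrite -expRD subrr expR0.
have eyy : expR y * expR (- y) = 1 by rewrite -expRD subrr expR0.
have e3 : 0 <= expR (- x) - expR (- y) by rewrite subr_ge0 ler_expR lerN2.
have e3' : 0 <= expR (- (x + s)) - expR (- (y + s)) by rewrite subr_ge0 ler_expR lerN2 lerD2r.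
have mg := ltW mG0; have Mg := ltW MG0.
have D1 : `|u - u'| <= MG * (expR (- x) - expR (- y)).
  have p1 : 0 <= mG * (expR (- x) - expR (- y)) by exact: mulr_ge0.
  have p2 : 0 <= mG * (expR (- (x + s)) - expR (- (y + s))) by exact: mulr_ge0.
  have p3 : MG * (expR (- (x + s)) - expR (- (y + s))) <= MG * (expR (- x) - expR (- y)).
    by rewrite ler_pM2l.
  by rewrite ler_norml /u /u'; apply/andP; split; lra.
have D2 : expR x * `|u - u'| <= MG * (y - x).
  apply: (le_trans (y := expR x * (MG * (expR (- x) - expR (- y))))); first by rewrite ler_pM2l.
  rewrite mulrCA mulrBr exx -dxy ler_pM2l//; lra.
have u'0 : 0 <= expR y * u'.
  apply: le_trans c1; rewrite mulr_ge0//.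
  by rewrite subr_ge0 -[leRHS]expR0 ler_expR oppr_le0 ltW.
have u'1 : expR y * u' <= MG.
  apply: le_trans c2 _; rewrite -[leRHS]mulr1 ler_pM2l//; have := expR_gt0 (- s); lra.
have D3 : expR y * u' - expR x * u' = (1 - expR (- (y - x))) * (expR y * u').
  by rewrite dxy mulrBl mul1r -mulrA (mulrA (expR (- y))) (mulrC (expR (- y))) eyy mul1r.
rewrite (_ : _ - _ = expR x * (u - u') - (expR y * u' - expR x * u')); last by ring.
apply: le_trans (ler_normB _ _) _.
rewrite normrM (gtr0_norm ex) D3.
have z0 : 0 <= 1 - expR (- (y - x)).
  by rewrite subr_ge0 -[leRHS]expR0 ler_expR oppr_le0 subr_ge0.
rewrite [X in _ + X]ger0_norm; last exact: mulr_ge0.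
have : (1 - expR (- (y - x))) * (expR y * u') <= (y - x) * MG.
  by apply: ler_pM => //; lra.
have : 0 <= MG * (y - x) by apply: mulr_ge0 => //; lra.
by move=> w1 w2; lra.
Qed.

(** The derivative r z^(r-1) is monotone, increasing or decreasing according to r >= 1 or not; the
    sum of its two endpoint values covers both cases. *)
Lemma powR_lipschitz (a b : R) : 0 < a -> exists2 L : R, 0 <= L &
  forall x y, a <= x <= b -> a <= y <= b -> `|x `^ r - y `^ r| <= L * `|x - y|.
Proof.
move=> a0; have pw := @powR_ge0 R.
exists (r * (a `^ (r - 1) + b `^ (r - 1))).
  by rewrite mulr_ge0 ?(ltW r0)// addr_ge0.
move=> x y.
wlog xy : x y / x <= y => [H hx hy|/andP[ax xb] /andP[ay yb]].
  have [xy|/ltW yx] := leP x y; first exact: H.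
  by rewrite distrC (distrC x); exact: H.
rewrite distrC (distrC x) [X in _ * X]ger0_norm ?subr_ge0//.
apply: (@mvt_bound _ (fun z => z `^ r) (fun z => r * z `^ (r - 1)) x y _ xy) => z /andP[xz zy].
  by apply: is_derive1_powR; lra.
rewrite ger0_norm; last by rewrite mulr_ge0 ?(ltW r0).
rewrite ler_pM2l//.
have [r1|r1] := leP 1 r.
  have : z `^ (r - 1) <= b `^ (r - 1) by apply: ge0_ler_powR; rewrite ?nnegrE; lra.
  by have := pw a (r - 1); lra.
have : z `^ (r - 1) <= a `^ (r - 1).
  rewrite -(opprB 1) !powRN lef_pV2 ?posrE ?powR_gt0//; try lra.
  by apply: ge0_ler_powR; rewrite ?nnegrE; lra.
by have := pw b (r - 1); lra.
Qed.

(** Enumerates the rationals of ]0, 1], with 1 as default. *)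
Definition unit_rat (m : nat) : R :=
  if unpickle m is Some q then if 0 < (ratr q : R) <= 1 then ratr q else 1 else 1.

Lemma unit_rat_gt0 m : 0 < unit_rat m <= 1.
Proof. by rewrite /unit_rat; case: unpickle => [q|]; rewrite ?ltr01 ?lexx//; case: ifP => //; rewrite ltr01 lexx. Qed.

Lemma unit_rat_dense (x y : R) : 0 <= x -> x < y -> y <= 1 -> exists m, x < unit_rat m < y.
Proof.
move=> x0 xy y1; have [q] := rat_in_itvoo xy; rewrite in_itv/= => /andP[xq qy].
exists (pickle q); rewrite /unit_rat pickleK ifT ?xq//.
by rewrite (le_lt_trans x0 xq) (le_trans (ltW qy)).
Qed.

(* A supremum over rational steps, so that measurability is immediate; it
   bounds all steps in ]0, ep] because [ratio] is continuous in the step. *)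
Definition osc ep (z : R) : R :=
  sups (fun m => `|ratio z (ep * unit_rat m) - k0 z| / MG) 0.

Let dev ep m z := `|ratio z (ep * unit_rat m) - k0 z| / MG.

Let dev_le1 ep m z : 0 < ep -> 0 <= dev ep m z <= 1.
Proof.
move=> ep0; have /andP[u0 u1] := unit_rat_gt0 m.
have eu : 0 < ep * unit_rat m by rewrite mulr_gt0.
rewrite divr_ge0 ?(ltW MG0)//= ler_pdivrMr// mul1r.
have a1 := ratio_ge0 z eu; have a2 := ratio_le z eu.
have /andP[b1 b2] := k0B z; have m0 := mG0.
by rewrite ler_norml; apply/andP; split; lra.
Qed.

Let osc_sup ep z : 0 < ep -> has_sup (sdrop (fun m => dev ep m z) 0).
Proof.
move=> ep0; split; first by exists (dev ep 0 z); exists 0%N.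
by exists 1 => _ [m _ <-]; have /andP[] := dev_le1 m z ep0.
Qed.

Let dev_le_osc ep m z : 0 < ep -> dev ep m z <= osc ep z.
Proof. by move=> ep0; apply: ub_le_sup; [exact: (osc_sup z ep0).2|exists m]. Qed.

Lemma osc01 ep z : 0 < ep -> 0 <= osc ep z <= 1.
Proof.
move=> ep0; rewrite (le_trans _ (dev_le_osc 0 z ep0)) ?divr_ge0 ?(ltW MG0)//=.
apply: ge_sup; first exact: (osc_sup z ep0).1.
by move=> _ [m _ <-]; have /andP[] := dev_le1 m z ep0.
Qed.

Lemma measurable_osc ep : 0 < ep -> measurable_fun [set: measurableTypeR R] (osc ep).
Proof.
move=> ep0; apply: measurable_fun_sups.
  by move=> z _; exists 1 => _ [m _ <-]; have /andP[] := dev_le1 m z ep0.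
move=> m; apply: measurable_funM; last exact: measurable_cst.
apply: measurableT_comp => //; apply: measurable_funB => //; exact: measurable_ratio.
Qed.

Lemma ratio_step z s t : 0 < s -> 0 < t -> `|ratio z s - ratio z t| <= 2 * MG / s * `|s - t|.
Proof.
move=> s0 t0; have t0' := ltW t0; have s0' := ltW s0.
have t1 := ratio_ge0 z t0; have t2 := ratio_le z t0.
pose B u := expR (Num.max z 0) * (Gh (Num.max z 0 + u) - Gh (Num.max z 0)).
have B1 : `|B s - B t| <= MG * `|s - t|.
  suff H a b : 0 <= a -> a <= b -> 0 <= B b - B a <= MG * (b - a).
    have [st|/ltW ts] := leP s t.
      rewrite distrC (distrC s) [X in _ * X]ger0_norm ?subr_ge0//.
      by have /andP[h1 h2] := H _ _ s0' st; rewrite ger0_norm.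
    rewrite [X in _ * X]ger0_norm ?subr_ge0//.
    by have /andP[h1 h2] := H _ _ t0' ts; rewrite ger0_norm.
  move=> a0 ab; rewrite /B -mulrBr opprB addrA subrK.
  have := @GhB (Num.max z 0 + a) (Num.max z 0 + b) (addr_ge0 (max0 z) a0).
  rewrite lerD2l => /(_ ab) /andP[h1 h2].
  have e1 : expR (- (Num.max z 0 + a)) = expR (- (Num.max z 0)) * expR (- a) by rewrite -expRD opprD.
  have e2 : expR (- (Num.max z 0 + b)) = expR (- (Num.max z 0)) * expR (- a) * expR (- (b - a)).
    by rewrite -!expRD; congr expR; ring.
  have q := expRN_ge (b - a).
  have pa : 0 < expR (- (Num.max z 0)) * expR (- a) by rewrite mulr_gt0 ?expR_gt0.
  have ba : expR (- (b - a)) <= 1 by rewrite -[leRHS]expR0 ler_expR oppr_le0 subr_ge0.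
  apply/andP; split.
    apply: mulr_ge0; first exact: expR_ge0.
    apply: le_trans h1; rewrite mulr_ge0 ?(ltW mG0)// e1 e2 subr_ge0.
    by rewrite ler_piMr// ltW.
  apply: (le_trans (y := expR (Num.max z 0) * (MG * (expR (- (Num.max z 0 + a)) - expR (- (Num.max z 0 + b)))))).
    by rewrite ler_pM2l ?expR_gt0.
  rewrite mulrCA ler_pM2l// e1 e2 -{1}[_ * expR (- a)]mulr1 -mulrBr !mulrA -expRD subrr expR0 mul1r.
  apply: (le_trans (y := 1 * (1 - expR (- (b - a))))); last by lra.
  apply: ler_wpM2r; first by lra.
  by rewrite -[leRHS]expR0 ler_expR oppr_le0.
have -> : ratio z s - ratio z t = (B s - B t - ratio z t * (s - t)) / s.
  by rewrite /ratio -/(B t) -/(B s); field; lra.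
rewrite normrM (gtr0_norm (x := s^-1)) ?invr_gt0// [leRHS]mulrAC ler_pM2r ?invr_gt0//.
apply: le_trans (ler_normB _ _) _; rewrite normrM (ger0_norm t1).
have := ler_wpM2r (normr_ge0 (s - t)) t2; lra.
Qed.

Lemma ratio_osc ep z s : 0 < s -> s <= ep -> `|ratio z s - k0 z| <= MG * osc ep z.
Proof.
move=> s0 sep; have ep0 := lt_le_trans s0 sep.
apply/ler_addgt0Pr => e e0.
(* Chosen so that a change of the step by [c] moves the quotient by at most [e] in [ratio_step]. *)
pose c := e * s / (2 * MG).
have c0 : 0 < c by rewrite divr_gt0 ?mulr_gt0.
have [m /andP[m1 m2]] : exists m, Num.max 0 (s - c) < ep * unit_rat m < s.
  have [] := @unit_rat_dense (Num.max 0 (s - c) / ep) (s / ep).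
  - by rewrite divr_ge0 ?(ltW ep0)// le_max lexx.
  - by rewrite ltr_pM2r ?invr_gt0// gt_max s0/=; lra.
  - by rewrite ler_pdivrMr// mul1r.
  move=> m; rewrite ltr_pdivrMr// ltr_pdivlMr// => /andP[h1 h2].
  by exists m; rewrite (mulrC ep) h1 h2.
move: m1; rewrite gt_max => /andP[m0 m1].
rewrite -(subrK (ratio z (ep * unit_rat m)) (ratio z s)) -addrA addrC.
apply: le_trans (ler_normD _ _) _; apply: lerD.
  by have := dev_le_osc m z ep0; rewrite /dev ler_pdivrMr// (mulrC MG).
apply: le_trans (ratio_step z s0 m0) _.
rewrite (ger0_norm (x := s - _)); last by lra.
have -> : e = 2 * MG / s * c by rewrite /c; field; rewrite !gt_eqF.
by rewrite ler_pM2l; [lra|rewrite divr_gt0 ?mulr_gt0].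
Qed.

Hypothesis ratio_lim : {ae expo, forall z, forall e, 0 < e ->
  exists2 c, 0 < c & forall s, 0 < s < c -> `|ratio z s - k0 z| <= e}.

(** Dominated convergence along the steps 1 / (n + 1): the oscillation is at most 1 and tends to 0
    wherever the quotient converges. *)
Lemma Ex_osc_small e : 0 < e -> exists2 ep, 0 < ep <= 1 & Ex expo (osc ep) <= e.
Proof.
move=> e0; pose s (n : nat) : R := n.+1%:R^-1.
have s0 n : 0 < s n by rewrite invr_gt0.
have i1 : expo.-integrable [set: measurableTypeR R] (EFin \o fun=> 1) by exact: L1_cst.
have L1o n : L1 expo (osc (s n)).
  apply: (@L1_bounded _ _ _ _ _ 1); first exact: measurable_osc.
  by move=> z; have /andP[a b] := osc01 z (s0 n); rewrite ger0_norm.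
have lim0 : \forall z \ae expo, [set: measurableTypeR R] z ->
    ((osc (s n) z)%:E @[n --> \oo] --> 0%E).
  apply: (@filterS _ _ (ae_filter_ringOfSetsType expo) _ _ _ ratio_lim) => z hz _; apply: cvg_EFin; first by apply: nearW.
  apply/cvgrPdist_le => e1 e10; have [c c0 hc] := hz (MG * e1) (mulr_gt0 MG0 e10).
  have [N hN] : exists N : nat, c^-1 < N%:R.
    by exists (Num.truncn c^-1).+1; rewrite truncnS_gt// ltW// invr_gt0.
  exists N => // n /= Nn; rewrite sub0r normrN ger0_norm ?(andP (osc01 z (s0 n))).1//.
  have sc : s n < c.
    rewrite -[c]invrK ltf_pV2 ?posrE ?invr_gt0//.
    by apply: lt_le_trans hN _; rewrite ler_nat (leq_trans Nn).
  apply: ge_sup; first exact: (osc_sup z (s0 n)).1.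
  move=> _ [m _ <-]; rewrite ler_pdivrMr// (mulrC e1).
  have /andP[u0 u1] := unit_rat_gt0 m.
  apply: hc; rewrite mulr_gt0//= (le_lt_trans _ sc)// ler_piMr// ltW//.
have dom : \forall z \ae expo, forall n : nat, [set: measurableTypeR R] z ->
    (`|(osc (s n) z)%:E| <= 1)%E.
  by apply: aeW => z n _; have /andP[a b] := osc01 z (s0 n); rewrite /= lee_fin ger0_norm.
have [_ _] := dominated_convergence (measurableT : measurable [set: measurableTypeR R])
  (fun n => (measurable_EFinP _ _).2 (measurable_osc (s0 n))) (measurable_cst 0%E) lim0 i1 dom.
rewrite integral0 => h.
have /cvgrPdist_le/(_ _ e0) [N _ hN] : Ex expo (osc (s n)) @[n --> \oo] --> 0.
  apply: fine_cvg.
  by apply: cvg_trans h; apply: near_eq_cvg; apply: nearW => n /=; rewrite -(EFin_Ex (L1o n)).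
exists (s N); first by rewrite s0 /s invf_le1// ler1n.
by have := hN N (leqnn N); rewrite sub0r normrN; apply: le_trans; exact: ler_norm.
Qed.

(** The Lipschitz function phi of the smooth sum. *)
Definition locpow ep (z : R) : R := ratio z ep `^ r.

Lemma measurable_locpow ep : measurable_fun [set: measurableTypeR R] (locpow ep).
Proof. by apply: (measurableT_comp (measurable_powR r)); exact: measurable_ratio. Qed.

Lemma locpow_le ep z : 0 < ep -> `|locpow ep z| <= MG `^ r.
Proof.
move=> ep0; rewrite ger0_norm ?powR_ge0//.
by apply: ge0_ler_powR; rewrite ?nnegrE ?(ltW r0) ?(ltW MG0) ?ratio_ge0 ?ratio_le.
Qed.

Lemma locpow_lipschitz ep : 0 < ep <= 1 -> exists2 L : R, 0 <= L &
  forall x y, 0 <= x -> 0 <= y -> `|locpow ep x - locpow ep y| <= L * `|x - y|.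
Proof.
move=> ep01; have /andP[ep0 ep1] := ep01.
have [L L0 hL] := @powR_lipschitz (mG / 2) MG ltac:(by rewrite divr_gt0).
exists (L * (3 * MG / ep)).
  by apply: mulr_ge0 => //; rewrite divr_ge0 ?mulr_ge0 ?(ltW MG0) ?(ltW ep0).
move=> x y x0 y0; apply: (le_trans (hL _ _ _ _)); rewrite ?ratio_ge ?ratio_le//.
by rewrite -mulrA ler_wpM2l//; exact: ratio_lipschitz.
Qed.

Lemma locpow_osc : exists2 L : R, 0 <= L &
  forall ep z s, 0 < s -> s <= ep -> ep <= 1 ->
    `|locpow s z - k0 z `^ r| <= L * osc ep z.
Proof.
have [L L0 hL] := @powR_lipschitz (mG / 2) MG ltac:(by rewrite divr_gt0).
exists (L * MG) => [|ep z s s0 sep ep1]; first by rewrite mulr_ge0 ?(ltW MG0).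
have /andP[a b] := k0B z.
have m0 := mG0.
apply: (le_trans (hL _ _ _ _)); rewrite ?ratio_ge ?ratio_le ?s0 ?(le_trans sep)//.
  by apply/andP; split => //; lra.
by rewrite -mulrA ler_wpM2l//; exact: ratio_osc.
Qed.

(** The summand [h] of the remainder: a true term minus its smooth version. *)
Definition gap_dev n ep (z z' : R) : R :=
  (n%:R * (Gh z' - Gh z)) `^ r - locpow ep z * (n%:R * expR (- z) * (z' - z)) `^ r.

Lemma measurable_gap_dev n ep :
  measurable_fun [set: measurableTypeR R * measurableTypeR R]
    (fun x : measurableTypeR R * measurableTypeR R => gap_dev n ep x.1 x.2).
Proof.
have m1 : measurable_fun [set: measurableTypeR R * measurableTypeR R]
  (fun x : measurableTypeR R * measurableTypeR R => x.1 : measurableTypeR R) by exact: measurable_fst.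
have m2 : measurable_fun [set: measurableTypeR R * measurableTypeR R]
  (fun x : measurableTypeR R * measurableTypeR R => x.2 : measurableTypeR R) by exact: measurable_snd.
apply: measurable_funB.
  apply: (measurableT_comp (measurable_powR r)); apply: measurable_funM => //.
  by apply: measurable_funB; [exact: (measurableT_comp mGh m2)|exact: (measurableT_comp mGh m1)].
apply: measurable_funM; first exact: (measurableT_comp (measurable_locpow ep) m1).
apply: (measurableT_comp (measurable_powR r)); apply: measurable_funM; last exact: measurable_funB.
apply: measurable_funM => //; apply: (measurableT_comp (@measurable_expR R)).
exact: measurableT_comp.
Qed.

(** The true term is exactly the smooth one with the quotient taken at the actual spacing [s], so
    the error only compares the quotient at two steps. *)
Let gap_devE n ep z s : 0 <= z -> 0 < s ->
  gap_dev n ep z (z + s) = (n%:R * expR (- z) * s) `^ r * (locpow s z - locpow ep z).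
Proof.
move=> z0 s0; have ns : 0 <= n%:R * expR (- z) * s.
  by rewrite !mulr_ge0 ?expR_ge0 ?(ltW s0).
rewrite /gap_dev (addrC z) addrK [RHS]mulrBr; congr (_ - _); last exact: mulrC.
rewrite /locpow -powRM//; last exact: ratio_ge0.
congr (_ `^ r); rewrite /ratio (max_idPl _)// (addrC s).
have := expRxMexpNx_1 z.
move: (expR z) (expR (- z)) => a b ab.
rewrite [RHS](_ : _ = n%:R * ((a * b) * (Gh (z + s) - Gh z))); last by field; lra.
by rewrite ab mul1r.
Qed.

(** Spacings of length at most [ep] are governed by the oscillation; longer ones are rare and are
    charged to the minimum, which is then 1. *)
Lemma gap_dev_bounds : exists2 K0 : R, 0 <= K0 & forall n ep, 0 < ep <= 1 ->
  (forall z z' : R, 0 <= z -> z <= z' ->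
    `|gap_dev n ep z z'| <= K0 * (n%:R * expR (- z) * (z' - z)) `^ r) /\
  (forall z z' : R, 0 <= z -> z <= z' -> gap_dev n ep z z' ^+ 2 <=
    K0 * (n%:R * expR (- z) * (z' - z)) `^ (2 * r) * (osc ep z + Num.min 1 ((z' - z) / ep))).
Proof.
have [L L0 hL] := locpow_osc.
pose M := MG `^ r; have M0 : 0 <= M by exact: powR_ge0.
exists (M + 4 * L ^+ 2 + M ^+ 2).
  by have := sqr_ge0 L; have := sqr_ge0 M; lra.
have l2 := sqr_ge0 L; have m2 := sqr_ge0 M.
move=> n ep /andP[ep0 ep1].
have dM s z : 0 < s -> `|locpow s z - locpow ep z| <= M.
  move=> s0; have := locpow_le z s0; have := locpow_le z ep0.
  have a0 : 0 <= locpow ep z by exact: powR_ge0.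
  have b0 : 0 <= locpow s z by exact: powR_ge0.
  rewrite (ger0_norm a0) (ger0_norm b0) => a b.
  by rewrite ler_norml; apply/andP; split; rewrite /M; lra.
split => z z' z0 zz'.
  have := zz'; rewrite le_eqVlt => /predU1P[<-|lt].
    by rewrite /gap_dev !subrr !mulr0 powR0 ?gt_eqF// mulr0 subrr normr0 mulr0.
  rewrite -(subrK z z') (addrC (z' - z)) gap_devE ?subr_gt0// normrM ger0_norm ?powR_ge0//.
  rewrite (addrC z) addrK mulrC ler_wpM2r ?powR_ge0//.
  by rewrite (le_trans (dM _ _ _)) ?subr_gt0//; lra.
have := zz'; rewrite le_eqVlt => /predU1P[<-|lt].
  rewrite /gap_dev !subrr !mulr0 !powR0 ?gt_eqF ?mulr_gt0//.
  by rewrite !mulr0 subrr expr0n mul0r.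
have /andP[q0 q1] := osc01 z ep0.
have s0 : 0 < z' - z by rewrite subr_gt0.
rewrite -{1}(subrK z z') (addrC (z' - z)) gap_devE// exprMn.
rewrite -(@powR_mulrn _ (_ `^ r) 2) ?powR_ge0// -powRrM (mulrC r).
rewrite (mulrC (M + _ + _)) -[leRHS]mulrA ler_wpM2l ?powR_ge0//.
have [sep|sep] := leP (z' - z) ep.
  have D : `|locpow (z' - z) z - locpow ep z| <= 2 * L * osc ep z.
    have h1 := hL ep z _ s0 sep ep1; have h2 := hL ep z _ ep0 (lexx ep) ep1.
    rewrite (_ : _ - _ = (locpow (z' - z) z - k0 z `^ r) - (locpow ep z - k0 z `^ r)); last by ring.
    by apply: le_trans (ler_normB _ _) _; lra.
  have m0 : 0 <= Num.min 1 ((z' - z) / ep) by rewrite le_min ler01 divr_ge0// ltW.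
  rewrite -real_normK ?num_real//.
  apply: (le_trans (y := (2 * L * osc ep z) ^+ 2)); first by rewrite lerXn2r ?nnegrE ?(le_trans _ D).
  rewrite !exprMn.
  have : osc ep z ^+ 2 <= osc ep z by rewrite expr2 ler_piMr.
  have : 0 <= (M + M ^+ 2) * osc ep z by apply: mulr_ge0 => //; lra.
  have : 0 <= (M + 4 * L ^+ 2 + M ^+ 2) * Num.min 1 ((z' - z) / ep) by apply: mulr_ge0 => //; lra.
  move: (osc ep z ^+ 2) (Num.min _ _) => a b h1 h2 h3.
  have : L ^+ 2 * a <= L ^+ 2 * osc ep z by rewrite ler_wpM2l.
  by rewrite !mulrDr !mulrDl in h1 h2 *; nra.
rewrite (min_idPl _); last by rewrite ler_pdivlMr// mul1r ltW.
rewrite -real_normK ?num_real//.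
apply: (le_trans (y := M ^+ 2)); first by rewrite lerXn2r ?nnegrE ?dM.
have : 0 <= (M + 4 * L ^+ 2 + M ^+ 2) * osc ep z by apply: mulr_ge0 => //; lra.
by rewrite mulrDr; lra.
Qed.

Definition density_limvar : R :=
  w_coef r * Ex expo (fun z => k0 z `^ (2 * r)) - t_coef r ^+ 2 * Ex expo (fun z => k0 z `^ r) ^+ 2.

Lemma limvar_locpow : exists2 K : R, 0 <= K & forall ep, 0 < ep <= 1 ->
  `|limvar r (locpow ep) - density_limvar| <= K * Ex expo (osc ep).
Proof.
have [L L0 hL] := locpow_osc.
pose M := MG `^ r; have M0 : 0 <= M by exact: powR_ge0.
have k0_ge0 z : 0 <= k0 z by have /andP[a b] := k0B z; have m0 := mG0; lra.
have kM z : k0 z `^ r <= M.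
  by apply: ge0_ler_powR; rewrite ?nnegrE ?(ltW r0) ?(ltW MG0)//; have /andP[] := k0B z.
have kr0 z : 0 <= k0 z `^ r by exact: powR_ge0.
have mk : measurable_fun [set: measurableTypeR R] (fun z => k0 z `^ r) by exact: (measurableT_comp (measurable_powR r)).
have Lk : L1 expo (fun z => k0 z `^ r).
  by apply: (@L1_bounded _ _ _ _ _ M) => // z; rewrite ger0_norm.
have Lk2 : L1 expo (fun z => (k0 z `^ r) ^+ 2).
  apply: (@L1_bounded _ _ _ _ _ (M ^+ 2)) => [|z]; first exact: measurable_funX.
  by rewrite ger0_norm ?sqr_ge0// lerXn2r ?nnegrE.
exists (`|w_coef r| * (2 * M * L) + t_coef r ^+ 2 * (2 * M * L)).
  by apply: addr_ge0; apply: mulr_ge0; rewrite ?normr_ge0 ?sqr_ge0// mulr_ge0// mulr_ge0.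
move=> ep ep01; have /andP[ep0 ep1] := ep01.
have mp := measurable_locpow ep.
have p0 z : 0 <= locpow ep z by exact: powR_ge0.
have pM z : locpow ep z <= M by have := locpow_le z ep0; rewrite ger0_norm.
have Lp : L1 expo (locpow ep).
  by apply: (@L1_bounded _ _ _ _ _ M) => // z; rewrite ger0_norm.
have Lp2 : L1 expo (fun z => locpow ep z ^+ 2).
  apply: (@L1_bounded _ _ _ _ _ (M ^+ 2)) => [|z]; first exact: measurable_funX.
  by rewrite ger0_norm ?sqr_ge0// lerXn2r ?nnegrE.
have Lo : L1 expo (osc ep).
  apply: (@L1_bounded _ _ _ _ _ 1) => [|z]; first exact: measurable_osc.
  by have /andP[a b] := osc01 z ep0; rewrite ger0_norm.
set o := Ex expo (osc ep).
have D1 : `|Ex expo (locpow ep) - Ex expo (fun z => k0 z `^ r)| <= L * o.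
  rewrite -ExB// -ExZ//; apply: le_trans (Ex_norm (L1B Lp Lk)) _.
  by apply: Ex_le; [exact: L1_norm (L1B Lp Lk)|exact: L1Z|move=> z; exact: hL].
have D2 : `|Ex expo (fun z => locpow ep z ^+ 2) - Ex expo (fun z => (k0 z `^ r) ^+ 2)| <= 2 * M * L * o.
  rewrite -ExB// -ExZ//; apply: le_trans (Ex_norm (L1B Lp2 Lk2)) _.
  apply: Ex_le; [exact: L1_norm (L1B Lp2 Lk2)|exact: L1Z|move=> z].
  rewrite subr_sqr normrM mulrC [leRHS](_ : _ = (2 * M) * (L * osc ep z)); last by ring.
  apply: ler_pM => //; last exact: hL.
  by rewrite ger0_norm ?addr_ge0//; have := pM z; have := kM z; lra.
have t0 : `|Ex expo (locpow ep)| <= M.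
  rewrite ger0_norm ?Ex_ge0// -[leRHS](Ex_cst expo M); apply: Ex_le => //; exact: L1_cst.
have t1 : `|Ex expo (fun z => k0 z `^ r)| <= M.
  rewrite ger0_norm ?Ex_ge0// -[leRHS](Ex_cst expo M); apply: Ex_le => //; exact: L1_cst.
have ek : Ex expo (fun z => k0 z `^ (2 * r)) = Ex expo (fun z => (k0 z `^ r) ^+ 2).
  by congr (Ex _ _); apply/funext => z; rewrite mulrC powRrM powR_mulrn.
rewrite /limvar /density_limvar (tail_int0 mp (C := M)); last by move=> z; rewrite ger0_norm.
rewrite (@tail_int0 _ (fun z => locpow ep z ^+ 2) (M ^+ 2)); last 2 first.
- exact: measurable_funX.
- by move=> z; rewrite ger0_norm ?sqr_ge0// lerXn2r ?nnegrE.
rewrite ek.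
set a := Ex expo (locpow ep) in D1 t0 *.
set b := Ex expo (fun z => k0 z `^ r) in D1 t1 *.
set a2 := Ex expo (fun z => locpow ep z ^+ 2) in D2 *.
set b2 := Ex expo (fun z => (k0 z `^ r) ^+ 2) in D2 *.
have D3 : `|a ^+ 2 - b ^+ 2| <= 2 * M * L * o.
  rewrite subr_sqr normrM mulrC -(mulrA (2 * M)); apply: ler_pM => //; by rewrite (le_trans (ler_normD _ _))// mulr_natl mulr2n lerD.
move: (w_coef r) (t_coef r) => wc tc.
rewrite (_ : _ - _ = wc * (a2 - b2) - tc ^+ 2 * (a ^+ 2 - b ^+ 2)); last by ring.
apply: le_trans (ler_normB _ _) _; rewrite (normrM wc) (normrM (tc ^+ 2)) [leRHS]mulrDl.
rewrite (ger0_norm (sqr_ge0 tc)) -!(mulrA _ (2 * M * L)).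
by apply: lerD; apply: ler_wpM2l => //; exact: sqr_ge0.
Qed.

End local_ratio.

Lemma ncdf_lipschitz (R : realType) (x y : R) :
  `|ncdf x - ncdf y| <= 20 * normal_peak 1 * `|x - y|.
Proof.
have := @heat_lipschitz R x 1 0 (x - y) ltr01.
by rewrite /heat sqrtr1 invr1 !mulr1 mul1r subr0 subKr sub0r normrN.
Qed.

Lemma invsqrt_lipschitz (R : realType) (c a b : R) : 0 < c -> c <= a -> c <= b ->
  `|(Num.sqrt a)^-1 - (Num.sqrt b)^-1| <= (c * Num.sqrt c)^-1 * `|a - b|.
Proof.
move=> c0 ca cb.
have a0 := lt_le_trans c0 ca; have b0 := lt_le_trans c0 cb.
have sc : 0 < Num.sqrt c by rewrite sqrtr_gt0.
have sa : Num.sqrt c <= Num.sqrt a by rewrite ler_wsqrtr.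
have sb : Num.sqrt c <= Num.sqrt b by rewrite ler_wsqrtr.
have ea := sqr_sqrtr (ltW a0); have eb := sqr_sqrtr (ltW b0); have ec := sqr_sqrtr (ltW c0).
move: (Num.sqrt a) (Num.sqrt b) (Num.sqrt c) sc sa sb ea eb ec => x y z z0 zx zy <- <- <-.
have x0 := lt_le_trans z0 zx; have y0 := lt_le_trans z0 zy.
rewrite (_ : x^-1 - y^-1 = (x * y * (x + y))^-1 * (y ^+ 2 - x ^+ 2)); last first.
  by field; rewrite !gt_eqF// addr_gt0.
rewrite normrM distrC ler_wpM2r// ger0_norm ?invr_ge0 ?mulr_ge0 ?addr_ge0 ?(ltW x0) ?(ltW y0)//.
rewrite lef_pV2 ?posrE ?mulr_gt0 ?addr_gt0 ?exprn_gt0//.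
rewrite expr2; apply: ler_pM; rewrite ?mulr_ge0 ?(ltW z0)//; last by lra.
by apply: ler_pM; rewrite ?(ltW z0).
Qed.

(** * Linearization, variance and limit law of the statistic *)

Section exponential_sample.
Context d (T : measurableType d) (R : realType) (P : probability T R).
Local Notation expo := (expo R).
Variables (r mG MG : R) (Gh k0 : R -> R).
Hypothesis r0 : 0 < r.
Hypothesis mG0 : 0 < mG.
Hypothesis mGh : measurable_fun [set: measurableTypeR R] Gh.
Hypothesis mk0 : measurable_fun [set: measurableTypeR R] k0.
Hypothesis GhB : forall z z', 0 <= z -> z <= z' ->
  mG * (expR (- z) - expR (- z')) <= Gh z' - Gh z <= MG * (expR (- z) - expR (- z')).
Hypothesis k0B : forall z, mG <= k0 z <= MG.
Hypothesis ratio_lim : {ae expo, forall z, forall e, 0 < e ->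
  exists2 c, 0 < c & forall s, 0 < s < c -> `|ratio Gh z s - k0 z| <= e}.
Variable Z : nat -> T -> R.
Hypothesis mZ : forall i, measurable_fun [set: T] (Z i).
Hypothesis Z0 : forall i w, 0 <= Z i w.
Hypothesis indZ : forall (s : seq nat) (B : nat -> set (measurableTypeR R)), uniq s ->
  (forall i, measurable (B i)) ->
  P (\bigcap_(i in [set` s]) Z i @^-1` B i) = (\prod_(i <- s) expo (B i))%E.

Definition exp_stat n : T -> R := gap_sum Z n (fun z z' => (n%:R * (Gh z' - Gh z)) `^ r).

Let MG0 : 0 < MG.
Proof. by have /andP[a b] := k0B 0; rewrite (lt_le_trans mG0)// (le_trans a b). Qed.

Let order_ge0 n k w : (k < n)%N -> 0 <= order_stat Z n k w.
Proof.
move=> kn; rewrite /order_stat.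
have /(mem_nth 0) : (k < size (sort <=%R [seq Z i w | i <- iota 0 n]))%N by rewrite size_sort size_map size_iota.
by rewrite mem_sort => /mapP[i _ ->].
Qed.

Let order_leS n k w : (k.+1 < n)%N -> order_stat Z n k w <= order_stat Z n k.+1 w.
Proof. by move=> kn; apply: (ordered_le Z0 w kn). Qed.

Let Gh_gap n k w : (k < n.-1)%N ->
  0 <= Gh (order_stat Z n k.+1 w) - Gh (order_stat Z n k w) <= MG.
Proof.
move=> kn; have k1n : (k.+1 < n)%N by rewrite -ltn_predRL.
have o0 := order_ge0 w (ltnW k1n); have ol := order_leS w k1n.
have /andP[h1 h2] := GhB o0 ol.
have e1 : expR (- order_stat Z n k w) <= 1 by rewrite -[leRHS]expR0 ler_expR oppr_le0.
have e2 := expR_gt0 (- order_stat Z n k.+1 w).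
apply/andP; split.
  by apply: le_trans h1; rewrite mulr_ge0 ?(ltW mG0)// subr_ge0 ler_expR lerN2.
by apply: le_trans h2 _; rewrite ler_piMr ?(ltW MG0)//; lra.
Qed.

Let mos k n : measurable_fun [set: T] (order_stat Z n k).
Proof. exact: measurable_ordered mZ n k.+1. Qed.

Lemma measurable_exp_stat n : measurable_fun [set: T] (exp_stat n).
Proof.
apply: measurable_sum => i.
apply: (measurableT_comp (measurable_powR r)); apply: measurable_funM => //.
by apply: measurable_funB; apply: (measurableT_comp mGh); exact: mos.
Qed.

Lemma exp_stat_bound n w : 0 <= exp_stat n w <= n.-1%:R * (n%:R * MG) `^ r.
Proof.
rewrite /exp_stat /gap_sum sumr_ge0 => [/=|i _]; last exact: powR_ge0.
rewrite mulr_natl -[in leRHS](card_ord n.-1) -sumr_const; apply: ler_sum => i _.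
have /andP[h1 h2] := Gh_gap w (ltn_ord i).
apply: ge0_ler_powR; rewrite ?nnegrE ?(ltW r0) ?mulr_ge0 ?(ltW MG0)//.
by rewrite ler_wpM2l.
Qed.

Lemma L2_exp_stat n : L2 P (exp_stat n).
Proof.
split; first exact: measurable_exp_stat.
apply: (@L1_bounded _ _ _ _ _ ((n.-1%:R * (n%:R * MG) `^ r) ^+ 2)).
  by apply: measurable_funX; exact: measurable_exp_stat.
move=> w; have /andP[a b] := exp_stat_bound n w.
by rewrite ger0_norm ?sqr_ge0// lerXn2r ?nnegrE ?(le_trans a b).
Qed.

Lemma sqb_center (f : T -> R) c : sqb P f c -> sqb P (fun w => f w - Ex P f) c.
Proof.
move=> [f2 fc]; have l1 := L2_L1 f2.
split; first exact: L2B f2 (L2_cst P _).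
apply: le_trans fc.
have -> : (fun w => (f w - Ex P f) ^+ 2) = (fun w => f w ^+ 2 - (2 * Ex P f * f w - Ex P f ^+ 2)).
  by apply/funext => w; ring.
rewrite ExB; [|exact: f2.2|by apply: L1B; [exact: L1Z|exact: L1_cst]].
rewrite ExB; [|exact: L1Z|exact: L1_cst].
by rewrite ExZ// Ex_cst -subr_ge0; have := sqr_ge0 (Ex P f); lra.
Qed.

Let E n := nspacing Z n.

(** The smooth sum also contains the spacing from 0 to the minimum, which the statistic lacks; that
    term is taken off. *)
Lemma exp_stat_split ep n w : (0 < n)%N ->
  exp_stat n w = gap_sum Z n (gap_dev r Gh n ep) w
    + (\sum_(k < n) locpow r Gh ep (wpos n (E n) k w) * (scl n (E n) k w * E n k w) `^ r
       - locpow r Gh ep 0 * E n 0 w `^ r).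
Proof.
case: n => // n _; rewrite /exp_stat /gap_sum /=.
rewrite [in RHS]big_ord_recl/= /wpos big_ord0.
have -> : scl n.+1 (E n.+1) 0 w * E n.+1 0 w = E n.+1 0 w.
  by rewrite /scl /wpos big_ord0 oppr0 expR0 mulr1 subn0 mulfV ?mul1r.
rewrite addrAC subrr add0r -big_split/=; apply: eq_bigr => i _.
have il : (i.+1 <= n.+1)%N by rewrite ltnS ltnW.
have := wpos_nspacing Z w il; rewrite /wpos => ->.
rewrite /gap_dev -addrA (_ : - _ + _ = 0) ?addr0//; apply/eqP; rewrite addrC subr_eq0; apply/eqP.
congr (_ * _ `^ r).
rewrite /scl wpos_nspacing// /E /nspacing.
have m0 : (n.+1 - i.+1)%:R != 0 :> R by rewrite subSS pnatr_eq0 -lt0n subn_gt0.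
rewrite /bump leq0n add1n -[ordered Z n.+1 i.+1 w]/(order_stat Z n.+1 i w).
rewrite -[ordered Z n.+1 i.+2 w]/(order_stat Z n.+1 i.+1 w).
by field.
Qed.

Let L ep n w : R := \sum_(k < n) lin r (locpow r Gh ep) n k (E n k w).

Let lin_sum ep n : [/\ L2 P (L ep n), Ex P (L ep n) = 0 &
  Ex P (fun w => L ep n w ^+ 2) = \sum_(k < n) linvar r (locpow r Gh ep) n k].
Proof.
have H := @Ex_sqr_sum _ _ _ P expo n (E n) (fun k => lin r (locpow r Gh ep) n k)
  (linvar r (locpow r Gh ep) n) (iid_nspacing mZ indZ n).
by apply: H => k _; exact: lin_moments.
Qed.

Let eventually_small (C e : R) : 0 <= C -> 0 < e -> exists N, forall n, (N <= n)%N ->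
  (0 < n)%N /\ C * (1 + harm R n) ^+ 2 <= e * n%:R.
Proof.
(* 102 comes from (1 + h)^2 <= 2 + 2 h^2 <= 102 sqrt n, by [harm_sqr]. *)
move=> C0 e0; pose B := (102 * C / e) ^+ 2.
have B0 : 0 <= B by exact: sqr_ge0.
exists (Num.truncn B).+1 => n Nn; have n0 : (0 < n)%N by rewrite (leq_trans _ Nn).
split => //.
have Bn : B <= n%:R.
  by apply: (le_trans (ltW (truncnS_gt B))); rewrite ler_nat.
pose s : R := Num.sqrt n%:R.
have s1 : 1 <= s by rewrite -sqrtr1 ler_wsqrtr// ler1n.
have s2 : s ^+ 2 = n%:R by rewrite sqr_sqrtr.
have Bs : 102 * C / e <= s.
  by rewrite -[leLHS]ger0_norm ?divr_ge0 ?mulr_ge0 ?(ltW e0)// -sqrtr_sqr ler_wsqrtr.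
have h : (1 + harm R n) ^+ 2 <= 102 * s.
  have := harm_sqr R n; have := sqr_ge0 (1 - harm R n); rewrite -/s.
  by rewrite !expr2 => a b; lra.
apply: le_trans (ler_wpM2l C0 h) _.
move: Bs; rewrite ler_pdivrMr// -s2 => Bs.
rewrite (_ : C * _ = 102 * C * s); last by ring.
rewrite (_ : e * _ = s * e * s); last by ring.
by rewrite ler_wpM2r//; lra.
Qed.

(** The mean of the remainder and the multiple n Gamma(r+1) of [tail_int] cancel on centering, so
    the mean of the statistic is never computed. *)
Lemma exp_stat_linearization e : 0 < e -> exists ep, [/\ 0 < ep <= 1,
  `|limvar r (locpow r Gh ep) - density_limvar r k0| <= e &
  exists N, forall n, (N <= n)%N -> (0 < n)%N /\
    sqb P (fun w => exp_stat n w - Ex P (exp_stat n) - L ep n w) (e * n%:R)].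
Proof.
move=> e0.
have [K K0 hK] := spacing_remainder mZ Z0 indZ r0.
have [C C0 hC] := gap_dev_bounds r0 mG0 GhB k0B.
have [V V0 hV] := limvar_locpow r0 mG0 mGh mk0 GhB k0B.
(* The order of the choices matters: first the weight [la], for the part of the bound proportional
   to it; then [ep], so that the mean oscillation is small even after division by [la]; finally
   n. *)
pose la := e / (8 * (72 * (1 + C * (1 + K)))).
have CK : 0 <= C * (1 + K) by apply: mulr_ge0 => //; lra.
have la0 : 0 < la by rewrite divr_gt0// mulr_gt0// mulr_gt0//; lra.
pose eta := e / (1 + V + 8 * (72 * C) * (2 / la)).
have q0 : 0 <= 8 * (72 * C) * (2 / la).
  by apply: mulr_ge0; [do 2!apply: mulr_ge0 => //|rewrite divr_ge0 ?(ltW la0)].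
have eta0 : 0 < eta by rewrite divr_gt0//; lra.
have [ep ep01 Oep] := Ex_osc_small mG0 mGh mk0 GhB k0B ratio_lim eta0.
have /andP[ep0 ep1] := ep01.
have hphi z : `|locpow r Gh ep z| <= MG `^ r by exact: (locpow_le r0 mG0 GhB k0B z ep0).
have [Lp Lp0 hLp] := locpow_lipschitz r0 mG0 GhB k0B ep01.
have mphi := measurable_locpow r mGh ep.
exists ep; split => //.
  apply: le_trans (hV _ ep01) _; apply: le_trans (ler_wpM2l V0 Oep) _.
  rewrite /eta mulrCA ler_piMr ?(ltW e0)// ler_pdivrMr ?mul1r; lra.
have [K1 K10 hK1] := smooth_sum P r0 mphi hphi hLp.
have [t t0 ht] : exists2 t : R, 0 <= t & forall n, (0 < n)%N ->
    sqb P (fun w => locpow r Gh ep 0 * E n 0 w `^ r) t.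
  exists (locpow r Gh ep 0 ^+ 2 * Ex expo (fun y => y `^ (2 * r))).
    by rewrite mulr_ge0 ?sqr_ge0// Ex_ge0// => y; exact: powR_ge0.
  move=> n n0; apply: sqbZ.
  have L2r : L1 expo (fun y => y `^ (2 * r)) by apply: L1_expo_pow; rewrite mulr_ge0 ?(ltW r0).
  have [] := @Ex_past_prod _ _ _ P expo n (E n) (iid_nspacing mZ indZ n) 0 n0 (fun=> 1)
    (fun y => y `^ (2 * r)) (measurable_cst _) (fun=> ler01) (fun y => powR_ge0 _ _) (L1_cst P 1) L2r.
  rewrite Ex_cst mul1r.
  have -> : (fun w => 1 * E n 0 w `^ (2 * r)) = (fun w => (E n 0 w `^ r) ^+ 2).
    by apply/funext => w; rewrite mul1r mulrC powRrM powR_mulrn// powR_ge0.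
  move=> l1 l2; split; last by rewrite l2.
  split=> //; apply: (measurableT_comp (measurable_powR r)); exact: measurable_nspacing.
(* These grow without bound as [la] and [ep] decrease, but they multiply only a harmonic number and
   1, both negligible against n. *)
pose C1 := 36 * C * (2 / la) * (3 / ep); pose C2 := 16 * (C ^+ 4 * (1 + K)).
have la2 : 0 <= 2 / la by rewrite divr_ge0 ?(ltW la0).
have ep3 : 0 <= 3 / ep by rewrite divr_ge0 ?(ltW ep0).
have C10 : 0 <= C1 by do 3?apply: mulr_ge0 => //.
have C20 : 0 <= C2 by do 2?apply: mulr_ge0 => //; [exact: exprn_ge0|lra].
have [N hN] := @eventually_small (C1 + C2 + 4 * K1 + 4 * t) (e / 2) ltac:(lra) ltac:(lra).
exists N => n /hN[n0 hn]; split => //.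
have iE := iid_nspacing mZ indZ n.
have hB := hK1 n (E n) iE (fun j w jn => nspacing_ge0 Z0 w jn).
have [hb1 hb2] := hC n ep ep01.
have hA := hK n (gap_dev r Gh n ep) (osc MG Gh k0 ep) C ep la ep0 la0 C0
  (measurable_gap_dev r mGh n ep) (measurable_osc mG0 mGh mk0 GhB k0B ep0)
  (fun z => osc01 mG0 GhB k0B z ep0) hb1 hb2.
have hX := sqbD hA (sqbB hB (ht n n0)).
set X := (fun w => _ + _) in hX.
have [L2L EL _] := lin_sum ep n.
pose cst := Ex P (gap_sum Z n (gap_dev r Gh n ep)) + n%:R * (Gamma (r + 1) * tail_int (locpow r Gh ep) 0).
have XE : exp_stat n = (fun w => (X w + L ep n w) + cst).
  by apply/funext => w; rewrite (exp_stat_split ep w n0) /X /L /cst; ring.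
have LX := L2_L1 hX.1.
have LL := L2_L1 L2L.
have EE : Ex P (exp_stat n) = Ex P X + cst.
  by rewrite XE (ExD (L1D LX LL) (L1_cst P cst)) (ExD LX LL) EL addr0 Ex_cst.
have -> : (fun w => exp_stat n w - Ex P (exp_stat n) - L ep n w) = (fun w => X w - Ex P X).
  by apply/funext => w; rewrite EE XE; ring.
apply: sqb_le (sqb_center hX).
have h0 : 0 <= harm R n by apply: sumr_ge0 => i _; rewrite invr_ge0.
set O := Ex expo _ in Oep *.
set h := harm R n in h0 hn *.
have hh : 1 <= (1 + h) ^+ 2 by rewrite expr2; nra.
have hh' : h <= (1 + h) ^+ 2 by rewrite expr2; nra.
have u1 : C1 * h <= C1 * (1 + h) ^+ 2 by exact: ler_wpM2l.
have u2 : C2 <= C2 * (1 + h) ^+ 2 by rewrite ler_peMr.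
have u3 : t <= t * (1 + h) ^+ 2 by rewrite ler_peMr.
have w1 : 72 * (C * (la * (1 + K))) <= e / 8.
  rewrite /la (_ : 72 * _ = e / 8 * (C * (1 + K) / (1 + C * (1 + K)))).
    by rewrite ler_piMr ?divr_ge0 ?(ltW e0)// ler_pdivrMr ?mul1r; lra.
  by field; rewrite gt_eqF//; lra.
have w2 : 72 * C * (2 / la) * O <= e / 8.
  have q1 : 0 <= 72 * C * (2 / la) by do 2!apply: mulr_ge0 => //.
  apply: le_trans (ler_wpM2l q1 Oep) _.
  set D := 1 + V + 8 * (72 * C) * (2 / la) in eta eta0 Oep *.
  have D0 : 0 < D by rewrite /D; lra.
  rewrite /eta [leLHS](_ : _ = e / 8 * (8 * (72 * C) * (2 / la) / D)).
    by rewrite ler_piMr ?divr_ge0 ?(ltW e0)// ler_pdivrMr// mul1r /D; lra.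
  by field; rewrite !gt_eqF.
have n0' : 0 <= n%:R :> R by [].
have w3 := ler_wpM2r n0' w1.
have w4 := ler_wpM2r n0' w2.
rewrite (_ : 2 * (18 * _ + 8 * _) + _ = 72 * (C * (la * (1 + K))) * n%:R / 2 + 72 * C * (2 / la) * O * n%:R / 2
  + (C1 * h + C2 + 4 * (K1 * (1 + h) ^+ 2) + 4 * t)); last first.
  by rewrite /C1 /C2 (mulrAC 3); move: (2 / la) (3 / ep) => x y; field.
rewrite !(mulrDl _ _ ((1 + h) ^+ 2)) in hn.
rewrite -(mulrA 4 K1) -(mulrA 4 t) in hn.
have en := mulr_ge0 (ltW e0) n0'.
lra.
Qed.

Let D n w : R := exp_stat n w - Ex P (exp_stat n).
Let V := density_limvar r k0.

Let D2 n : L2 P (D n).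
Proof. exact: L2B (L2_exp_stat n) (L2_cst P _). Qed.

Let approx e : 0 < e -> exists ep, [/\ 0 < ep <= 1 &
  exists N, forall n, (N <= n)%N -> [/\ (0 < n)%N,
    sqb P (fun w => D n w - L ep n w) (e * n%:R) &
    `|(\sum_(k < n) linvar r (locpow r Gh ep) n k) / n%:R - V| <= 2 * e]].
Proof.
move=> e0; have [ep [ep01 lv [N hN]]] := exp_stat_linearization e0.
have /andP[ep0 ep1] := ep01.
have hphi z : `|locpow r Gh ep z| <= MG `^ r by exact: (locpow_le r0 mG0 GhB k0B z ep0).
have [Lp Lp0 hLp] := locpow_lipschitz r0 mG0 GhB k0B ep01.
have [K K0 hK] := sum_linvar r (measurable_locpow r mGh ep) hphi hLp.
have [N' hN'] := eventually_small K0 e0.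
exists ep; split => //; exists (maxn N N') => n; rewrite geq_max => /andP[/hN[n0 hR] /hN'[_ hh]].
split => //; have n0' : 0 < n%:R :> R by rewrite ltr0n.
rewrite -(subrK (limvar r (locpow r Gh ep)) (_ / _)) -addrA.
apply: le_trans (ler_normD _ _) _; rewrite mulr_natl mulr2n lerD//.
rewrite (_ : _ - _ = (\sum_(k < n) linvar r (locpow r Gh ep) n k - n%:R * limvar r (locpow r Gh ep)) / n%:R); last first.
  by field; rewrite gt_eqF.
rewrite normrM normfV (gtr0_norm n0') ler_pdivrMr//.
apply: le_trans (hK n n0) _; apply: le_trans hh; rewrite ler_wpM2l//.
have h0 : 0 <= harm R n by apply: sumr_ge0 => i _; rewrite invr_ge0.
by rewrite expr2; nra.
Qed.

(** With U = D - L, Young's inequality gives |D^2 - L^2| <= del L^2 + (1 + 1 / del) U^2, so a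
    mean-square error del^2 n of the linearization costs O(del) in the normalised variance. *)
Lemma exp_stat_variance e : 0 < e -> exists N, forall n, (N <= n)%N -> (0 < n)%N /\
  `|n%:R^-1 * Ex P (fun w => D n w ^+ 2) - V| <= e.
Proof.
(* The constant 8 leaves room for the multiples of [del] in the three errors below. *)
move=> e0; pose del := Num.min 1 (e / (`|V| + 8)).
have V8 : 0 < `|V| + 8 by have := normr_ge0 V; lra.
have del0 : 0 < del by rewrite lt_min ltr01 divr_gt0.
have del1 : del <= 1 by rewrite ge_min lexx.
have dele : del * (`|V| + 8) <= e by rewrite -ler_pdivlMr// ge_min lexx orbT.
have [|ep [ep01 [N hN]]] := @approx (del ^+ 2); first exact: exprn_gt0.
exists N => n /hN[n0 [R2 hR] hL]; split => //.
have n0' : 0 < n%:R :> R by rewrite ltr0n.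
have [L2L EL EL2] := lin_sum ep n.
pose U w := D n w - L ep n w.
have dd : del ^+ 2 <= del by rewrite expr2 ler_piMr// ltW.
have LU := R2.2; have LL := L2L.2; have LD := (D2 n).2.
set EU := Ex P (fun w => U w ^+ 2) in hR.
set ELL := Ex P (fun w => L ep n w ^+ 2) in EL2.
have EDL : `|Ex P (fun w => D n w ^+ 2) - ELL| <= del * ELL + (1 + del^-1) * EU.
  rewrite -ExB//; apply: le_trans (Ex_norm (L1B LD LL)) _.
  rewrite -!ExZ// -ExD; [|exact: L1Z|exact: L1Z].
  apply: Ex_le; [exact: L1_norm (L1B LD LL)|by apply: L1D; exact: L1Z|move=> w].
  have -> : D n w ^+ 2 - L ep n w ^+ 2 = 2 * (L ep n w * U w) + U w ^+ 2 by rewrite /U; ring.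
  move: (L ep n w) (U w) => a b.
  have h1 : 0 <= del * (a - del^-1 * b) ^+ 2 by rewrite mulr_ge0 ?sqr_ge0 ?ltW.
  have h2 : 0 <= del * (a + del^-1 * b) ^+ 2 by rewrite mulr_ge0 ?sqr_ge0 ?ltW.
  have e1 : del * (a - del^-1 * b) ^+ 2 = del * a ^+ 2 - 2 * (a * b) + del^-1 * b ^+ 2 by field; rewrite gt_eqF.
  have e2 : del * (a + del^-1 * b) ^+ 2 = del * a ^+ 2 + 2 * (a * b) + del^-1 * b ^+ 2 by field; rewrite gt_eqF.
  have := sqr_ge0 b; rewrite ler_norml mulrDl mul1r => b2.
  by apply/andP; split; lra.
have EU1 : (1 + del^-1) * EU / n%:R <= 2 * del.
  rewrite ler_pdivrMr//; apply: (le_trans (ler_wpM2l _ hR)).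
    by rewrite addr_ge0// invr_ge0 ltW.
  rewrite mulrA ler_pM2r// mulrDl mul1r expr2 mulrA mulVf ?gt_eqF// mul1r.
  by rewrite expr2 in dd; lra.
rewrite -EL2 in hL.
have EL3 : ELL / n%:R <= `|V| + 2.
  by move: hL; rewrite ler_norml => /andP[_]; have := ler_norm V; lra.
rewrite (_ : _ - V = (Ex P (fun w => D n w ^+ 2) - ELL) / n%:R + (ELL / n%:R - V)); last by field; rewrite gt_eqF.
apply: le_trans (ler_normD _ _) _.
rewrite normrM normfV (gtr0_norm n0').
have : `|Ex P (fun w => D n w ^+ 2) - ELL| / n%:R <= del * (ELL / n%:R) + (1 + del^-1) * EU / n%:R.
  by rewrite mulrA -mulrDl ler_pM2r ?invr_gt0.
have : del * (ELL / n%:R) <= del * (`|V| + 2) by rewrite ler_pM2l.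
by rewrite !mulrDr in dele *; lra.
Qed.

(** The sign is not visible in the formula; it follows from being a limit of variances. *)
Lemma density_limvar_ge0 : 0 <= V.
Proof.
rewrite leNgt; apply/negP => V0.
have [N /(_ N (leqnn N))[n0]] := @exp_stat_variance (- V / 2) ltac:(lra).
have : 0 <= N%:R^-1 * Ex P (fun w => D N w ^+ 2).
  by rewrite mulr_ge0 ?invr_ge0// Ex_ge0// => w; exact: sqr_ge0.
by rewrite ler_norml => a /andP[_]; lra.
Qed.

Let heat_cont w del e : 0 < del -> 0 < e -> exists2 rho, 0 < rho &
  forall v, `|v - V| <= rho -> `|heat w (del + v) 0 - heat w (del + V) 0| <= e.
Proof.
move=> del0 e0.
have dV : 0 < del + V by have := density_limvar_ge0; lra.
pose c := del / 2; have c0 : 0 < c by rewrite divr_gt0.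
pose B := 20 * normal_peak 1 * (`|w| * (c * Num.sqrt c)^-1).
have B0 : 0 <= B.
  by apply: mulr_ge0; [rewrite mulr_ge0 ?normal_peak_ge0|rewrite mulr_ge0// invr_ge0 mulr_ge0 ?sqrtr_ge0// ltW].
exists (Num.min c (e / (B + 1))) => [|v]; first by rewrite lt_min c0 divr_gt0//; lra.
rewrite le_min => /andP[h1 h2].
have V0 := density_limvar_ge0.
apply: (le_trans (ncdf_lipschitz _ _)); rewrite subr0 -mulrBr normrM.
have h3 : `|(Num.sqrt (del + v))^-1 - (Num.sqrt (del + V))^-1| <= (c * Num.sqrt c)^-1 * `|v - V|.
  rewrite (_ : v - V = del + v - (del + V)); last by ring.
  by apply: invsqrt_lipschitz => //; move: h1; rewrite ler_norml => /andP[] /=; rewrite /c; lra.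
apply: (@le_trans _ _ (B * `|v - V|)).
  rewrite /B -(mulrA (20 * normal_peak 1)) -(mulrA `|w|).
  by apply: ler_wpM2l; [rewrite mulr_ge0 ?normal_peak_ge0|exact: ler_wpM2l].
apply: le_trans (ler_wpM2l B0 h2) _.
by rewrite mulrCA ler_piMr ?(ltW e0)// ler_pdivrMr ?mul1r; lra.
Qed.

Lemma exp_stat_heat w del e : 0 < del -> 0 < e -> exists N, forall n, (N <= n)%N -> (0 < n)%N /\
  `|Ex P (fun u => heat w del ((Num.sqrt n%:R)^-1 * D n u)) - heat w (del + V) 0| <= e.
Proof.
move=> del0 e0; have e3 : 0 < e / 3 by lra.
have [rho rho0 hrho] := heat_cont w del0 e3.
set Lip := (Num.sqrt del)^-1 * (20 * normal_peak 1).
have Lip0 : 0 <= Lip.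
  by rewrite mulr_ge0 ?invr_ge0 ?sqrtr_ge0// mulr_ge0 ?normal_peak_ge0.
(* The first bound keeps the variance of the linear part within [rho] of its limit; the second
   controls the linearization error, whose root is multiplied by the Lipschitz constant of
   [heat]. *)
pose e1 := Num.min (rho / 2) ((e / 3 / (Lip + 1)) ^+ 2).
have q0 : 0 < e / 3 / (Lip + 1) by rewrite divr_gt0//; lra.
have e10 : 0 < e1 by rewrite lt_min divr_gt0//= exprn_gt0.
have [ep [ep01 [N hN]]] := approx e10.
have /andP[ep0 ep1] := ep01.
have hphi z : `|locpow r Gh ep z| <= MG `^ r by exact: (locpow_le r0 mG0 GhB k0B z ep0).
have [K K0 hK] := clt_lin r0 hphi P w del0.
have [N' hN'] : exists N, forall n, (N <= n)%N -> K / Num.sqrt n%:R <= e / 3.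
  have B0 : 0 <= (K / (e / 3)) ^+ 2 by exact: sqr_ge0.
  exists (Num.truncn ((K / (e / 3)) ^+ 2)).+1 => n Nn.
  have n0 : 0 < n%:R :> R by rewrite ltr0n (leq_trans _ Nn).
  rewrite ler_pdivrMr ?sqrtr_gt0// mulrC -ler_pdivrMr//.
  rewrite -[leLHS](ger0_norm (divr_ge0 K0 (ltW e3))) -sqrtr_sqr ler_wsqrtr//.
  by apply: (le_trans (ltW (truncnS_gt _))); rewrite ler_nat.
exists (maxn N N') => n; rewrite geq_max => /andP[/hN[n0 [R2 hR] hL] /hN' hK'].
split => //; have n0' : 0 < n%:R :> R by rewrite ltr0n.
have s0 : 0 < Num.sqrt n%:R :> R by rewrite sqrtr_gt0.
have [L2L _ _] := lin_sum ep n.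
have LH (f : T -> R) : measurable_fun [set: T] f -> L1 P (fun u => heat w del ((Num.sqrt n%:R)^-1 * f u)).
  move=> mf; apply: (@L1_bounded _ _ _ _ _ 1); last by move=> u; exact: heat_bound.
  by apply: (measurableT_comp (measurable_heat w del)); exact: measurable_funM.
pose U u := D n u - L ep n u.
have LU := L2_L1 R2.
have T1 : `|Ex P (fun u => heat w del ((Num.sqrt n%:R)^-1 * D n u)) -
    Ex P (fun u => heat w del ((Num.sqrt n%:R)^-1 * L ep n u))| <= e / 3.
  have h1 := LH _ (D2 n).1; have h2 := LH _ L2L.1.
  rewrite -ExB//; apply: le_trans (Ex_norm (L1B h1 h2)) _.
  apply: (@le_trans _ _ (Ex P (fun u => Lip * (Num.sqrt n%:R)^-1 * `|U u|))).
    apply: Ex_le; [exact: L1_norm (L1B h1 h2)|by apply: L1Z; exact: L1_norm|move=> u].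
    apply: (le_trans (heat_lipschitz w _ _ del0)).
    by rewrite -/Lip -mulrBr normrM (gtr0_norm (x := _^-1)) ?invr_gt0// mulrA.
  rewrite ExZ; last exact: L1_norm.
  have L2U : L2 P (fun u => `|U u|).
    split; first by apply: measurableT_comp => //; exact: R2.1.
    by rewrite (_ : (fun u => _) = (fun u => U u ^+ 2)) ?R2.2//; apply/funext => u; rewrite real_normK ?num_real.
  have Q : Ex P (fun u => `|U u|) <= e / 3 / (Lip + 1) * Num.sqrt n%:R.
    have q1 := Ex_sqr_le L2U.
    have E0 : 0 <= Ex P (fun u => `|U u|) by apply: Ex_ge0.
    have qs := mulr_ge0 (ltW q0) (ltW s0).
    rewrite -(@ler_pXn2r _ 2) ?nnegrE//.
    apply: le_trans q1 _; rewrite (_ : (fun u => _) = (fun u => U u ^+ 2)); last first.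
      by apply/funext => u; rewrite real_normK ?num_real.
    apply: le_trans hR _; rewrite exprMn sqr_sqrtr ?(ltW n0')// ler_pM2r//.
    by rewrite ge_min lexx orbT.
  have Ls : 0 <= Lip * (Num.sqrt n%:R)^-1 by rewrite mulr_ge0 ?invr_ge0 ?(ltW s0).
  apply: le_trans (ler_wpM2l Ls Q) _.
  rewrite [leLHS](_ : _ = e / 3 * (Lip / (Lip + 1))).
    by rewrite ler_piMr ?(ltW e3)// ler_pdivrMr ?mul1r; lra.
  by field; rewrite !gt_eqF//; lra.
have T2 := hK n (E n) n0 (iid_nspacing mZ indZ n).
have T3 := hrho ((\sum_(k < n) linvar r (locpow r Gh ep) n k) / n%:R).
have /T3 {}T3 : `|(\sum_(k < n) linvar r (locpow r Gh ep) n k) / n%:R - V| <= rho.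
  by apply: le_trans hL _; rewrite mulrC -ler_pdivlMr// ge_min lexx.
rewrite -/(L ep n) in T2.
set a1 := Ex P _ in T1 *; set a2 := Ex P _ in T1.
have {}T2 : `|a2 - heat w (del + (\sum_(k < n) linvar r (locpow r Gh ep) n k) / n%:R) 0| <= e / 3.
  exact: le_trans T2 hK'.
set b := heat w _ 0 in T2 T3.
rewrite (_ : a1 - _ = (a1 - a2) + ((a2 - b) + (b - heat w (del + V) 0))); last by ring.
apply: le_trans (ler_normD _ _) _.
rewrite (_ : e = e / 3 + (e / 3 + e / 3)); last by field.
by rewrite lerD// (le_trans (ler_normD _ _))// lerD.
Qed.

End exponential_sample.

(** * From smoothed to sharp distribution functions *)

Section cdf_limit.
Context (R : realType).
Implicit Types (w V M e : R).

Definition normal_cdf V w : R := if V == 0 then (0 <= w)%R%:R else ncdf (w / Num.sqrt V).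

Lemma ncdf_tails e : 0 < e -> exists M : R,
  [/\ 0 < M, forall x, M <= x -> 1 - e <= ncdf x & forall x, x <= - M -> ncdf x <= e].
Proof.
move=> e0; have [M [h1 h2]] := cdf_tails (normal_prob (0 : R) 1) e0.
exists (Num.max 1 M); split; first by rewrite lt_max ltr01.
- move=> x Mx; rewrite -lee_fin ncdfE; apply: h1.
  by apply: le_trans Mx; rewrite le_max lexx orbT.
- move=> x xM; rewrite -lee_fin ncdfE; apply: h2.
  by apply: le_trans xM _; rewrite lerN2 le_max lexx orbT.
Qed.

(** Smoothing at scale [s] with threshold shifted by M s: as s shrinks both effects vanish at a
    continuity point of the limit. The shift lets the smooth function bound the indicator from one
    side. *)
Lemma heat_to_normal_cdf V w M e : 0 <= V -> 0 < V \/ w != 0 -> 0 < e ->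
  exists2 s : R, 0 < s & `|heat (w + M * s) (s ^+ 2 + V) 0 - normal_cdf V w| <= e.
Proof.
move=> V0 Vw e0; rewrite /normal_cdf; case: eqP => [V00|/eqP Vn].
  have wn : w != 0 by case: Vw => //; rewrite V00 ltxx.
  have [M' [M'0 t1 t2]] := ncdf_tails e0.
  have MM : 0 < `|M| + M' by have := normr_ge0 M; lra.
  exists (`|w| / (`|M| + M')); first by rewrite divr_gt0// normr_gt0.
  set s := _ / _; have s0 : 0 < s by rewrite divr_gt0// normr_gt0.
  have sM : s * (`|M| + M') = `|w| by rewrite /s mulfVK// gt_eqF.
  rewrite /heat V00 addr0 sqrtr_sqr (gtr0_norm s0) subr0.
  have [w0|w0] := leP 0 w.
    rewrite mulr1n ler_norml; apply/andP; split; last first.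
      by have := ncdf_le1 ((w + M * s) / s); lra.
    have : 1 - e <= ncdf ((w + M * s) / s); last by lra.
    apply: t1; rewrite ler_pdivlMr// -(ger0_norm w0) -sM.
    by have := ler_norm (- M); rewrite normrN; nra.
  rewrite mulr0n subr0 ger0_norm ?ncdf_ge0//; apply: t2.
  rewrite ler_pdivrMr// -(opprK w) -(ltr0_norm w0) -sM.
  by have := ler_norm M; nra.
have Vp : 0 < V by rewrite lt_neqAle eq_sym Vn.
have sV : 0 < Num.sqrt V by rewrite sqrtr_gt0.
pose B := 20 * normal_peak 1 * (`|w| * (V * Num.sqrt V)^-1 + `|M| * (Num.sqrt V)^-1).
have B0 : 0 <= B.
  apply: mulr_ge0; first by rewrite mulr_ge0 ?normal_peak_ge0.
  by rewrite addr_ge0// mulr_ge0// invr_ge0 ?mulr_ge0 ?(ltW sV).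
pose s := Num.min 1 (e / (B + 1)).
have s0 : 0 < s by rewrite lt_min ltr01 divr_gt0//; lra.
have s1 : s <= 1 by rewrite ge_min lexx.
exists s => //; apply: (le_trans (ncdf_lipschitz _ _)); rewrite subr0.
have d1 := @invsqrt_lipschitz R V (s ^+ 2 + V) V Vp ltac:(by rewrite lerDr sqr_ge0) (lexx V).
have s2 : 0 <= s ^+ 2 by exact: sqr_ge0.
have ss : s ^+ 2 <= s by rewrite expr2 ler_piMr// ltW.
rewrite addrK (ger0_norm s2) in d1.
have d2 : (Num.sqrt (s ^+ 2 + V))^-1 <= (Num.sqrt V)^-1.
  by rewrite lef_pV2 ?posrE ?sqrtr_gt0 ?ler_wsqrtr ?lerDr//; lra.
have d3 : 0 <= (Num.sqrt (s ^+ 2 + V))^-1 by rewrite invr_ge0 sqrtr_ge0.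
apply: (@le_trans _ _ (B * s)); last first.
  have se : s <= e / (B + 1) by rewrite ge_min lexx orbT.
  apply: le_trans (ler_wpM2l B0 se) _.
  by rewrite mulrCA ler_piMr ?(ltW e0)// ler_pdivrMr ?mul1r; lra.
rewrite /B -(mulrA (20 * normal_peak 1)); apply: ler_wpM2l.
  by rewrite mulr_ge0 ?normal_peak_ge0.
have zz : 0 <= (V * Num.sqrt V)^-1 by rewrite invr_ge0 mulr_ge0 ?(ltW sV).
move: zz d1 d2 d3; move: (Num.sqrt (s ^+ 2 + V))^-1 (Num.sqrt V)^-1 (V * Num.sqrt V)^-1 => x y z zz d1 d2 d3.
rewrite (_ : _ - _ = w * (x - y) + M * s * x); last by ring.
apply: le_trans (ler_normD _ _) _; rewrite mulrDl; apply: lerD.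
  rewrite normrM -mulrA ler_wpM2l//; apply: le_trans d1 _.
  by rewrite ler_wpM2l.
rewrite !normrM (ger0_norm d3) (gtr0_norm s0) mulrAC ler_wpM2r ?(ltW s0)//.
by rewrite ler_wpM2l.
Qed.

Variables (d : measure_display) (T : measurableType d) (P : probability T R).

Lemma prob_ray_Ex (W : T -> R) w : measurable_fun [set: T] W ->
  P [set u | W u <= w] = (Ex P (fun u => (W u <= w)%R%:R))%:E /\
  L1 P (fun u => (W u <= w)%R%:R).
Proof.
move=> mW; have mI : measurable [set u | W u <= w].
  rewrite (_ : [set _ | _] = W @^-1` `]-oo, w]); first by rewrite -[_ @^-1` _]setTI; exact: mW.
  by apply/seteqP; split => u /=; rewrite in_itv.
have IE u : \1_[set u | W u <= w] u = (W u <= w)%R%:R :> R.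
  by rewrite indicE; congr (_%:R); congr nat_of_bool; apply/idP/idP; rewrite inE.
have mf : measurable_fun [set: T] (fun u => (W u <= w)%R%:R : R).
  rewrite [X in measurable_fun _ X](_ : _ = \1_[set u | W u <= w]).
    exact: measurable_indic.
  by apply/funext => u; rewrite IE.
have l1 : L1 P (fun u => (W u <= w)%R%:R).
  by apply: (@L1_bounded _ _ _ _ _ 1) => // u; case: (W u <= w); rewrite ?normr1 ?normr0.
split => //; rewrite EFin_Ex// -[X in P X]setIT -integral_indic//.
by apply: eq_integral => u _; rewrite IE.
Qed.

(** The indicator of the ray lies, up to e / 3, between two smoothed indicators with thresholds
    shifted to the left and to the right; their limits are both close to the normal distribution
    function. The value w = 0 is excluded for V = 0, where the limit jumps. *)
Lemma cdf_limit (W : nat -> T -> R) V : 0 <= V ->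
  (forall n, measurable_fun [set: T] (W n)) ->
  (forall w del e, 0 < del -> 0 < e -> exists N, forall n, (N <= n)%N ->
     `|Ex P (fun u => heat w del (W n u)) - heat w (del + V) 0| <= e) ->
  forall w, 0 < V \/ w != 0 ->
  P [set u | W n u <= w] @[n --> \oo] --> (normal_cdf V w)%:E.
Proof.
move=> V0 mW hW w Vw.
have PE n := prob_ray_Ex w (mW n).
under eq_fun do rewrite (PE _).1.
apply: cvg_EFin; first exact: nearW.
apply/cvgrPdist_le => e e0; have e3 : 0 < e / 3 by rewrite divr_gt0.
have [M [M0 t1 t2]] := ncdf_tails e3.
have [s s0 hs] := heat_to_normal_cdf M V0 Vw e3.
have [s' s'0 hs'] := heat_to_normal_cdf (- M) V0 Vw e3.
have [N hN] := hW (w + M * s) (s ^+ 2) (e / 3) (exprn_gt0 2 s0) e3.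
have [N' hN'] := hW (w + - M * s') (s' ^+ 2) (e / 3) (exprn_gt0 2 s'0) e3.
exists (maxn N N') => // n; rewrite /= geq_max => /andP[/hN a1 /hN' a2].
have LH w' t : L1 P (fun u => heat w' t (W n u)).
  apply: (@L1_bounded _ _ _ _ _ 1); last by move=> u; exact: heat_bound.
  exact: (measurableT_comp (measurable_heat w' t)).
have up : Ex P (fun u => (W n u <= w)%R%:R) <= Ex P (fun u => heat (w + M * s) (s ^+ 2) (W n u)) + e / 3.
  rewrite -[X in _ + X](Ex_cst P) -ExD//; last exact: L1_cst.
  apply: Ex_le; [exact: (PE n).2|by apply: L1D => //; exact: L1_cst|move=> u].
  have [uw|_] := leP (W n u) w; last by rewrite addr_ge0 ?ncdf_ge0// ltW.
  rewrite -lerBlDr; apply: t1; rewrite sqrtr_sqr (gtr0_norm s0) ler_pdivlMr//; lra.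
have lo : Ex P (fun u => heat (w + - M * s') (s' ^+ 2) (W n u)) - e / 3 <= Ex P (fun u => (W n u <= w)%R%:R).
  rewrite -[X in _ - X](Ex_cst P) -ExB//; last exact: L1_cst.
  apply: Ex_le; [by apply: L1B => //; exact: L1_cst|exact: (PE n).2|move=> u].
  have [_|uw] := leP (W n u) w.
    by have := ncdf_le1 ((w + - M * s' - W n u) / Num.sqrt (s' ^+ 2)); rewrite /heat /=; lra.
  rewrite subr_le0; apply: t2; rewrite sqrtr_sqr (gtr0_norm s'0) ler_pdivrMr//; lra.
rewrite distrC; move: a1 a2 hs hs' up lo; rewrite !ler_norml.
set p := Ex P _; set x := Ex P _; set y := Ex P _; set h := heat _ _ _; set h' := heat _ _ _.
move: p x y h h' (normal_cdf V w) => p x y h h' v.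
move=> /andP[i1 i2] /andP[i3 i4] /andP[i5 i6] /andP[i7 i8] i9 i10.
clear - i1 i2 i3 i4 i5 i6 i7 i8 i9 i10; by apply/andP; split; lra.
Qed.

End cdf_limit.

(** * Transfer to general densities *)

Section admissible_densities.
Context (R : realType).
Local Notation mu := (@lebesgue_measure R).
Variables (c1 c2 : R) (h : R -> R).
Hypothesis c12 : c1 < c2.
Hypothesis hd : admissible_density `[c1, c2] h.

Let mh : measurable_fun [set: R] h. Proof. by have [[]] := hd. Qed.
Let h0 x : 0 <= h x. Proof. by have [[]] := hd. Qed.
Let h1 : (\int[mu]_x (h x)%:E = 1)%E. Proof. by have [[]] := hd. Qed.
Let hout x : ~ `[c1, c2]%classic x -> h x = 0. Proof. by have [_ H _ _] := hd; exact: H. Qed.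

Lemma admissible_integrable (D : set R) : measurable D -> mu.-integrable D (EFin \o h).
Proof.
move=> mD; apply: (@integrableS _ _ _ mu [set: R]) => //.
apply/integrableP; split; first exact/measurable_EFinP.
rewrite (_ : (\int[mu]_x _)%E = (\int[mu]_x (h x)%:E)%E) ?h1 ?ltry//.
by under eq_integral => x _ do rewrite /= ger0_norm//.
Qed.

Lemma admissible_bounds : exists m M : R, [/\ 0 < m, m <= M, forall x, h x <= M &
  forall x, c1 <= x <= c2 -> m <= h x].
Proof.
have [_ _ [M hM] [m m0 hm]] := hd; exists m, M; split=> //.
  by apply: le_trans (hM c1); apply: hm; rewrite /= in_itv/= lexx ltW.
Qed.

Lemma dist_funB x y : x <= y -> dist_fun h y - dist_fun h x = \int[mu]_(t in `]x, y]) h t.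
Proof.
move=> xy; rewrite /dist_fun.
by apply: Rintegral_itvB => //; exact: admissible_integrable.
Qed.

Let len x y : x <= y -> mu `]x, y]%classic = (y - x)%:E.
Proof.
move=> xy; have := lebesgue_measure_itv `]x, y]; rewrite /= lte_fin => ->.
case: ltP => // yx; congr EFin.
by apply/esym/eqP; rewrite subr_eq0 eq_le xy yx.
Qed.

Let Rint_cst x y (c : R) : x <= y -> \int[mu]_(t in `]x, y]) c = c * (y - x).
Proof.
by move=> xy; rewrite Rintegral_cst//; congr (_ * _); rewrite -[RHS]/(fine (y - x)%:E) -(len xy).
Qed.

Let int_cst x y (c : R) : x <= y -> mu.-integrable `]x, y] (EFin \o (fun=> c)).
Proof.
move=> xy; apply: measurable_bounded_integrable => //.
- by rewrite [X in (X < _)%E](len xy) ltry.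
- by exists `|c|; split; [exact: num_real|move=> z /ltW cz t _ /=].
Qed.

Lemma dist_fun_le M x y : (forall t, h t <= M) -> x <= y -> dist_fun h y - dist_fun h x <= M * (y - x).
Proof.
move=> hM xy; rewrite dist_funB// -Rint_cst//; apply: le_Rintegral => //.
  exact: admissible_integrable.
exact: int_cst.
Qed.

Lemma dist_fun_ge m x y : (forall t, c1 <= t <= c2 -> m <= h t) -> c1 <= x -> x <= y -> y <= c2 ->
  m * (y - x) <= dist_fun h y - dist_fun h x.
Proof.
move=> hm cx xy yc; rewrite dist_funB// -Rint_cst//; apply: le_Rintegral => //.
- exact: int_cst.
- exact: admissible_integrable.
move=> t /=; rewrite in_itv/= => /andP[xt ty]; apply: hm.
by rewrite (le_trans cx (ltW xt)) (le_trans ty yc).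
Qed.

Lemma dist_fun_mono x y : x <= y -> dist_fun h x <= dist_fun h y.
Proof. by move=> xy; rewrite -subr_ge0 dist_funB//; apply: Rintegral_ge0. Qed.

Lemma measurable_dist_fun : measurable_fun [set: R] (dist_fun h).
Proof. by apply: nondecreasing_measurable => // x y; exact: dist_fun_mono. Qed.

Lemma dist_fun_left x : x <= c1 -> dist_fun h x = 0.
Proof.
have D0 y : y < c1 -> dist_fun h y = 0.
  move=> yc; rewrite /dist_fun (_ : \int[mu]_(t in _) h t = \int[mu]_(t in `]-oo, y]) 0).
    by rewrite Rintegral_cst// mul0r.
  apply: eq_Rintegral => t; rewrite inE/= in_itv/= => ty; apply: hout => /=.
  by rewrite in_itv/= leNgt (le_lt_trans ty yc).
rewrite le_eqVlt => /predU1P[->|]; last exact: D0.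
have [m [M [m0 mM hM _]]] := admissible_bounds.
apply/eqP; rewrite eq_le; apply/andP; split; last by apply: Rintegral_ge0.
(* The endpoint itself, where the density may be positive: compare with a point at distance e / M to
   its left. *)
apply/ler_addgt0Pr => e e0; have M0 : 0 < M by exact: lt_le_trans mM.
have q0 : 0 < e / M by rewrite divr_gt0.
have := @dist_fun_le M (c1 - e / M) c1 hM ltac:(lra).
rewrite (D0 (c1 - e / M)); last by lra.
by rewrite subr0 opprB addrC subrK mulrCA mulfV ?gt_eqF// mulr1 add0r.
Qed.

Lemma dist_fun_right x : c2 <= x -> dist_fun h x = 1.
Proof.
move=> cx; rewrite /dist_fun -[RHS]/(fine 1%E) -h1 /Rintegral; congr fine.
rewrite integral_mkcond; apply: eq_integral => t _; rewrite patchE.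
case: ifPn => //; rewrite notin_setE/= in_itv/= => /negP; rewrite -ltNge => xt.
by rewrite hout//= in_itv/= => /andP[_]; rewrite leNgt (le_lt_trans cx xt).
Qed.

Lemma dist_fun01 x : 0 <= dist_fun h x <= 1.
Proof.
apply/andP; split; first by apply: Rintegral_ge0.
have cm : c2 <= Num.max c2 x by rewrite le_max lexx.
by rewrite -(dist_fun_right cm) dist_fun_mono// le_max lexx orbT.
Qed.

Lemma dist_fun_derivative : {ae mu, forall x, derivative (dist_fun h) x (h x)}.
Proof.
have hl : locally_integrable [set: R] h.
  by apply: open_integrable_locally; [exact: openT|exact: admissible_integrable].
have := FTC1Ny (fun y => admissible_integrable (measurable_itv _)) hl.
apply: (@filterS _ _ (ae_filter_ringOfSetsType mu)) => x [dx dh].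
by rewrite /derivative -dh derive1E; exact: derivableP.
Qed.

Lemma continuous_dist_fun x : {for x, continuous (dist_fun h)}.
Proof.
have [m [M [m0 mM hM _]]] := admissible_bounds.
have M0 : 0 < M by exact: lt_le_trans mM.
apply/(@cvgrPdist_le _ R^o) => e e0; near=> y.
have xy : `|x - y| <= e / M.
  by near: y; apply/nbhs_ballP; exists (e / M) => /=; [exact: divr_gt0|move=> y; rewrite /ball/= => /ltW].
have -> : e = M * (e / M) by rewrite mulrCA mulfV ?gt_eqF// mulr1.
apply: le_trans (_ : M * `|x - y| <= _); last by rewrite ler_pM2l.
have [le|/ltW le] := leP x y.
  rewrite distrC ger0_norm ?subr_ge0 ?dist_fun_mono// distrC ger0_norm ?subr_ge0//.
  exact: dist_fun_le.
rewrite ger0_norm ?subr_ge0 ?dist_fun_mono// ger0_norm ?subr_ge0//.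
exact: dist_fun_le.
Unshelve. all: by end_near. Qed.

Lemma dist_fun_surj u : 0 <= u <= 1 -> exists q, c1 <= q <= c2 /\ dist_fun h q = u.
Proof.
move=> /andP[u0 u1].
have [||q qi qe] := @IVT R (dist_fun h) c1 c2 u (ltW c12).
- by apply: continuous_subspaceT => x; exact: continuous_dist_fun.
- by rewrite dist_fun_left// dist_fun_right// (min_idPl _)// (max_idPr _)// u0 u1.
by exists q; split => //; move: qi; rewrite in_itv.
Qed.

End admissible_densities.

Lemma derivative_expansion (R : realType) (F : R -> R) (x df e : R) : derivative F x df -> 0 < e ->
  exists2 c : R, 0 < c & forall y, x < y -> y - x <= c -> `|F y - F x - df * (y - x)| <= e * (y - x).
Proof.
move=> hF e0; have [dF dE] := hF.
have : (fun u => u^-1 *: (F (u *: 1 + x) - F x)) @ 0^' --> df by rewrite -dE; exact: dF.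
move/cvgrPdist_le/(_ _ e0); rewrite near_withinE => /nbhs_ballP[c /= c0 hc].
exists (c / 2) => [|y xy yc]; first by rewrite divr_gt0.
have yx : 0 < y - x by rewrite subr_gt0.
have := hc (y - x); rewrite /ball/= sub0r normrN gtr0_norm// => /(_ _ _)/=.
have lt : y - x < c by rewrite (le_lt_trans yc)// ltr_pdivrMr// ltr_pMr// ltr1n.
move=> /(_ lt); rewrite gt_eqF// => /(_ isT).
rewrite scaler1 subrK distrC /GRing.scale/= => h.
rewrite (_ : _ - df * _ = (y - x) * ((y - x)^-1 * (F y - F x) - df)); last by field; rewrite gt_eqF.
by rewrite normrM gtr0_norm// mulrC ler_pM2r.
Qed.

(** The elementary core of [quant_ratio_lim]: a = exp(- z), b = exp(- s), D is the increment of the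
    quantile, a - a b that of F and Gd that of G. Two first order expansions with common error [eta]
    give the quotient. *)
Lemma quotient_of_increments (R : realType) (a b s D Gd fq gq eta m M B e : R) :
  0 < a -> 0 < s -> s <= eta -> 1 - s <= b -> (1 + s) * b <= 1 -> 0 < b ->
  0 < D -> 0 < m -> m <= fq -> 0 <= gq <= M -> 0 <= B -> 0 <= Gd <= B * (a - a * b) ->
  `|a - a * b - fq * D| <= eta * D -> `|Gd - gq * D| <= eta * D ->
  (1 + B + M) * eta <= e * m -> `|a^-1 * Gd / s - gq / fq| <= e.
Proof.
move=> a0 s0 seta bs1 bs b0 D0 m0 mfq /andP[g0 gM] B0 /andP[Gd0 GdB] eF eG Ke.
have f0 := lt_le_trans m0 mfq; have eta0 := lt_le_trans s0 seta.
set rho := a^-1 * Gd / s.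
pose phi := (1 - b) / s.
have phi1 : phi <= 1 by rewrite ler_pdivrMr ?mul1r//; lra.
have sb0 := mulr_ge0 (ltW s0) (ltW b0).
have phi0 : 0 <= phi by apply: divr_ge0; [lra|exact: ltW].
have phis : 1 - phi <= s.
  rewrite lerBlDr -lerBlDl /phi ler_pdivlMr//.
  have : s * (1 - b) <= s * s by rewrite ler_pM2l//; lra.
  by lra.
have u0 : 0 <= 1 - phi by lra.
have rho0 : 0 <= rho by apply: divr_ge0; [apply: mulr_ge0 => //; rewrite invr_ge0 ltW|exact: ltW].
have rhoB : rho <= B.
  rewrite /rho ler_pdivrMr// mulrC ler_pdivrMr//; apply: (le_trans GdB).
  rewrite -mulrA ler_wpM2l// -[X in X - _]mulr1 -mulrBr mulrC ler_pM2r//; lra.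
have rhoD : rho * (a - a * b) = Gd * phi by rewrite /rho /phi; field; rewrite !gt_eqF.
have key : `|rho * fq - gq| * D <= (1 + B + M) * eta * D.
  rewrite -[X in _ * X <= _](gtr0_norm D0) -normrM.
  have rD2 : rho * (a - a * b - fq * D) = Gd * phi - rho * (fq * D) by rewrite mulrBr rhoD.
  (* With phi = (1 - b) / s, which lies between 1 - s and 1, the error splits into the expansion of
     F, the expansion of G and the defect 1 - phi. *)
  rewrite [X in `|X|](_ : _ = - (rho * (a - a * b - fq * D)) + ((Gd - gq * D) * phi - gq * D * (1 - phi))); last first.
    by rewrite rD2; ring.
  apply: le_trans (ler_normD _ _) _; rewrite normrN normrM (ger0_norm rho0).
  rewrite (_ : _ * eta * D = B * (eta * D) + (eta * D + M * D * eta)); last by ring.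
  apply: lerD; first by apply: ler_pM.
  apply: le_trans (ler_normB _ _) _; apply: lerD.
    by rewrite normrM (ger0_norm phi0) -[leRHS]mulr1; apply: ler_pM.
  have gD0 : 0 <= gq * D by rewrite mulr_ge0// ltW.
  rewrite ger0_norm; last exact: mulr_ge0.
  by apply: ler_pM => //; [rewrite ler_pM2r|exact: le_trans phis seta].
rewrite ler_pM2r// in key.
rewrite (_ : rho - _ = (rho * fq - gq) / fq); last by field; rewrite gt_eqF.
rewrite normrM normfV (gtr0_norm f0) ler_pdivrMr//; apply: (le_trans key).
apply: (le_trans Ke); rewrite ler_wpM2l//.
have p0 : 0 <= (1 + B + M) * eta by apply: mulr_ge0; [lra|exact: ltW].
by rewrite -(pmulr_lge0 _ m0) (le_trans p0).
Qed.

(** * The quantile transform *)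

Section quantile_transform.
Context (R : realType).
Local Notation mu := (@lebesgue_measure R).
Local Notation expo := (expo R).
Variables (c1 c2 : R) (f g : R -> R).
Hypothesis c12 : c1 < c2.
Hypothesis hf : admissible_density `[c1, c2] f.
Hypothesis hg : admissible_density `[c1, c2] g.
Local Notation F := (dist_fun f).
Local Notation G := (dist_fun g).
Variables (mf Mf mg Mg : R).
Hypothesis mf0 : 0 < mf.
Hypothesis mMf : mf <= Mf.
Hypothesis fM : forall x, f x <= Mf.
Hypothesis fm : forall x, c1 <= x <= c2 -> mf <= f x.
Hypothesis mg0 : 0 < mg.
Hypothesis mMg : mg <= Mg.
Hypothesis gM : forall x, g x <= Mg.
Hypothesis gm : forall x, c1 <= x <= c2 -> mg <= g x.

Let Mf0 : 0 < Mf. Proof. exact: lt_le_trans mMf. Qed.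
Let Mg0 : 0 < Mg. Proof. exact: lt_le_trans mMg. Qed.

(* Right of [c2] the logarithm has the junk value [ln 0 = 0]. *)
Definition expmap (x : R) : R := - ln (1 - F x).

Lemma measurable_expmap : measurable_fun [set: R] expmap.
Proof.
apply: measurableT_comp => //; apply: (measurableT_comp (@measurable_ln R)).
by apply: measurable_funB => //; exact: measurable_dist_fun hf.
Qed.

Lemma expmap_ge0 x : 0 <= expmap x.
Proof.
have /andP[a b] := dist_fun01 hf x.
by rewrite oppr_ge0 ln_le0//; lra.
Qed.

Let F_strict x y : c1 <= x -> x < y -> y <= c2 -> F x < F y.
Proof.
move=> cx xy yc; have := dist_fun_ge hf fm cx (ltW xy) yc.
have : 0 < mf * (y - x) by rewrite mulr_gt0// subr_gt0.
by lra.
Qed.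

Let F_lt1 x : c1 <= x < c2 -> F x < 1.
Proof. by move=> /andP[a b]; rewrite -(dist_fun_right hf (lexx c2)) F_strict. Qed.

Lemma expmap_mono x y : c1 <= x < c2 -> c1 <= y < c2 -> x <= y -> expmap x <= expmap y.
Proof.
move=> /F_lt1 hx /F_lt1 hy xy; rewrite lerN2 ler_ln ?posrE ?subr_gt0//.
by rewrite lerD2l lerN2; exact: dist_fun_mono hf _ _ xy.
Qed.

(** A solution exists by the intermediate value theorem and is unique, since F is strictly
    increasing on the support; this makes [quant] the inverse of [expmap] there. *)
Definition quant (z : R) : R :=
  xget c1 [set q | c1 <= q <= c2 /\ F q = 1 - expR (- Num.max z 0)].

Lemma quantP z : c1 <= quant z <= c2 /\ F (quant z) = 1 - expR (- Num.max z 0).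
Proof.
rewrite /quant; case: xgetP => [q -> //|/forallNP/forallNP H].
have e1 : expR (- Num.max z 0) <= 1 by rewrite -[leRHS]expR0 ler_expR oppr_le0 le_max lexx orbT.
have e0 := expR_gt0 (- Num.max z 0).
have [|q hq] := @dist_fun_surj R c1 c2 f c12 hf (1 - expR (- Num.max z 0)); first by apply/andP; split; lra.
by case: (H q).
Qed.

Lemma quantK x : c1 <= x < c2 -> quant (expmap x) = x.
Proof.
move=> hx; have x1 := F_lt1 hx; have [/andP[a b] e] := quantP (expmap x).
move: e; rewrite (max_idPl _) ?expmap_ge0// /expmap opprK lnK ?posrE ?subr_gt0// subKr => e.
have /andP[cx xc] := hx.
have [lt|lt|//] := ltgtP (quant (expmap x)) x.
  by have := F_strict a lt (ltW xc); rewrite /expmap e ltxx.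
by have := F_strict cx lt b; rewrite /expmap e ltxx.
Qed.

Lemma quant_mono z z' : z <= z' -> quant z <= quant z'.
Proof.
move=> zz'; have [/andP[a b] e] := quantP z; have [/andP[a' b'] e'] := quantP z'.
rewrite leNgt; apply/negP => lt; have := F_strict a' lt b.
rewrite e e' ltNge lerD2l lerN2 ler_expR lerN2.
by rewrite ge_max !le_max zz' lexx orbT.
Qed.

Lemma measurable_quant : measurable_fun [set: measurableTypeR R] quant.
Proof. by apply: nondecreasing_measurable => // x y; exact: quant_mono. Qed.

Definition quant_dist (z : R) : R := G (quant z).

Definition quant_ratio (z : R) : R := g (quant z) / f (quant z).

Lemma measurable_quant_dist : measurable_fun [set: measurableTypeR R] quant_dist.
Proof. by apply: (measurableT_comp (measurable_dist_fun hg)); exact: measurable_quant. Qed.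

Lemma measurable_quant_ratio : measurable_fun [set: measurableTypeR R] quant_ratio.
Proof.
have [[mF _ _] _ _ _] := hf; have [[mG _ _] _ _ _] := hg.
apply: measurable_funM; first exact: (measurableT_comp mG measurable_quant).
(* The inverse is written as a power in order to use the measurability of powers; the base is
   positive on the support. *)
rewrite (_ : (fun z => _) = (fun z => f (quant z) `^ (-1))); last first.
  apply/funext => z; rewrite powR_inv1//; apply: le_trans (ltW mf0) _.
  by apply: fm; have [] := quantP z.
by apply: (measurableT_comp (measurable_powR (-1))); exact: (measurableT_comp mF measurable_quant).
Qed.

Lemma quant_ratio_bounds z : mg / Mf <= quant_ratio z <= Mg / mf.
Proof.
have [qc _] := quantP z; have a := gm qc; have b := fm qc; have f0 := lt_le_trans mf0 b.
apply/andP; split; apply: ler_pM; rewrite ?invr_ge0 ?lef_pV2 ?posrE ?fM ?gM ?(ltW mg0) ?(ltW Mf0) ?(ltW f0)//.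
exact: le_trans (ltW mg0) a.
Qed.

Let Fdiff z z' : 0 <= z -> z <= z' -> F (quant z') - F (quant z) = expR (- z) - expR (- z').
Proof.
move=> z0 zz'; have [_ e] := quantP z; have [_ e'] := quantP z'.
by rewrite e e' !(max_idPl _) ?(le_trans z0)//; ring.
Qed.

Let quant_diff z z' : 0 <= z -> z <= z' ->
  mf * (quant z' - quant z) <= expR (- z) - expR (- z') <= Mf * (quant z' - quant z).
Proof.
move=> z0 zz'; have [/andP[a b] _] := quantP z; have [/andP[a' b'] _] := quantP z'.
have qq := quant_mono zz'.
by rewrite -Fdiff// (dist_fun_le hf fM qq) (dist_fun_ge hf fm).
Qed.

Lemma quant_dist_bounds z z' : 0 <= z -> z <= z' ->
  mg / Mf * (expR (- z) - expR (- z')) <= quant_dist z' - quant_dist z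
    <= Mg / mf * (expR (- z) - expR (- z')).
Proof.
move=> z0 zz'; have /andP[h1 h2] := quant_diff z0 zz'.
have [/andP[a b] _] := quantP z; have [/andP[a' b'] _] := quantP z'.
have qq := quant_mono zz'.
have h3 := dist_fun_ge hg gm a qq b'; have h4 := dist_fun_le hg gM qq.
apply/andP; split.
  by apply: le_trans h3; rewrite -mulrA ler_pM2l// mulrC ler_pdivrMr// mulrC.
by apply: le_trans h4 _; rewrite -mulrA ler_pM2l// mulrC ler_pdivlMr// mulrC.
Qed.

Lemma quant_ratio_lim z : 0 <= z ->
  derivative F (quant z) (f (quant z)) -> derivative G (quant z) (g (quant z)) ->
  forall e, 0 < e -> exists2 c, 0 < c & forall s, 0 < s < c ->
    `|ratio quant_dist z s - quant_ratio z| <= e.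
Proof.
move=> z0 dF dG e e0; set q := quant z in dF dG *.
have [qc _] := quantP z; have fq := fm qc; have f0 := lt_le_trans mf0 fq.
pose K := 1 + Mg / mf + Mg; have K0 : 0 < K.
  have q0 : 0 <= Mg / mf by apply: divr_ge0; exact: ltW.
  by have := Mg0; rewrite /K; lra.
pose eta := e * mf / K; have eta0 : 0 < eta by rewrite divr_gt0 ?mulr_gt0.
have [cF cF0 hcF] := derivative_expansion dF eta0.
have [cG cG0 hcG] := derivative_expansion dG eta0.
(* A step s moves the quantile by at most s / mf, hence the factor [mf]. *)
exists (Num.min eta (mf * Num.min cF cG)) => [|s].
  by rewrite lt_min eta0 mulr_gt0// lt_min cF0 cG0.
rewrite lt_min => /andP[s0 /andP[seta sc]].
have zs : z <= z + s by rewrite lerDl ltW.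
have /andP[h1 h2] := quant_diff z0 zs.
have /andP[G1 G2] := quant_dist_bounds z0 zs.
have FD := Fdiff z0 zs.
have ee : expR (- (z + s)) = expR (- z) * expR (- s) by rewrite opprD expRD.
rewrite /ratio (max_idPl _)//.
have ez := expR_gt0 z; have ezz := expRxMexpNx_1 z.
set q' := quant (z + s) in h1 h2 FD *.
set a := expR (- z) in h1 h2 FD G1 G2 ee ezz *.
have a0 : 0 < a by exact: expR_gt0.
have a1 : a <= 1 by rewrite /a -[leRHS]expR0 ler_expR oppr_le0.
have es := expRN_ge s.
have es1 : expR (- s) < 1 by rewrite -[ltRHS]expR0 ltr_expR oppr_lt0.
set b := expR (- s) in ee es es1 *.
rewrite ee in h1 h2 FD G1 G2.
have dpos : 0 < a - a * b by rewrite subr_gt0 -[ltRHS]mulr1 ltr_pM2l.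
have b1s : 1 - b <= s by rewrite lerBlDr -lerBlDl.
have das : a - a * b <= s.
  rewrite -[X in X - _]mulr1 -mulrBr; apply: le_trans b1s.
  by rewrite ler_piMl// subr_ge0 ltW.
have qq : 0 < q' - q by rewrite -(pmulr_rgt0 _ Mf0); exact: lt_le_trans h2.
have qs : mf * (q' - q) < mf * Num.min cF cG by apply: le_lt_trans sc; exact: le_trans h1 das.
move: qs; rewrite ltr_pM2l// lt_min => /andP[/ltW qF /ltW qG].
have q'q : q < q' by rewrite -subr_gt0.
have := hcF q' q'q qF; rewrite -/q FD => eF.
have eG := hcG q' q'q qG.
have ea : expR z = a^-1 by apply: (mulIf (lt0r_neq0 a0)); rewrite ezz mulVf ?gt_eqF.
have bs : (1 + s) * b <= 1.
  by rewrite -[leRHS](expRxMexpNx_1 s) ler_pM2r ?expR_gt0//; exact: expR_ge1Dx.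
have MGm : 0 <= Mg / mf by apply: divr_ge0; exact: ltW.
rewrite ea; apply: (quotient_of_increments (D := q' - q) (m := mf) (M := Mg) (B := Mg / mf) a0 s0 (ltW seta) es bs) => //.
- exact: expR_gt0.
- by rewrite gM (le_trans (ltW mg0))//; exact: gm.
- rewrite G2 andbT; apply: le_trans G1; apply: mulr_ge0; [exact: divr_ge0 (ltW mg0) (ltW Mf0)|exact: ltW].
- by rewrite -/K /eta mulrCA mulfV ?mulr1// gt_eqF.
Qed.

End quantile_transform.

(** * Transfer to a sample of density f *)

Section transfer.
Context d (T : measurableType d) (R : realType) (P : probability T R).
Local Notation mu := (@lebesgue_measure R).
Local Notation expo := (expo R).
Variables (c1 c2 : R) (f g : R -> R).
Hypothesis c12 : c1 < c2.
Hypothesis hf : admissible_density `[c1, c2] f.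
Hypothesis hg : admissible_density `[c1, c2] g.
Variable X : nat -> {RV P >-> R}.
Hypothesis hX : iid_with_density X f.

Variable r : R.
Hypothesis r0 : 0 < r.

Let Z i (w : T) : R := expmap f (X i w).

Let mZ i : measurable_fun [set: T] (Z i).
Proof. by apply: (measurableT_comp (measurable_expmap hf)); exact: measurable_funP. Qed.

Let Z0 i w : 0 <= Z i w.
Proof. exact: expmap_ge0 hf _. Qed.

(** The right endpoint is excluded as well, because [expmap] has a junk value there. *)
Let interior_null : (\int[mu]_(x in ~` `[c1, c2[%classic) (f x)%:E = 0)%E.
Proof.
rewrite -(integral0 mu (~` `[c1, c2[%classic)).
have [[mf _ _] fout _ _] := hf.
apply: ae_eq_integral => //.
- exact: measurableC.
- by apply/measurable_EFinP; exact: measurable_funTS.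
exists [set c2]; split; [exact: measurable_set1|exact: lebesgue_measure_set1|].
move=> x /= h; apply: contrapT => xc2; apply: h => xc; congr EFin; apply: fout => /=.
move: xc; rewrite /= !in_itv/= => xc /andP[a b]; apply: xc.
by rewrite a lt_neqAle b andbT; apply/eqP.
Qed.

Let endpoints_null i : P (X i @^-1` (~` `[c1, c2[%classic)) = 0%E.
Proof.
have [_ /(_ i) hd] := hX.
by rewrite -interior_null -hd//; exact: measurableC.
Qed.

(** For t >= 0 the event Z > t is q < X < c2, where F(q) = 1 - exp(- t): at and beyond c2 the junk
    value of [expmap] is 0, which does not exceed t. *)
Let law_ray i t : P (Z i @^-1` `]t, +oo[%classic) = expo `]t, +oo[%classic.
Proof.
have [t0|t0] := ltP t 0.
  rewrite expo_ray_neg ?(ltW t0)// (_ : _ @^-1` _ = setT) ?probability_setT//.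
  by apply/seteqP; split => w //= _; rewrite in_itv/= andbT (lt_le_trans t0).
rewrite expo_ray//.
have [m [M [m0 mM fM fm]]] := admissible_bounds c12 hf.
have [|q [/andP[cq qc] Fq]] := @dist_fun_surj R c1 c2 f c12 hf (1 - expR (- t)).
  have := expR_gt0 (- t); have : expR (- t) <= 1 by rewrite -[leRHS]expR0 ler_expR oppr_le0.
  by move=> a b; apply/andP; split; lra.
have e1 := expR_gt0 (- t).
have -> : Z i @^-1` `]t, +oo[%classic = X i @^-1` `]q, c2[%classic.
  apply/seteqP; split => w; rewrite /= /Z !in_itv/= ?andbT.
    move: (X i w : R) => x; rewrite /expmap => h.
    have F1 : 0 < 1 - dist_fun f x.
      by rewrite ltNge; apply/negP => /ln0 lx; move: h; rewrite lx oppr0 ltNge t0.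
    have Fx : dist_fun f q < dist_fun f x.
      have : expR (ln (1 - dist_fun f x)) < expR (- t) by rewrite ltr_expR; lra.
      by rewrite lnK ?posrE// Fq; lra.
    apply/andP; split; rewrite ltNge; apply/negP => le.
      by move: Fx; rewrite ltNge (dist_fun_mono hf).
    by move: F1; rewrite (dist_fun_right hf)// subrr ltxx.
  move: (X i w : R) => x /andP[qx xc].
  have := dist_fun_ge hf fm cq (ltW qx) (ltW xc).
  have := dist_fun_ge hf fm (le_trans cq (ltW qx)) (ltW xc) (lexx c2).
  have p1 : 0 < m * (x - q) by rewrite mulr_gt0// subr_gt0.
  have p2 : 0 < m * (c2 - x) by rewrite mulr_gt0// subr_gt0.
  rewrite (dist_fun_right hf (lexx c2)) Fq /expmap => a b.
  have F1 : 0 < 1 - dist_fun f x by lra.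
  have : expR (ln (1 - dist_fun f x)) < expR (- t) by rewrite lnK ?posrE//; lra.
  by rewrite ltr_expR; lra.
have [_ /(_ i) hd] := hX.
have -> : P (X i @^-1` `]q, c2[%classic) = (\int[mu]_(x in `]q, c2[%classic) (f x)%:E)%E.
  by rewrite -hd.
have ii (D : set R) : measurable D -> mu.-integrable D (EFin \o f) by exact: (admissible_integrable hf).
rewrite -[LHS]fineK; last by apply: integrable_fin_num => //; exact: ii.
congr EFin; rewrite -/(Rintegral _ _ _) Rintegral_itv_bndo_bndc; last exact: ii.
by rewrite -(dist_funB hf qc) (dist_fun_right hf (lexx c2)) Fq; ring.
Qed.

Let law i (B : set (measurableTypeR R)) : measurable B -> P (Z i @^-1` B) = expo B.
Proof.
have mZi : @measurable_fun _ _ T (measurableTypeR R) setT (Z i) := mZ i.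
pose Zi : {mfun T >-> measurableTypeR R} := @mfun_Sub _ _ T (measurableTypeR R) (Z i) (mem_set mZi).
move=> mB; rewrite -[LHS]/(distribution P Zi B).
apply: measure_eq_rays => // [x|x]; last exact: law_ray.
exact: (le_lt_trans (probability_le1 _ _) (ltry _)).
Qed.

Let indZ (s : seq nat) (B : nat -> set (measurableTypeR R)) : uniq s ->
  (forall i, measurable (B i)) ->
  P (\bigcap_(i in [set` s]) Z i @^-1` B i) = (\prod_(i <- s) expo (B i))%E.
Proof.
move=> us mB; have [ind _] := hX.
have mpre i : measurable (expmap f @^-1` B i : set R).
  by have := measurable_expmap hf measurableT (mB i); rewrite setTI.
have := ind s (fun i => expmap f @^-1` B i) us mpre => ->.
by apply: eq_bigr => i _; rewrite -(law i (mB i)).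
Qed.

Let k0 := quant_ratio c1 c2 f g.
Let Gh := quant_dist c1 c2 f g.

Let interior_ae : {ae P, forall w, forall i, c1 <= X i w < c2}.
Proof.
suff : P.-negligible (~` [set w | forall i, c1 <= X i w < c2]) by [].
rewrite (_ : ~` _ = \bigcup_i (X i @^-1` (~` `[c1, c2[%classic))); last first.
  apply/seteqP; split => [w /= /existsNP[i hi]|w [i _ /= hi] h].
    by exists i => //=; rewrite in_itv.
  by apply: hi; rewrite in_itv; exact: h.
apply: negligible_bigcup => i; exists (X i @^-1` (~` `[c1, c2[%classic)); split => //; last exact: endpoints_null.
by rewrite -[X in measurable X]setTI; apply: measurable_funP => //; exact: measurableC.
Qed.

Let k0Z : {ae P, forall w, k0 (Z 0 w) = g (X 0 w) / f (X 0 w)}.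
Proof.
move: interior_ae; apply: (@filterS _ _ (ae_filter_ringOfSetsType P)) => w /(_ 0%N) h.
have [mf [Mf [mf0 mMf fM fm]]] := admissible_bounds c12 hf.
by rewrite /k0 /quant_ratio /Z (quantK c12 hf mf0 fm).
Qed.

(** Almost surely all points lie in [c1, c2[, where [expmap] is increasing and hence commutes with
    sorting, and is inverted by [quant]. *)
Let spacing_exp n : {ae P, forall w, spacing_stat X g r n w = exp_stat r Gh Z n w}.
Proof.
move: interior_ae; apply: (@filterS _ _ (ae_filter_ringOfSetsType P)) => w h.
have [mf [Mf [mf0 mMf fM fm]]] := admissible_bounds c12 hf.
have xs i : (i < n)%N -> order_stat X n i w \in [seq X i w | i <- iota 0 n].
  by move=> i_n; rewrite -(mem_sort <=%R) mem_nth// size_sort size_map size_iota.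
have inn i : (i < n)%N -> c1 <= order_stat X n i w < c2.
  by move=> /xs /mapP[j _ ->].
have ordZ i : (i < n)%N -> order_stat Z n i w = expmap f (order_stat X n i w).
  move=> i_n; rewrite /order_stat.
  have -> : sort <=%R [seq Z i w | i <- iota 0 n] = map (expmap f) (sort <=%R [seq X i w | i <- iota 0 n]).
    apply: le_sorted_eq; first exact: sort_le_sorted.
      apply: (@homo_sorted_in _ _ (fun x => c1 <= x < c2) (expmap f) <=%R).
      - by move=> x y; exact: (expmap_mono hf mf0 fm).
      - by rewrite all_sort; apply/allP => _ /mapP[j _ ->]; exact: h.
      - exact: sort_le_sorted.
    rewrite perm_sort perm_sym (_ : [seq Z j w | j <- iota 0 n] = map (expmap f) [seq X j w | j <- iota 0 n]).
      by apply: perm_map; rewrite perm_sort.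
    by rewrite -map_comp.
  by rewrite (nth_map 0)// size_sort size_map size_iota.
rewrite /spacing_stat /exp_stat /gap_sum big_mkord; apply: eq_bigr => i _.
have i1 : (i.+1 < n)%N by rewrite -ltn_predRL.
rewrite (ordZ _ i1) (ordZ _ (ltnW i1)) /Gh /quant_dist.
by rewrite (quantK c12 hf mf0 fm (inn _ i1)) (quantK c12 hf mf0 fm (inn _ (ltnW i1))).
Qed.

(** Differentiability of F and G fails on a Lebesgue-null set of points x; the task is to see that
    its preimage under [quant] is null for the exponential law. *)
Let k0_lim : {ae expo, forall z, forall e, 0 < e ->
  exists2 c, 0 < c & forall s, 0 < s < c -> `|ratio Gh z s - k0 z| <= e}.
Proof.
have [mf [Mf [mf0 mMf fM fm]]] := admissible_bounds c12 hf.
have [mg [Mg [mg0 mMg gM gm]]] := admissible_bounds c12 hg.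
have [N [mN N0 hN]] : mu.-negligible (~` [set x | derivative (dist_fun f) x (f x) /\ derivative (dist_fun g) x (g x)]).
  by rewrite setCI; apply: negligibleU; [exact: dist_fun_derivative hf|exact: dist_fun_derivative hg].
have mQ := measurable_quant c12 hf mf0 fm.
have mN' : measurable (quant c1 c2 f @^-1` N : set (measurableTypeR R)).
  by have := mQ measurableT N mN; rewrite setTI.
have null : expo (quant c1 c2 f @^-1` N) = 0%E.
  (* The exponential law is that of [Z 0], and almost surely the quantile of [Z 0] is [X 0], whose
     law has density f and so charges no Lebesgue-null set. *)
  rewrite -(law 0 mN'); apply/eqP; rewrite -measure_le0.
  have mX (B : set R) : measurable B -> measurable (X 0%N @^-1` B).
    by move=> mB; rewrite -[X in measurable X]setTI; exact: measurable_funP.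
  apply: (@le_trans _ _ (P (X 0%N @^-1` N `|` X 0%N @^-1` (~` `[c1, c2[%classic)))).
    apply: le_measure; rewrite ?inE.
    - by have := mZ 0%N measurableT mN'; rewrite setTI.
    - by apply: measurableU; apply: mX => //; exact: measurableC.
    - move=> w /= hw; have [xc|xc] := boolP (c1 <= X 0%N w < c2).
        by left; move: hw; rewrite /Z (quantK c12 hf mf0 fm).
      by right; rewrite /= in_itv; exact/negP.
  apply: le_trans (measureU2 _ _ _) _; [exact: mX|by apply: mX; exact: measurableC|].
  rewrite [X in (_ + X)%E](endpoints_null 0) adde0.
  have [_ /(_ 0%N N mN) hN'] := hX.
  rewrite [leLHS](_ : _ = (\int[mu]_(x in N) (f x)%:E)%E)//.
  by rewrite (null_set_integral mN (measurable_int _ (admissible_integrable hf mN)) N0).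
exists (quant c1 c2 f @^-1` N `|` `]-oo, 0[%classic); split.
- by apply: measurableU.
- by rewrite measureU0//; exact: expo_neg.
move=> z /= nz; have [z0|z0] := ltP z 0; first by right; rewrite /= in_itv.
left; apply: contrapT => nN; apply: nz.
have [dF dG] : derivative (dist_fun f) (quant c1 c2 f z) (f (quant c1 c2 f z)) /\
    derivative (dist_fun g) (quant c1 c2 f z) (g (quant c1 c2 f z)).
  by apply: contrapT => h; apply: nN; exact: hN.
exact: (quant_ratio_lim c12 hf hg mf0 mMf fM fm mg0 mMg gM gm z0 dF dG).
Qed.

Let I p := \int[mu]_(x in `[c1, c2]) ((g x / f x) `^ p * f x).

(** The exponential law is again realised by [Z 0], whose quantile is almost surely [X 0];
    integrating against the density f replaces a change of variables. *)
Let Ex_k0 p : 0 < p -> Ex expo (fun z => k0 z `^ p) = I p.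
Proof.
move=> p0.
have [mf [Mf [mf0 mMf fM fm]]] := admissible_bounds c12 hf.
have [mg [Mg [mg0 mMg gM gm]]] := admissible_bounds c12 hg.
have mk0 := measurable_quant_ratio c12 hf hg mf0 fm.
have kb := quant_ratio_bounds c12 hf mf0 mMf fM fm mg0 gM gm.
have k00 z : 0 <= k0 z.
  by have /andP[a _] := kb z; apply: le_trans a; apply: divr_ge0; [exact: ltW|exact: le_trans (ltW mf0) mMf].
have mkp : measurable_fun [set: measurableTypeR R] (fun z => k0 z `^ p).
  by apply: (measurableT_comp (measurable_powR p)).
have Lk : L1 expo (fun z => k0 z `^ p).
  apply: (@L1_bounded _ _ _ _ _ ((Mg / mf) `^ p)) => // z; rewrite ger0_norm ?powR_ge0//.
  have /andP[_ b] := kb z.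
  by apply: ge0_ler_powR; rewrite ?nnegrE ?(ltW p0)// (le_trans (k00 z) b).
have [_ <-] := Ex_sample (P := P) mZ indZ 0 (fun z => powR_ge0 (k0 z) p) Lk.
pose u x := (g x / f x) `^ p.
have [[mF F0 _] fout _ _] := hf; have [[mG G0 _] gout _ _] := hg.
have mfi : measurable_fun [set: R] (fun x => (f x)^-1).
  rewrite (_ : (fun x => _) = (fun x => f x `^ (-1))); last first.
    by apply/funext => x; rewrite powR_inv1.
  exact: (measurableT_comp (measurable_powR (-1)) mF).
have mu' : measurable_fun [set: R] u.
  by apply: (measurableT_comp (measurable_powR p)); exact: measurable_funM.
transitivity (Ex P (fun w => u (X 0%N w))).
  rewrite /Ex /Rintegral; congr fine; apply: ae_eq_integral => //.
  - apply/measurable_EFinP.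
    exact: (measurableT_comp mkp (mZ 0%N)).
  - by apply/measurable_EFinP; apply: (measurableT_comp mu').
  move: k0Z; apply: (@filterS _ _ (ae_filter_ringOfSetsType P)) => w e _.
  by rewrite /u -e.
rewrite /Ex /I /Rintegral; congr fine.
have muE : measurable_fun [set: R] (EFin \o u) by exact/measurable_EFinP.
have uE x : (0 <= (EFin \o u) x)%E by rewrite /= lee_fin powR_ge0.
have mX : @measurable_fun _ _ T (measurableTypeR R) setT (X 0%N) := measurable_funP (X 0%N).
pose X0 : {mfun T >-> measurableTypeR R} := @mfun_Sub _ _ T (measurableTypeR R) (X 0%N) (mem_set mX).
rewrite -[LHS](@ge0_integral_distribution _ _ _ _ _ P X0 (EFin \o u))//.
have hd (B : set (measurableTypeR R)) : measurable B ->
    distribution P X0 B = (\int[mu]_(x in B) (f x)%:E)%E := hX.2 0%N B.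
rewrite (@integral_density _ (measurableTypeR R) R (distribution P X0) mu f F0 mF hd)//.
rewrite [RHS]integral_mkcond; apply: eq_integral => x _; rewrite patchE.
case: ifPn => //; rewrite notin_setE => /fout ->.
by rewrite mule0.
Qed.

Let limit_var : density_limvar r k0 = sigma2 c1 c2 f g r.
Proof. by rewrite /density_limvar /sigma2 !Ex_k0// mulr_gt0. Qed.

Let S n : T -> R := spacing_stat X g r n.
Let S' n : T -> R := exp_stat r Gh Z n.

Let mS n : measurable_fun [set: T] (S n).
Proof.
apply: measurable_sum => i; apply: (measurableT_comp (measurable_powR r)).
apply: measurable_funM => //; apply: measurable_funB;
  apply: (measurableT_comp (measurable_dist_fun hg)); exact: measurable_sort_nth.
Qed.

Let hyps : exists mG MG, [/\ 0 < mG, measurable_fun [set: measurableTypeR R] Gh,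
  measurable_fun [set: measurableTypeR R] k0,
  (forall z z', 0 <= z -> z <= z' ->
    mG * (expR (- z) - expR (- z')) <= Gh z' - Gh z <= MG * (expR (- z) - expR (- z'))) &
  (forall z, mG <= k0 z <= MG)].
Proof.
have [mf [Mf [mf0 mMf fM fm]]] := admissible_bounds c12 hf.
have [mg [Mg [mg0 mMg gM gm]]] := admissible_bounds c12 hg.
exists (mg / Mf), (Mg / mf); split.
- by rewrite divr_gt0// (lt_le_trans mf0).
- exact: (measurable_quant_dist c12 hf hg mf0 fm).
- exact: (measurable_quant_ratio c12 hf hg mf0 fm).
- move=> z z'; exact: (quant_dist_bounds c12 hf hg mf0 mMf fM fm mg0 mMg gM gm).
- exact: (quant_ratio_bounds c12 hf mf0 mMf fM fm mg0 gM gm).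
Qed.

Let Ex_S (h : R -> R) n : measurable_fun [set: R] h -> Ex P (fun w => h (S n w)) = Ex P (fun w => h (S' n w)).
Proof.
have [mG [MG [mG0 mGh mk0 GhB k0B]]] := hyps.
have mS' : measurable_fun [set: T] (S' n) by exact: measurable_exp_stat.
move=> mh; rewrite /Ex /Rintegral; congr fine; apply: ae_eq_integral => //.
- by apply/measurable_EFinP; exact: (measurableT_comp mh).
- by apply/measurable_EFinP; exact: (measurableT_comp mh).
by move: (spacing_exp n); apply: (@filterS _ _ (ae_filter_ringOfSetsType P)) => w /= e _; rewrite /S e.
Qed.

Let L2_S n : L2 P (S n).
Proof.
have [mG [MG [mG0 mGh mk0 GhB k0B]]] := hyps.
split => //; have [mS' LS'] := L2_exp_stat P r0 mG0 mGh GhB k0B mZ Z0 n.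
move: LS' => /integrableP[m1 i1]; apply/integrableP; split.
  by apply/measurable_EFinP; exact: measurable_funX.
rewrite (_ : (\int[P]_x _)%E = (\int[P]_x `|(EFin \o (fun w => (S' n w ^+ 2)%R)) x|)%E)//.
apply: ae_eq_integral => //.
- by apply: measurableT_comp => //; apply/measurable_EFinP; exact: measurable_funX.
- by apply: measurableT_comp.
by move: (spacing_exp n); apply: (@filterS _ _ (ae_filter_ringOfSetsType P)) => w /= e _; rewrite /S e.
Qed.

Let mean n : fine 'E_P[S n] = Ex P (S' n).
Proof. by rewrite -(Ex_S n (@measurable_id _ R setT)) /Ex /Rintegral unlock. Qed.

Let var n : 'V_P[S n] = (Ex P (fun w => (S' n w - Ex P (S' n)) ^+ 2))%:E.
Proof.
have mh : measurable_fun [set: R] (fun x : R => (x - Ex P (S' n)) ^+ 2).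
  by apply: measurable_funX; exact: measurable_funB.
rewrite -(Ex_S n mh) EFin_Ex; last exact: (L2B (L2_S n) (L2_cst P _)).2.
rewrite /variance covariance.unlock mean expectation.unlock.
by apply: eq_integral => w _; rewrite expr2.
Qed.

Lemma spacing_stat_variance :
  ((n%:R^-1)%:E * 'V_P[S n])%E @[n --> \oo] --> (sigma2 c1 c2 f g r)%:E.
Proof.
have [mG [MG [mG0 mGh mk0 GhB k0B]]] := hyps.
have h := exp_stat_variance r0 mG0 mGh mk0 GhB k0B k0_lim mZ Z0 indZ.
under eq_fun do rewrite var -EFinM.
apply: cvg_EFin; first exact: nearW.
apply/cvgrPdist_le => e e0; have [N hN] := h e e0.
exists N => // n /= /hN[_]; rewrite distrC limit_var; exact.
Qed.

Lemma spacing_stat_clt : cvg_in_distribution P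
  (fun n w => (Num.sqrt n%:R)^-1 * (S n w - fine 'E_P[S n]))
  (centered_normal (sigma2 c1 c2 f g r)).
Proof.
have [mG [MG [mG0 mGh mk0 GhB k0B]]] := hyps.
have V0 := density_limvar_ge0 r0 mG0 mGh mk0 GhB k0B k0_lim mZ Z0 indZ.
have h := exp_stat_heat r0 mG0 mGh mk0 GhB k0B k0_lim mZ Z0 indZ.
rewrite limit_var in V0; set V := sigma2 c1 c2 f g r in V0 *.
move=> w cw.
have nE y : centered_normal V `]-oo, y]%classic = (normal_cdf V y)%:E.
  rewrite /centered_normal /normal_cdf; case: eqP => [_|/eqP Vn].
    rewrite [LHS]diracE; congr (_%:R%:E); congr nat_of_bool; apply/idP/idP; rewrite inE/= in_itv//.
  by apply: ncdf_scale; rewrite sqrtr_gt0 lt_neqAle eq_sym Vn.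
(* For V = 0 the limit is the point mass at 0, whose distribution function jumps at 0, so a
   continuity point is nonzero. *)
have ww : 0 < V \/ w != 0.
  have [VV|Vn] := eqVneq V 0; last by left; rewrite lt_neqAle eq_sym Vn.
  right; apply/eqP => w0.
  have n1 : nbhs (centered_normal V `]-oo, w]%classic) [set x | ((2^-1)%:E < x)%E].
    apply: open_nbhs_nbhs; split; first exact: open_ereal_gt_ereal.
    by rewrite /= nE w0 /normal_cdf VV eqxx lexx lte_fin invf_lt1// ltr1n.
  have /nbhs_ballP[e /= e0 he] := cw _ n1.
  have := he (w - e / 2); rewrite /ball/= opprB addrC subrK gtr0_norm ?divr_gt0//.
  rewrite ltr_pdivrMr// ltr_pMr// ltr1n => /(_ isT).
  rewrite /= nE w0 /normal_cdf VV eqxx sub0r oppr_ge0 leNgt divr_gt0//= lte_fin ltNge.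
  by rewrite invr_ge0 ler0n.
rewrite nE.
apply: (@cdf_limit R _ _ P (fun n u => (Num.sqrt n%:R)^-1 * (S n u - fine 'E_P[S n])) V V0) => //.
  by move=> n; apply: measurable_funM => //; exact: measurable_funB.
move=> x del e del0 e0; have [N hN] := h x del e del0 e0.
exists N => n /hN[_]; rewrite limit_var -/V mean.
rewrite -(@Ex_S (fun y => heat x del ((Num.sqrt n%:R)^-1 * (y - Ex P (S' n))))) //.
apply: (measurableT_comp (measurable_heat x del)).
by apply: measurable_funM => //; exact: measurable_funB.
Qed.

End transfer.

Unset Implicit Arguments.

Theorem corollary3p2 (R : realType) (d : measure_display)
    (T : measurableType d) (P : probability T R)
    (c1 c2 : R) (hc : c1 < c2) (f g : R -> R)
    (hf : admissible_density `[c1, c2] f)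
    (hg : admissible_density `[c1, c2] g)
    (X : nat -> {RV P >-> R}) (hX : iid_with_density X f)
    (r : R) (hr : 0 < r) :
  ((n%:R^-1)%:E * 'V_P[spacing_stat X g r n])%E @[n --> \oo]
      --> (sigma2 c1 c2 f g r)%:E
  /\ cvg_in_distribution P
       (fun n w => (Num.sqrt n%:R)^-1 *
          (spacing_stat X g r n w - fine 'E_P[spacing_stat X g r n]))
       (centered_normal (sigma2 c1 c2 f g r)).
Proof.
by split; [exact: spacing_stat_variance|exact: spacing_stat_clt].
Qed.
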